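(* Let $X$ be a closed subscheme of the toric variety $Y_\Delta$ over $K$ such that $X\cap O(\sigma)$ is equidimensional of dimension $d_\sigma$ for every $\sigma\in\Delta$. Suppose that for all cones $\sigma\in\Delta$ and all faces $\tau\prec\sigma$ there exists a finite polyhedral complex structure $\Sigma$ on $\mathrm{Trop}(X)\cap N_{\mathbb R}(\tau)$ with the following property: for every $d_\tau$-dimensional polyhedron $P\in\Sigma$ whose recession cone intersects the relative interior of $\overline\sigma:=\pi_\tau(\sigma)$ in $N_{\mathbb R}(\tau)$, the canonical projection $\pi_{\overline\sigma}(P)$ has dimension $d_\sigma$ in $N_{\mathbb R}(\sigma)$. Then the tropical skeleton $S_{\mathrm{Trop}}(X)$ is closed in $X^{\mathrm{an}}$.
   Context: $K$ is a field complete with respect to a (possibly trivial) non-Archimedean valuation. $M\cong\mathbb Z^n$, $N=\mathrm{Hom}(M,\mathbb Z)$, $N_{\mathbb R}=N\otimes\mathbb R$, $T=\mathrm{Spec}(K[M])$ with characters $\chi^u$, $u\in M$. $\Delta$ is a pointed rational fan in $N_{\mathbb R}$ and $Y_\Delta$ is the associated toric variety over $K$ with dense torus $T$; as a set $Y_\Delta=\bigsqcup_{\sigma\in\Delta}O(\sigma)$ with torus orbits $O(\sigma)=\mathrm{Spec}(K[\sigma^\perp\cap M])$. Put $N_{\mathbb R}(\sigma)=N_{\mathbb R}/\langle\sigma\rangle$, where $\langle\sigma\rangle$ is the linear span, and let $\pi_\sigma\colon N_{\mathbb R}\to N_{\mathbb R}(\sigma)$ be the projection. For $\tau\prec\sigma$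 and $\overline\sigma=\pi_\tau(\sigma)\subset N_{\mathbb R}(\tau)$, the canonical projection is $\pi_{\overline\sigma}\colon N_{\mathbb R}(\tau)\to N_{\mathbb R}(\tau)/\langle\overline\sigma\rangle=N_{\mathbb R}(\sigma)$. $\overline N{}^\Delta_{\mathbb R}=\bigsqcup_{\sigma\in\Delta}N_{\mathbb R}(\sigma)$ is the Kajiwara--Payne partial compactification of $N_{\mathbb R}$, glued from the open pieces $\mathrm{Hom}(\sigma^\vee\cap M,\mathbb R\cup\{\infty\})$ (monoid homomorphisms, topology of pointwise convergence), where for a face $\tau\prec\sigma$ a point $\omega\in N_{\mathbb R}(\tau)$ is the homomorphism $u\mapsto\langle u,\omega\rangle$ if $u\in\tau^\perp$ and $u\mapsto\infty$ otherwise. $Y^{\mathrm{an}}$ denotes Berkovich analytification. The map $\mathrm{trop}\colon Y_\Delta^{\mathrm{an}}\to\overline N{}^\Delta_{\mathbb R}$ is given by $\langle u,\mathrm{trop}(\xi)\rangle=-\log|\chi^u(\xi)|$. $\mathrm{Trop}(X)=\mathrm{trop}(X^{\mathrm{an}})$; for $\omega\in\mathrm{Trop}(X)\cap N_{\mathbb R}(\sigma)$, $X_\omega=\mathrm{trop}^{-1}(\omega)\cap X^{\mathrm{an}}$ is an affinoid domain in $(X\cap O(\sigma))^{\mathrm{an}}$. The Shilov boundary of an affinoid space $\mathscr M(\mathcal A)$ is the (finite) smallest subset on which every $|f|$, $f\in\mathcal A$, attains its maximum. The tropical skeleton is $S_{\mathrm{Trop}}(X)=\{\xi\in X^{\mathrm{an}}\mid\xi\text{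 is a Shilov boundary point of }X_{\mathrm{trop}(\xi)}\}$. *)

(* Defs.v *)
From HB Require Import structures.
From mathcomp Require Import all_boot all_order all_algebra finmap.
From mathcomp Require Import all_classical all_reals all_analysis.
From mathcomp.multinomials Require monalg.
(* The notations of monalg clash with those of MathComp-Analysis. *)
Import (canonicals) monalg.

Set Implicit Arguments.
Unset Strict Implicit.
Unset Printing Implicit Defensive.

Import Order.TTheory GRing.Theory Num.Theory.
Import numFieldNormedType.Exports.

Local Open Scope classical_set_scope.
Local Open Scope ring_scope.

(* ** Monoid algebras                                                        *)

(* Finitely supported functions on a commutative monoid [G], written          *)
(* additively, with the convolution product.  The ring structure that the     *)
(* library puts on [malg] requires a monoid without non-trivial units, so it  *)
(* does not apply to the lattices used below.                                 *)
Definition monoid_algebra (F : fieldType) (G : nmodType) : Type :=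
  monalg.malg G F.

Section MonoidAlgebra.
Context (F : fieldType) (G : nmodType).
Implicit Types (f g h : monoid_algebra F G) (u : G) (c : F).
Local Notation A := (monoid_algebra F G).

HB.instance Definition _ := GRing.Lmodule.copy A (monalg.malg G F).

Definition coef (u : G) (f : A) : F := monalg.mcoeff u f.
Definition supp (f : A) : {fset G} := monalg.msupp f.
Definition monomial (u : G) (c : F) : A := monalg.mkmalgU u c.
Definition chi (u : G) : A := monomial u 1.

Definition ma_mul (f g : A) : A :=
  \sum_(u <- supp f) \sum_(w <- supp g) monomial (u + w) (coef u f * coef w g).

Let mono0 u : monomial u 0 = 0.
Proof. exact: monalg.monalgU0. Qed.

Let monoD u c d : monomial u (c + d) = monomial u c + monomial u d.
Proof. exact: monalg.monalgUD. Qed.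

Let ma_mulw (d1 d2 : {fset G}) f g :
  (supp f `<=` d1)%fset -> (supp g `<=` d2)%fset ->
  ma_mul f g =
  \sum_(u <- d1) \sum_(w <- d2) monomial (u + w) (coef u f * coef w g).
Proof.
move=> le1 le2; rewrite /ma_mul (big_fset_incl _ le1) /=; last first.
  move=> u _ /monalg.mcoeff_outdom fu; apply: big1 => w _.
  by rewrite /coef fu mul0r mono0.
apply: eq_bigr => u _; apply: big_fset_incl => // w _ /monalg.mcoeff_outdom gw.
by rewrite /coef gw mulr0 mono0.
Qed.

Let suppU u c : (supp (monomial u c) `<=` [fset u])%fset.
Proof. exact: monalg.msuppU_le. Qed.

Let suppD f g : (supp (f + g)%R `<=` supp f `|` supp g)%fset.
Proof. exact: monalg.msuppD_le. Qed.

Let coefD u f g : coef u (f + g) = coef u f + coef u g.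
Proof. exact: monalg.mcoeffD. Qed.

Let coefUU u c : coef u (monomial u c) = c.
Proof. exact: monalg.mcoeffUU. Qed.

Let maE f : f = \sum_(u <- supp f) monomial u (coef u f).
Proof. exact: monalg.monalgE. Qed.

Let ma_mulC : commutative ma_mul.
Proof.
move=> f g; rewrite /ma_mul exchange_big /=.
by apply: eq_bigr => u _; apply: eq_bigr => w _; rewrite addrC mulrC.
Qed.

Let ma_mulDl : left_distributive ma_mul +%R.
Proof.
move=> f g h.
rewrite (ma_mulw (suppD f g) (fsubset_refl _)).
rewrite (ma_mulw (fsubsetUl _ (supp g)) (fsubset_refl (supp h))).
rewrite (ma_mulw (fsubsetUr (supp f) _) (fsubset_refl (supp h))).
rewrite -big_split /=; apply: eq_bigr => u _.
rewrite -big_split /=; apply: eq_bigr => w _.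
by rewrite coefD mulrDl monoD.
Qed.

Let ma_mulDr : right_distributive ma_mul +%R.
Proof. by move=> f g h; rewrite ma_mulC ma_mulDl !(ma_mulC f). Qed.

Let ma_mul0l : left_zero 0 ma_mul.
Proof. by move=> f; rewrite /ma_mul /supp monalg.msupp0 big_seq_fset0. Qed.

Let ma_mul0r : right_zero 0 ma_mul.
Proof. by move=> f; rewrite ma_mulC ma_mul0l. Qed.

Let ma_mulUU u w c d :
  ma_mul (monomial u c) (monomial w d) = monomial (u + w) (c * d).
Proof. by rewrite (ma_mulw (suppU u c) (suppU w d)) !big_seq_fset1 !coefUU. Qed.

Let ma_mulUl u c g :
  ma_mul (monomial u c) g =
  \sum_(w <- supp g) monomial (u + w) (c * coef w g).
Proof.
by rewrite (ma_mulw (suppU u c) (fsubset_refl _)) big_seq_fset1 coefUU.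
Qed.

Let ma_mul_suml (s : seq G) (E : G -> A) g :
  ma_mul (\sum_(u <- s) E u) g = \sum_(u <- s) ma_mul (E u) g.
Proof. by elim/big_rec2: _ => // u y x _ <-; rewrite ma_mulDl. Qed.

Let ma_mul_sumr (s : seq G) (E : G -> A) g :
  ma_mul g (\sum_(u <- s) E u) = \sum_(u <- s) ma_mul g (E u).
Proof. by elim/big_rec2: _ => // u y x _ <-; rewrite ma_mulDr. Qed.

Let ma_mulA : associative ma_mul.
Proof.
move=> f g h; rewrite {1 2}[f]maE.
rewrite (ma_mul_suml _ _ (ma_mul g h)) (ma_mul_suml _ _ g) (ma_mul_suml _ _ h).
apply: eq_bigr => u _; rewrite {1 2}[g]maE.
rewrite (ma_mul_suml _ _ h) !(ma_mul_sumr _ _ (monomial u _)) (ma_mul_suml _ _ h).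
apply: eq_bigr => w _; rewrite {1 2}[h]maE.
rewrite (ma_mul_sumr _ _ (monomial w _)) (ma_mul_sumr _ _ (monomial u _)).
rewrite (ma_mul_sumr _ _ (ma_mul _ _)).
by apply: eq_bigr => z _; rewrite !ma_mulUU addrA mulrA.
Qed.

Let ma_mul1l : left_id (chi 0) ma_mul.
Proof.
move=> f; rewrite ma_mulUl [RHS]maE; apply: eq_bigr => u _.
by rewrite add0r mul1r.
Qed.

Let ma_oner_neq0 : chi 0 != 0 :> A.
Proof.
apply/eqP => /(congr1 (coef 0)) /eqP.
by rewrite coefUU /coef monalg.mcoeff0 oner_eq0.
Qed.

HB.instance Definition _ := GRing.Zmodule_isComNzRing.Build A
  ma_mulA ma_mulC ma_mul1l ma_mulDl ma_oner_neq0.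

Let ma_scaleE c f : c *: f = monomial 0 c * f.
Proof.
rewrite [RHS]ma_mulUl; transitivity (\sum_(w <- supp f) monomial w (c * coef w f)).
  by [].
by apply: eq_bigr => w _; rewrite add0r.
Qed.

Let ma_scaleAl c f g : c *: (f * g) = (c *: f) * g.
Proof. by rewrite !ma_scaleE mulrA. Qed.

HB.instance Definition _ := GRing.Lmodule_isLalgebra.Build F A ma_scaleAl.
HB.instance Definition _ := GRing.Lalgebra_isComAlgebra.Build F A.

End MonoidAlgebra.

(* The K-linear map induced by a partially defined map of exponents: the      *)
(* monomials on which [phi] is undefined are sent to 0.                       *)
Definition ma_pmap (F : fieldType) (G G' : nmodType) (phi : G -> option G')
    (f : monoid_algebra F G) : monoid_algebra F G' :=
  \sum_(u <- supp f) if phi u is Some u' then monomial u' (coef u f) else 0.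

(* ** Ideals and dimension                                                   *)

Section Ideals.
Context (A : comNzRingType).
Implicit Types I P : set A.

(* The unit ideal is allowed. *)
Definition ideal I : Prop :=
  [/\ I 0, forall x y, I x -> I y -> I (x + y) & forall a x, I x -> I (a * x)].

Definition prime_ideal P : Prop :=
  [/\ ideal P, ~ P 1 & forall x y, P (x * y) -> P x \/ P y].

Definition minimal_prime I P : Prop :=
  [/\ prime_ideal P, I `<=` P &
      forall Q, prime_ideal Q -> I `<=` Q -> Q `<=` P -> Q = P].

(* C 0, ..., C d is a strictly increasing chain of primes containing P. *)
Definition prime_chain P (d : nat) (C : nat -> set A) : Prop :=
  (forall i, (i <= d)%N -> prime_ideal (C i) /\ P `<=` C i) /\
  (forall i, (i < d)%N -> C i `<` C i.+1).

Definition krull_dim_quotient P (d : nat) : Prop :=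
  (exists C, prime_chain P d C) /\ (forall C, ~ prime_chain P d.+1 C).

(* Every irreducible component of Spec (A / I) has dimension d; this holds    *)
(* for every d when Spec (A / I) is empty.                                    *)
Definition equidimensional I (d : nat) : Prop :=
  forall P, minimal_prime I P -> krull_dim_quotient P d.

End Ideals.

(* ** Convex geometry in a finite-dimensional real vector space              *)

Section Convex.
Context (R : realType) (V : vectType R).
Implicit Types (S C P F : set V) (U : {vspace V}).

Definition is_span S U : Prop :=
  (forall x, S x -> x \in U) /\
  (forall W : {vspace V}, (forall x, S x -> x \in W) -> (U <= W)%VS).

Definition linspan S : {vspace V} := xget 0%VS [set U | is_span S U].

Lemma linspanP S : is_span S (linspan S).
Proof.
rewrite /linspan; case: xgetP => [U _ //|noU]; exfalso.
pose D : pred nat := fun d =>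
  `[< exists U : {vspace V}, (forall x, S x -> x \in U) /\ \dim U = d >].
have exD : exists d, D d.
  exists (\dim (fullv : {vspace V})); apply/asboolP; exists fullv.
  by split=> // x _; rewrite memvf.
case: (ex_minnP exD) => d /asboolP[U [SU dU]] dmin.
apply: (noU U); split=> // W SW.
suff UWE : (U :&: W)%VS == U by rewrite -(eqP UWE) capvSr.
rewrite eqEdim capvSl /= dU; apply: dmin; apply/asboolP; exists (U :&: W)%VS.
by split=> // x Sx; rewrite memv_cap SU ?SW.
Qed.

(* The direction of the affine span. *)
Definition dirspan S : {vspace V} := linspan [set x - y | x in S & y in S].

Definition affdim S : nat := \dim (dirspan S).

(* The sup norm in a basis of V defines its Euclidean topology. *)
Definition relint C : set V :=
  [set x | C x /\ exists2 e : R, 0 < e &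
    forall y, y - x \in dirspan C ->
      (forall i, `|coord (vbasis fullv) i (y - x)| < e) -> C y].

Definition polyhedron P : Prop :=
  P !=set0 /\
  exists (m : nat) (l : 'I_m -> 'Hom(V, R^o)) (c : 'I_m -> R),
    P = [set x | forall i, (l i x : R) <= c i].

(* Non-empty faces: the loci where a linear form is minimal.  The form l = 0  *)
(* gives P itself.                                                            *)
Definition face F P : Prop :=
  F !=set0 /\ exists l : 'Hom(V, R^o),
    F = [set x | P x /\ forall y, P y -> (l x : R) <= l y].

Definition recession_cone P : set V :=
  [set y | forall x (t : R), P x -> 0 <= t -> P (x + t *: y)].

Definition polyhedral_complex (Sigma : set (set V)) : Prop :=
  [/\ finite_set Sigma,
      forall P, Sigma P -> polyhedron P,
      forall P F, Sigma P -> face F P -> Sigma F &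
      forall P Q, Sigma P -> Sigma Q ->
        P `&` Q = set0 \/ (face (P `&` Q) P /\ face (P `&` Q) Q)].

(* The quotient V / U, realised as a complement of U; [quot_pi] is the        *)
(* projection along U.                                                        *)
Definition quot U : vectType R := subvs_of (U^C)%VS.
Definition quot_pi U (x : V) : quot U := vsproj (U^C)%VS (daddv_pi (U^C) U x).

End Convex.

Lemma quot_pi_eq0 (R : realType) (V : vectType R) (U : {vspace V}) (x : V) :
  (quot_pi U x == 0) = (x \in U).
Proof.
have UC0 : (U^C :&: U = 0)%VS by rewrite capvC capv_compl.
have UCT : (U^C + U = fullv)%VS by rewrite addvC addv_complf.
have xE : daddv_pi U^C U x + daddv_pi U U^C x = x.
  by apply: daddv_pi_add => //; rewrite UCT memvf.
apply/eqP/idP => [x0|xU].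
  have : vsval (quot_pi U x) = 0 by rewrite x0 linear0.
  rewrite vsprojK ?memv_pi // => d0.
  by rewrite -xE d0 add0r memv_pi.
have xU' : daddv_pi U U^C x = x by apply: daddv_pi_id => //; rewrite capv_compl.
have : daddv_pi U^C U x = 0 by apply: (addIr x); rewrite add0r -{2}xU' xE.
by rewrite /quot_pi => ->; rewrite linear0.
Qed.

Lemma quot_piB (R : realType) (V : vectType R) (U : {vspace V}) (x y : V) :
  quot_pi U (x - y) = quot_pi U x - quot_pi U y.
Proof. by rewrite /quot_pi !linearB. Qed.

Lemma quot_piK (R : realType) (V : vectType R) (U : {vspace V}) (w : quot U) :
  quot_pi U (vsval w) = w.
Proof.
rewrite /quot_pi daddv_pi_id ?vsvalK //; last exact: subvsP.
by rewrite capvC capv_compl.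
Qed.

(* ** Fans in N_R = R^n, with M = Z^n                                        *)

Section Fans.
Context (R : realType) (n : nat).
Implicit Types sigma tau : set 'rV[R]_n.

Definition pairing (u : 'rV[int]_n) (w : 'rV[R]_n) : R :=
  \sum_(i < n) (u 0 i)%:~R * w 0 i.

Definition rational_cone sigma : Prop :=
  exists (m : nat) (g : 'I_m -> 'rV[int]_n),
    sigma = [set w | exists2 c : 'I_m -> R, (forall i, 0 <= c i) &
                       w = \sum_i c i *: map_mx intr (g i)].

Definition pointed_cone sigma : Prop :=
  forall w, sigma w -> sigma (- w) -> w = 0.

Definition pointed_rational_fan (Delta : set (set 'rV[R]_n)) : Prop :=
  [/\ Delta !=set0 /\ finite_set Delta,
      forall sigma, Delta sigma -> rational_cone sigma /\ pointed_cone sigma,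
      forall sigma tau, Delta sigma -> face tau sigma -> Delta tau &
      forall sigma sigma', Delta sigma -> Delta sigma' ->
        face (sigma `&` sigma') sigma /\ face (sigma `&` sigma') sigma'].

Definition in_dual sigma : {pred 'rV[int]_n} :=
  fun u => `[< forall w, sigma w -> 0 <= pairing u w >].

Definition in_perp sigma : {pred 'rV[int]_n} :=
  fun u => `[< forall w, sigma w -> pairing u w = 0 >].

Let pairing0 w : pairing 0 w = 0.
Proof. by rewrite /pairing big1 // => i _; rewrite mxE mul0r. Qed.

Let pairingD u u' w : pairing (u + u') w = pairing u w + pairing u' w.
Proof.
rewrite /pairing -big_split /=; apply: eq_bigr => i _.
by rewrite mxE intrD mulrDl.
Qed.

Let pairingN u w : pairing (- u) w = - pairing u w.
Proof.
by rewrite /pairing -sumrN; apply: eq_bigr => i _; rewrite mxE mulrNz mulNr.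
Qed.

Let in_dual_closed sigma : Algebra.nmod_closed (in_dual sigma).
Proof.
split; first by apply/asboolP => w _; rewrite pairing0.
move=> u u' /asboolP hu /asboolP hu'; apply/asboolP => w sw.
by rewrite pairingD addr_ge0 ?hu ?hu'.
Qed.

HB.instance Definition _ sigma :=
  GRing.isAddClosed.Build 'rV[int]_n (in_dual sigma) (in_dual_closed sigma).

Let in_perp_closed sigma : Algebra.zmod_closed (in_perp sigma).
Proof.
split; first by apply/asboolP => w _; rewrite pairing0.
move=> u u' /asboolP hu /asboolP hu'; apply/asboolP => w sw.
by rewrite pairingD pairingN hu ?hu' ?subr0.
Qed.

HB.instance Definition _ sigma :=
  GRing.isZmodClosed.Build 'rV[int]_n (in_perp sigma) (in_perp_closed sigma).

(* The monoid sigma^vee /\ M and the group sigma^perp /\ M. *)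
Definition dualM sigma : Type := {u : 'rV[int]_n | in_dual sigma u}.
HB.instance Definition _ sigma := SubChoice.on (dualM sigma).
HB.instance Definition _ sigma :=
  GRing.SubChoice_isSubNmodule.Build _ _ (dualM sigma)
    (Algebra.rpred0D (in_dual sigma)).

Definition perpM sigma : Type := {u : 'rV[int]_n | in_perp sigma u}.
HB.instance Definition _ sigma := SubChoice.on (perpM sigma).
HB.instance Definition _ sigma :=
  GRing.SubChoice_isSubZmodule.Build _ _ (perpM sigma)
    (zmodClosedP (in_perp sigma)).

(* N_R(sigma) = N_R / <sigma>. *)
Definition NRq sigma : vectType R := quot (linspan sigma).
Definition piq sigma (w : 'rV[R]_n) : NRq sigma := quot_pi (linspan sigma) w.

(* For tau a face of sigma, the projection N_R(tau) -> N_R(sigma): apply      *)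
(* [piq sigma] to any representative in N_R.                                  *)
Definition piq2 tau sigma (w : NRq tau) : NRq sigma := piq sigma (vsval w).

Lemma piq2_piq tau sigma (w : 'rV[R]_n) :
  tau `<=` sigma -> piq2 sigma (piq tau w) = piq sigma w.
Proof.
move=> ts; apply/eqP; rewrite -subr_eq0 -[_ - _]quot_piB quot_pi_eq0.
have: vsval (piq tau w) - w \in linspan tau.
  by rewrite -quot_pi_eq0 quot_piB quot_piK subrr.
apply/subvP/(proj2 (linspanP tau)) => x tx.
by apply: (proj1 (linspanP sigma)); exact: ts.
Qed.

(* u is orthogonal to <sigma>, so any representative of w gives this value. *)
Definition pairingq sigma (u : perpM sigma) (w : NRq sigma) : R :=
  pairing (val u) (vsval w).

End Fans.

(* ** Toric varieties and their closed subschemes                            *)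

Section Toric.
Context (R : realType) (n : nat) (K : fieldType).
Implicit Types sigma tau : set 'rV[R]_n.

(* Coordinate rings of the affine chart Y_sigma and of the orbit O(sigma). *)
Definition chart_ring sigma : comAlgType K := monoid_algebra K (dualM sigma).
Definition orbit_ring sigma : comAlgType K := monoid_algebra K (perpM sigma).

(* For tau a face of sigma: restriction to the open subscheme Y_tau of        *)
(* Y_sigma, and restriction to the locally closed subscheme O(tau), which     *)
(* kills the monomials that are not in tau^perp.                              *)
Definition to_chart sigma tau (f : chart_ring sigma) : chart_ring tau :=
  ma_pmap (fun u : dualM sigma => insub (val u) : option (dualM tau)) f.
Definition to_orbit sigma tau (f : chart_ring sigma) : orbit_ring tau :=
  ma_pmap (fun u : dualM sigma => insub (val u) : option (perpM tau)) f.

(* A closed subscheme of Y_Delta is a quasi-coherent ideal sheaf: an ideal of *)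
(* each chart, compatible with the localisations for the faces of each cone.  *)
Definition ideal_sheaf (Delta : set (set 'rV[R]_n))
    (I : forall sigma, set (chart_ring sigma)) : Prop :=
  (forall sigma, Delta sigma -> ideal (I sigma)) /\
  (forall sigma tau, Delta sigma -> face tau sigma ->
     I tau = smallest (@ideal (chart_ring tau))
                      (@to_chart sigma tau @` I sigma)).

Record closed_subscheme (Delta : set (set 'rV[R]_n)) := ClosedSubscheme {
  chart_ideal : forall sigma, set (chart_ring sigma);
  chart_idealP : ideal_sheaf Delta chart_ideal
}.

(* The ideal of the intersection of X with O(sigma). *)
Definition orbit_ideal (Delta : set (set 'rV[R]_n))
    (X : closed_subscheme Delta) sigma : set (orbit_ring sigma) :=
  @to_orbit sigma sigma @` @chart_ideal _ X sigma.

End Toric.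
Arguments orbit_ideal {R n K Delta} X sigma _.

(* ** Berkovich analytification                                              *)

Definition nonarch_abs (R : realType) (K : fieldType) (v : K -> R) : Prop :=
  [/\ forall x, 0 <= v x, forall x, v x = 0 <-> x = 0,
      forall x y, v (x * y) = v x * v y &
      forall x y, v (x + y) <= Num.max (v x) (v y)].

Definition complete_abs (R : realType) (K : fieldType) (v : K -> R) : Prop :=
  forall x : nat -> K,
    (forall e : R, 0 < e -> exists N : nat, forall i j,
       (N <= i)%N -> (N <= j)%N -> v (x i - x j) < e) ->
    exists l : K, forall e : R, 0 < e -> exists N : nat, forall i,
      (N <= i)%N -> v (x i - l) < e.

(* Multiplicative seminorms on A extending the absolute value of K, i.e. the  *)
(* points of (Spec A)^an.                                                     *)
Definition mult_seminorm (R : realType) (K : fieldType) (v : K -> R)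
    (A : comAlgType K) (xi : A -> R) : Prop :=
  [/\ forall f, 0 <= xi f, forall c, xi c%:A = v c,
      forall f g, xi (f * g) = xi f * xi g &
      forall f g, xi (f + g) <= Num.max (xi f) (xi g)].

(* A point of Y_Delta^an lies in the analytification of exactly one orbit. *)
Record toric_an (R : realType) (n : nat) (K : fieldType) (v : K -> R)
    (Delta : set (set 'rV[R]_n)) := ToricAn {
  orb : set 'rV[R]_n;
  orbP : Delta orb;
  snorm : orbit_ring K orb -> R;
  snormP : mult_seminorm v snorm
}.
Arguments snorm {R n K v Delta} t f.

Section Topology.
Context (R : realType) (n : nat) (K : fieldType) (v : K -> R).
Context (Delta : set (set 'rV[R]_n)).
Local Notation Y := (toric_an v Delta).

HB.instance Definition _ := gen_eqMixin Y.
HB.instance Definition _ := gen_choiceMixin Y.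

(* If [orb p] is a face of sigma then p is a point of Y_sigma^an, and this is *)
(* the corresponding seminorm on K[sigma^vee /\ M].                           *)
Definition chart_snorm (sigma : set 'rV[R]_n) (p : Y) :
    {ptws chart_ring K sigma -> R} :=
  fun f => snorm p (to_orbit (orb p) f).
Arguments chart_snorm sigma p : clear implicits.

(* Gluing of the spaces Y_sigma^an, each with pointwise convergence. *)
Definition toric_an_open (U : set Y) : Prop :=
  forall sigma, Delta sigma ->
    exists2 W : set {ptws chart_ring K sigma -> R}, open W &
      forall p : Y, face (orb p) sigma -> U p <-> W (chart_snorm sigma p).

Let openT : toric_an_open setT.
Proof. by move=> sigma _; exists setT; [exact: openT|]. Qed.

Let openI (U U' : set Y) :
  toric_an_open U -> toric_an_open U' -> toric_an_open (U `&` U').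
Proof.
move=> oU oU' sigma Ds.
have [W oW UW] := oU _ Ds; have [W' oW' UW'] := oU' _ Ds.
exists (W `&` W'); first exact: openI.
by move=> p ps; have := UW p ps; have := UW' p ps; rewrite /setI /=; tauto.
Qed.

Let open_bigU (I : Type) (f : I -> set Y) :
  (forall i, toric_an_open (f i)) -> toric_an_open (\bigcup_i f i).
Proof.
move=> of_ sigma Ds.
have /choice[W WP] : forall i, exists W : set {ptws chart_ring K sigma -> R},
    open W /\ forall p : Y, face (orb p) sigma ->
      f i p <-> W (chart_snorm sigma p).
  by move=> i; have [W oW fW] := of_ i _ Ds; exists W.
exists (\bigcup_i W i); first by apply: bigcup_open => i _; case: (WP i).
move=> p ps; split=> -[i _ fip]; exists i => //.
  by apply/(proj2 (WP i)).
by apply/(proj2 (WP i)).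
Qed.

HB.instance Definition _ :=
  isOpenTopological.Build Y openT openI open_bigU.

End Topology.
Arguments chart_snorm {R n K v Delta} sigma p.

(* ** Tropicalization and the tropical skeleton                              *)

Section Tropical.
Context (R : realType) (n : nat) (K : fieldType) (v : K -> R).
Context (Delta : set (set 'rV[R]_n)) (X : closed_subscheme K Delta).
Implicit Types sigma : set 'rV[R]_n.

(* The points of the analytification of the intersection of X with O(sigma). *)
Definition orbit_an sigma : set {ptws orbit_ring K sigma -> R} :=
  [set xi | mult_seminorm v xi /\ forall f, orbit_ideal X sigma f -> xi f = 0].
Arguments orbit_an sigma _ : clear implicits.

Definition X_an : set (toric_an v Delta) :=
  [set p | orbit_an (orb p) (snorm p)].

(* trop(xi) = w, for xi in O(sigma)^an and w in N_R(sigma).  There is exactly *)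
(* one such w when sigma is a rational cone.                                  *)
Definition is_trop sigma (xi : orbit_ring K sigma -> R) (w : NRq sigma) :=
  forall u : perpM sigma, pairingq u w = - ln (xi (chi K u)).

(* X_w = trop^-1(w) /\ X^an, for w in N_R(sigma). *)
Definition trop_fiber sigma (w : NRq sigma) :
    set {ptws orbit_ring K sigma -> R} :=
  [set xi | orbit_an sigma xi /\ is_trop xi w].

(* The intersection of Trop(X) with N_R(sigma). *)
Definition Trop sigma : set (NRq sigma) := [set w | trop_fiber w !=set0].

(* X_w = M(A), where A is the quotient of the algebra of Laurent series below *)
(* (the coordinate ring of the fiber trop^-1(w) in O(sigma)^an) by the ideal  *)
(* generated by [orbit_ideal X].                                              *)
Definition affinoid_series sigma (w : NRq sigma) : set (perpM sigma -> K) :=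
  [set a | forall e : R, 0 < e ->
    finite_set [set u | e <= v (a u) * expR (- pairingq u w)]].

(* |a(xi)|, as the limit of |f(xi)| over the finite partial sums f of a. *)
Definition series_abs sigma (xi : orbit_ring K sigma -> R)
    (a : perpM sigma -> K) : R :=
  lim ((fun F : {fset perpM sigma} => xi (\sum_(u <- F) monomial u (a u))) @
       filter_from setT (fun F => [set F' : {fset perpM sigma} | F `<=` F']%fset)).

Definition boundary sigma (w : NRq sigma)
    (B : set {ptws orbit_ring K sigma -> R}) : Prop :=
  [/\ B `<=` trop_fiber w,
      closed (B : set (subspace (trop_fiber w))) &
      forall a, affinoid_series w a ->
        exists2 b, B b &
          forall xi, trop_fiber w xi -> series_abs xi a <= series_abs b a].

(* The smallest closed boundary; "closed" is needed, as for instance the      *)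
(* classical points of a disc also form a boundary.                           *)
Definition shilov_boundary sigma (w : NRq sigma)
    (B : set {ptws orbit_ring K sigma -> R}) : Prop :=
  boundary w B /\ forall C, boundary w C -> B `<=` C.

Definition S_Trop : set (toric_an v Delta) :=
  [set p | X_an p /\ exists w : NRq (orb p), is_trop (snorm p) w /\
    exists2 B, shilov_boundary w B & B (snorm p)].

End Tropical.

Arguments X_an {R n K} v {Delta} X _.
Arguments Trop {R n K} v {Delta} X sigma _.
Arguments S_Trop {R n K} v {Delta} X _.
Arguments orbit_an {R n K} v {Delta} X sigma _.

(* Main.v *)
(* Let A = K[M] be the coordinate ring of an orbit and I the ideal of X.  For   *)
(* d characters psi_1, ..., psi_d along which A / I becomes finite over        *)
(* S = K[psi_1, ..., psi_d] after inverting the psi_i, and a tropical point w,  *)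
(* let N_w be the Gauss norm on S with weights exp(- <psi_i, w>).  If moreover  *)
(* the psi_i are injective on the span of every polyhedron of a complex        *)
(* structure on Trop(X), then the Shilov boundary of X_w consists of the points *)
(* of X_w that restrict to N_w on S.  They dominate all other points because    *)
(* the minimal equation over S of an element takes its largest slope over N_w;  *)
(* the values of the characters are kept fixed by multiplying with high powers  *)
(* of a function that is maximal exactly there.  They are all needed because    *)
(* each of them is a peak point.                                              *)
(*                                                                            *)
(* Let p in the closure lie on O(sigma) without restricting to the Gauss norm:  *)
(* some g in S has |g(p)| < N(g).  This inequality is open, so it holds at a    *)
(* skeleton point q on O(tau) near p.  As points over nearby weights exist near *)
(* q, cancellation in g persists over a box of weights, hence the characters    *)
(* psi_i of sigma satisfy a linear relation on some d_tau-dimensional P in      *)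
(* Trop(X) /\ N_R(tau).  Letting q tend to p, P contains points going to        *)
(* infinity in the directions of sigma only, so its recession cone meets the    *)
(* relative interior of pi_tau(sigma), and by hypothesis pi(P) has dimension    *)
(* d_sigma.  A relation between the psi_i on pi(P) contradicts their choice.    *)

From HB Require Import structures.
From mathcomp Require Import all_boot all_order all_algebra fingroup perm finmap.
From mathcomp Require Import all_classical all_reals all_analysis.
From mathcomp.multinomials Require monalg.
From mathcomp Require Import ring lra zify.
Require Import Defs.

Set Implicit Arguments.
Unset Strict Implicit.
Unset Printing Implicit Defensive.

Import Order.TTheory GRing.Theory Num.Theory.
Import numFieldNormedType.Exports.

Local Open Scope classical_set_scope.
Local Open Scope ring_scope.

(** * Multiplicative seminorms by minimality *)

(** The skeleton can be read off from restrictions to polynomial rings, and the failure of such a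
    restriction to be a Gauss norm spreads to a whole polyhedron, which the hypothesis forbids.

    All points are built by one device, [valuation_exists]: a minimal seminorm with prescribed
    values on a multiplicative set is multiplicative. It yields points on hypersurfaces
    ([hypersurface_point]) and extends valuations along finite maps ([lying_over]). Since polynomial
    rings are completely integrally closed, an element of the coordinate ring has, modulo a minimal
    prime and up to a power of the product of the psi_i, a monic minimal equation over
    K[psi_1, ..., psi_d] ([monic_generator]), whose Newton polygon controls its values. The largest
    slope is attained at a point over the Gauss norm ([max_point]); truncations of the equation give
    functions that separate points ([separate_value], [peak]). So the points over the Gauss norm
    dominate the whole fiber ([over_point_above]), and none of them can be omitted ([peak_off]).

    For the closure, let p lie on O(sigma) and be a limit of skeleton points of O(tau), and suppose
    that |g (p)| is smaller than the Gauss norm of g for a polynomial g in the characters of sigma.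
    This strict inequality is open in the chart of sigma ([open_chart_lt]). Points over Gauss norms
    move continuously with the weights ([nearby_points]), so near a skeleton point q two terms of g
    balance over a whole box of weights, hence on a d_tau-dimensional polyhedron P
    ([tie_polyhedron]). As q tends to p, P acquires a recession direction in the relative interior
    of the image of sigma ([recession_meets]), and the projection of P has dimension d_sigma by
    hypothesis. The characters of sigma were chosen injective on the directions of this projection,
    so the balance, a linear relation between them, is a contradiction ([closure_orbit]). *)

Section Valuations.
Context (R : realType) (A : comNzRingType).
Implicit Types (p q : A -> R) (x y a : A).

Definition submult p : Prop :=
  [/\ forall x, 0 <= p x, p 0 = 0,
      forall x y, p (x - y) <= Num.max (p x) (p y) &
      forall x y, p (x * y) <= p x * p y].

(** Non-zero elements may have value 0: these are multiplicative seminorms, as needed for points of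
    Berkovich spaces. *)
Definition valuation q : Prop :=
  [/\ forall x, 0 <= q x, q 0 = 0, q 1 = 1,
      forall x y, q (x * y) = q x * q y &
      forall x y, q (x + y) <= Num.max (q x) (q y)].

Lemma le_gt (a b : R) : (forall M, b < M -> a <= M) -> a <= b.
Proof. by move=> h; apply/ler_addgt0Pr => e e0; apply: h; rewrite ltrDl. Qed.

Lemma inf_le (I : Type) (f : I -> R) (i : I) :
  (forall i, 0 <= f i) -> inf (range f) <= f i.
Proof.
move=> f0; apply: ge_inf; last by exists i.
by exists 0 => _ [j _ <-]; exact: f0.
Qed.

Lemma le_inf (I : Type) (i : I) (f : I -> R) c :
  (forall i, c <= f i) -> c <= inf (range f).
Proof.
move=> cf; apply: lb_le_inf; first by exists (f i); exists i.
by move=> _ [j _ <-].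
Qed.

Lemma le_max_inf (I J : Type) (i0 : I) (j0 : J) (f : I -> R) (g : J -> R) c :
  (forall i j, c <= Num.max (f i) (g j)) ->
  c <= Num.max (inf (range f)) (inf (range g)).
Proof.
move=> cfg; rewrite le_max; apply/orP.
have [cf|/existsNP[i /negP]] := pselect (forall i, c <= f i).
  by left; exact: le_inf.
rewrite -ltNge => fic; right; apply: le_inf => // j.
by have := cfg i j; rewrite le_max leNgt fic.
Qed.

Lemma le_mul_inf (I J : Type) (i0 : I) (j0 : J) (f : I -> R) (g : J -> R) c :
  (forall i, 0 <= f i) -> (forall j, 0 <= g j) ->
  (forall i j, c <= f i * g j) -> c <= inf (range f) * inf (range g).
Proof.
move=> f0 g0 cfg.
have If : 0 <= inf (range f) by exact: le_inf.
have Ig : 0 <= inf (range g) by exact: le_inf.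
have [c0|c0] := leP c 0; first by apply: le_trans c0 _; exact: mulr_ge0.
have fpos i : 0 < f i.
  rewrite lt_neqAle f0 andbT; apply/eqP => fi0.
  by have := cfg i j0; rewrite -fi0 mul0r leNgt c0.
have cfi i : c <= f i * inf (range g).
  rewrite mulrC -ler_pdivrMr //; apply: le_inf => // j.
  by rewrite ler_pdivrMr // mulrC.
have Ig0 : 0 < inf (range g).
  rewrite lt_neqAle Ig andbT; apply/eqP => gi0.
  by have := cfi i0; rewrite -gi0 mulr0 leNgt c0.
rewrite -ler_pdivrMr //; apply: le_inf => // i.
by rewrite ler_pdivrMr.
Qed.

(** The index k expresses directedness: one member of the family controls members i and j at once,
    so both inequalities pass to the infimum. *)
Lemma submult_inf (I : Type) (i0 : I) (f : I -> A -> R) :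
  (forall i x, 0 <= f i x) -> (forall i, f i 0 = 0) ->
  (forall i j, exists k, forall x y, f k (x - y) <= Num.max (f i x) (f j y)) ->
  (forall i j, exists k, forall x y, f k (x * y) <= f i x * f j y) ->
  submult (fun x => inf (range (f^~ x))).
Proof.
move=> f0 f00 fB fM; split.
- by move=> x; exact: le_inf.
- apply/eqP; rewrite eq_le; apply/andP; split; last exact: le_inf.
  by apply: (le_trans (@inf_le _ (f^~ 0) i0 _)) => //; rewrite f00.
- move=> x y; apply: le_max_inf => // i j; have [k fk] := fB i j.
  by apply: le_trans (fk x y); exact: (@inf_le _ (f^~ _)).
- move=> x y; apply: le_mul_inf => // i j; have [k fk] := fM i j.
  by apply: le_trans (fk x y); exact: (@inf_le _ (f^~ _)).
Qed.

Section Submult.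
Context (p : A -> R) (pP : submult p).

Lemma submultN x : p (- x) = p x.
Proof.
have [p0 p00 pB _] := pP.
have h z : p (- z) <= p z.
  by have := pB 0 z; rewrite sub0r p00 max_r.
by apply/eqP; rewrite eq_le h -{1}[x]opprK h.
Qed.

Lemma submultD x y : p (x + y) <= Num.max (p x) (p y).
Proof. by have [_ _ pB _] := pP; rewrite -{1}[y]opprK -[p y]submultN. Qed.

Lemma submult_sum (I : Type) (r : seq I) (P : pred I) (F : I -> A) c :
  0 <= c -> (forall i, P i -> p (F i) <= c) -> p (\sum_(i <- r | P i) F i) <= c.
Proof.
have [_ p00 _ _] := pP.
move=> c0 h; apply: (big_ind (fun z => p z <= c)) => //; first by rewrite p00.
by move=> x y xc yc; apply: le_trans (submultD _ _) _; rewrite ge_max xc.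
Qed.

Lemma submultMn x n : p (x *+ n) <= p x.
Proof.
have [p0 p00 _ _] := pP.
elim: n => [|n IHn]; first by rewrite mulr0n p00.
by rewrite mulrS; apply: le_trans (submultD _ _) _; rewrite ge_max lexx.
Qed.

(* The limit of the p (x ^+ n) ^ (1 / n), without extracting roots. *)
Definition growth x : set R :=
  [set M | 0 < M /\ exists C : R, forall n, p (x ^+ n) <= C * M ^+ n].

Definition spectral x : R := inf (growth x).

Lemma growth_le x M : growth x M -> spectral x <= M.
Proof.
move=> xM; apply: ge_inf => //; exists 0 => z [z0 _]; exact: ltW.
Qed.

Lemma submult_pow_le x M n : p x <= M -> p (x ^+ n) <= p 1 * M ^+ n.
Proof.
have [p0 _ _ pM] := pP.
move=> xM; have M0 : 0 <= M := le_trans (p0 x) xM.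
elim: n => [|n IHn]; first by rewrite !expr0 mulr1.
by rewrite !exprS; apply: le_trans (pM _ _) _; rewrite mulrCA; exact: ler_pM.
Qed.

Lemma growth_gt x M : p x < M -> growth x M.
Proof.
have [p0 _ _ _] := pP.
move=> xM; split; first exact: le_lt_trans (p0 x) xM.
by exists (p 1) => n; apply: submult_pow_le; exact: ltW.
Qed.

(** Write n = q N + r: the multiple of N is controlled by the hypothesis, and the finitely many
    remainders r only change the constant. *)
Lemma growth_pow x N M :
  (0 < N)%N -> 0 < M -> p (x ^+ N) <= M ^+ N -> growth x M.
Proof.
have [p0 p00 pB pM] := pP.
move=> N0 M0 h; split=> //.
pose C := \big[Num.max/0]_(i < N) (p (x ^+ i) / M ^+ i).
exists (p 1 * C) => n.
rewrite (divn_eq n N) !exprD [(_ * N)%N]mulnC !exprM.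
apply: le_trans (pM _ _) _; rewrite mulrACA.
apply: ler_pM => //; first exact: submult_pow_le.
rewrite -ler_pdivrMr ?exprn_gt0 // /C.
exact: (le_bigmax _ (fun i : 'I_N => p (x ^+ i) / M ^+ i)
  (Ordinal (ltn_pmod n N0))).
Qed.

Lemma growth_upward x M M' : growth x M -> M <= M' -> growth x M'.
Proof.
have [p0 _ _ _] := pP.
move=> [M0 [C hC]] MM'; split; first exact: lt_le_trans M0 MM'.
have C0 : 0 <= C by have := hC 0%N; rewrite !expr0 mulr1; exact: le_trans.
exists C => n; apply: le_trans (hC n) _; rewrite ler_wpM2l //.
by rewrite lerXn2r // ?nnegrE ltW // (lt_le_trans M0).
Qed.

Lemma spectral_gt x M : spectral x < M -> growth x M.
Proof.
have [p0 _ _ _] := pP.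
move=> xM; have gx : growth x !=set0.
  by exists (p x + 1); apply: growth_gt; rewrite ltrDl.
by have [z gz zM] := inf_lt gx xM; exact: growth_upward gz (ltW zM).
Qed.

Lemma spectral_ge x c : (forall M, growth x M -> c <= M) -> c <= spectral x.
Proof.
have [p0 _ _ _] := pP.
move=> h; apply: lb_le_inf => //.
by exists (p x + 1); apply: growth_gt; rewrite ltrDl.
Qed.

Lemma spectral_le x : spectral x <= p x.
Proof. by apply: le_gt => M xM; apply: growth_le; exact: growth_gt. Qed.

Lemma spectral_ge0 x : 0 <= spectral x.
Proof. by apply: spectral_ge => M [M0 _]; exact: ltW. Qed.

(** Binomial formula; by the ultrametric inequality the binomial coefficients are harmless, so the
    same M works for the sum. *)
Lemma growthD x y M : growth x M -> growth y M -> growth (x + y) M.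
Proof.
have [p0 _ _ pM] := pP.
move=> [M0 [C hC]] [_ [D hD]]; split=> //; exists (C * D) => n.
have C0 : 0 <= C by have := hC 0%N; rewrite !expr0 mulr1; exact: le_trans.
have D0 : 0 <= D by have := hD 0%N; rewrite !expr0 mulr1; exact: le_trans.
rewrite exprDn; apply: submult_sum => [|i _].
  by rewrite !mulr_ge0 // exprn_ge0 // ltW.
apply: le_trans (submultMn _ _) _; apply: le_trans (pM _ _) _.
have -> : M ^+ n = M ^+ (n - i) * M ^+ i by rewrite -exprD subnK // -ltnS.
by rewrite mulrACA; apply: ler_pM.
Qed.

Lemma growthN x M : growth x M -> growth (- x) M.
Proof.
move=> [M0 [C hC]]; split=> //; exists C => n; rewrite exprNn -signr_odd.
by case: odd; rewrite ?expr1 ?expr0 ?mulN1r ?mul1r ?submultN.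
Qed.

Lemma growthM x y M M' : growth x M -> growth y M' -> growth (x * y) (M * M').
Proof.
have [p0 _ _ pM] := pP.
move=> [M0 [C hC]] [M'0 [D hD]]; split; first exact: mulr_gt0.
exists (C * D) => n; rewrite !exprMn; apply: le_trans (pM _ _) _.
by rewrite mulrACA; exact: ler_pM.
Qed.

Lemma submult_spectral : submult spectral.
Proof.
have [p0 p00 _ _] := pP.
split; first exact: spectral_ge0.
- by apply/eqP; rewrite eq_le spectral_ge0 andbT -p00; exact: spectral_le.
- move=> x y; apply: le_gt => M; rewrite gt_max => /andP[xM yM].
  by apply: growth_le; apply: growthD; [|apply: growthN]; exact: spectral_gt.
- move=> x y; rewrite /(spectral x) /(spectral y).
  have xn : growth x !=set0 by exists (p x + 1); apply: growth_gt; rewrite ltrDl.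
  have yn : growth y !=set0 by exists (p y + 1); apply: growth_gt; rewrite ltrDl.
  have mulinf (S S' : set R) (c : R) : S !=set0 -> S' !=set0 ->
      (forall z, S z -> 0 <= z) -> (forall z, S' z -> 0 <= z) ->
      (forall z b, S z -> S' b -> c <= z * b) -> c <= inf S * inf S'.
    move=> [s Ss] [s' Ss'] S0 S'0 h.
    have rng (Z : set R) : range (fun z : {z | Z z} => proj1_sig z) = Z.
      apply/seteqP; split=> [_ [[z Zz] _ <-] //|z Zz].
      by exists (exist _ z Zz).
    rewrite -(rng S) -(rng S'); apply: le_mul_inf.
    + exact: (exist _ s Ss).
    + exact: (exist _ s' Ss').
    + by case=> z Zz /=; exact: S0.
    + by case=> z Zz /=; exact: S'0.
    + by move=> [z Zz] [z' Zz'] /=; exact: h.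
  apply: mulinf => //.
  + by move=> a [a0 _]; exact: ltW.
  + by move=> a [a0 _]; exact: ltW.
  + by move=> a b xa yb; apply: growth_le; exact: growthM.
Qed.

(** Replaces an argument by N-th roots: c is shrunk by a factor 1 - e with e so small that its N-th
    power still reaches t. *)
Lemma exprn_approx (c t : R) N :
  (0 < N)%N -> 0 <= t -> t < c ^+ N -> 0 < c -> exists2 M, 0 < M < c & t <= M ^+ N.
Proof.
move=> N0 t0 tc c0; pose s := t / c ^+ N.
have s1 : s < 1 by rewrite ltr_pdivrMr ?exprn_gt0 // mul1r.
have s0 : 0 <= s by rewrite divr_ge0 // exprn_ge0 // ltW.
(* Bernoulli: (1 - e)^N >= 1 - N e. *)
pose e := (1 - s) / (N.+1)%:R.
have e0 : 0 < e by rewrite divr_gt0 ?subr_gt0 // ltr0n.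
have eN : N%:R * e <= 1 - s.
  by rewrite mulrC -mulrA ger_pMr ?subr_gt0 // ler_pdivrMl ?ltr0n // mulr1 ler_nat.
have e1 : e < 1.
  rewrite /e ltr_pdivrMr ?ltr0n // mul1r; apply: (@le_lt_trans _ _ 1).
    by rewrite gerBl.
  by rewrite -[1]/(1%:R) ltr_nat ltnS.
exists ((1 - e) * c).
  by rewrite mulr_gt0 ?subr_gt0 //= gtr_pMl // gtrBl.
have bern : 1 - N%:R * e <= (1 - e) ^+ N.
  elim: (N) => [|k IHk]; first by rewrite mul0r subr0 expr0.
  rewrite exprS; apply: (@le_trans _ _ ((1 - e) * (1 - k%:R * e))).
    rewrite -subr_ge0.
    have -> : (1 - e) * (1 - k%:R * e) - (1 - k.+1%:R * e) = k%:R * (e * e).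
      by rewrite -natr1; ring.
    by rewrite mulr_ge0 // mulr_ge0 // ltW.
  by rewrite ler_wpM2l // subr_ge0 ltW.
rewrite exprMn -ler_pdivrMr ?exprn_gt0 //; apply: le_trans bern.
by rewrite -/s; lra.
Qed.

End Submult.

(* Berkovich: a minimal element among the seminorms below [p] that are exactly *)
(* multiplicative against [Mon] is multiplicative.                            *)
Section MultSeminorm.
Context (p0 : A -> R) (p0P : submult p0) (Mon : set (A * R)).
Hypothesis Mon1 : Mon (1, 1).
Hypothesis MonM : forall s b s' b', Mon (s, b) -> Mon (s', b') ->
  Mon (s * s', b * b').
Hypothesis Mon_gt0 : forall s b, Mon (s, b) -> 0 < b.
Hypothesis Mon_le : forall s b x, Mon (s, b) -> p0 (s * x) <= b * p0 x.
Hypothesis Mon_ge : forall s b, Mon (s, b) -> b <= p0 s.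

(** The condition [1 <= q 1] keeps the zero seminorm out of the class. *)
Definition mon_class q : Prop :=
  [/\ submult q, forall x, q x <= p0 x, 1 <= q 1 &
      forall s b x, Mon (s, b) -> q (s * x) = b * q x].

(** Localise p0 at [Mon]: take the infimum of p0 (s x) / b over all (s, b) in [Mon]. The products (s
    s', b b') make this family directed, and they also yield exactness against [Mon]. *)
Lemma mon_class_ex : exists q, mon_class q.
Proof.
have [p00 p000 pB pM] := p0P.
pose I := {sb : A * R | Mon sb}.
pose i0 : I := exist _ (1, 1) Mon1.
pose f (i : I) x := p0 ((sval i).1 * x) / (sval i).2.
have f_ge0 i x : 0 <= f i x.
  by case: i => -[s b] Ms; rewrite /f /= divr_ge0 // ltW // (Mon_gt0 Ms).
pose mulI (i j : I) : I :=
  exist _ ((sval i).1 * (sval j).1, (sval i).2 * (sval j).2)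
    (MonM (s := (sval i).1) (b := (sval i).2) (s' := (sval j).1) (b' := (sval j).2)
      (eq_ind _ Mon (svalP i) _ (surjective_pairing _))
      (eq_ind _ Mon (svalP j) _ (surjective_pairing _))).
have f_mul i j x : f (mulI i j) x <= f j x.
  case: i j => -[s b] Ms [[s' b'] Ms']; rewrite /f /=.
  have b0 := Mon_gt0 Ms; have b'0 := Mon_gt0 Ms'.
  rewrite ler_pdivrMr ?mulr_gt0 // -mulrA; apply: le_trans (Mon_le _ Ms) _.
  by rewrite [leRHS]mulrC -!mulrA ler_pM2l // mulrC divfK ?gt_eqF.
have f_mulC i j x : f (mulI i j) x = f (mulI j i) x.
  by rewrite /f /= [_.1 * _]mulrC [_.2 * _]mulrC.
exists (fun x => inf (range (f^~ x))); split.
- apply: (submult_inf i0) => //.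
  + by move=> i; rewrite /f mulr0 p000 mul0r.
  + move=> i j; exists (mulI i j) => x y.
    apply: (@le_trans _ _ (Num.max (f (mulI i j) x) (f (mulI i j) y))).
      have b0 : 0 < (sval (mulI i j)).2.
        by case: i j => -[s b] Ms [[s' b'] Ms']; exact: (Mon_gt0 (MonM Ms Ms')).
      rewrite /f mulrBr; move: b0 (sval (mulI i j)).1; move: (_.2) => b b0 z.
      by rewrite ler_pdivrMr // (maxr_pMl _ _ (ltW b0)) !divfK ?gt_eqF.
    rewrite ge_max; apply/andP; split; rewrite le_max.
      by rewrite f_mulC f_mul.
    by rewrite f_mul orbT.
  + move=> i j; exists (mulI i j) => x y; rewrite /f /=.
    case: i j => -[s b] Ms [[s' b'] Ms'] /=.
    rewrite mulf_div mulrACA ler_wpM2r ?pM // invr_ge0 ltW //.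
    exact: Mon_gt0 (MonM Ms Ms').
- move=> x; apply: le_trans (@inf_le _ (f^~ x) i0 _) _ => //.
  by rewrite /f /= mul1r divr1.
- apply: (le_inf i0) => -[[s b] Ms]; rewrite /f /= mulr1.
  by rewrite ler_pdivlMr ?(Mon_gt0 Ms) // mul1r Mon_ge.
- move=> s b x Ms; have b0 := Mon_gt0 Ms.
  pose i : I := exist _ (s, b) Ms.
  apply/eqP; rewrite eq_le; apply/andP; split.
    rewrite -ler_pdivrMl //; apply: (le_inf i0) => j.
    rewrite ler_pdivrMl //; apply: le_trans (@inf_le _ (f^~ _) j _) _ => //.
    case: j => -[s' b'] Ms'; have b'0 := Mon_gt0 Ms'.
    by rewrite /f /= [leRHS]mulrA ler_wpM2r ?invr_ge0 ?(ltW b'0) // mulrCA Mon_le.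
  apply: (le_inf i0) => j.
  apply: (@le_trans _ _ (b * f (mulI j i) x)).
    by rewrite ler_pM2l //; exact: (@inf_le _ (f^~ _)).
  case: j => -[s' b'] Ms'; have b'0 := Mon_gt0 Ms'.
  rewrite /f /= -[s' * s * x]mulrA; set P := p0 _.
  suff -> : b * (P / (b' * b)) = P / b' by [].
  by field; rewrite !gt_eqF.
Qed.

(** Zorn's lemma for the reversed order; a chain is bounded by its pointwise infimum. *)
Lemma mon_class_min : exists2 q, mon_class q &
  forall q', mon_class q' -> (forall x, q' x <= q x) -> q' = q.
Proof.
have [q0 q0P] := mon_class_ex.
pose T := {q | mon_class q}.
pose le (q q' : T) := `[< forall x, sval q' x <= sval q x >].
have [] := @Zorn T le.
- by move=> q; apply/asboolP.
- move=> q1 q2 q3 /asboolP h1 /asboolP h2; apply/asboolP => x.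
  exact: le_trans (h2 x) (h1 x).
- move=> [q1 q1P] [q2 q2P] /asboolP/= h1 /asboolP/= h2; apply: eq_exist.
  apply/funext => x.
  by apply/eqP; rewrite eq_le h1 h2.
- move=> C totC; have [C0|/set0P[c0 Cc0]] := eqVneq C set0.
    by exists (exist _ q0 q0P) => s; rewrite C0.
  pose I := {q : T | C q}.
  pose i0 : I := exist _ c0 Cc0.
  pose f (i : I) := sval (sval i).
  have fP (i : I) : mon_class (f i) by exact: svalP (sval i).
  have f0 i x : 0 <= f i x by have [[]] := fP i.
  have dir i j : exists k, forall x, f k x <= f i x /\ f k x <= f j x.
    case: i j => [i Ci] [j Cj].
    have [/asboolP ij|/asboolP ji] := totC _ _ Ci Cj.
      by exists (exist _ j Cj) => x; split=> //; exact: ij.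
    by exists (exist _ i Ci) => x; split=> //; exact: ji.
  have qP : mon_class (fun x => inf (range (f^~ x))).
    split.
    - apply: (submult_inf i0) => //; first by move=> i; case: (fP i) => -[].
        move=> i j; have [k fk] := dir i j; exists k => x y.
        have [[_ _ fB _] _ _ _] := fP k; apply: le_trans (fB _ _) _.
        by rewrite ge_max !le_max (fk x).1 (fk y).2 orbT.
      move=> i j; have [k fk] := dir i j; exists k => x y.
      have [[_ _ _ fM] _ _ _] := fP k; apply: le_trans (fM _ _) _.
      by rewrite ler_pM // ?(fk x).1 ?(fk y).2.
    - move=> x; apply: le_trans (@inf_le _ (f^~ x) i0 _) _ => //.
      by have [_ + _ _] := fP i0; exact.
    - by apply: (le_inf i0) => i; have [] := fP i.
    - move=> s b x Ms; have b0 := Mon_gt0 Ms.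
      have fs i : f i (s * x) = b * f i x by have [_ _ _] := fP i; exact.
      apply/eqP; rewrite eq_le; apply/andP; split.
        rewrite -ler_pdivrMl //; apply: (le_inf i0) => i.
        by rewrite ler_pdivrMl // -fs; exact: (@inf_le _ (f^~ _)).
      apply: (le_inf i0) => i; rewrite fs ler_pM2l //.
      exact: (@inf_le _ (f^~ _)).
  exists (exist _ _ qP) => s Cs; apply/asboolP => x.
  exact: (@inf_le _ (f^~ _) (exist _ s Cs)).
- move=> [q qP] qmin; exists q => // q' q'P q'q.
  have e : exist _ q' q'P = exist _ q qP :> T by apply: qmin; apply/asboolP.
  by have := congr1 sval e.
Qed.

(** Any construction that lowers a seminorm and stays in the class must return the minimal seminorm
    q. Applied to the spectral seminorm this gives q (a^N) = q (a)^N; applied to the limit of q (y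
    a^n) / q (a)^n it gives multiplicativity. *)
Lemma valuation_exists : exists q, [/\ valuation q, forall x, q x <= p0 x &
  forall s b, Mon (s, b) -> q s = b].
Proof.
have [q qP qmin] := mon_class_min.
have [qs qp q1 qMon] := qP; have [q0 q00 qB qM] := qs.
have specq : spectral q = q.
  apply: qmin; last exact: spectral_le.
  split; first exact: submult_spectral.
  - by move=> x; apply: le_trans (qp x); exact: spectral_le.
  - apply: spectral_ge => // M [M0 [C hC]]; rewrite leNgt; apply/negP => M1.
    have C1 : 0 < C.
      by have := hC 0%N; rewrite !expr0 mulr1; apply: lt_le_trans; apply: lt_le_trans q1.
    have [n nlt] : exists n : nat, C * M ^+ n < 1.
      have := @cvg_expr R M; rewrite ger0_norm ?ltW // => /(_ M1).
      move/cvgrPdist_lt => /(_ C^-1); rewrite invr_gt0 => /(_ C1) [n _ /(_ n (leqnn n))].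
      rewrite /= sub0r normrN ger0_norm ?exprn_ge0 ?ltW // => h.
      by exists n; rewrite mulrC -ltr_pdivlMr // mul1r.
    have := hC n; rewrite expr1n => h.
    by have := le_lt_trans (le_trans q1 h) nlt; rewrite ltxx.
  - move=> s b x Ms; have b0 := Mon_gt0 Ms.
    have qsn n y : q (s ^+ n * y) = b ^+ n * q y.
      elim: n y => [|n IHn] y; first by rewrite !expr0 !mul1r.
      by rewrite !exprS -!mulrA (qMon _ _ _ Ms) IHn.
    apply/eqP; rewrite eq_le; apply/andP; split.
      rewrite -ler_pdivrMl //; apply: spectral_ge => // M [M0 [C hC]].
      rewrite ler_pdivrMl //; apply: growth_le => //; split; first exact: mulr_gt0.
      by exists C => n; rewrite !exprMn qsn mulrCA ler_pM2l // exprn_gt0.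
    apply: spectral_ge => // M [M0 [C hC]].
    rewrite mulrC -ler_pdivlMr //; apply: growth_le => //; split.
      exact: divr_gt0.
    exists C => n; rewrite expr_div_n mulrA ler_pdivlMr ?exprn_gt0 //.
    by have := hC n; rewrite exprMn qsn mulrC.
have q11 : q 1 = 1.
  apply/eqP; rewrite eq_le q1 andbT -[X in X _ <= _]specq; apply: le_gt => M M1.
  apply: growth_le => //; split; first exact: lt_trans M1.
  exists (q 1) => n; rewrite expr1n ler_peMr // exprn_ege1 // ltW //.
have qX a N : q (a ^+ N) = q a ^+ N.
  apply/eqP; rewrite eq_le; apply/andP; split.
    by rewrite -[leRHS]mul1r -q11; exact: submult_pow_le.
  case: N => [|N]; first by rewrite !expr0 q11.
  rewrite leNgt; apply/negP => qlt.
  have qa0 : 0 < q a.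
    rewrite lt_neqAle q0 andbT; apply/eqP => qa0; move: qlt.
    by rewrite -qa0 expr0n /= ltNge q0.
  (* A strict inequality q (a^N) < q (a)^N leaves room for a growth rate M below q a, against
     [specq]. *)
  have [M /andP[M0 Mq] hM] := exprn_approx (ltn0Sn N) (q0 _) qlt qa0.
  have := growth_le (growth_pow qs (ltn0Sn N) M0 hM).
  by rewrite specq leNgt Mq.
have qmul a x : q (x * a) = q x * q a.
  have [qa0|qa0] := eqVneq (q a) 0.
    by apply/eqP; rewrite qa0 mulr0 eq_le q0 andbT -[leRHS](mulr0 (q x)) -qa0 qM.
  have {}qa0 : 0 < q a by rewrite lt_neqAle eq_sym qa0 q0.
  (* This sequence decreases in n; its infimum lies in the class, hence equals q, and its term n = 1
     gives the missing inequality. *)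
  pose f n y := q (y * a ^+ n) / q a ^+ n.
  have f0 n y : 0 <= f n y by rewrite divr_ge0 // exprn_ge0.
  have fS n m y : f (n + m)%N y <= f n y.
    rewrite /f ler_pdivrMr ?exprn_gt0 // !exprD mulrA mulrA.
    by rewrite divfK ?expf_neq0 ?gt_eqF // -qX qM.
  pose g y := inf (range (f^~ y)).
  have gq y : g y <= q y.
    by apply: le_trans (@inf_le _ (f^~ y) 0%N _) _ => //; rewrite /f !expr0 mulr1 divr1.
  have gP : mon_class g.
    split.
    - apply: (submult_inf 0%N) => //.
      + by move=> i; rewrite /f mul0r q00 mul0r.
      + move=> i j; exists (i + j)%N => y z.
        apply: (@le_trans _ _ (Num.max (f (i + j)%N y) (f (i + j)%N z))).
          rewrite /f mulrBl ler_pdivrMr ?exprn_gt0 //.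
          by rewrite (maxr_pMl _ _ (ltW (exprn_gt0 _ qa0))) !divfK ?expf_neq0 ?gt_eqF.
        by rewrite ge_max !le_max fS addnC fS orbT.
      + move=> i j; exists (i + j)%N => y z; rewrite /f mulf_div -exprD.
        rewrite ler_wpM2r ?invr_ge0 ?exprn_ge0 //.
        by rewrite exprD mulrACA qM.
    - by move=> y; apply: le_trans (gq y) _.
    - by apply: (le_inf 0%N) => n; rewrite /f mul1r qX divff // expf_neq0 // gt_eqF.
    - move=> s b y Ms; have b0 := Mon_gt0 Ms.
      have fs n : f n (s * y) = b * f n y by rewrite /f -mulrA (qMon _ _ _ Ms) mulrA.
      apply/eqP; rewrite eq_le; apply/andP; split.
        rewrite -ler_pdivrMl //; apply: (le_inf 0%N) => i.
        by rewrite ler_pdivrMl // -fs; exact: (@inf_le _ (f^~ _)).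
      apply: (le_inf 0%N) => i; rewrite fs ler_pM2l //.
      exact: (@inf_le _ (f^~ _)).
  have gE : g = q by exact: qmin.
  apply/eqP; rewrite eq_le qM /= -ler_pdivlMr // -{1}gE.
  exact: le_trans (@inf_le _ (f^~ x) 1%N _) _.
exists q; split=> //.
  by split=> //; exact: submultD.
by move=> s b Ms; rewrite -[s]mulr1 (qMon _ _ _ Ms) q11 mulr1.
Qed.

End MultSeminorm.

End Valuations.

(** * Gauss norms *)

Section ValuationTheory.
Context (R : realType) (A : comNzRingType) (q : A -> R) (qP : valuation q).

Lemma val_ge0 x : 0 <= q x. Proof. by have [] := qP. Qed.
Lemma val0 : q 0 = 0. Proof. by have [] := qP. Qed.
Lemma val1 : q 1 = 1. Proof. by have [] := qP. Qed.
Lemma valM x y : q (x * y) = q x * q y. Proof. by have [] := qP. Qed.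
Lemma valD x y : q (x + y) <= Num.max (q x) (q y). Proof. by have [] := qP. Qed.

Lemma valX x n : q (x ^+ n) = q x ^+ n.
Proof. by elim: n => [|n IHn]; rewrite ?expr0 ?val1 // !exprS valM IHn. Qed.

Lemma val_prod (I : Type) (r : seq I) (P : pred I) (F : I -> A) :
  q (\prod_(i <- r | P i) F i) = \prod_(i <- r | P i) q (F i).
Proof. by apply: big_morph; [exact: valM|exact: val1]. Qed.

Lemma valN x : q (- x) = q x.
Proof.
have qN1 : q (-1) = 1.
  have := valX (-1) 2; rewrite sqrrN expr1n val1 => /esym/eqP.
  by rewrite sqrp_eq1 ?val_ge0 // => /eqP.
by rewrite -mulN1r valM qN1 mul1r.
Qed.

Lemma valB x y : q (x - y) <= Num.max (q x) (q y).
Proof. by rewrite -[q y]valN; exact: valD. Qed.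

Lemma valuation_submult : submult q.
Proof.
split; [exact: val_ge0|exact: val0|exact: valB|].
by move=> x y; rewrite valM.
Qed.

Lemma val_sum_le (I : Type) (r : seq I) (P : pred I) (F : I -> A) c :
  0 <= c -> (forall i, P i -> q (F i) <= c) -> q (\sum_(i <- r | P i) F i) <= c.
Proof. exact: submult_sum valuation_submult _ _ _ _ _. Qed.

Lemma val_sum_lt (I : Type) (r : seq I) (P : pred I) (F : I -> A) c :
  0 < c -> (forall i, P i -> q (F i) < c) -> q (\sum_(i <- r | P i) F i) < c.
Proof.
move=> c0 h; apply: (big_ind (fun z => q z < c)) => //; first by rewrite val0.
by move=> x y xc yc; apply: le_lt_trans (valD _ _) _; rewrite gt_max xc.
Qed.

Lemma val_eqD x y : q x < q y -> q (x + y) = q y.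
Proof.
move=> xy; apply/eqP; rewrite eq_le; apply/andP; split.
  by apply: le_trans (valD _ _) _; rewrite ge_max lexx andbT ltW.
rewrite leNgt; apply/negP => h.
have := valB (x + y) x; rewrite [x + y]addrC addrK leNgt gt_max xy andbT.
by rewrite addrC h.
Qed.

Lemma val_eqB x y : q (x - y) < q y -> q x = q y.
Proof. by move/val_eqD; rewrite subrK. Qed.

Lemma val_lt_eq x y : q (x - y) < q x -> q x = q y.
Proof.
move=> h; apply/esym; apply: val_eqB.
by rewrite -opprB valN.
Qed.

Lemma val_addeq0 x y : q (x + y) = 0 -> q x = q y.
Proof.
have h z t : q (z + t) = 0 -> q z <= q t.
  by move=> e; have := valB (z + t) t; rewrite addrK e max_r // val_ge0.
by move=> e; apply/eqP; rewrite eq_le !h // addrC.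
Qed.

End ValuationTheory.

Section Gauss.
Context (R : realType) (S : idomainType) (N : S -> R) (NP : valuation N).
Context (a : R) (a_gt0 : 0 < a).
Implicit Types p q h : {poly S}.

Definition gauss p : R := \big[Num.max/0]_(i < size p) (N p`_i * a ^+ i).

Lemma gauss_ge0 p : 0 <= gauss p.
Proof. by rewrite /gauss; apply: bigmax_ge_id. Qed.

Lemma gauss_ge p i : N p`_i * a ^+ i <= gauss p.
Proof.
have [ip|pi] := ltnP i (size p); last first.
  by rewrite nth_default // (val0 NP) mul0r gauss_ge0.
exact: (le_bigmax _ (fun i : 'I__ => N p`_i * a ^+ i) (Ordinal ip)).
Qed.

Lemma gauss_le p c : 0 <= c -> (forall i, N p`_i * a ^+ i <= c) -> gauss p <= c.
Proof. by move=> c0 h; apply/bigmax_leP; split. Qed.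

Lemma gauss_lt p c : 0 < c -> (forall i, N p`_i * a ^+ i < c) -> gauss p < c.
Proof. by move=> c0 h; apply/bigmax_ltP; split. Qed.

Lemma gauss_coef p i c : N p`_i * a ^+ i = c -> (forall j, N p`_j * a ^+ j <= c) ->
  gauss p = c.
Proof.
move=> ic h; apply/eqP; rewrite eq_le; apply/andP; split; last first.
  by rewrite -ic gauss_ge.
by apply: gauss_le => //; rewrite -ic mulr_ge0 ?(val_ge0 NP) // exprn_ge0 // ltW.
Qed.

Lemma gauss_cZX c i : gauss (c *: 'X^i) = N c * a ^+ i.
Proof.
apply: (@gauss_coef _ i); first by rewrite coefZ coefXn eqxx mulr1.
move=> j; rewrite coefZ coefXn; have [->|_] := eqVneq j i; first by rewrite mulr1.
rewrite mulr0 (val0 NP) mul0r mulr_ge0 ?(val_ge0 NP) // exprn_ge0 //; exact: ltW.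
Qed.

Lemma gaussC c : gauss c%:P = N c.
Proof. by have := gauss_cZX c 0; rewrite expr0 alg_polyC expr0 mulr1. Qed.

Lemma gaussB p q : gauss (p - q) <= Num.max (gauss p) (gauss q).
Proof.
apply: gauss_le => [|i]; first by rewrite le_max gauss_ge0.
have ai : 0 <= a ^+ i by rewrite exprn_ge0 // ltW.
rewrite coefB; apply: (@le_trans _ _ (Num.max (N p`_i) (N q`_i) * a ^+ i)).
  by rewrite ler_wpM2r // (valB NP).
by rewrite maxr_pMl // ge_max !le_max !gauss_ge orbT.
Qed.

Lemma gauss_attained p : 0 < gauss p ->
  exists i, (i < size p)%N && (N p`_i * a ^+ i == gauss p).
Proof.
move=> p0; apply: contrapT => h.
suff : gauss p < gauss p by rewrite ltxx.
apply: gauss_lt => // i; rewrite lt_neqAle gauss_ge andbT; apply/eqP => e.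
apply: h; exists i; rewrite e eqxx andbT ltnNge; apply/negP => si.
by move: p0; rewrite -e nth_default // (val0 NP) mul0r ltxx.
Qed.

Definition top_index p i : Prop :=
  N p`_i * a ^+ i = gauss p /\ forall j, (i < j)%N -> N p`_j * a ^+ j < gauss p.

Definition bot_index p i : Prop :=
  N p`_i * a ^+ i = gauss p /\ forall j, (j < i)%N -> N p`_j * a ^+ j < gauss p.

Lemma top_index_ex p : 0 < gauss p -> exists i, top_index p i.
Proof.
move=> p0; have ex := gauss_attained p0.
have ub i : (i < size p)%N && (N p`_i * a ^+ i == gauss p) -> (i <= size p)%N.
  by case/andP => /ltnW.
case: (ex_maxnP ex ub) => i /andP[ip /eqP pi] mi; exists i; split=> // j ij.
rewrite lt_neqAle gauss_ge andbT; apply/eqP => e.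
have [jp|pj] := ltnP j (size p).
  by have := mi j; rewrite jp e eqxx => /(_ isT); rewrite leqNgt ij.
by move: p0; rewrite -e nth_default // (val0 NP) mul0r ltxx.
Qed.

Lemma bot_index_ex p : 0 < gauss p -> exists i, bot_index p i.
Proof.
move=> p0; have ex := gauss_attained p0.
case: (ex_minnP ex) => i /andP[ip /eqP pi] mi; exists i; split=> // j ij.
rewrite lt_neqAle gauss_ge andbT; apply/eqP => e.
have := mi j; rewrite (ltn_trans ij ip) e eqxx => /(_ isT).
by rewrite leqNgt ij.
Qed.

Lemma gauss_mul_coef p q i j : 0 < gauss p * gauss q ->
  (forall k l, (k + l = i + j)%N -> (k, l) <> (i, j) ->
     (N p`_k * a ^+ k) * (N q`_l * a ^+ l) < gauss p * gauss q) ->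
  N ((p * q)`_(i + j) - p`_i * q`_j) * a ^+ (i + j) < gauss p * gauss q.
Proof.
move=> pq0 h; have aij : 0 < a ^+ (i + j) by rewrite exprn_gt0.
have iij : (i < (i + j).+1)%N by rewrite ltnS leq_addr.
rewrite coefM (bigD1 (Ordinal iij)) //= addKn addrAC subrr add0r.
rewrite -ltr_pdivlMr //; apply: (val_sum_lt NP) => [|k ki].
  by rewrite divr_gt0.
rewrite ltr_pdivlMr // (valM NP).
have kij : (k <= i + j)%N by rewrite -ltnS.
have <- : a ^+ k * a ^+ (i + j - k) = a ^+ (i + j) by rewrite -exprD subnKC.
rewrite mulrACA; apply: h; first by rewrite subnKC.
by move=> [ki' _]; case/eqP: ki; apply/val_inj.
Qed.

Lemma gauss_mul_eq p q i j : 0 < gauss p * gauss q ->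
  N p`_i * a ^+ i = gauss p -> N q`_j * a ^+ j = gauss q ->
  (forall k l, (k + l = i + j)%N -> (k, l) <> (i, j) ->
     (N p`_k * a ^+ k) * (N q`_l * a ^+ l) < gauss p * gauss q) ->
  N (p * q)`_(i + j) * a ^+ (i + j) = gauss p * gauss q.
Proof.
move=> pq0 pi qj h; have aij : 0 < a ^+ (i + j) by rewrite exprn_gt0.
have e : N (p`_i * q`_j) * a ^+ (i + j) = gauss p * gauss q.
  by rewrite (valM NP) exprD mulrACA pi qj.
rewrite -e; congr (_ * _); apply: (val_eqB NP).
by rewrite -(ltr_pM2r aij) e; exact: gauss_mul_coef.
Qed.

Lemma gaussM_le p q : gauss (p * q) <= gauss p * gauss q.
Proof.
apply: gauss_le => [|k]; first by rewrite mulr_ge0 // gauss_ge0.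
have ak : 0 < a ^+ k by rewrite exprn_gt0.
rewrite -ler_pdivlMr // coefM; apply: (val_sum_le NP) => [|i _].
  by rewrite divr_ge0 ?mulr_ge0 ?gauss_ge0 // ltW.
rewrite ler_pdivlMr // (valM NP).
have <- : a ^+ i * a ^+ (k - i) = a ^+ k by rewrite -exprD subnKC // -ltnS.
by rewrite mulrACA ler_pM ?gauss_ge // mulr_ge0 ?(val_ge0 NP) // exprn_ge0 // ltW.
Qed.

Lemma top_index_dom p q i j : 0 < gauss p -> 0 < gauss q ->
  top_index p i -> top_index q j ->
  forall k l, (i + j <= k + l)%N -> (k, l) <> (i, j) ->
     (N p`_k * a ^+ k) * (N q`_l * a ^+ l) < gauss p * gauss q.
Proof.
move=> p0 q0 [pi tp] [qj tq] k l kl ne.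
have nn r m : 0 <= N r`_m * a ^+ m.
  by rewrite mulr_ge0 ?(val_ge0 NP) // exprn_ge0 // ltW.
have [ik|] := ltnP i k.
  apply: (@le_lt_trans _ _ (N p`_k * a ^+ k * gauss q)).
    by rewrite ler_wpM2l // gauss_ge.
  by rewrite ltr_pM2r // tp.
move=> ki; have jl : (j < l)%N.
  by rewrite ltnNge; apply/negP => lj; apply: ne; congr (_, _); lia.
apply: (@le_lt_trans _ _ (gauss p * (N q`_l * a ^+ l))).
  by rewrite ler_wpM2r // gauss_ge.
by rewrite ltr_pM2l // tq.
Qed.

Lemma bot_index_dom p q i j : 0 < gauss p -> 0 < gauss q ->
  bot_index p i -> bot_index q j ->
  forall k l, (k + l <= i + j)%N -> (k, l) <> (i, j) ->
     (N p`_k * a ^+ k) * (N q`_l * a ^+ l) < gauss p * gauss q.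
Proof.
move=> p0 q0 [pi tp] [qj tq] k l kl ne.
have nn r m : 0 <= N r`_m * a ^+ m.
  by rewrite mulr_ge0 ?(val_ge0 NP) // exprn_ge0 // ltW.
have [ik|] := ltnP k i.
  apply: (@le_lt_trans _ _ (N p`_k * a ^+ k * gauss q)).
    by rewrite ler_wpM2l // gauss_ge.
  by rewrite ltr_pM2r // tp.
move=> ki; have jl : (l < j)%N.
  by rewrite ltnNge; apply/negP => lj; apply: ne; congr (_, _); lia.
apply: (@le_lt_trans _ _ (gauss p * (N q`_l * a ^+ l))).
  by rewrite ler_wpM2r // gauss_ge.
by rewrite ltr_pM2l // tq.
Qed.

(** Gauss's lemma: in the coefficient at the sum of the two largest dominating indices, exactly one
    product reaches the product of the norms. *)
Lemma gaussM p q : gauss (p * q) = gauss p * gauss q.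
Proof.
apply/eqP; rewrite eq_le gaussM_le /=.
have [|p0] := leP (gauss p) 0.
  move=> p0; have -> : gauss p = 0 by apply/eqP; rewrite eq_le p0 gauss_ge0.
  by rewrite mul0r gauss_ge0.
have [|q0] := leP (gauss q) 0.
  move=> q0; have -> : gauss q = 0 by apply/eqP; rewrite eq_le q0 gauss_ge0.
  by rewrite mulr0 gauss_ge0.
have [i ti] := top_index_ex p0; have [j tj] := top_index_ex q0.
rewrite -(@gauss_mul_eq p q i j) ?gauss_ge ?mulr_gt0 //; first exact: ti.1.
  exact: tj.1.
by move=> k l kl ne; apply: (top_index_dom p0 q0 ti tj) => //; rewrite kl.
Qed.

Lemma gauss_valuation : valuation gauss.
Proof.
split; [exact: gauss_ge0| | |exact: gaussM|].
- by rewrite -(polyC0 S) gaussC (val0 NP).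
- by rewrite -(polyC1 S) gaussC (val1 NP).
move=> p q; have N1 : gauss (- q) = gauss q.
  by rewrite /gauss size_polyN; apply: eq_bigr => i _; rewrite coefN (valN NP).
by have := gaussB p (- q); rewrite opprK N1.
Qed.

Lemma gaussX : gauss 'X = a.
Proof. by have := gauss_cZX 1 1; rewrite scale1r !expr1 (val1 NP) mul1r. Qed.

Hypothesis N_eq0 : forall c, N c = 0 -> c = 0.

Lemma gauss_gt0 p : p != 0 -> 0 < gauss p.
Proof.
move=> p0; apply: lt_le_trans (gauss_ge p (size p).-1).
rewrite mulr_gt0 ?exprn_gt0 // lt_neqAle (val_ge0 NP) andbT eq_sym.
by apply: contra_neq p0 => /N_eq0/eqP; rewrite lead_coef_eq0 => /eqP.
Qed.

Lemma gauss_eq0 p : gauss p = 0 -> p = 0.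
Proof.
by have [//|/gauss_gt0 p0] := eqVneq p 0 => p0'; rewrite p0' ltxx in p0.
Qed.

(* The largest and the smallest dominating index of a product are both        *)
(* additive, so they coincide for a factor of a monomial.                     *)
Lemma gauss_monomial_multiple (m : S) (i : nat) (h Q : {poly S}) : m != 0 ->
  gauss (m *: 'X^i - h * Q) < N m * a ^+ i ->
  exists k l, [/\ (k + l = i)%N, 0 < gauss Q, N Q`_k * a ^+ k = gauss Q,
    forall j, j != k -> N Q`_j * a ^+ j < gauss Q &
    N (m - h`_l * Q`_k) < N m].
Proof.
move=> m0; set mu := N m * a ^+ i => lt_mu.
have gm : gauss (m *: 'X^i) = mu by rewrite gauss_cZX.
have mu0 : 0 < mu.
  by rewrite -gm gauss_gt0 // -size_poly_eq0 size_scale // size_polyXn.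
have eP : gauss (h * Q) = mu.
  by rewrite -gm; apply/esym/(val_lt_eq gauss_valuation); rewrite gm.
have hQ0 : 0 < gauss h * gauss Q by rewrite -gaussM eP.
have Q0 : 0 < gauss Q.
  rewrite lt_neqAle gauss_ge0 andbT; apply/eqP => e.
  by move: hQ0; rewrite -e mulr0 ltxx.
have h0 : 0 < gauss h by move: hQ0; rewrite pmulr_lgt0.
have out j : j != i -> N (h * Q)`_j * a ^+ j < mu.
  move=> ji; apply: le_lt_trans lt_mu; apply: le_trans (gauss_ge _ j).
  by rewrite coefB coefZ coefXn (negPf ji) mulr0 sub0r (valN NP).
have [l tl] := top_index_ex h0; have [k tk] := top_index_ex Q0.
have [l' bl] := bot_index_ex h0; have [k' bk] := bot_index_ex Q0.
have eqi s t : N h`_s * a ^+ s = gauss h -> N Q`_t * a ^+ t = gauss Q ->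
    (forall x y, (x + y = s + t)%N -> (x, y) <> (s, t) ->
     (N h`_x * a ^+ x) * (N Q`_y * a ^+ y) < gauss h * gauss Q) -> (s + t = i)%N.
  move=> hs Qt dom; apply/eqP; apply: contraT => /out.
  by rewrite (gauss_mul_eq _ hs Qt dom) // -gaussM eP ltxx.
have topd := top_index_dom h0 Q0 tl tk; have botd := bot_index_dom h0 Q0 bl bk.
have lki : (l + k = i)%N.
  by apply: eqi tl.1 tk.1 _ => x y xy; apply: topd; rewrite xy.
have lki' : (l' + k' = i)%N.
  by apply: eqi bl.1 bk.1 _ => x y xy; apply: botd; rewrite xy.
have lel : (l' <= l)%N.
  by rewrite leqNgt; apply/negP => /(bl.2); rewrite tl.1 ltxx.
have lek : (k' <= k)%N.
  by rewrite leqNgt; apply/negP => /(bk.2); rewrite tk.1 ltxx.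
have kk : k' = k by lia.
exists k, l; split=> //; [by rewrite addnC|exact: tk.1| |].
- move=> j; rewrite neq_ltn => /orP[jk|]; last exact: tk.2.
  by apply: bk.2; rewrite kk.
- have ai : 0 < a ^+ i by rewrite exprn_gt0.
  rewrite -(ltr_pM2r ai) -/mu.
  have -> : m - h`_l * Q`_k = (m *: 'X^i - h * Q)`_i + ((h * Q)`_i - h`_l * Q`_k).
    by rewrite coefB coefZ coefXn eqxx mulr1 addrA subrK.
  apply: le_lt_trans (ler_wpM2r (ltW ai) (valD NP _ _)) _.
  rewrite maxr_pMl ?(ltW ai) // gt_max (le_lt_trans (gauss_ge _ _) lt_mu) /=.
  rewrite -{1 2}lki -eP gaussM; apply: gauss_mul_coef => // x y xy.
  by apply: topd; rewrite xy.
Qed.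

(** By the last hypothesis the residue seminorm of the Gauss norm modulo Q keeps the values of the
    monomials with coefficients in [Mon]. So [valuation_exists] gives a multiplicative seminorm
    below it that is exact on them: a point of the hypersurface Q = 0 at which the variable has
    value a. *)
Lemma hypersurface_point (Mon : set S) (Q : {poly S}) :
  Mon 1 -> (forall m m', Mon m -> Mon m' -> Mon (m * m')) -> (forall m, Mon m -> m != 0) ->
  (forall m i h, Mon m -> N m * a ^+ i <= gauss (m *: 'X^i - h * Q)) ->
  exists b : {poly S} -> R, [/\ valuation b, forall p, b p <= gauss p,
    b Q = 0, b 'X = a & forall m, Mon m -> b m%:P = N m].
Proof.
move=> Mon1 MonM Mon0 hge.
have gV := gauss_valuation.
pose f (h p : {poly S}) := gauss (p - h * Q).
pose p0 (p : {poly S}) := inf (range (f^~ p)).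
have f0 h p : 0 <= f h p by exact: gauss_ge0.
have p0g p : p0 p <= gauss p.
  apply: le_trans (@inf_le _ _ (f^~ p) 0 _) _ => //.
  by rewrite /f mul0r subr0.
have p00 p : 0 <= p0 p by exact: (le_inf (0 : {poly S})).
have p0_0 : p0 0 = 0 by apply/eqP; rewrite eq_le p00 -[leRHS](val0 gV) p0g.
have p0P : submult p0.
  split=> // p q.
    apply: (le_max_inf (0 : {poly S}) (0 : {poly S})) => h h'.
    apply: le_trans (@inf_le _ _ (f^~ _) (h - h') _) _ => //.
    apply: le_trans (valB gV _ _); rewrite /f mulrBl opprB addrACA.
    by rewrite le_eqVlt; apply/orP; left; apply/eqP; congr gauss; ring.
  apply: (le_mul_inf (0 : {poly S}) (0 : {poly S})) => // h h'.
  rewrite -gaussM.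
  apply: le_trans (@inf_le _ _ (f^~ _) (h * q + p * h' - h * h' * Q) _) _ => //.
  by rewrite le_eqVlt; apply/orP; left; apply/eqP; congr gauss; ring.
have p0Q : p0 Q = 0.
  apply/eqP; rewrite eq_le p00 andbT.
  apply: le_trans (@inf_le _ _ (f^~ _) 1 _) _ => //.
  by rewrite /f mul1r subrr (val0 gV).
pose M : set ({poly S} * R) := [set x | exists m i,
  [/\ Mon m, x.1 = m *: 'X^i & x.2 = N m * a ^+ i]].
have Mp m i : Mon m -> M (m *: 'X^i, N m * a ^+ i) by move=> Mm; exists m, i.
have N0 m : Mon m -> 0 < N m.
  move=> /Mon0 m0; rewrite lt_neqAle (val_ge0 NP) andbT eq_sym.
  by apply: contra_neq m0; exact: N_eq0.
have [|||||b [bV bp bM]] := @valuation_exists _ _ p0 p0P M.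
- by exists 1, 0%N; split=> //=; rewrite ?expr0 ?scale1r ?(val1 NP) ?mulr1.
- move=> s x s' x' [m [i [Mm /= -> ->]]] [m' [i' [Mm' /= -> ->]]].
  exists (m * m'), (i + i')%N; split=> /=; first exact: MonM.
    by rewrite -scalerAl -scalerAr scalerA exprD.
  by rewrite (valM NP) exprD mulrACA.
- by move=> s x [m [i [Mm /= _ ->]]]; rewrite mulr_gt0 ?exprn_gt0 // N0.
- move=> s x p [m [i [Mm /= -> ->]]].
  have c0 : 0 < N m * a ^+ i by rewrite mulr_gt0 ?exprn_gt0 // N0.
  rewrite -ler_pdivrMl //; apply: (le_inf (0 : {poly S})) => h.
  rewrite ler_pdivrMl // -gauss_cZX -gaussM.
  apply: le_trans (@inf_le _ _ (f^~ _) (m *: 'X^i * h) _) _ => //.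
  by rewrite /f mulrBr mulrA.
- by move=> s x [m [i [Mm /= -> ->]]]; apply: (le_inf (0 : {poly S})) => h; exact: hge.
exists b; split=> //.
- by move=> p; apply: le_trans (bp p) _.
- by apply/eqP; rewrite eq_le (val_ge0 bV) andbT -p0Q.
- by have := bM _ _ (Mp 1 1%N Mon1); rewrite scale1r !expr1 (val1 NP) mul1r.
- move=> m Mm; have := bM _ _ (Mp m 0%N Mm).
  by rewrite !expr0 mulr1 alg_polyC.
Qed.

End Gauss.

(** * Iterated polynomial rings *)

(** The iterated form lets Gauss norms, integral closedness and chains of primes be treated one
    variable at a time. The outermost variable is the one of index d - 1. *)
Fixpoint mvpoly (K : fieldType) (d : nat) : idomainType :=
  if d is d'.+1 then ({poly mvpoly K d'} : idomainType) else K.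

Fixpoint mvterms (K : fieldType) (d : nat) : mvpoly K d -> seq (K * seq nat) :=
  match d with
  | 0 => fun c : K => if c == 0 then [::] else [:: (c, [::])]
  | d'.+1 => fun p : {poly mvpoly K d'} =>
      [seq (t.1, rcons t.2 i) | i <- iota 0 (size p), t <- mvterms p`_i]
  end.

Section Mveval.
Context (K : fieldType) (T : comAlgType K) (x : nat -> T).

Fixpoint mveval (d : nat) : {rmorphism mvpoly K d -> T} :=
  match d with
  | 0 => in_alg T
  | d'.+1 => horner_eval (x d') \o map_poly (mveval d')
  end.

Definition mvmon (d : nat) (e : seq nat) : T := \prod_(i < d) x i ^+ nth 0%N e i.

Lemma mvevalS d (p : {poly mvpoly K d}) :
  mveval d.+1 p = (map_poly (mveval d) p).[x d].
Proof. by []. Qed.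

Lemma mveval0 (c : K) : mveval 0 c = c%:A.
Proof. by []. Qed.

End Mveval.

Section Mvgauss.
Context (R : realType) (K : fieldType) (v : K -> R) (a : nat -> R).

Fixpoint mvgauss (d : nat) : mvpoly K d -> R :=
  match d with
  | 0 => v
  | d'.+1 => gauss (@mvgauss d') (a d')
  end.

Definition mvweight (d : nat) (e : seq nat) : R := \prod_(i < d) a i ^+ nth 0%N e i.

End Mvgauss.

Section Terms.
Context (K : fieldType).

Lemma mvterms_size d (s : mvpoly K d) t : t \in mvterms s -> size t.2 = d.
Proof.
elim: d s t => [|d IHd] s t /=.
  by case: eqP => // _; rewrite inE => /eqP->.
case/allpairsPdep => i [u [_ us ->]] /=.
by rewrite size_rcons (IHd _ _ us).
Qed.

Lemma uniq_map_inj (T T' : eqType) (f : T -> T') (r : seq T) :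
  uniq [seq f i | i <- r] -> {in r &, injective f}.
Proof.
elim: r => [//|x r IHr] /= /andP[xr ur] y z; rewrite !inE.
move=> /predU1P[->|yr] /predU1P[->|zr] // e; last exact: IHr.
  by case/negP: xr; rewrite e map_f.
by case/negP: xr; rewrite -e map_f.
Qed.

Lemma mvterms_uniq d (s : mvpoly K d) : uniq [seq t.2 | t <- mvterms s].
Proof.
elim: d s => [|d IHd] s /=; first by case: eqP.
rewrite map_allpairs; apply: allpairs_uniq_dep.
- exact: iota_uniq.
- by move=> i _; have := IHd s`_i; exact: map_uniq.
- move=> [i t] [j u] /allpairsPdep[i' [t' [_ it /= [-> e]]]].
  move: it; rewrite -{}e => it /allpairsPdep[j' [u' [_ ju /= [-> e]]]].
  move: ju; rewrite -{}e => ju /= /eqP; rewrite eqseq_rcons => /andP[/eqP tu /eqP ij].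
  rewrite -ij in ju *; congr existT.
  by rewrite (uniq_map_inj (IHd _) it ju tu).
Qed.

Lemma mvterms_neq0 d (s : mvpoly K d) t : t \in mvterms s -> t.1 != 0.
Proof.
elim: d s t => [|d IHd] s t /=.
  by case: eqP => // /eqP s0; rewrite inE => /eqP->.
by case/allpairsPdep => i [u [_ us ->]] /=; exact: IHd us.
Qed.

Lemma mvterms_nil d (s : mvpoly K d) : mvterms s = [::] -> s = 0.
Proof.
elim: d s => [|d IHd] s; first by rewrite /=; case: eqP.
move=> h; apply/eqP; rewrite -lead_coef_eq0; apply/eqP/IHd.
case e : (mvterms (lead_coef (s : {poly mvpoly K d}))) => [//|t ts].
have [s0|s0] := eqVneq (s : {poly mvpoly K d}) 0.
  by move: e; rewrite s0 lead_coef0; case: (d) => [|k] //=; rewrite ?eqxx // size_poly0.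
have : (t.1, rcons t.2 (size (s : {poly mvpoly K d})).-1) \in mvterms (s : mvpoly K d.+1).
  apply/allpairsPdep; exists (size (s : {poly mvpoly K d})).-1, t; split=> //.
    by rewrite mem_iota /= add0n ltn_predL lt0n size_poly_eq0.
  exact: (eq_ind_r (fun l => t \in l) (mem_head t ts) e).
by rewrite h.
Qed.

Lemma mvweight_rcons (S : pzSemiRingType) (a : nat -> S) d e i : size e = d ->
  \prod_(j < d.+1) a j ^+ nth 0%N (rcons e i) j =
  (\prod_(j < d) a j ^+ nth 0%N e j) * a d ^+ i.
Proof.
move=> ed; rewrite big_ord_recr /= nth_rcons ed ltnn eqxx; congr (_ * _).
by apply: eq_bigr => j _; rewrite nth_rcons ed ltn_ord.
Qed.

Lemma mveval_terms (T : comAlgType K) (x : nat -> T) d (s : mvpoly K d) :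
  mveval x d s = \sum_(t <- mvterms s) t.1 *: mvmon x d t.2.
Proof.
elim: d s => [|d IHd] s.
  rewrite mveval0 /=; case: eqP => [->|_]; first by rewrite big_nil scale0r.
  by rewrite big_seq1 /= /mvmon big_ord0.
rewrite mvevalS /= big_allpairs_dep /=.
rewrite horner_poly -(big_mkord xpredT (fun i => mveval x d _`_i * x d ^+ i)).
rewrite /index_iota subn0; apply: eq_bigr => i _.
rewrite IHd mulr_suml; apply: eq_big_seq => t ts /=.
by rewrite /mvmon mvweight_rcons ?(mvterms_size ts) // scalerAl.
Qed.

Section GaussTerms.
Context (R : realType) (v : K -> R) (v_abs : nonarch_abs v).
Context (a : nat -> R).

Lemma abs_valuation : valuation v.
Proof.
have [v0 v00 vM vD] := v_abs; split=> //; first by apply/v00.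
have v1 : v 1 != 0 by apply/eqP => /v00/eqP; rewrite oner_eq0.
by apply: (mulfI v1); rewrite -vM !mulr1.
Qed.

Lemma mvgauss_valuation d : (forall i, (i < d)%N -> 0 < a i) ->
  valuation (@mvgauss R K v a d).
Proof.
elim: d => [|d IHd] a0; first exact: abs_valuation.
apply: gauss_valuation; last exact: a0.
by apply: IHd => i id; apply: a0; rewrite ltnS ltnW.
Qed.

Lemma mvgauss_eq0 d (s : mvpoly K d) : (forall i, (i < d)%N -> 0 < a i) ->
  mvgauss v a s = 0 -> s = 0.
Proof.
elim: d s => [|d IHd] s a0; first by case: v_abs => _ v00 _ _ /v00.
have a0' i : (i < d)%N -> 0 < a i by move=> id; apply: a0; rewrite ltnS ltnW.
apply: gauss_eq0; [exact: mvgauss_valuation|exact: a0|].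
by move=> c; exact: IHd.
Qed.

Lemma mvgauss_term_le d (s : mvpoly K d) t : (forall i, (i < d)%N -> 0 < a i) ->
  t \in mvterms s -> v t.1 * mvweight a d t.2 <= mvgauss v a s.
Proof.
elim: d s t => [|d IHd] s t a0 /=.
  by case: eqP => // _; rewrite inE => /eqP->; rewrite /mvweight big_ord0 mulr1.
have a0' i : (i < d)%N -> 0 < a i by move=> id; apply: a0; rewrite ltnS ltnW.
case/allpairsPdep => i [u [_ us ->]] /=.
rewrite /mvweight mvweight_rcons ?(mvterms_size us) // mulrA.
apply: le_trans (gauss_ge (mvgauss_valuation a0') _ _ i).
by rewrite ler_wpM2r ?IHd // exprn_ge0 // ltW // a0.
Qed.

Lemma mvgauss_term_ex d (s : mvpoly K d) : (forall i, (i < d)%N -> 0 < a i) ->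
  s != 0 -> exists2 t, t \in mvterms s & v t.1 * mvweight a d t.2 = mvgauss v a s.
Proof.
elim: d s => [|d IHd] s a0 s0 /=.
  exists (s, [::]); first by rewrite (negPf s0) inE.
  by rewrite /mvweight big_ord0 mulr1.
have a0' i : (i < d)%N -> 0 < a i by move=> id; apply: a0; rewrite ltnS ltnW.
have NV := mvgauss_valuation a0'.
have gs0 : 0 < gauss (@mvgauss R K v a d) (a d) s.
  by apply: gauss_gt0 => //; [exact: a0|move=> c; exact: mvgauss_eq0].
have [i /andP[ip /eqP pi]] := gauss_attained NV gs0.
have si0 : (s : {poly mvpoly K d})`_i != 0.
  by apply: contraTneq gs0 => e; rewrite -pi e (val0 NV) mul0r ltxx.
have [t ts et] := IHd _ a0' si0.
exists (t.1, rcons t.2 i).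
  by apply/allpairsPdep; exists i, t; rewrite mem_iota /= add0n.
by rewrite /mvweight mvweight_rcons ?(mvterms_size ts) // mulrA et pi.
Qed.

End GaussTerms.

End Terms.

Section Points.
Context (R : realType) (K : fieldType) (v : K -> R) (v_abs : nonarch_abs v).
Context (T : comAlgType K).
Implicit Types (xi : T -> R).

Lemma seminorm_valuation xi : mult_seminorm v xi -> valuation xi.
Proof.
case=> x0 xc xM xD; have [_ _ _ _ _] := abs_valuation v_abs => //.
split=> //.
  by rewrite -(scale0r (1 : T)) xc (val0 (abs_valuation v_abs)).
by rewrite -(scale1r (1 : T)) xc (val1 (abs_valuation v_abs)).
Qed.

Lemma seminormZ xi c f : mult_seminorm v xi -> xi (c *: f) = v c * xi f.
Proof. by case=> _ xc xM _; rewrite -xc -xM mulr_algl. Qed.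

Lemma seminorm_mvmon xi (x : nat -> T) d e : mult_seminorm v xi ->
  xi (mvmon x d e) = mvweight (fun i => xi (x i)) d e.
Proof.
move=> xP; have xV := seminorm_valuation xP.
by rewrite /mvmon (val_prod xV); apply: eq_bigr => i _; rewrite (valX xV).
Qed.

Definition on_gauss (x : nat -> T) d xi : Prop :=
  forall s, xi (mveval x d s) = mvgauss v (fun i => xi (x i)) s.

Section OnGauss.
Context (x : nat -> T) (d : nat) (xi : T -> R) (xP : mult_seminorm v xi).
Hypothesis x_gt0 : forall i, (i < d)%N -> 0 < xi (x i).

Lemma seminorm_le_gauss s : xi (mveval x d s) <= mvgauss v (fun i => xi (x i)) s.
Proof.
have xV := seminorm_valuation xP.
rewrite mveval_terms big_seq; apply: (val_sum_le xV) => [|t ts].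
  by have /val_ge0 := mvgauss_valuation v_abs x_gt0; apply.
by rewrite seminormZ // seminorm_mvmon // mvgauss_term_le.
Qed.

(** Restricting to the Gauss norm of its own weights becomes a family of weak inequalities between
    evaluations, hence a closed condition even when the weights vary. *)
Lemma on_gaussP : on_gauss x d xi <-> forall s t, t \in mvterms (s : mvpoly K d) ->
  v t.1 * mvweight (fun i => xi (x i)) d t.2 <= xi (mveval x d s).
Proof.
have xV := seminorm_valuation xP; split=> [xg s t ts|h s].
  by rewrite xg mvgauss_term_le.
apply/eqP; rewrite eq_le seminorm_le_gauss /=.
have [->|s0] := eqVneq s 0.
  by rewrite rmorph0 (val0 xV) (val0 (mvgauss_valuation v_abs x_gt0)).
by have [t ts <-] := mvgauss_term_ex v_abs x_gt0 s0; exact: h.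
Qed.

(** A single dominant term would fix the value by the ultrametric inequality, so cancellation needs
    two terms of the same size. This is where ties of tropical polynomials come from. *)
Lemma gauss_tie (s : mvpoly K d) :
  xi (mveval x d s) < mvgauss v (fun i => xi (x i)) s ->
  exists t u, [/\ t \in mvterms s, u \in mvterms s, t.2 != u.2 &
    v t.1 * mvweight (fun i => xi (x i)) d t.2 =
    v u.1 * mvweight (fun i => xi (x i)) d u.2].
Proof.
have xV := seminorm_valuation xP.
have [->|s0] := eqVneq s 0.
  by rewrite rmorph0 (val0 xV) (val0 (mvgauss_valuation v_abs x_gt0)) ltxx.
have [t ts et] := mvgauss_term_ex v_abs x_gt0 s0 => lt_s.
apply: contrapT => notie.
have xt : xi (t.1 *: mvmon x d t.2) = mvgauss v (fun i => xi (x i)) s.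
  by rewrite seminormZ // seminorm_mvmon.
move: lt_s; rewrite mveval_terms (bigD1_seq t) //=; last exact: map_uniq (mvterms_uniq s).
set rest := \sum_(_ <- _ | _) _; suff hr : xi rest < mvgauss v (fun i => xi (x i)) s.
  by rewrite addrC (val_eqD xV) xt ?ltxx.
rewrite /rest big_seq_cond; apply: (val_sum_lt xV).
  rewrite -et mulr_gt0 //; last first.
    by apply: prodr_gt0 => i _; rewrite exprn_gt0 // x_gt0.
  have [v0 v00 _ _] := v_abs; rewrite lt_neqAle v0 andbT eq_sym.
  by apply: contra_neq (mvterms_neq0 ts) => /v00.
move=> u /andP[us ut]; rewrite seminormZ // seminorm_mvmon // lt_neqAle.
rewrite mvgauss_term_le // andbT; apply/eqP => eu; apply: notie.
exists t, u; split=> //; last by rewrite et eu.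
by apply: contra_neq ut => /esym /(uniq_map_inj (mvterms_uniq s) us ts).
Qed.

End OnGauss.
End Points.

(** * Integral closedness of polynomial rings *)

(* Complete integral closedness, in terms of divisibility.                    *)
Definition cint_closed (S : idomainType) : Prop :=
  forall a b h : S, b != 0 -> h != 0 ->
    (forall n, exists c, h * a ^+ n = c * b ^+ n) -> exists c, a = c * b.

Lemma cint_closed_field (K : fieldType) : cint_closed K.
Proof. by move=> a b h b0 _ _; exists (a / b); rewrite divfK. Qed.

Section Fraction.
Context (S : idomainType).
Local Notation F := {fraction S}.
Local Notation iota := (@FracField.tofrac S).
Local Notation "P ^i" := (map_poly (@FracField.tofrac S) P)
  (at level 2, format "P ^i") : ring_scope.

Lemma tofrac_inj : injective iota.
Proof. by move=> x y /eqP; rewrite tofrac_eq => /eqP. Qed.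

Lemma fraction_ratio (x : F) : exists r s : S, s != 0 /\ x * iota s = iota r.
Proof.
elim/quotW: x => y; exists (frac y).1, (frac y).2; split.
  exact: denom_ratioP.
rewrite -[LHS]/(FracField.mul _ _) !piE /FracField.mulf; apply/eqmodP.
rewrite /= FracField.equivfE !numden_Ratio ?oner_eq0 ?mulf_neq0 ?denom_ratioP ?oner_neq0 //.
by rewrite !mulr1 mulrC.
Qed.

Lemma map_tofrac_inj : injective (fun P : {poly S} => P^i).
Proof. exact: map_inj_poly tofrac_inj (rmorph0 _). Qed.

(** Over the fraction field divide a and b by their gcd: by coprimality every power of b / gcd
    divides h, so b / gcd has degree 0. *)
Lemma cint_closed_div (a b h : {poly S}) : b != 0 -> h != 0 ->
  (forall n, exists c, h * a ^+ n = c * b ^+ n) -> b^i %| a^i.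
Proof.
move=> b0 h0 hab.
have inj0 (P : {poly S}) : P != 0 -> P^i != 0.
  move=> P0; apply: contra_neq P0 => e; apply: map_tofrac_inj.
  by rewrite e rmorph0.
have bi0 := inj0 _ b0; have hi0 := inj0 _ h0.
pose g := gcdp a^i b^i.
have g0 : g != 0 by rewrite gcdp_eq0 negb_and bi0 orbT.
have /divpK ea : g %| a^i by exact: dvdp_gcdl.
have /divpK eb : g %| b^i by exact: dvdp_gcdr.
have cop : coprimep (b^i %/ g) (a^i %/ g).
  by rewrite coprimep_sym coprimep_div_gcd // bi0 orbT.
have dvdh n : (b^i %/ g) ^+ n %| h^i.
  rewrite -(Gauss_dvdpl _ (coprimep_expr n (coprimep_expl n cop))).
  rewrite -(dvdp_mul2r _ _ (expf_neq0 n g0)) -mulrA -!exprMn ea eb.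
  have [c hc] := hab n; rewrite -!rmorphXn -rmorphM hc rmorphM.
  exact: dvdp_mull.
have /eqP s1 : size (b^i %/ g) == 1%N.
  have q0 : b^i %/ g != 0.
    by apply: contra_neq bi0 => e; rewrite -eb e mul0r.
  have := size_exp (b^i %/ g) (size h^i).
  have := dvdp_leq hi0 (dvdh (size h^i)).
  move: q0 hi0; rewrite -!size_poly_gt0; set y := size h^i.
  set z := size ((b^i %/ g) ^+ y); set x := size (b^i %/ g); nia.
have /size_poly1P[c c0 ec] : size (b^i %/ g) == 1%N by rewrite s1.
rewrite -eb ec mul_polyC dvdpZl //; exact: dvdp_gcdl.
Qed.

(** Induction on the degree: complete integral closedness of S, applied to leading coefficients,
    puts that of q in S; subtracting the leading term preserves the hypothesis by the binomial
    formula. *)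
Lemma cint_closed_lift (clS : cint_closed S) (h : {poly S}) m (q : {poly F}) :
  h != 0 -> (size q <= m)%N -> (forall n, exists c, h^i * q ^+ n = c^i) ->
  exists c, q = c^i.
Proof.
move=> h0; elim: m q => [|m IHm] q.
  by rewrite leqn0 size_poly_eq0 => /eqP-> _; exists 0; rewrite rmorph0.
move=> sq hq; have [->|q0] := eqVneq q 0; first by exists 0; rewrite rmorph0.
have [r1 [r2 [r20 er]]] := fraction_ratio (lead_coef q).
have [r e1] : exists r, r1 = r * r2.
  apply: (clS r1 r2 (lead_coef h)); rewrite ?lead_coef_eq0 // => n.
  have [c hc] := hq n; exists (lead_coef c); apply: tofrac_inj.
  have := congr1 lead_coef hc.
  rewrite lead_coefM lead_coef_exp !lead_coef_map_inj ?rmorph0 //; try exact: tofrac_inj.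
  by rewrite !rmorphM !rmorphXn /= -er exprMn mulrA => ->.
have lq : lead_coef q = iota r.
  have r2F : iota r2 != 0 by rewrite tofrac_eq0.
  by apply: (mulIf r2F); rewrite er e1 rmorphM.
pose u : {poly S} := r *: 'X^((size q).-1).
have uE : u^i = iota r *: 'X^((size q).-1) by rewrite map_polyZ /= map_polyXn.
have [|n|c hc] := IHm (q - u^i).
- apply/leq_sizeP => j mj; rewrite coefB uE coefZ coefXn -lq.
  have [->|ji] := eqVneq j (size q).-1; first by rewrite mulr1 -lead_coefE subrr.
  rewrite mulr0 subr0 nth_default //.
  by move: (size q) sq ji => k; lia.
- have := hq; move/choice => [f fP].
  exists (\sum_(i < n.+1) (f (n - i)%N * (- u) ^+ i) *+ 'C(n, i)).
  rewrite exprDn mulr_sumr rmorph_sum; apply: eq_bigr => i _.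
  rewrite -mulrnAr mulrA fP [in RHS]rmorphMn rmorphM rmorphXn rmorphN.
  by rewrite mulrnAr.
- by exists (c + u); rewrite rmorphD /= -hc subrK.
Qed.

Lemma cint_closed_poly : cint_closed S -> cint_closed {poly S}.
Proof.
move=> clS a b h b0 h0 hab.
have bi0 : b^i != 0.
  by apply: contra_neq b0 => e; apply: map_tofrac_inj; rewrite e rmorph0.
have /dvdpP[q eq] := cint_closed_div b0 h0 hab.
have [n|c hc] := @cint_closed_lift clS h (size q) q h0 (leqnn _).
  have [c hc] := hab n; exists c.
  apply: (mulIf (expf_neq0 n bi0)).
  by rewrite -mulrA -exprMn -eq -!rmorphXn -!rmorphM hc.
by exists c; apply: map_tofrac_inj; rewrite rmorphM /= -hc.
Qed.

End Fraction.

Lemma cint_closed_mvpoly (K : fieldType) d : cint_closed (mvpoly K d).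
Proof.
by elim: d => [|d IHd]; [exact: cint_closed_field|exact: cint_closed_poly].
Qed.

Section MonicGenerator.
Context (S : idomainType) (clS : cint_closed S).
Context (I : set {poly S}) (I_prime : prime_ideal I).
Hypothesis I_const : forall c, I c%:P -> c = 0.
Hypothesis I_monic : exists2 Q, Q \is monic & I Q.
Local Notation F := {fraction S}.
Local Notation iota := (@FracField.tofrac S).
Local Notation "P ^i" := (map_poly (@FracField.tofrac S) P)
  (at level 2, format "P ^i") : ring_scope.

Let I_sub P P' : I P -> I P' -> I (P - P').
Proof.
have [[_ ID IM] _ _] := I_prime.
by move=> IP IP'; apply: ID => //; rewrite -mulN1r; exact: IM.
Qed.

Let I_mul P P' : I P' -> I (P * P').
Proof. by have [[_ _ IM] _ _] := I_prime; exact: IM. Qed.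

Let I_scale c P : I P -> I (c *: P).
Proof. by rewrite -mul_polyC; exact: I_mul. Qed.

Let min_elt : exists q, [/\ I q, q != 0 &
  forall P, I P -> (size P < size q)%N -> P = 0].
Proof.
pose D n := `[< exists q, [/\ I q, q != 0 & size q = n] >].
have exD : exists n, D n.
  have [Q Qm IQ] := I_monic; exists (size Q); apply/asboolP; exists Q.
  by rewrite monic_neq0.
case: (ex_minnP exD) => n /asboolP[q [Iq q0 sq]] nmin; exists q; split=> // P IP.
rewrite sq => Pn; apply/eqP; apply: contraT => P0.
by have := nmin (size P) (asboolT (ex_intro _ P (And3 IP P0 erefl))); rewrite leqNgt Pn.
Qed.

(** Over the fraction field the ideal is generated by the monic multiple Q0 of an element q of least
    degree; the point is that Q0 has coefficients in S. A monic element of I bounds the denominators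
    of all powers of the companion matrix C of Q0 by one t. With m the degree of Q0, t^m Q0^n = det
    (t (X - C)^n) then lies in S[X] for every n, and complete integral closedness applies. *)
Lemma monic_generator : exists Q, [/\ Q \is monic, I Q &
  forall P, I P -> exists h, P = h * Q].
Proof.
have [q [Iq q0 qmin]] := min_elt; pose s := lead_coef q.
have s0 : s != 0 by rewrite lead_coef_eq0.
have is0 : iota s != 0 by rewrite tofrac_eq0.
pose Q0 : {poly F} := (iota s)^-1 *: q^i.
have sqi : size q^i = size q.
  by rewrite size_map_inj_poly ?rmorph0 //; exact: tofrac_inj.
have sQ0 : size Q0 = size q by rewrite size_scale ?invr_eq0.
have Q0m : Q0 \is monic.
  rewrite monicE lead_coefZ lead_coef_map_inj ?rmorph0 //; last exact: tofrac_inj.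
  by rewrite -/s mulVf.
have qQ0 : q^i = iota s *: Q0 by rewrite scalerA divff ?scale1r.
have dvdQ P : I P -> exists h, P^i = h * Q0.
  move=> IP; have e := Pdiv.Idomain.divp_eq P q.
  have r0 : P %% q = 0.
    apply: qmin; last by rewrite Pdiv.Idomain.ltn_modp.
    have -> : P %% q = lead_coef q ^+ scalp P q *: P - P %/ q * q by rewrite e addrC addKr.
    by apply: I_sub; [exact: I_scale|exact: I_mul].
  exists ((iota (s ^+ scalp P q))^-1 *: ((P %/ q)^i * (iota s)%:P)).
  rewrite -scalerAl -mulrA mul_polyC -qQ0 -rmorphM /=.
  have -> : P %/ q * q = s ^+ scalp P q *: P by rewrite e r0 addr0.
  by rewrite map_polyZ scalerA mulVf ?scale1r // tofrac_eq0 expf_neq0.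
pose m := (size q).-1.
have sqm : size q = m.+1 by rewrite prednK // size_poly_gt0.
(* Pseudo-division by q: each multiplication by the leading coefficient s lowers the degree bound by
   one. *)
have red j (P : {poly S}) : (size P <= m + j)%N -> exists2 r : {poly S}, (size r <= m)%N & I (s ^+ j *: P - r).
  elim: j P => [|j IHj] P sP.
    exists P; first by rewrite -[m]addn0.
    by rewrite expr0 scale1r subrr; have [[]] := I_prime.
  pose P' := s *: P - P`_(m + j) *: 'X^j * q.
  have [|r sr Ir] := IHj P'.
    apply/leq_sizeP => i mi; rewrite coefB coefZ -scalerAl coefZ coefXnM.
    rewrite ltnNge (leq_trans (leq_addl m j) mi) /=.
    have [->|im] := eqVneq i (m + j)%N.
      by rewrite addnK -[q`_m]/(lead_coef q) mulrC subrr.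
    have mji : (m + j < i)%N by rewrite ltn_neqAle eq_sym im.
    rewrite [P`_i]nth_default; last by apply: leq_trans sP _; rewrite addnS.
    rewrite [q`_(i - j)]nth_default ?mulr0 ?subr0 // sqm; lia.
  exists r => //.
  have -> : s ^+ j.+1 *: P - r = (s ^+ j *: P' - r) + (s ^+ j * P`_(m + j)) *: 'X^j * q.
    by rewrite /P' scalerBr scalerA -exprSr -!scalerAl scalerA [in RHS]addrAC subrK.
  have [[_ ID _] _ _] := I_prime; apply: ID => //; exact: I_mul.
have [Q1 Q1m IQ1] := I_monic; pose M := size Q1; pose t := s ^+ M.
have t0 : iota t != 0 by rewrite tofrac_eq0 expf_neq0.
(* Division by the monic Q1 first bounds the degree, so the denominator t does not depend on n. *)
have redX n : exists2 r : {poly S}, (size r <= m)%N & I (t *: 'X^n - r).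
  pose P := Pdiv.Ring.rmodp 'X^n Q1.
  have [|r sr Ir] := red M P.
    apply: leq_trans (leq_addl m M); apply: ltnW.
    by rewrite Pdiv.Ring.ltn_rmodpN0 // monic_neq0.
  exists r => //.
  have -> : t *: 'X^n - r = (s ^+ M *: P - r) + t *: (Pdiv.Ring.rdivp 'X^n Q1 * Q1).
    by rewrite {1}(Pdiv.RingMonic.rdivp_eq Q1m 'X^n) scalerDr -addrA addrC.
  by have [[_ ID _] _ _] := I_prime; apply: ID => //; apply: I_scale; exact: I_mul.
pose dd := (size Q0).-1.
have ddE : dd = m by rewrite /dd sQ0.
have sQ : size Q0 = dd.+1 by rewrite ddE sQ0.
have QE : Q0 = \sum_(j < dd) Q0`_j *: 'X^j + 'X^dd.
  rewrite -{1}(coefK Q0) poly_def sQ big_ord_recr /=; congr (_ + _).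
  by have := Q0m; rewrite monicE lead_coefE sQ => /eqP ->; rewrite scale1r.
pose C : 'M[F]_dd := companionmx Q0.
pose pol (u : 'rV[F]_dd) : {poly F} := \sum_j u 0 j *: 'X^j.
have spol u : (size (pol u) <= dd)%N.
  apply: leq_trans (size_sum _ _ _) _; apply/bigmax_leqP => j _.
  by apply: leq_trans (size_scale_leq _ _) _; rewrite size_polyXn.
have polE u (j : 'I_dd) : (pol u)`_j = u 0 j.
  rewrite coef_sum (bigD1 j) //= coefZ coefXn eqxx mulr1 big1 ?addr0 // => i ij.
  by rewrite coefZ coefXn eq_sym (inj_eq val_inj) (negPf ij) mulr0.
(* Row vectors stand for residues modulo Q0, and C acts on them as multiplication by X. *)
have claimA u : exists h, 'X * pol u - pol (u *m C) = h * Q0.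
  exists (\sum_(i < dd) (u 0 i * (i == dd.-1 :> nat)%:R)%:P).
  have -> : pol (u *m C) = \sum_i u 0 i *: \sum_j C i j *: 'X^j.
    rewrite /pol; under eq_bigr => j _ do rewrite mxE scaler_suml.
    rewrite exchange_big; apply: eq_bigr => i _; rewrite scaler_sumr.
    by apply: eq_bigr => j _; rewrite scalerA.
  rewrite /pol mulr_sumr -sumrB mulr_suml; apply: eq_bigr => i _.
  rewrite -scalerAr -exprS -scalerBr mul_polyC -scalerA; congr (_ *: _).
  have [id|id] := eqVneq (i : nat) dd.-1; last first.
    rewrite scale0r; apply/eqP; rewrite subr_eq0; apply/eqP.
    have i1 : (i.+1 < dd)%N by have := ltn_ord i; lia.
    rewrite (bigD1 (Ordinal i1)) //= mxE (negPf id) eqxx scale1r big1 ?addr0 // => j ji.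
    rewrite mxE (negPf id) (_ : (i.+1 == j :> nat) = false) ?scale0r //.
    by apply: contra_neqF ji => /eqP e; apply/val_inj.
  rewrite scale1r; have -> : i.+1 = dd by have := ltn_ord i; lia.
  under eq_bigr => j _ do rewrite mxE id eqxx scaleNr.
  by rewrite sumrN opprK [RHS]QE addrC.
pose P k : 'M[F]_dd := iter k (fun A => A *m C) 1%:M.
have claimB k (i : 'I_dd) : exists h : {poly F}, 'X^(k + i) - pol (row i (P k)) = h * Q0.
  elim: k => [|k [h hk]].
    exists 0; rewrite mul0r; apply/eqP; rewrite subr_eq0; apply/eqP.
    rewrite /pol (bigD1 i) //= !mxE eqxx scale1r big1 ?addr0 // => j ji.
    by rewrite !mxE eq_sym (negPf ji) scale0r.
  have [h' hk'] := claimA (row i (P k)); exists ('X * h + h').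
  rewrite /= row_mul mulrDl -hk' -mulrA -hk addSn exprS mulrBr addrA subrK //.
have small (g h : {poly F}) : (size g <= dd)%N -> g = h * Q0 -> g = 0.
  move=> sg e; apply/eqP; apply: contraT => g0.
  have : Q0 %| g by rewrite e dvdp_mull.
  by move/(dvdp_leq g0); rewrite sQ leqNgt ltnS sg.
have claimC k i j : exists c, iota t * P k i j = iota c.
  have [r sr Ir] := redX (k + i)%N; have [h e] := dvdQ _ Ir.
  have [h' e'] := claimB k i; exists r`_j.
  have : iota t *: pol (row i (P k)) - r^i = 0.
    apply: (@small _ (h - iota t *: h')).
      rewrite (leq_trans (size_polyD _ _)) // geq_max size_polyN.
      rewrite (leq_trans (size_scale_leq _ _)) //=.
      by rewrite (leq_trans (size_poly _ _)) // ddE.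
    rewrite mulrBl -e -scalerAl -e' scalerBr rmorphB /= map_polyZ /= map_polyXn.
    by rewrite opprB [RHS]addrC addrA subrK.
  move/(congr1 (fun g : {poly F} => g`_j)); rewrite coefB coefZ polE mxE coef_map coef0.
  by move/eqP; rewrite subr_eq0 => /eqP.
pose A n : 'M[{poly F}]_dd := iter n (mulmx (char_poly_mx C)) 1%:M.
(* C^k (X - C) A_n splits into X C^k A_n and C^(k+1) A_n, so the induction on n has to carry all
   k. *)
have claimD n k i j : exists c : {poly S},
    (iota t)%:P * (map_mx polyC (P k) *m A n) i j = c^i.
  elim: n k i j => [|n IHn] k i j.
    have [c hc] := claimC k i j; exists c%:P.
    by rewrite mulmx1 mxE -rmorphM /= hc map_polyC.
  have [c hc] := IHn k i j; have [c' hc'] := IHn k.+1 i j.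
  exists ('X * c - c'); rewrite rmorphB rmorphM /= map_polyX -hc -hc' /=.
  rewrite /char_poly_mx mulmxBl mulmxBr mulmxA mulmxA mul_mx_scalar -scalemxAl.
  by rewrite map_mxM !mxE mulrBr mulrCA.
have detA n : \det (A n) = Q0 ^+ n.
  elim: n => [|n IHn]; first by rewrite det1.
  by rewrite /= det_mulmx IHn exprS -[\det _]/(char_poly C) companionmxK.
have t1 : (t ^+ dd)%:P != 0 :> {poly S} by rewrite polyC_eq0 !expf_neq0.
have [n|Q eQ] := cint_closed_lift clS t1 (leqnn (size Q0)).
  have /choice[f fP] : forall ij : 'I_dd * 'I_dd, exists c : {poly S},
      (iota t)%:P * (A n) ij.1 ij.2 = c^i.
    move=> [i j]; have [c hc] := claimD n 0%N i j; exists c.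
    by rewrite -hc /= map_mx1 mul1mx.
  exists (\det (\matrix_(i, j) f (i, j))).
  rewrite -det_map_mx -detA map_polyC /= rmorphXn polyC_exp -detZ; congr (\det _).
  by apply/matrixP => i j; rewrite !mxE -fP.
have Qm : Q \is monic.
  move: Q0m; rewrite eQ !monicE lead_coef_map_inj ?rmorph0 //; last exact: tofrac_inj.
  by rewrite -(rmorph1 iota) (inj_eq (@tofrac_inj S)).
have qE : q = s%:P * Q.
  by apply: map_tofrac_inj; rewrite qQ0 eQ rmorphM /= map_polyC mul_polyC.
have IQ : I Q.
  have [_ _ prI] := I_prime; have := Iq; rewrite {1}qE => /prI[/I_const/eqP|//].
  by rewrite (negPf s0).
exists Q; split=> // R IR; exists (Pdiv.Ring.rdivp R Q).
have e := Pdiv.RingMonic.rdivp_eq Qm R.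
suff r0 : Pdiv.Ring.rmodp R Q = 0 by rewrite {1}e r0 addr0.
apply: qmin.
  have -> : Pdiv.Ring.rmodp R Q = R - Pdiv.Ring.rdivp R Q * Q by rewrite {2}e addrC addKr.
  by apply: I_sub => //; exact: I_mul.
rewrite qE mul_polyC size_scale //.
by rewrite Pdiv.Ring.ltn_rmodpN0 // monic_neq0.
Qed.

End MonicGenerator.

(** * Finite extensions *)

Section Ideal.
Context (T : comNzRingType) (J : set T) (J_ideal : ideal J).

Lemma ideal0 : J 0. Proof. by have [] := J_ideal. Qed.
Lemma idealD x y : J x -> J y -> J (x + y). Proof. by have [_ + _] := J_ideal; exact. Qed.
Lemma idealM a x : J x -> J (a * x). Proof. by have [_ _] := J_ideal; exact. Qed.
Lemma idealN x : J x -> J (- x). Proof. by rewrite -mulN1r; exact: idealM. Qed.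
Lemma idealB x y : J x -> J y -> J (x - y).
Proof. by move=> Jx Jy; apply: idealD => //; exact: idealN. Qed.

Lemma ideal_sum (I : Type) (r : seq I) (P : pred I) (F : I -> T) :
  (forall i, P i -> J (F i)) -> J (\sum_(i <- r | P i) F i).
Proof. by move=> h; apply: big_ind => //; [exact: ideal0|exact: idealD]. Qed.

Lemma ideal_trans x y z : J (x - y) -> J (y - z) -> J (x - z).
Proof. by move=> xy yz; rewrite -(subrK y x) -addrA; exact: idealD. Qed.

Lemma ideal_subM x y x' y' : J (x - x') -> J (y - y') -> J (x * y - x' * y').
Proof.
move=> hx hy; have -> : x * y - x' * y' = y * (x - x') + x' * (y - y') by ring.
by apply: idealD; exact: idealM.
Qed.

Lemma ideal_subsum (I : Type) (r : seq I) (F G : I -> T) :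
  (forall i, J (F i - G i)) -> J (\sum_(i <- r) F i - \sum_(i <- r) G i).
Proof. by move=> h; rewrite -sumrB; exact: ideal_sum. Qed.

End Ideal.

Section FgMod.
Context (S T : comNzRingType) (Phi : {rmorphism S -> T}).
Implicit Types (J A : set T) (x y z : T).

Definition fg_subring J A : Prop :=
  [/\ J `<=` A, forall s, A (Phi s),
      forall x y, A x -> A y -> A (x + y),
      forall x y, A x -> A y -> A (x * y) &
      exists (l : nat) (m : 'I_l -> T), (forall i, A (m i)) /\
        forall f, A f -> exists c : 'I_l -> S, J (f - \sum_i Phi (c i) * m i)].

Definition localized A (X : T) : set T := [set f | exists N, A (X ^+ N * f)].

(* [T / J] is finite over [S] after inverting the image of [X]; everything is  *)
(* stated in [T] modulo [J] to avoid quotient rings and localisations.        *)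
Definition loc_finite J (X : S) : Prop :=
  exists A, fg_subring J A /\ forall f, localized A (Phi X) f.

Section FgSubring.
Context (J A : set T) (J_ideal : ideal J) (AP : fg_subring J A).

Lemma fg0 : A 0. Proof. by have [_ h _ _ _] := AP; rewrite -(rmorph0 Phi). Qed.
Lemma fg1 : A 1. Proof. by have [_ h _ _ _] := AP; rewrite -(rmorph1 Phi). Qed.
Lemma fgD x y : A x -> A y -> A (x + y). Proof. by have [_ _ + _ _] := AP; exact. Qed.
Lemma fgM x y : A x -> A y -> A (x * y). Proof. by have [_ _ _ + _] := AP; exact. Qed.
Lemma fgPhi s : A (Phi s). Proof. by have [_ + _ _ _] := AP; exact. Qed.
Lemma fgJ x : J x -> A x. Proof. by have [+ _ _ _ _] := AP; exact. Qed.

Lemma fgX x n : A x -> A (x ^+ n).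
Proof.
move=> Ax; elim: n => [|n IHn]; first by rewrite expr0; exact: fg1.
by rewrite exprS; exact: fgM.
Qed.

Lemma fgN x : A x -> A (- x).
Proof.
by move=> Ax; rewrite -mulN1r -(rmorphN1 Phi); apply: fgM => //; exact: fgPhi.
Qed.

Lemma fg_sum (I : Type) (r : seq I) (P : pred I) (F : I -> T) :
  (forall i, P i -> A (F i)) -> A (\sum_(i <- r | P i) F i).
Proof. by move=> h; apply: big_ind => //; [exact: fg0|exact: fgD]. Qed.

Context (X : S).
Local Notation loc := (localized A (Phi X)).

Lemma loc_ge x N N' : A (Phi X ^+ N * x) -> (N <= N')%N -> A (Phi X ^+ N' * x).
Proof.
move=> h NN'; rewrite -(subnK NN') exprD -mulrA; apply: fgM => //.
by rewrite -rmorphXn; exact: fgPhi.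
Qed.

Lemma loc_sub x : A x -> loc x.
Proof. by move=> Ax; exists 0%N; rewrite expr0 mul1r. Qed.

Lemma locD x y : loc x -> loc y -> loc (x + y).
Proof.
move=> [N hN] [N' hN']; exists (N + N')%N; rewrite mulrDr; apply: fgD.
  by apply: loc_ge hN _; exact: leq_addr.
by apply: loc_ge hN' _; exact: leq_addl.
Qed.

Lemma locM x y : loc x -> loc y -> loc (x * y).
Proof.
by move=> [N hN] [N' hN']; exists (N + N')%N; rewrite exprD mulrACA; exact: fgM.
Qed.

Lemma locX x n : loc x -> loc (x ^+ n).
Proof.
move=> lx; elim: n => [|n IHn]; last by rewrite exprS; exact: locM.
by apply: loc_sub; rewrite expr0; exact: fg1.
Qed.

Lemma loc_sum (I : Type) (r : seq I) (P : pred I) (F : I -> T) :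
  (forall i, P i -> loc (F i)) -> loc (\sum_(i <- r | P i) F i).
Proof.
by move=> h; apply: big_ind => //; [apply: loc_sub; exact: fg0|exact: locD].
Qed.

Lemma loc_prod (I : Type) (r : seq I) (P : pred I) (F : I -> T) :
  (forall i, P i -> loc (F i)) -> loc (\prod_(i <- r | P i) F i).
Proof.
by move=> h; apply: big_ind => //; [apply: loc_sub; exact: fg1|exact: locM].
Qed.

(** Take the polynomials of degree at most D in z with coefficients in A, modulo J. The relation
    rewrites z^(D+1), so they are stable under multiplication by z and form a ring, generated as a
    module by the z^i m_j. *)
Let adjoin_integral z D (a : nat -> T) : (forall i, A (a i)) ->
  J (z ^+ D.+1 + \sum_(i < D.+1) a i * z ^+ i) ->
  exists A', [/\ fg_subring J A', A `<=` A' & A' z].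
Proof.
move=> Aa rel.
pose sp (c : nat -> T) := \sum_(i < D.+1) c i * z ^+ i.
pose A' := [set f | exists c : nat -> T, (forall i, A (c i)) /\ J (f - sp c)].
have A'J x y : J (x - y) -> A' y -> A' x.
  move=> xy [c [Ac yc]]; exists c; split=> //; exact: (ideal_trans J_ideal xy).
have A'D x y : A' x -> A' y -> A' (x + y).
  move=> [c [Ac xc]] [c' [Ac' yc]]; exists (fun i => c i + c' i); split.
    by move=> i; exact: fgD.
  have -> : sp (fun i => c i + c' i) = sp c + sp c'.
    by rewrite /sp -big_split; apply: eq_bigr => i _; rewrite /= mulrDl.
  by rewrite opprD addrACA; exact: idealD.
have A'0 : A' 0.
  exists (fun=> 0); split=> [i|]; first exact: fg0.
  by rewrite /sp big1 ?subrr => [|i _]; [exact: ideal0|rewrite mul0r].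
have A'A x y : A x -> A' y -> A' (x * y).
  move=> Ax [c [Ac yc]]; exists (fun i => x * c i); split=> [i|]; first exact: fgM.
  have -> : sp (fun i => x * c i) = x * sp c.
    by rewrite /sp mulr_sumr; apply: eq_bigr => i _; rewrite mulrA.
  by rewrite -mulrBr; exact: idealM.
have A'1 : A' 1.
  exists (fun i => if i == 0%N then 1 else 0); split=> [i|].
    by case: eqP => _; [exact: fg1|exact: fg0].
  rewrite /sp big_ord_recl /= expr0 mulr1 big1 ?addr0 ?subrr; last first.
    by move=> i _; rewrite mul0r.
  exact: ideal0.
have A'sum (I : Type) (r : seq I) (F : I -> T) :
    (forall i, A' (F i)) -> A' (\sum_(i <- r) F i).
  by move=> h; apply: big_ind.
have AA' x : A x -> A' x by move=> Ax; rewrite -[x]mulr1; exact: A'A.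
have A'z y : A' y -> A' (z * y).
  move=> [c [Ac yc]]; apply: (@A'J _ (z * sp c)).
    by rewrite -mulrBr; exact: idealM.
  (* Shift the coefficients by one and rewrite the term c_D z^(D+1) by the relation. *)
  pose c' i := (if i is i'.+1 then c i' else 0) - c D * a i.
  exists c'; split.
    move=> i; apply: fgD; first by case: i => [|i] //; exact: fg0.
    by apply: fgN; exact: fgM.
  have -> : z * sp c - sp c' = c D * (z ^+ D.+1 + \sum_(i < D.+1) a i * z ^+ i).
    have -> : sp c' = \sum_(i < D) c i * z ^+ i.+1 - c D * \sum_(i < D.+1) a i * z ^+ i.
      rewrite /sp; under eq_bigr => i _ do rewrite /c' mulrBl.
      rewrite sumrB big_ord_recl /= mul0r add0r; congr (_ - _).
      by rewrite mulr_sumr; apply: eq_bigr => i _; rewrite mulrA.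
    have -> : z * sp c = \sum_(i < D) c i * z ^+ i.+1 + c D * z ^+ D.+1.
      by rewrite /sp mulr_sumr big_ord_recr /= mulrCA -exprS; congr (_ + _);
         apply: eq_bigr => i _; rewrite mulrCA -exprS.
    by rewrite -/(z ^+ _) mulrDr opprB addrACA addrA; ring.
  exact: idealM.
have A'zn y n : A' y -> A' (z ^+ n * y).
  by move=> A'y; elim: n => [|n IHn]; rewrite ?expr0 ?mul1r // exprS -mulrA; exact: A'z.
exists A'; split=> //; last by rewrite -[z]mulr1; exact: A'z.
split=> //.
- by move=> x Jx; apply: (@A'J _ 0) => //; rewrite subr0.
- by move=> s; apply: AA'; exact: fgPhi.
- move=> x y A'x [c [Ac yc]]; apply: (@A'J _ (\sum_(i < D.+1) c i * (z ^+ i * x))).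
    have -> : \sum_(i < D.+1) c i * (z ^+ i * x) = x * sp c.
      by rewrite /sp mulr_sumr; apply: eq_bigr => i _; ring.
    by rewrite -mulrBr; exact: idealM.
  by apply: A'sum => i; apply: A'A => //; exact: A'zn.
have [_ _ _ _ [l [m [Am gen]]]] := AP.
pose I : finType := ('I_D.+1 * 'I_l)%type.
pose ev (k : 'I_#|I|) : I := enum_val k.
exists #|I|, (fun k => z ^+ (ev k).1 * m (ev k).2).
split=> [k|f [c [Ac fc]]]; first by apply: A'zn; exact: AA'.
have /choice[g hg] : forall i : nat, exists g : 'I_l -> S, J (c i - \sum_j Phi (g j) * m j).
  by move=> i; exact: gen.
exists (fun k => g (ev k).1 (ev k).2).
apply: (ideal_trans J_ideal fc).
rewrite -(@reindex _ _ _ _ _ ev xpredT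
  (fun ij => Phi (g ij.1 ij.2) * (z ^+ ij.1 * m ij.2))); last first.
  exact/onW_bij/enum_val_bij.
rewrite -(pair_bigA _ (fun (i : 'I_D.+1) j => Phi (g i j) * (z ^+ i * m j))) /=.
have -> : \sum_(i < D.+1) \sum_j Phi (g i j) * (z ^+ i * m j) =
    \sum_(i < D.+1) (\sum_j Phi (g i j) * m j) * z ^+ i.
  apply: eq_bigr => i _; rewrite mulr_suml; apply: eq_bigr => j _.
  by rewrite mulrA mulrAC.
apply: ideal_subsum => // i; rewrite -mulrBl mulrC; exact: idealM.
Qed.

(** Clear denominators: for w a high power of X, the product w z is integral over A itself, with
    coefficients w^(D - i) b_i. *)
Lemma fg_adjoin z D (b : nat -> T) : (forall i, loc (b i)) ->
  J (z ^+ D + \sum_(i < D) b i * z ^+ i) ->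
  exists A', [/\ fg_subring J A', A `<=` A' & localized A' (Phi X) z].
Proof.
(* In degree 0 the relation says that 1 lies in J; then every relation of degree 1 holds as well. *)
wlog D0 : D b / (0 < D)%N.
  move=> h; case: D => [|D]; last exact: h.
  move=> lb; rewrite expr0 big_ord0 addr0 => J1.
  apply: (h 1%N (fun=> 0)) => //; first by move=> i; apply: loc_sub; exact: fg0.
  by rewrite -[X in J X]mulr1; exact: idealM.
case: D D0 => // D _ lb rel.
have /choice[N hN] := lb.
pose M := (\max_(i < D.+1) N i)%N; pose w := Phi X ^+ M.
have Aw : A w by rewrite /w -rmorphXn; exact: fgPhi.
pose a i := if (i < D.+1)%N then w ^+ (D.+1 - i) * b i else 0.
have [||A' [A'P AA' A'z]] := @adjoin_integral (w * z) D a.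
- move=> i; rewrite /a; case: ltnP => [iD|_]; last exact: fg0.
  rewrite subSn // exprSr -mulrA; apply: fgM; first exact: fgX.
  by apply: (loc_ge (hN i)); exact: (leq_bigmax (Ordinal iD)).
- have -> : (w * z) ^+ D.+1 + \sum_(i < D.+1) a i * (w * z) ^+ i =
      w ^+ D.+1 * (z ^+ D.+1 + \sum_(i < D.+1) b i * z ^+ i).
    rewrite mulrDr exprMn mulr_sumr; congr (_ + _); apply: eq_bigr => i _.
    have -> : w ^+ D.+1 = w ^+ (D.+1 - i) * w ^+ i.
      by rewrite -exprD subnK // ltnW.
    by rewrite /a ltn_ord exprMn; ring.
  exact: idealM.
- by exists A'; split=> //; exists M.
Qed.

End FgSubring.
End FgMod.

Section Determinant.
Context (S T : comNzRingType) (Phi : {rmorphism S -> T}).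
Context (J A : set T) (J_ideal : ideal J).

(** The adjugate shows that det M kills every m_k modulo J, and 1 is a combination of the m_k. *)
Lemma det_annihilates l (m : 'I_l -> T) (e : 'I_l -> T) (M : 'M[T]_l) :
  (forall j, J (\sum_k M j k * m k)) -> J (1 - \sum_k e k * m k) -> J (\det M).
Proof.
move=> hM h1.
have hdet k : J (\det M * m k).
  have -> : \det M * m k = \sum_j adjugate M k j * (\sum_i M j i * m i).
    have adjE i : \sum_j adjugate M k j * M j i = \det M *+ (k == i).
      by have := congr1 (fun B : 'M[T]_l => B k i) (mul_adj_mx M); rewrite !mxE.
    under eq_bigr => j _ do rewrite mulr_sumr.
    rewrite exchange_big (bigD1 k) //= [X in _ + X]big1 ?addr0 => [|i ik].
      under eq_bigr => j _ do rewrite mulrA.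
      by rewrite -mulr_suml adjE eqxx mulr1n.
    under eq_bigr => j _ do rewrite mulrA.
    by rewrite -mulr_suml adjE eq_sym (negPf ik) mulr0n mul0r.
  by apply: ideal_sum => // j _; apply: idealM => //; exact: hM.
have -> : \det M = \det M * (1 - \sum_k e k * m k) + \sum_k e k * (\det M * m k).
  rewrite mulrBr mulr1 mulr_sumr -addrA [X in _ + X]addrC.
  by rewrite -sumrB big1 ?addr0 // => k _; rewrite mulrCA subrr.
apply: idealD => //; first exact: idealM.
by apply: ideal_sum => // k _; exact: idealM.
Qed.

Lemma fg_integral z : fg_subring Phi J A -> A z ->
  exists Q : {poly S}, Q \is monic /\ J (map_poly Phi Q).[z].
Proof.
move=> AP Az; have [_ _ _ _ [l [m [Am gen]]]] := AP.
have [e he] := gen _ (fg1 AP).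
have /choice[g hg] : forall j, exists g : 'I_l -> S,
    J (z * m j - \sum_k Phi (g k) * m k).
  by move=> j; apply: gen; apply: (fgM AP).
pose G : 'M[S]_l := \matrix_(j, k) g j k.
exists (char_poly G); split; first exact: char_poly_monic.
pose ev : {rmorphism {poly S} -> T} := horner_eval z \o map_poly Phi.
rewrite -[X in J X]/(ev (char_poly G)) /char_poly -det_map_mx.
apply: (det_annihilates (m := m) (e := fun k => Phi (e k))) => // j.
have -> : \sum_k map_mx ev (char_poly_mx G) j k * m k =
    z * m j - \sum_k Phi (g j k) * m k.
  have evE k : ev (char_poly_mx G j k) = z *+ (j == k) - Phi (g j k).
    rewrite !mxE rmorphB rmorphMn /= /horner_eval map_polyX hornerX map_polyC /=.
    by rewrite hornerC.
  under eq_bigr => k _ do rewrite mxE evE mulrBl.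
  rewrite sumrB (bigD1 j) //= eqxx mulr1n big1 ?addr0 // => k kj.
  by rewrite eq_sym (negPf kj) mulr0n mul0r.
exact: hg.
Qed.

Context (R : realType).

(** Every permutation other than the identity meets an off-diagonal entry, which is smaller than s;
    so the product over the diagonal dominates. *)
Lemma det_dominant l (b : S -> R) (s : S) (G : 'M[S]_l) : valuation b -> 0 < b s ->
  (forall i j, b (G i j) < b s) -> b (\det (s%:M - G)) = b s ^+ l.
Proof.
move=> bV s0 bG.
have ble i j : b ((s%:M - G) i j) <= b s.
  rewrite !mxE; apply: le_trans (valB bV _ _) _; rewrite ge_max (ltW (bG _ _)) andbT.
  by case: eqP => _; rewrite ?mulr1n ?mulr0n ?(val0 bV) // ltW.
have bsgn k : b ((-1) ^+ k) = 1 by rewrite (valX bV) (valN bV) (val1 bV) expr1n.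
have b1 : b (\prod_i (s%:M - G) i ((1%g : 'S_l) i)) = b s ^+ l.
  rewrite (val_prod bV) -[l in RHS]card_ord -prodr_const; apply: eq_bigr => i _.
  rewrite !mxE perm1 eqxx mulr1n addrC; apply: (val_eqD bV).
  by rewrite (valN bV).
rewrite /determinant (bigD1 1%g) //= odd_perm1 expr0 mul1r addrC -b1.
apply: (val_eqD bV); rewrite b1; apply: (val_sum_lt bV) => [|p p1].
  exact: exprn_gt0.
rewrite (valM bV) bsgn mul1r (val_prod bV).
have [i pi] : exists i, p i != i.
  apply: contrapT => /forallNP h; case/eqP: p1; apply/permP => i.
  by rewrite perm1; apply/eqP; rewrite -[_ == _]negbK; apply/negP/h.
have -> : b s ^+ l = b s * \prod_(j < l | j != i) b s.
  have -> : b s ^+ l = \prod_(j < l) b s by rewrite prodr_const card_ord.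
  by rewrite (bigD1 i).
rewrite (bigD1 i) //=.
have bi : b ((s%:M - G) i (p i)) < b s.
  by rewrite !mxE eq_sym (negPf pi) mulr0n sub0r (valN bV).
have p0 : 0 < \prod_(j < l | j != i) b s by apply: prodr_gt0.
apply: (@le_lt_trans _ _ (b ((s%:M - G) i (p i)) * \prod_(j < l | j != i) b s)).
  rewrite ler_wpM2l ?(val_ge0 bV) //; apply: ler_prod => j _.
  by rewrite (val_ge0 bV) ble.
by rewrite ltr_pM2r.
Qed.

(** Measure f by the smallest coefficients that express some X^N f through module generators. The
    constant C0, a bound for the structure constants, makes this submultiplicative. On the image of
    S it is at least b: too small an expression of X^N s would give a matrix G such that det (X^N s
    - G) falls into J although its value is a power of that of X^N s. [valuation_exists] then makes
    it multiplicative and exact on S. *)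
Lemma lying_over (X : S) (b : S -> R) : loc_finite Phi J X -> valuation b ->
  0 < b X -> (forall s, J (Phi s) -> b s = 0) ->
  exists q : T -> R, [/\ valuation q, forall f, J f -> q f = 0 &
    forall s, q (Phi s) = b s].
Proof.
move=> [A0 [AP locA]] bV X0 bJ.
have [_ _ _ _ [l [m [Am gen]]]] := AP.
have [e he] := gen _ (fg1 AP).
have /choice[C hC] : forall ij : 'I_l * 'I_l, exists c : 'I_l -> S,
    J (m ij.1 * m ij.2 - \sum_k Phi (c k) * m k).
  by move=> ij; apply: gen; apply: (fgM AP).
pose C0 : R := \big[Num.max/1]_(x : 'I_l * 'I_l * 'I_l) b (C x.1 x.2).
have C0_1 : 1 <= C0 by exact: bigmax_ge_id.
have C0_0 : 0 < C0 by exact: lt_le_trans C0_1.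
have C0_ge i j k : b (C (i, j) k) <= C0.
  exact: (le_bigmax _ (fun x : 'I_l * 'I_l * 'I_l => b (C x.1 x.2)) (i, j, k)).
(* [rep f Ng]: the pair [Ng] writes [X ^ N f] in terms of the generators. *)
pose rep f (Ng : nat * ('I_l -> S)) :=
  J (Phi X ^+ Ng.1 * f - \sum_k Phi (Ng.2 k) * m k).
pose nrm (Ng : nat * ('I_l -> S)) : R :=
  (\big[Num.max/0]_k b (Ng.2 k)) / b X ^+ Ng.1.
have XN n : 0 < b X ^+ n by exact: exprn_gt0.
have nrm0 Ng : 0 <= nrm Ng by rewrite divr_ge0 ?bigmax_ge_id // ltW.
have nrm_ge Ng k : b (Ng.2 k) <= nrm Ng * b X ^+ Ng.1.
  by rewrite divfK ?gt_eqF //; exact: (le_bigmax _ (fun k => b (Ng.2 k))).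
have nrm_le Ng c : 0 <= c -> (forall k, b (Ng.2 k) <= c * b X ^+ Ng.1) -> nrm Ng <= c.
  move=> c0 h; rewrite ler_pdivrMr //; apply/bigmax_leP; split=> [|k _]; last exact: h.
  by rewrite mulr_ge0 // ltW.
have rep_ext f N' Ng : rep f Ng -> exists2 g, rep f (Ng.1 + N', g)%N & nrm ((Ng.1 + N')%N, g) <= nrm Ng.
  move=> r; exists (fun k => X ^+ N' * Ng.2 k).
    rewrite /rep /= addnC exprD -mulrA.
    have -> : \sum_k Phi (X ^+ N' * Ng.2 k) * m k =
        Phi X ^+ N' * \sum_k Phi (Ng.2 k) * m k.
      by rewrite mulr_sumr; apply: eq_bigr => k _; rewrite rmorphM rmorphXn mulrA.
    by rewrite -mulrBr; exact: idealM.
  apply: nrm_le => // k; rewrite /= (valM bV) (valX bV) exprD mulrA [leRHS]mulrC.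
  by rewrite ler_pM2l.
have ex_rep f : exists Ng, rep f Ng.
  by have [N hN] := locA f; have [g hg] := gen _ hN; exists (N, g).
pose Ix f := {Ng | rep f Ng}.
pose nI f (i : Ix f) := nrm (sval i).
have i0 f : Ix f by have [Ng h] := cid (ex_rep f); exists Ng.
have nI0 f i : 0 <= nI f i by exact: nrm0.
pose p0 f := C0 * inf (range (nI f)).
have p0_le f Ng : rep f Ng -> p0 f <= C0 * nrm Ng.
  by move=> r; rewrite ler_pM2l //; exact: (@inf_le _ _ _ (exist _ Ng r)).
have p0_ge0 f : 0 <= p0 f by rewrite mulr_ge0 ?(ltW C0_0) //; exact: (le_inf (i0 f)).
have p0_Phi s f : p0 (Phi s * f) <= b s * p0 f.
  have [s0|s0] := eqVneq (b s) 0.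
    have [Ng r] := ex_rep f; rewrite s0 mul0r.
    apply: le_trans (@p0_le _ (Ng.1, fun k => s * Ng.2 k) _) _.
      rewrite /rep /=; have -> : \sum_k Phi (s * Ng.2 k) * m k = Phi s * \sum_k Phi (Ng.2 k) * m k.
        by rewrite mulr_sumr; apply: eq_bigr => k _; rewrite rmorphM mulrA.
      by rewrite mulrCA -mulrBr; exact: idealM.
    rewrite -(mulr0 C0) ler_pM2l //; apply: nrm_le => // k /=.
    by rewrite (valM bV) s0 !mul0r.
  have {}s0 : 0 < b s by rewrite lt_neqAle eq_sym s0 (val_ge0 bV).
  rewrite mulrCA ler_pM2l // -ler_pdivrMl //; apply: (le_inf (i0 f)) => -[Ng r].
  rewrite ler_pdivrMl // /nI /=.
  have r' : rep (Phi s * f) (Ng.1, fun k => s * Ng.2 k).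
    rewrite /rep /=; have -> : \sum_k Phi (s * Ng.2 k) * m k = Phi s * \sum_k Phi (Ng.2 k) * m k.
      by rewrite mulr_sumr; apply: eq_bigr => k _; rewrite rmorphM mulrA.
    by rewrite mulrCA -mulrBr; exact: idealM.
  apply: le_trans (@inf_le _ _ (nI _) (exist _ _ r') _) _ => //.
  rewrite /nI /=; apply: nrm_le => [|k /=]; first by rewrite mulr_ge0 // ltW.
  by rewrite (valM bV) -mulrA ler_pM2l.
have p0P : submult p0.
  split=> //.
  - apply/eqP; rewrite eq_le p0_ge0 andbT; apply: le_trans (@p0_le _ (0%N, fun=> 0) _) _.
      rewrite /rep /= mulr0 big1 ?subrr => [|k _]; first exact: ideal0.
      by rewrite rmorph0 mul0r.
    by rewrite -(mulr0 C0) ler_pM2l //; apply: nrm_le => // k /=; rewrite (val0 bV) mul0r.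
  - move=> x y; rewrite /p0 [leRHS]maxC -maxr_pMr ?(ltW C0_0) // ler_pM2l // maxC.
    apply: (le_max_inf (i0 x) (i0 y)) => -[[N g] r] [[N' g'] r'] /=; rewrite /nI /=.
    have [h rh hle] := rep_ext x N' _ r; have [h' rh' hle'] := rep_ext y N _ r'.
    rewrite /= in rh hle rh' hle'; rewrite addnC in rh' hle'.
    have r2 : rep (x - y) ((N + N')%N, fun k => h k - h' k).
      rewrite /rep /= mulrBr.
      have -> : \sum_k Phi (h k - h' k) * m k = \sum_k Phi (h k) * m k - \sum_k Phi (h' k) * m k.
        by rewrite -sumrB; apply: eq_bigr => k _; rewrite rmorphB mulrBl.
      rewrite opprD opprK addrACA; apply: idealD => //; rewrite addrC -opprB; exact: idealN.
    apply: le_trans (@inf_le _ _ (nI _) (exist _ _ r2) _) _ => //; rewrite /nI /=.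
    apply: nrm_le => [|k /=]; first by rewrite le_max nrm0.
    apply: le_trans (valB bV _ _) _.
    rewrite maxr_pMl ?(ltW (XN _)) // ge_max !le_max.
    apply/andP; split; apply/orP; [left|right].
      by apply: le_trans (nrm_ge ((N + N')%N, h) k) _; rewrite ler_pM2r.
    by apply: le_trans (nrm_ge ((N + N')%N, h') k) _; rewrite ler_pM2r.
  - move=> x y; rewrite /p0 -mulrA ler_pM2l // mulrCA -ler_pdivrMl //.
    apply: (le_mul_inf (i0 x) (i0 y)) => // -[[N g] r] [[N' g'] r'] /=; rewrite /nI /=.
    pose h k := \sum_i \sum_j g i * g' j * C (i, j) k.
    have r2 : rep (x * y) ((N + N')%N, h).
      rewrite /rep /= exprD mulrACA; apply: (ideal_trans J_ideal (ideal_subM J_ideal r r')).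
      rewrite /= mulr_suml.
      have -> : \sum_k Phi (h k) * m k =
          \sum_i \sum_j Phi (g i) * Phi (g' j) * \sum_k Phi (C (i, j) k) * m k.
        under eq_bigr => k _ do rewrite rmorph_sum mulr_suml.
        rewrite exchange_big; apply: eq_bigr => i _.
        under eq_bigr => k _ do rewrite rmorph_sum mulr_suml.
        rewrite exchange_big; apply: eq_bigr => j _ /=.
        by rewrite mulr_sumr; apply: eq_bigr => k _; rewrite !rmorphM mulrA.
      apply: ideal_subsum => // i; rewrite mulr_sumr; apply: ideal_subsum => // j.
      by rewrite mulrACA -mulrBr; apply: idealM => //; exact: (hC (i, j)).
    rewrite ler_pdivrMl //.
    apply: le_trans (@inf_le _ _ (nI _) (exist _ _ r2) _) _ => //; rewrite /nI /=.
    apply: nrm_le => [|k /=]; first exact: mulr_ge0 (ltW C0_0) (mulr_ge0 (nrm0 _) (nrm0 _)).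
    have c0 : 0 <= C0 * (nrm (N, g) * nrm (N', g')) * b X ^+ (N + N').
      exact: mulr_ge0 (mulr_ge0 (ltW C0_0) (mulr_ge0 (nrm0 _) (nrm0 _))) (ltW (XN _)).
    apply: (val_sum_le bV) => // i _; apply: (val_sum_le bV) => // j _.
    rewrite !(valM bV) exprD.
    have -> : C0 * (nrm (N, g) * nrm (N', g')) * (b X ^+ N * b X ^+ N') =
       (nrm (N, g) * b X ^+ N) * (nrm (N', g') * b X ^+ N') * C0 by ring.
    apply: ler_pM => //; rewrite ?mulr_ge0 ?(val_ge0 bV) //.
    apply: ler_pM; rewrite ?(val_ge0 bV) //; first exact: (nrm_ge (N, g)).
    exact: (nrm_ge (N', g')).
have p0_ge s : 0 < b s -> b s <= p0 (Phi s).
  move=> s0; rewrite /p0 -ler_pdivrMl //; apply: (le_inf (i0 _)) => -[[N g] r].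
  rewrite ler_pdivrMl // /nI /=; rewrite leNgt; apply/negP => lt_s.
  pose s' := X ^+ N * s.
  have bs' : b s' = b s * b X ^+ N by rewrite (valM bV) (valX bV) mulrC.
  have s'0 : 0 < b s' by rewrite bs' mulr_gt0.
  pose G : 'M[S]_l := \matrix_(j, k) \sum_i g i * C (i, j) k.
  have bG j k : b (G j k) < b s'.
    rewrite mxE; apply: (val_sum_lt bV) => // i _; rewrite (valM bV) bs'.
    apply: (@le_lt_trans _ _ (nrm (N, g) * b X ^+ N * C0)).
      by rewrite ler_pM ?(val_ge0 bV) //; exact: (nrm_ge (N, g)).
    by rewrite mulrAC ltr_pM2r // mulrC.
  have : J (Phi (\det (s'%:M - G))).
    rewrite -det_map_mx; apply: (det_annihilates (m := m) (e := fun k => Phi (e k))) => // j.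
    have -> : \sum_k map_mx Phi (s'%:M - G) j k * m k =
        Phi s' * m j - \sum_i Phi (g i) * \sum_k Phi (C (i, j) k) * m k.
      under eq_bigr => k _ do rewrite !mxE rmorphB rmorphMn rmorph_sum mulrBl.
      rewrite sumrB (bigD1 j) //= eqxx mulr1n big1 ?addr0; last first.
        by move=> k kj; rewrite eq_sym (negPf kj) mulr0n mul0r.
      congr (_ - _); under eq_bigr => k _ do rewrite mulr_suml.
      rewrite exchange_big; apply: eq_bigr => i _; rewrite mulr_sumr.
      by apply: eq_bigr => k _; rewrite rmorphM mulrA.
    apply: (@ideal_trans _ _ J_ideal _ ((\sum_i Phi (g i) * m i) * m j)).
      rewrite -mulrBl mulrC; apply: idealM => //.
      by rewrite /s' rmorphM rmorphXn; exact: r.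
    rewrite mulr_suml; apply: ideal_subsum => // i; rewrite -mulrA -mulrBr.
    by apply: idealM => //; exact: (hC (i, j)).
  move/bJ; rewrite (det_dominant bV s'0 bG) => /eqP.
  by rewrite expf_eq0 (gt_eqF s'0) andbF.
pose M : set (T * R) := [set x | exists2 s, 0 < b s & x = (Phi s, b s)].
have [|||||q [qV qp qM]] := @valuation_exists _ _ p0 p0P M.
- by exists 1; rewrite ?(val1 bV) ?rmorph1 ?ltr01.
- move=> s x s' x' [t t0 [-> ->]] [t' t'0 [-> ->]]; exists (t * t').
    by rewrite (valM bV) mulr_gt0.
  by rewrite rmorphM (valM bV).
- by move=> s x [t t0 [_ ->]].
- by move=> s x y [t t0 [-> ->]].
- by move=> s x [t t0 [-> ->]]; exact: p0_ge.
exists q; split=> // [f Jf|s].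
- apply/eqP; rewrite eq_le (val_ge0 qV) andbT; apply: le_trans (qp _) _.
  apply: le_trans (@p0_le _ (0%N, fun=> 0) _) _.
    rewrite /rep /= expr0 mul1r big1 ?subr0 // => k _.
    by rewrite rmorph0 mul0r.
  by rewrite -(mulr0 C0) ler_pM2l //; apply: nrm_le => // k /=; rewrite (val0 bV) mul0r.
- have [s0|s0] := eqVneq (b s) 0; last first.
    by apply: qM; exists s => //; rewrite lt_neqAle eq_sym s0 (val_ge0 bV).
  apply/eqP; rewrite s0 eq_le (val_ge0 qV) andbT; apply: le_trans (qp _) _.
  by rewrite -[Phi s]mulr1; apply: le_trans (p0_Phi _ _) _; rewrite s0 mul0r.
Qed.

End Determinant.

(** * Pointwise convergence *)

Section PointwiseTopology.
Context (R : realType) (T : choiceType).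
Local Notation F := {ptws T -> R}.

Lemma eval_continuous (f : T) : continuous (fun xi : F => xi f).
Proof. exact: (@proj_continuous T (fun=> R) f). Qed.

Lemma closed_leq (U : topologicalType) (f g : U -> R) :
  continuous f -> continuous g -> closed [set x | f x <= g x].
Proof.
move=> cf cg.
have cgf : continuous (fun x => g x - f x).
  by move=> x; apply: cvgB; [exact: cg|exact: cf].
have -> : [set x | f x <= g x] = (fun x => g x - f x) @^-1` [set y | 0 <= y].
  by apply/seteqP; split=> x /=; rewrite subr_ge0.
by apply: (proj1 (continuous_closedP _) cgf); exact: closed_ge.
Qed.

Lemma closed_forall (U : topologicalType) (I : Type) (P : I -> set U) :
  (forall i, closed (P i)) -> closed [set x | forall i, P i x].
Proof.
move=> h; have -> : [set x | forall i, P i x] = \bigcap_i P i.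
  by apply/seteqP; split=> x; [move=> hx i _; exact: hx|move=> hx i; exact: hx].
by apply: closed_bigI => i _; exact: h.
Qed.

Lemma closed_imply (U : topologicalType) (A : Prop) (P : set U) :
  closed P -> closed [set x | A -> P x].
Proof.
move=> cP; have [a|na] := pselect A.
  by have -> : [set x | A -> P x] = P by apply/seteqP; split=> x //=; apply.
have -> : [set x | A -> P x] = setT by apply/seteqP; split=> x // _ a; case: na.
exact: closedT.
Qed.

Lemma compact_of_bounds (B : T -> R) (P : set F) :
  closed P -> (forall xi, P xi -> forall f, 0 <= xi f <= B f) -> compact P.
Proof.
move=> cP PB.
have cB := @tychonoff T (fun=> R) (fun f => `[0, B f]%classic) (fun f => @segment_compact R 0 (B f)).
apply: (subclosed_compact cP cB) => xi Pxi f /=.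
by rewrite in_itv /=; exact: PB.
Qed.

(* [compact_cover] is stated for pointed spaces. *)
Definition ptws_pointed : ptopologicalType := HB.pack F (Pointed.on (T -> R)).

Lemma compact_ptws_cover (C : set F) (I : choiceType) (D : set I) (f : I -> set F) :
  compact C -> (forall i, D i -> open (f i)) -> C `<=` cover D f ->
  finite_subset_cover D f C.
Proof.
move=> cC; have : @cover_compact ptws_pointed C by rewrite -compact_cover.
exact.
Qed.

Lemma compact_max (P : set F) (g : F -> R) : compact P -> P !=set0 -> continuous g ->
  exists2 xi, P xi & forall zeta, P zeta -> g zeta <= g xi.
Proof.
move=> cP P0 cg.
have [|xi Pxi ximax] := @compact_EVT_max F R g P P0 cP.
  exact: continuous_subspaceT.
by exists xi; [rewrite -inE|move=> z Pz; apply: ximax; rewrite inE].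
Qed.

End PointwiseTopology.

(** * Products of variables and Newton polygon estimates *)

Fixpoint mvX (K : fieldType) (d : nat) : mvpoly K d :=
  if d is d'.+1 then ((mvX K d')%:P * 'X : {poly mvpoly K d'}) else 1.

Section MvX.
Context (R : realType) (K : fieldType) (v : K -> R) (v_abs : nonarch_abs v).

Lemma mveval_X (T : comAlgType K) (x : nat -> T) d :
  mveval x d (mvX K d) = \prod_(i < d) x i.
Proof.
elim: d => [|d IHd]; first by rewrite rmorph1 big_ord0.
have e : map_poly (mveval x d) ((mvX K d)%:P * 'X) = (mveval x d (mvX K d))%:P * 'X.
  by rewrite rmorphM /= map_polyC map_polyX.
by rewrite mvevalS /= e hornerM hornerC hornerX IHd big_ord_recr.
Qed.

Lemma mvgauss_X (a : nat -> R) d : (forall i, (i < d)%N -> 0 < a i) ->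
  mvgauss v a (mvX K d) = \prod_(i < d) a i.
Proof.
elim: d => [|d IHd] a0; first by rewrite big_ord0 /= (val1 (abs_valuation v_abs)).
have a0' i : (i < d)%N -> 0 < a i by move=> id; apply: a0; rewrite ltnS ltnW.
have ad := a0 d (ltnSn d).
have NV := mvgauss_valuation v_abs a0'.
by rewrite /= gaussM // gaussC // gaussX // IHd // big_ord_recr.
Qed.

Lemma mvgauss_mono (a b : nat -> R) d (s : mvpoly K d) :
  (forall i, (i < d)%N -> 0 < a i <= b i) -> mvgauss v a s <= mvgauss v b s.
Proof.
move=> ab.
have a0 i : (i < d)%N -> 0 < a i by case/ab/andP.
have b0 i : (i < d)%N -> 0 < b i by case/ab/andP; exact: lt_le_trans.
have [->|s0] := eqVneq s 0.
  by rewrite !(val0 (mvgauss_valuation v_abs _)).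
have [t ts <-] := mvgauss_term_ex v_abs a0 s0.
apply: le_trans (mvgauss_term_le v_abs b0 ts); rewrite ler_wpM2l //.
  by have [] := v_abs.
apply: ler_prod => i _; have /andP[ai bi] := ab i (ltn_ord i).
by rewrite exprn_ge0 ?(ltW ai) //= lerXn2r // nnegrE ltW // b0.
Qed.

End MvX.

Fixpoint mvC (K : fieldType) (d : nat) (c : K) : mvpoly K d :=
  match d with 0 => c | d'.+1 => ((mvC d' c)%:P : {poly mvpoly K d'}) end.

Section Evaluation.
Context (S T : comNzRingType) (Phi : {rmorphism S -> T}).

Definition poly_ev (z : T) : {rmorphism {poly S} -> T} := horner_eval z \o map_poly Phi.

Lemma poly_evE z (P : {poly S}) :
  poly_ev z P = \sum_(i < size P) Phi P`_i * z ^+ i.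
Proof. by rewrite /poly_ev /= /horner_eval horner_poly. Qed.

Lemma poly_evC z c : poly_ev z c%:P = Phi c.
Proof. by rewrite /poly_ev /= /horner_eval map_polyC hornerC. Qed.

Lemma poly_evX z : poly_ev z 'X = z.
Proof. by rewrite /poly_ev /= /horner_eval map_polyX hornerX. Qed.

Lemma fg_subring_ev J A z : ideal J -> fg_subring Phi J A -> A z ->
  fg_subring (poly_ev z) J A.
Proof.
move=> JI AP Az; have [JA APhi AD AM [l [m [Am gen]]]] := AP.
split=> // [P|].
  rewrite poly_evE; apply: (fg_sum AP) => i _; apply: AM => //.
  exact: (fgX AP).
exists l, m; split=> // f Af; have [c hc] := gen f Af.
exists (fun i => (c i)%:P).
by under eq_bigr => i _ do rewrite poly_evC.
Qed.

Context (R : realType) (xi : T -> R) (xV : valuation xi).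

(** If z were larger than c, the leading term would strictly dominate all others in Q (z) and could
    not be cancelled. *)
Lemma root_le (Q : {poly S}) (z : T) (c : R) : Q \is monic -> xi (poly_ev z Q) = 0 ->
  0 <= c -> (forall j, (j < (size Q).-1)%N -> xi (Phi Q`_j) <= c ^+ ((size Q).-1 - j)) ->
  xi z <= c.
Proof.
move=> Qm Q0 c0 hc; rewrite leNgt; apply/negP => cz.
have z0 : 0 < xi z by exact: le_lt_trans cz.
move: Q0; rewrite poly_evE; have := monic_neq0 Qm; rewrite -size_poly_gt0.
move: Qm hc; rewrite monicE lead_coefE.
case: (size Q) => // m /= /eqP Qm hc _; rewrite big_ord_recr /= Qm rmorph1 mul1r.
rewrite (val_eqD xV) (valX xV); first by apply/eqP; rewrite gt_eqF // exprn_gt0.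
apply: (val_sum_lt xV) => [|j _]; first exact: exprn_gt0.
rewrite (valM xV) (valX xV).
apply: (@le_lt_trans _ _ (c ^+ (m - j) * xi z ^+ j)).
  by rewrite ler_wpM2r ?hc // exprn_ge0 // ltW.
rewrite -[m in ltRHS](subnK (ltnW (ltn_ord j))) exprD ltr_pM2r ?exprn_gt0 //.
by rewrite ltrXn2r ?nnegrE // ?ltW // -lt0n subn_gt0.
Qed.

Section DropPoly.
Context (N : S -> R) (N_ge0 : forall s, 0 <= N s) (xN : forall s, xi (Phi s) <= N s).
Context (Q : {poly S}) (z : T) (c : R) (k : nat) (c_gt0 : 0 < c).
Hypothesis Qz : xi (poly_ev z Q) = 0.
Hypothesis Nk : 0 < N Q`_k.
Hypothesis dom : forall j, N Q`_j * c ^+ j <= N Q`_k * c ^+ k.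

Let dom_drop i : N Q`_(i + k) * c ^+ i <= N Q`_k.
Proof. by rewrite -(ler_pM2r (exprn_gt0 k c_gt0)) -mulrA -exprD. Qed.

(** Split Q as Q_low + X^k D at an index k that dominates at radius c. For |z| <= c the value of D
    (z) is at most N (Q_k), with equality when Q_k has its full value and k is the largest
    dominating index. For |z| > c the equation Q (z) = 0 turns z^k D (z) into - Q_low (z), which is
    strictly smaller. So D (z) separates the two regions. *)
Lemma drop_poly_le : xi z <= c -> xi (poly_ev z (drop_poly k Q)) <= N Q`_k.
Proof.
move=> zc; rewrite poly_evE; apply: (val_sum_le xV) => [|i _]; first exact: ltW.
rewrite coef_drop_poly (valM xV) (valX xV); apply: le_trans (dom_drop i).
apply: ler_pM => //; rewrite ?(val_ge0 xV) ?exprn_ge0 ?(val_ge0 xV) //.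
by rewrite lerXn2r // nnegrE ?(val_ge0 xV) // ltW.
Qed.

Lemma drop_poly_eq : xi z <= c -> xi (Phi Q`_k) = N Q`_k ->
  (forall j, (k < j)%N -> N Q`_j * c ^+ j < N Q`_k * c ^+ k) ->
  xi (poly_ev z (drop_poly k Q)) = N Q`_k.
Proof.
move=> zc xk sdom.
have kQ : (k < size Q)%N.
  rewrite ltnNge; apply/negP => h; move: Nk.
  by rewrite -xk nth_default // rmorph0 (val0 xV) ltxx.
have sd : size (drop_poly k Q) = (size Q - k).-1.+1.
  by rewrite size_drop_poly prednK // subn_gt0.
rewrite poly_evE sd big_ord_recl expr0 mulr1 addrC.
rewrite coef_drop_poly add0n (val_eqD xV) xk //.
apply: (val_sum_lt xV) => [//|i _]; rewrite coef_drop_poly (valM xV) (valX xV) lift0.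
apply: (@le_lt_trans _ _ (N Q`_(i.+1 + k) * c ^+ i.+1)).
  apply: ler_pM => //; rewrite ?(val_ge0 xV) ?exprn_ge0 ?(val_ge0 xV) //.
  by rewrite lerXn2r // nnegrE ?(val_ge0 xV) // ltW.
rewrite -(ltr_pM2r (exprn_gt0 k c_gt0)) -mulrA -exprD; apply: sdom.
by rewrite addSn ltnS leq_addl.
Qed.

Lemma drop_poly_lt : c < xi z -> xi (poly_ev z (drop_poly k Q)) < N Q`_k.
Proof.
move=> cz; have z0 : 0 < xi z by exact: lt_trans cz.
have zk : 0 < xi z ^+ k by exact: exprn_gt0.
have lhs u : xi u * xi z ^+ k = xi (u * z ^+ k) by rewrite (valM xV) (valX xV).
rewrite -(ltr_pM2r zk) lhs.
have e : poly_ev z (drop_poly k Q) * z ^+ k = poly_ev z Q - poly_ev z (take_poly k Q).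
  rewrite -[in X in _ = X - _](poly_take_drop k Q) rmorphD rmorphM rmorphXn.
  by rewrite poly_evX addrC addKr.
rewrite e; apply: le_lt_trans (valB xV _ _) _; rewrite Qz gt_max; apply/andP; split; first exact: mulr_gt0.
rewrite poly_evE; apply: (val_sum_lt xV) => [|i _]; first exact: mulr_gt0.
rewrite coef_take_poly; case: ltnP => [ik|_]; last first.
  by rewrite rmorph0 mul0r (val0 xV) mulr_gt0.
rewrite (valM xV) (valX xV); apply: (@le_lt_trans _ _ (N Q`_i * xi z ^+ i)).
  by rewrite ler_wpM2r // exprn_ge0 // ltW.
have kE (u : R) : u ^+ k = u ^+ (k - i) * u ^+ i by rewrite -exprD subnK // ltnW.
rewrite kE mulrA ltr_pM2r ?exprn_gt0 //.
apply: (@le_lt_trans _ _ (N Q`_k * c ^+ (k - i))).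
  by rewrite -(ler_pM2r (exprn_gt0 i c_gt0)) -mulrA -kE.
rewrite ltr_pM2l //.
by rewrite ltrXn2r ?nnegrE // ?ltW // -lt0n subn_gt0.
Qed.

End DropPoly.
End Evaluation.

(** * Points over the Gauss norm *)

Section Core.
Context (R : realType) (K : fieldType) (v : K -> R) (v_abs : nonarch_abs v).
Context (T : comAlgType K) (x : nat -> T) (d : nat).
Local Notation phi := (mveval x d).
Local Notation S := (mvpoly K d).
Local Notation F := {ptws T -> R}.
Implicit Types (J p : set T) (a : nat -> R) (xi zeta b : T -> R).

Definition points J : set F :=
  [set xi | mult_seminorm v xi /\ forall f, J f -> xi f = 0].

Definition pos_weights a : Prop := forall i, (i < d)%N -> 0 < a i.
Definition on_weights a xi : Prop := forall i, (i < d)%N -> xi (x i) = a i.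
Definition over_gauss a xi : Prop := forall s, xi (phi s) = mvgauss v a s.

Lemma mvgauss_ext a a' (s : S) : (forall i, (i < d)%N -> a i = a' i) ->
  mvgauss v a s = mvgauss v a' s.
Proof.
elim: d s => [//|k IHk] s aa' /=; rewrite (aa' k) // /gauss.
apply: eq_bigr => i _; rewrite (IHk (s : {poly _})`_i) // => j jk.
by apply: aa'; rewrite ltnS ltnW.
Qed.

Lemma mveval_mvC c : phi (mvC d c) = c%:A.
Proof. by elim: d => [//|k IHk]; rewrite mvevalS /= map_polyC hornerC. Qed.

Lemma mvgauss_mvC a c : pos_weights a -> mvgauss v a (mvC d c) = v c.
Proof.
rewrite /pos_weights; elim: d => [//|k IHk] a0 /=.
have a0' i : (i < k)%N -> 0 < a i by move=> ik; apply: a0; rewrite ltnS ltnW.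
by rewrite gaussC ?IHk //; [exact: mvgauss_valuation|exact: a0].
Qed.

Lemma mvpoly_var i : (i < d)%N -> exists s : S, phi s = x i /\
  forall a, pos_weights a -> mvgauss v a s = a i.
Proof.
rewrite /pos_weights; elim: d => [//|k IHk]; rewrite ltnS leq_eqVlt.
have aS a : (forall i, (i < k.+1)%N -> 0 < a i) -> forall i, (i < k)%N -> 0 < a i.
  by move=> a0 j jk; apply: a0; rewrite ltnS ltnW.
case/predU1P => [->|/IHk[s [es as_]]].
  exists ('X : {poly mvpoly K k}); split=> [|a a0].
    by rewrite mvevalS map_polyX hornerX.
  by rewrite /= gaussX //; [apply: mvgauss_valuation => //; exact: aS|exact: a0].
exists (s%:P : {poly mvpoly K k}); split=> [|a a0].
  by rewrite mvevalS map_polyC hornerC.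
rewrite /= gaussC ?as_ //; first exact: aS.
  by apply: mvgauss_valuation => //; exact: aS.
exact: a0.
Qed.

Lemma valuation_point xi : valuation xi ->
  (forall c, xi (phi (mvC d c)) = v c) -> mult_seminorm v xi.
Proof.
by move=> xV h; split; [exact: val_ge0|move=> c; rewrite -mveval_mvC|exact: valM|exact: valD].
Qed.

Section Weights.
Context (a : nat -> R) (a_gt0 : pos_weights a).

Lemma gauss_val : valuation (@mvgauss R K v a d).
Proof. exact: mvgauss_valuation. Qed.

Lemma over_on xi : over_gauss a xi -> on_weights a xi.
Proof. by move=> xo i /mvpoly_var[s [<- sa]]; rewrite xo sa. Qed.

Lemma points_le_gauss xi s : mult_seminorm v xi -> on_weights a xi ->
  xi (phi s) <= mvgauss v a s.
Proof.
move=> xP xa; rewrite -(@mvgauss_ext (fun i => xi (x i)) a) //.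
by apply: seminorm_le_gauss => // i id; rewrite xa // a_gt0.
Qed.

Lemma over_point xi : valuation xi -> over_gauss a xi -> mult_seminorm v xi.
Proof.
by move=> xV xo; apply: valuation_point => // c; rewrite xo mvgauss_mvC.
Qed.

Lemma point_X xi : mult_seminorm v xi -> on_weights a xi ->
  xi (phi (mvX K d)) = \prod_(i < d) a i.
Proof.
move=> xP xa; rewrite mveval_X (val_prod (seminorm_valuation v_abs xP)).
by apply: eq_bigr => i _; rewrite xa.
Qed.

Lemma prod_weights_gt0 : 0 < \prod_(i < d) a i.
Proof. by apply: prodr_gt0 => i _; exact: a_gt0. Qed.

(** Elements that behave like monomials: the weights alone force their value. They are the
    coefficients used in [hypersurface_point] when the point to be built need not restrict to the
    Gauss norm. *)
Definition rigid_elt : set S := [set m | m != 0 /\ forall xi : T -> R,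
  mult_seminorm v xi -> on_weights a xi -> xi (phi m) = mvgauss v a m].

Lemma rigid1 : rigid_elt 1.
Proof.
split=> [|xi xP _]; first exact: oner_neq0.
by rewrite rmorph1 (val1 gauss_val) (val1 (seminorm_valuation v_abs xP)).
Qed.

Lemma rigidM m m' : rigid_elt m -> rigid_elt m' -> rigid_elt (m * m').
Proof.
move=> [m0 hm] [m'0 hm']; split=> [|xi xP xa]; first exact: mulf_neq0.
by rewrite rmorphM (valM gauss_val) (valM (seminorm_valuation v_abs xP)) hm // hm'.
Qed.

Lemma rigid_mvC c : c != 0 -> rigid_elt (mvC d c).
Proof.
move=> c0; split=> [|xi xP _].
  apply: contra_neq c0 => e; have := mvgauss_mvC c a_gt0; rewrite e (val0 gauss_val).
  by case: v_abs => _ v0 _ _ /esym/v0.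
by rewrite mveval_mvC mvgauss_mvC //; case: xP.
Qed.

(** The values of h and q multiply to N (m), and so do their Gauss norms, which bound them; hence
    both bounds are attained. *)
Lemma rigid_unit m h q : rigid_elt m -> mvgauss v a (m - h * q) < mvgauss v a m ->
  forall xi, mult_seminorm v xi -> on_weights a xi -> xi (phi q) = mvgauss v a q.
Proof.
move=> [m0 mr] lt_m xi xP xa.
have xV := seminorm_valuation v_abs xP; have NV := gauss_val.
have eN : mvgauss v a h * mvgauss v a q = mvgauss v a m.
  by rewrite -(valM NV); apply/esym/(val_lt_eq NV).
have m1 : 0 < mvgauss v a m.
  by apply: le_lt_trans lt_m; exact: (val_ge0 NV).
have ex : xi (phi h) * xi (phi q) = mvgauss v a m.
  rewrite -(valM xV) -rmorphM -(mr _ xP xa); apply/esym/(val_lt_eq xV).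
  rewrite (mr _ xP xa) -rmorphB; apply: le_lt_trans lt_m.
  exact: points_le_gauss.
have hl := points_le_gauss h xP xa; have ql := points_le_gauss q xP xa.
apply/eqP; rewrite eq_le ql /= -(ler_pM2l (x := mvgauss v a h)); last first.
  by rewrite lt_neqAle (val_ge0 NV) andbT; apply: contraTneq m1 => e; rewrite -eN -e mul0r ltxx.
by rewrite eN -ex ler_wpM2r // (val_ge0 xV).
Qed.

End Weights.

Section Compactness.
Context (J : set T) (J_ideal : ideal J) (J_fin : loc_finite phi J (mvX K d)).

(** Some X^N z is a root of a monic polynomial over S whose coefficients are bounded by their Gauss
    norms at the weights c2, and X is bounded below by c1^d. *)
Lemma points_bounded (c1 c2 : R) z : 0 < c1 -> exists C, forall xi, points J xi ->
  (forall i, (i < d)%N -> c1 <= xi (x i) <= c2) -> xi z <= C.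
Proof.
move=> c10; have [A [AP locA]] := J_fin; have [N hN] := locA z.
have [Q [Qm JQ]] := fg_integral J_ideal AP hN.
pose B := \big[Num.max/1]_(j < size Q) mvgauss v (fun=> c2) Q`_j.
have B1 : 1 <= B by exact: bigmax_ge_id.
exists (B / (c1 ^+ d) ^+ N) => xi [xP xJ] hx; have xV := seminorm_valuation v_abs xP.
have x0 i : (i < d)%N -> 0 < xi (x i) by case/hx/andP => /(lt_le_trans c10).
have Xc : c1 ^+ d <= xi (phi (mvX K d)).
  rewrite mveval_X (val_prod xV) -[d in c1 ^+ d]card_ord -prodr_const.
  by apply: ler_prod => i _; rewrite ltW //=; have /andP[] := hx i (ltn_ord i).
have c1d : 0 < c1 ^+ d by rewrite exprn_gt0.
rewrite ler_pdivlMr ?exprn_gt0 //.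
apply: (@le_trans _ _ (xi (phi (mvX K d) ^+ N * z))).
  rewrite (valM xV) (valX xV) mulrC ler_wpM2r ?(val_ge0 xV) //.
  by rewrite lerXn2r ?nnegrE ?(val_ge0 xV) // ltW.
apply: (root_le xV Qm) => [||j jQ]; first exact: (xJ _ JQ).
  exact: le_trans ler01 B1.
apply: (@le_trans _ _ B); last first.
  by rewrite ler_eXnr // subn_gt0.
have jQ' : (j < size Q)%N by apply: leq_trans jQ (leq_pred _).
apply: (@le_trans _ _ (mvgauss v (fun=> c2) Q`_j)); last first.
  by rewrite /B; apply: (le_bigmax _ (fun j : 'I_(size Q) => mvgauss v (fun=> c2) Q`_j) (Ordinal jQ')).
apply: le_trans (seminorm_le_gauss v_abs xP x0 _) _.
by apply: mvgauss_mono => // i id; rewrite x0 //=; have /andP[] := hx i id.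
Qed.

End Compactness.
End Core.

(** * Points over the Gauss norm are peak points *)

Section Peaks.
Context (R : realType) (K : fieldType) (v : K -> R) (v_abs : nonarch_abs v).
Context (T : comAlgType K) (x : nat -> T) (d : nat).
Local Notation phi := (mveval x d).
Local Notation S := (mvpoly K d).
Local Notation F := {ptws T -> R}.
Local Notation points := (@points R K v T).
Local Notation on_weights := (@on_weights R K T x d).
Local Notation over_gauss := (@over_gauss R K v T x d).
Local Notation pos_weights := (@pos_weights R d).

Lemma closed_eqfun (U : topologicalType) (f g : U -> R) :
  continuous f -> continuous g -> closed [set y | f y = g y].
Proof.
move=> cf cg.
have -> : [set y | f y = g y] = [set y | f y <= g y] `&` [set y | g y <= f y].
  apply/seteqP; split=> y /=; first by move=> ->; rewrite lexx.
  by case=> h1 h2; apply/eqP; rewrite eq_le h1.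
by apply: closedI; exact: closed_leq.
Qed.

Lemma closed_points J : closed (points J).
Proof.
have ev f : continuous (fun xi : F => xi f) by exact: eval_continuous.
have cst (c : R) : continuous (fun xi : F => c) by exact: cst_continuous.
have -> : points J =
    [set xi : F | forall f, 0 <= xi f] `&` [set xi : F | forall c, xi c%:A = v c] `&`
    [set xi : F | forall f g, xi (f * g) = xi f * xi g] `&`
    [set xi : F | forall f g, xi (f + g) <= Num.max (xi f) (xi g)] `&`
    [set xi : F | forall f, J f -> xi f = 0].
  apply/seteqP; split=> xi; first by case=> -[? ? ? ?] ?; do ![split].
  by case=> -[[[? ?] ?] ?] ?; do ![split].
repeat apply: closedI.
- by apply: closed_forall => f; exact: closed_leq.
- by apply: closed_forall => c; exact: closed_eqfun.
- apply: closed_forall => f; apply: closed_forall => g; apply: closed_eqfun => //.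
  by move=> xi; apply: (@continuousM R F (fun xi : F => xi f) (fun xi : F => xi g)); exact: ev.
- apply: closed_forall => f; apply: closed_forall => g; apply: closed_leq => //.
  by move=> xi; apply: continuous_max; exact: ev.
- by apply: closed_forall => f; apply: closed_imply; exact: closed_eqfun.
Qed.

Lemma closed_over a : closed (over_gauss a : set F).
Proof.
apply: closed_forall => s; apply: closed_eqfun; first exact: eval_continuous.
by exact: cst_continuous.
Qed.

Lemma weights_bounds a : pos_weights a ->
  exists c1 c2, 0 < c1 /\ forall i, (i < d)%N -> c1 <= a i <= c2.
Proof.
suff h k : (forall i, (i < k)%N -> 0 < a i) ->
    exists c1 c2, 0 < c1 /\ forall i, (i < k)%N -> c1 <= a i <= c2 by exact: h.
elim: k => [|k IHk] a0; first by exists 1, 1.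
have [|c1 [c2 [c10 h]]] := IHk; first by move=> i ik; apply: a0; rewrite ltnS ltnW.
exists (Num.min c1 (a k)), (Num.max c2 (a k)); split.
  by rewrite lt_min c10 a0.
move=> i; rewrite ltnS leq_eqVlt => /predU1P[->|/h/andP[h1 h2]].
  by rewrite ge_min le_max lexx !orbT.
by rewrite ge_min le_max h1 h2.
Qed.

Section Compact.
Context (J : set T) (J_ideal : ideal J) (J_fin : loc_finite phi J (mvX K d)).

Lemma compact_points (c1 c2 : R) (P : set F) : 0 < c1 -> closed P -> P `<=` points J ->
  (forall xi, P xi -> forall i, (i < d)%N -> c1 <= xi (x i) <= c2) -> compact P.
Proof.
move=> c10 cP PJ Px.
have /choice[B hB] := fun z => points_bounded v_abs J_ideal J_fin c2 z c10.
apply: (compact_of_bounds (B := B)) cP _ => xi Pxi f.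
have [[xi0 _ _ _] _] := PJ _ Pxi.
by rewrite xi0 hB //; [exact: PJ|exact: Px].
Qed.

Context (a : nat -> R) (a_gt0 : pos_weights a).

Lemma compact_on_weights (P : set F) : closed P -> P `<=` points J ->
  (forall xi, P xi -> on_weights a xi) -> compact P.
Proof.
move=> cP PJ Pa; have [c1 [c2 [c10 h]]] := weights_bounds a_gt0.
by apply: (compact_points c10 cP PJ) => xi /Pa h' i id; rewrite (h' i id); exact: h.
Qed.

Lemma integral_multiple z : exists N (Q : {poly S}), Q \is monic /\
  forall xi, points J xi -> xi (poly_ev phi (phi (mvX K d) ^+ N * z) Q) = 0.
Proof.
have [A [AP locA]] := J_fin; have [N hN] := locA z.
have [Q [Qm JQ]] := fg_integral J_ideal AP hN.
by exists N, Q; split=> // xi [_ xJ]; exact: (xJ _ JQ).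
Qed.

Lemma point_Xmul xi N z : mult_seminorm v xi -> on_weights a xi ->
  xi (phi (mvX K d) ^+ N * z) = (\prod_(i < d) a i) ^+ N * xi z.
Proof.
move=> xP xa; have xV := seminorm_valuation v_abs xP.
by rewrite (valM xV) (valX xV) (point_X v_abs xP xa).
Qed.

(** At both points the lowest non-zero coefficient Q_k of an integral equation has the value of a
    product z1 z2. This value is the same at b and c, so no factor can drop: the analogue for
    seminorms of the incomparability of primes in an integral extension. *)
Lemma over_incomparable (b c : T -> R) : points J b -> points J c ->
  over_gauss a b -> over_gauss a c -> (forall z, c z <= b z) -> forall z, c z = b z.
Proof.
move=> bJ cJ bo co cb z; apply/eqP; rewrite eq_le cb /= leNgt; apply/negP => lt_z.
have [bP _] := bJ; have [cP _] := cJ.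
have bV := seminorm_valuation v_abs bP; have cV := seminorm_valuation v_abs cP.
have X0 := prod_weights_gt0 a_gt0.
have [N [Q [Qm hQ]]] := integral_multiple z.
move: hQ; set z1 := _ * z => hQ.
have lt1 : c z1 < b z1.
  have ba := over_on v_abs a_gt0 bo; have ca := over_on v_abs a_gt0 co.
  by rewrite /z1 !point_Xmul // ltr_pM2l // exprn_gt0.
have bz1 : 0 < b z1 := le_lt_trans (val_ge0 cV z1) lt1.
have exk : exists k, Q`_k != 0.
  by exists (size Q).-1; rewrite -lead_coefE lead_coef_eq0 monic_neq0.
case: (ex_minnP exk) => k Qk kmin.
have Nk : 0 < mvgauss v a Q`_k.
  rewrite lt_neqAle (val_ge0 (gauss_val v_abs a_gt0)) andbT eq_sym.
  by apply: contra_neq Qk; exact: mvgauss_eq0.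
have t0 : take_poly k Q = 0.
  apply/polyP => i; rewrite coef_take_poly coef0; case: ltnP => // ik.
  by apply/eqP; apply: contraTT ik => /kmin; rewrite -leqNgt.
have eQ : poly_ev phi z1 Q = poly_ev phi z1 (drop_poly k Q) * z1 ^+ k.
  by rewrite -{1}(poly_take_drop k Q) t0 add0r rmorphM rmorphXn poly_evX.
have bD : b (poly_ev phi z1 (drop_poly k Q)) = 0.
  have := hQ _ bJ; rewrite eQ (valM bV) (valX bV) => /eqP.
  by rewrite mulf_eq0 expf_eq0 (gt_eqF bz1) andbF orbF => /eqP.
have cD : c (poly_ev phi z1 (drop_poly k Q)) = 0.
  by apply/eqP; rewrite eq_le (val_ge0 cV) andbT -bD cb.
pose z2 := poly_ev phi z1 (drop_poly k.+1 Q).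
have eD : poly_ev phi z1 (drop_poly k Q) = phi Q`_k + z1 * z2.
  have -> : drop_poly k Q = (Q`_k)%:P + drop_poly k.+1 Q * 'X.
    apply/polyP => i; rewrite coefD coefC coefMX coef_drop_poly.
    by case: i => [|i] /=; rewrite ?add0n ?addr0 // add0r coef_drop_poly addSnnS.
  by rewrite rmorphD rmorphM poly_evC poly_evX mulrC.
have prodE (u : T -> R) : valuation u -> u (poly_ev phi z1 (drop_poly k Q)) = 0 ->
    over_gauss a u -> u z1 * u z2 = mvgauss v a Q`_k.
  move=> uV u0 uo; rewrite -uo -(valM uV); apply/esym/(val_addeq0 uV); rewrite -eD.
  exact: u0.
have b2 := prodE _ bV bD bo; have c2 := prodE _ cV cD co.
have bz2 : 0 < b z2 by move: Nk; rewrite -b2 pmulr_rgt0.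
suff : c z1 * c z2 < b z1 * b z2 by rewrite b2 c2 ltxx.
apply: (@le_lt_trans _ _ (c z1 * b z2)); first by rewrite ler_wpM2l ?(val_ge0 cV).
by rewrite ltr_pM2r.
Qed.

(** If c does not restrict to the Gauss norm, a polynomial separates. Otherwise [over_incomparable]
    gives z smaller at b than at c, and the truncated integral equation of z, at a radius between
    the two values, is maximal at b and smaller at c. *)
Lemma peak (b c : T -> R) : points J b -> over_gauss a b ->
  points J c -> on_weights a c -> c <> b ->
  exists (h : T) (kappa : R), [/\ 0 < kappa, b h = kappa, c h < kappa &
    forall xi, points J xi -> on_weights a xi -> xi h <= kappa].
Proof.
move=> bJ bo cJ ca cb; have [bP _] := bJ; have [cP _] := cJ.
have bV := seminorm_valuation v_abs bP; have cV := seminorm_valuation v_abs cP.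
have ba := over_on v_abs a_gt0 bo; have NV := gauss_val v_abs a_gt0.
have [co|/existsNP[s cs]] := pselect (over_gauss a c); last first.
  have lt_s : c (phi s) < mvgauss v a s.
    by rewrite lt_neqAle (points_le_gauss v_abs a_gt0) // andbT; apply/eqP.
  exists (phi s), (mvgauss v a s); split=> //.
    by apply: le_lt_trans lt_s; exact: (val_ge0 cV).
  by move=> xi [xP _] xa; exact: (points_le_gauss v_abs a_gt0).
have [z lt_z] : exists z, b z < c z.
  apply: contrapT => h; apply: cb; apply/funext => z.
  apply: (over_incomparable bJ cJ bo co) => y.
  by rewrite leNgt; apply/negP => lt_y; apply: h; exists y.
have X0 := prod_weights_gt0 a_gt0.
have [N [Q [Qm hQ]]] := integral_multiple z.
move: hQ; set z1 := _ * z => hQ.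
have lt1 : b z1 < c z1 by rewrite /z1 !point_Xmul // ltr_pM2l // exprn_gt0.
pose al := (b z1 + c z1) / 2.
have al1 : b z1 < al by rewrite midf_lt.
have al2 : al < c z1 by rewrite midf_lt.
have al0 : 0 < al by apply: le_lt_trans al1; exact: (val_ge0 bV).
have N0 (s : S) : mvgauss v a s = 0 -> s = 0 by exact: (mvgauss_eq0 v_abs a_gt0).
have GQ : 0 < gauss (@mvgauss R K v a d) al Q by apply: (gauss_gt0 NV) => //; exact: monic_neq0.
have [k [ek tk]] := top_index_ex NV GQ.
have Nk : 0 < mvgauss v a Q`_k by move: GQ; rewrite -ek pmulr_lgt0 ?exprn_gt0.
have dom j : mvgauss v a Q`_j * al ^+ j <= mvgauss v a Q`_k * al ^+ k.
  by rewrite ek gauss_ge.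
have xN xi : points J xi -> on_weights a xi -> forall s, xi (phi s) <= mvgauss v a s.
  by move=> [xP _] xa s; exact: (points_le_gauss v_abs a_gt0).
exists (poly_ev phi z1 (drop_poly k Q)), (mvgauss v a Q`_k); split=> //.
- apply: (drop_poly_eq bV (xN _ bJ ba) al0 Nk) => //.
  + exact: ltW.
  + by move=> j kj; rewrite ek; exact: tk.
- apply: (drop_poly_lt cV (xN _ cJ ca) al0 _ Nk dom) => //.
  exact: hQ.
- move=> xi xJ xa; have xV := seminorm_valuation v_abs xJ.1.
  have [xz|xz] := leP (xi z1) al.
    by apply: (drop_poly_le xV (xN _ xJ xa) al0 Nk dom).
  apply/ltW/(drop_poly_lt xV (xN _ xJ xa) al0 _ Nk dom) => //.
  exact: hQ.
Qed.

Lemma prod_lt_seq (I : eqType) (r : seq I) (f g : I -> R) i :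
  (forall j, j \in r -> 0 <= f j <= g j) -> (forall j, j \in r -> 0 < g j) ->
  i \in r -> f i < g i -> \prod_(j <- r) f j < \prod_(j <- r) g j.
Proof.
elim: r => [//|k r IHr] fg g0; rewrite inE !big_cons.
have [ki _ lt_i|ki /= ir lt_i] := eqVneq i k.
  apply: (@le_lt_trans _ _ (f k * \prod_(j <- r) g j)).
    rewrite ler_wpM2l //; first by have /andP[] := fg k (mem_head _ _).
    by rewrite big_seq [leRHS]big_seq; apply: ler_prod => j jr; apply: fg; rewrite inE jr orbT.
  rewrite ltr_pM2r -?ki // big_seq; apply: prodr_gt0 => j jr.
  by apply: g0; rewrite inE jr orbT.
have /andP[fk0 fk] := fg k (mem_head _ _).
have P0 : 0 <= \prod_(j <- r) f j.
  by rewrite big_seq; apply: prodr_ge0 => j jr; have /andP[] := fg j (mem_behead (s := k :: r) jr).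
apply: (@le_lt_trans _ _ (g k * \prod_(j <- r) f j)); first by rewrite ler_wpM2r.
rewrite ltr_pM2l ?g0 ?mem_head //; apply: IHr => // j jr.
  by apply: fg; rewrite inE jr orbT.
by apply: g0; rewrite inE jr orbT.
Qed.

(** Finitely many of the open sets where a peak function of b is not maximal cover C; multiply these
    functions. *)
Lemma peak_off (b : T -> R) (C : set F) : points J b -> over_gauss a b ->
  compact C -> C `<=` points J -> (forall xi, C xi -> on_weights a xi) -> ~ C b ->
  exists (h : T) (kappa : R), [/\ 0 < kappa, b h = kappa,
    forall xi, C xi -> xi h < kappa &
    forall xi, points J xi -> on_weights a xi -> xi h <= kappa].
Proof.
move=> bJ bo cC CJ Ca nCb; have bV := seminorm_valuation v_abs bJ.1.
pose D : set (T * R) := [set hk | [/\ 0 < hk.2, b hk.1 = hk.2 &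
  forall xi, points J xi -> on_weights a xi -> xi hk.1 <= hk.2]].
pose U (hk : T * R) : set F := [set xi | xi hk.1 < hk.2].
have oU i : D i -> open (U i).
  move=> _; have -> : U i = ~` [set xi : F | i.2 <= xi i.1].
    by apply/seteqP; split=> xi /=; [move=> h; apply/negP; rewrite -ltNge|move/negP; rewrite -ltNge].
  apply: closed_openC; apply: closed_leq; first by exact: cst_continuous.
  exact: eval_continuous.
have [] := compact_ptws_cover cC oU.
  move=> xi Cxi; have [|h [k [k0 bh xh mx]]] := peak bJ bo (CJ _ Cxi) (Ca _ Cxi).
    by move=> e; apply: nCb; rewrite -e.
  by exists (h, k).
move=> D' D'D CD'; exists (\prod_(i <- D') i.1), (\prod_(i <- D') i.2); split.
- by rewrite big_seq; apply: prodr_gt0 => i /D'D; rewrite inE => -[].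
- rewrite (val_prod bV) big_seq [RHS]big_seq; apply: eq_bigr => i /D'D.
  by rewrite inE => -[].
- move=> xi Cxi; have xV := seminorm_valuation v_abs (CJ _ Cxi).1.
  have [i iD' Uxi] := CD' _ Cxi; rewrite (val_prod xV).
  apply: (@prod_lt_seq _ _ _ _ i) => // [j|j].
    move=> /D'D; rewrite inE => -[_ _ /(_ _ (CJ _ Cxi) (Ca _ Cxi)) ->].
    by rewrite (val_ge0 xV).
  by move=> /D'D; rewrite inE => -[].
- move=> xi xJ xa; have xV := seminorm_valuation v_abs xJ.1.
  rewrite (val_prod xV) big_seq [leRHS]big_seq; apply: ler_prod => i /D'D.
  by rewrite inE => -[_ _ /(_ _ xJ xa) ->]; rewrite (val_ge0 xV).
Qed.

End Compact.
End Peaks.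

(** * Largest values and minimal equations *)

Lemma nth_root (R : realType) (t : R) n : 0 <= t -> (0 < n)%N ->
  exists2 r : R, 0 <= r & r ^+ n = t.
Proof.
move=> t0 n0; exists (t `^ n%:R^-1); first exact: powR_ge0.
by rewrite -powR_mulrn ?powR_ge0 // -powRrM mulVf ?powRr1 // pnatr_eq0 -lt0n.
Qed.

Section MaxPoint.
Context (R : realType) (K : fieldType) (v : K -> R) (v_abs : nonarch_abs v).
Context (T : comAlgType K) (x : nat -> T) (d : nat).
Local Notation phi := (mveval x d).
Local Notation S := (mvpoly K d).
Local Notation F := {ptws T -> R}.
Local Notation points := (@points R K v T).
Local Notation on_weights := (@on_weights R K T x d).
Local Notation over_gauss := (@over_gauss R K v T x d).
Local Notation pos_weights := (@pos_weights R d).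
Local Notation X := (mvX K d).

(** With m the degree of Q, al is the maximum of the N (Q_j)^(1 / (m - j)) for j < m. There is no
    slope when all these coefficients vanish. *)
Lemma largest_slope (a : nat -> R) (Q : {poly S}) : pos_weights a ->
  (forall j, (j < (size Q).-1)%N -> Q`_j = 0) \/
  exists al : R, [/\ 0 < al,
    forall j, (j < (size Q).-1)%N -> mvgauss v a Q`_j <= al ^+ ((size Q).-1 - j) &
    exists2 j, (j < (size Q).-1)%N & mvgauss v a Q`_j = al ^+ ((size Q).-1 - j)].
Proof.
move=> a0; have NV := gauss_val v_abs a0; set m := (size Q).-1.
have [h|/existsNP[j0 /not_implyP[jm0 Qj0]]] := pselect (forall j, (j < m)%N -> Q`_j = 0).
  by left.
right; have /choice[r hr] : forall j : 'I_m, exists r : R,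
    0 <= r /\ r ^+ (m - j) = mvgauss v a Q`_j.
  move=> j; have [|r r0 er] := @nth_root R (mvgauss v a Q`_j) (m - j) (val_ge0 NV _).
    by rewrite subn_gt0.
  by exists r.
have [jm _ jmax] := Order.TotalTheory.arg_maxP r (isT : xpredT (Ordinal jm0)).
have N0 : 0 < mvgauss v a Q`_j0.
  rewrite lt_neqAle (val_ge0 NV) andbT eq_sym; apply/eqP => e; apply: Qj0.
  exact: (mvgauss_eq0 v_abs a0 e).
have r0 : 0 < r (Ordinal jm0).
  rewrite lt_neqAle (hr _).1 andbT eq_sym; apply: contraTneq N0 => e.
  by rewrite -(hr (Ordinal jm0)).2 e expr0n subn_eq0 leqNgt jm0 ltxx.
exists (r jm); split.
- by apply: lt_le_trans r0 _; exact: jmax.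
- move=> j jm'; rewrite -(hr (Ordinal jm')).2 lerXn2r ?nnegrE ?(hr _).1 //.
  exact: jmax.
- by exists jm => //; rewrite (hr jm).2.
Qed.

Section Ideal.
Context (p : set T) (p_ideal : ideal p).

(** As z lies in A, evaluation at z makes A finite over [{poly S}] modulo p, so [lying_over] extends
    b. The hypothesis on rigid elements fixes the values of the constants and of the variables. *)
Lemma lift_point (a : nat -> R) (A : set T) (z : T) (b : {poly S} -> R) : pos_weights a ->
  fg_subring phi p A -> (forall f, localized A (phi X) f) -> A z -> valuation b ->
  (forall m, rigid_elt v x a m -> b m%:P = mvgauss v a m) ->
  (forall P, p (poly_ev phi z P) -> b P = 0) ->
  exists zeta, [/\ points p zeta, on_weights a zeta &
    forall P, zeta (poly_ev phi z P) = b P].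
Proof.
move=> a0 AP locA Az bV bm bp.
have var i : (i < d)%N -> exists s : S, [/\ rigid_elt v x a s, phi s = x i &
    mvgauss v a s = a i].
  move=> id; have [s [es sa]] := mvpoly_var v_abs x id; exists s; split=> //; last exact: sa.
  split=> [|xi _ xa]; last by rewrite es sa // xa.
  apply: contraTneq (a0 _ id) => e.
  by rewrite -(sa _ a0) e (val0 (gauss_val v_abs a0)) ltxx.
have rX : b (X)%:P = \prod_(i < d) a i.
  rewrite bm; first by rewrite mvgauss_X.
  split=> [|xi xP xa]; last by rewrite mvgauss_X // (point_X v_abs xP xa).
  apply: contraTneq (prod_weights_gt0 a0) => e.
  by rewrite -(mvgauss_X v_abs a0) e (val0 (gauss_val v_abs a0)) ltxx.
have [||||q [qV qp qb]] := @lying_over {poly S} T (poly_ev phi z) p p_ideal R (X)%:P b.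
- exists A; split; first exact: fg_subring_ev.
  by rewrite poly_evC.
- by [].
- by rewrite rX prod_weights_gt0.
- by [].
have qphi s : q (phi s) = b s%:P by rewrite -qb poly_evC.
have qP : mult_seminorm v q.
  apply: (valuation_point (x := x) (d := d)) => // c; rewrite qphi.
  have [->|c0] := eqVneq c 0.
    have -> : mvC d (0 : K) = 0 by elim: (d) => [//|k IHk] /=; rewrite IHk polyC0.
    by rewrite (val0 bV) (val0 (abs_valuation v_abs)).
  by rewrite bm ?mvgauss_mvC //; exact: rigid_mvC.
exists q; split=> //.
by move=> i id; have [s [rs es sa]] := var i id; rewrite -es qphi bm.
Qed.

End Ideal.

Section Prime.
Context (p : set T) (p_prime : prime_ideal p) (p_fin : loc_finite phi p X).
Hypothesis p_inj : forall s, p (phi s) -> s = 0.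

Let p_ideal : ideal p. Proof. by case: p_prime. Qed.

Lemma prime_ker z : prime_ideal [set P | p (poly_ev phi z P)].
Proof.
have [_ p1 pM] := p_prime; split.
- split.
  + by rewrite /mkset rmorph0; exact: (ideal0 p_ideal).
  + by move=> P P' hP hP'; rewrite /mkset rmorphD; exact: (idealD p_ideal).
  + by move=> P P' hP; rewrite /mkset rmorphM; exact: (idealM p_ideal).
- by rewrite /mkset rmorph1.
- by move=> P P'; rewrite /mkset rmorphM; exact: pM.
Qed.

(** The kernel of evaluation at X^N z modulo p is a prime of [{poly S}] that meets S in 0 and
    contains a monic polynomial, so [monic_generator] applies. *)
Lemma minimal_equation z : exists A N (Q : {poly S}),
  [/\ fg_subring phi p A, forall f, localized A (phi X) f, A (phi X ^+ N * z) &
   [/\ Q \is monic, p (poly_ev phi (phi X ^+ N * z) Q) &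
   forall P, p (poly_ev phi (phi X ^+ N * z) P) -> exists h, P = h * Q]].
Proof.
have [A [AP locA]] := p_fin; have [N hN] := locA z.
have [Q1 [Q1m JQ1]] := fg_integral p_ideal AP hN.
have [||Q [Qm JQ Qgen]] := monic_generator (@cint_closed_mvpoly K d) (prime_ker (phi X ^+ N * z)).
- by move=> c; rewrite /mkset poly_evC; exact: p_inj.
- by exists Q1.
by exists A, N, Q.
Qed.

(* The minimal equation of [X ^ N z] has coefficients in [S] because [S] is    *)
(* integrally closed; its largest slope is the value at a point over the Gauss *)
(* norm, hence bounds the value at all points with the same weights.          *)
Lemma max_point z : exists N (Q : {poly S}), [/\ Q \is monic,
  forall xi, points p xi -> xi (poly_ev phi (phi X ^+ N * z) Q) = 0 &
  forall a, pos_weights a -> exists b, [/\ points p b, over_gauss a b &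
    forall j, (j < (size Q).-1)%N ->
      mvgauss v a Q`_j <= b (phi X ^+ N * z) ^+ ((size Q).-1 - j)]].
Proof.
have [A [N [Q [AP locA Az [Qm pQ Qgen]]]]] := minimal_equation z.
set z1 := phi X ^+ N * z in Az pQ Qgen *.
exists N, Q; split=> // [xi [_ xp]|a a0]; first exact: (xp _ pQ).
have NV := gauss_val v_abs a0.
have [Q0|[al [al0 al_le [j jm ej]]]] := largest_slope Q a0.
  have [||||q [qV qp qN]] := @lying_over S T phi p p_ideal R X (@mvgauss R K v a d).
  - by exists A.
  - exact: NV.
  - by rewrite mvgauss_X // prod_weights_gt0.
  - by move=> s /p_inj->; rewrite (val0 NV).
  - exists q; split=> //; last by move=> j jQ; rewrite Q0 // (val0 NV) exprn_ge0 // (val_ge0 qV).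
    by split=> //; exact: over_point qN.
have N0 (s : S) : mvgauss v a s = 0 -> s = 0 by exact: (mvgauss_eq0 v_abs a0).
set m := (size Q).-1 in jm ej al_le *.
have Qlead : Q`_m = 1 by apply/eqP; rewrite -monicE.
have GQ : gauss (@mvgauss R K v a d) al Q = al ^+ m.
  apply: (@gauss_coef _ _ _ NV _ al0 _ m); first by rewrite Qlead (val1 NV) mul1r.
  move=> i; have [im|mi] := ltnP i m.
    apply: (@le_trans _ _ (al ^+ (m - i) * al ^+ i)).
      by rewrite ler_wpM2r ?al_le // exprn_ge0 // ltW.
    by rewrite -exprD subnK // ltnW.
  have [->|im] := eqVneq i m; first by rewrite Qlead (val1 NV) mul1r.
  rewrite nth_default ?(val0 NV) ?mul0r ?exprn_ge0 ?(ltW al0) //.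
  by apply: leq_trans (leqSpred _) _; rewrite ltn_neqAle eq_sym im.
have ej' : mvgauss v a Q`_j * al ^+ j = gauss (@mvgauss R K v a d) al Q.
  by rewrite ej GQ -exprD subnK // ltnW.
have em : mvgauss v a Q`_m * al ^+ m = gauss (@mvgauss R K v a d) al Q.
  by rewrite Qlead (val1 NV) mul1r GQ.
have [|||s i h s0|b1 [b1V b1le b1Q b1X b1s]] :=
  @hypersurface_point _ _ _ NV al al0 N0 [set s | s != 0] Q.
- exact: oner_neq0.
- by move=> s s' /= s0 s'0; rewrite mulf_neq0.
- by [].
(* At the largest slope both j and the leading index m dominate, whereas a factor of a monomial, up
   to smaller terms, has a single dominating index. *)
- rewrite leNgt; apply/negP => lt_h.
  have [k [l [_ _ ek dom _]]] := gauss_monomial_multiple NV al0 N0 s0 lt_h.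
  have [jk|jk] := eqVneq j k; last by have := dom _ jk; rewrite ej' ltxx.
  have mk : m != k by rewrite -jk gtn_eqF.
  by have := dom _ mk; rewrite em ltxx.
have b1N s : b1 s%:P = mvgauss v a s.
  by have [->|s0] := eqVneq s 0; [rewrite polyC0 (val0 b1V) (val0 NV)|exact: b1s].
have [||q [qp qa qb]] := @lift_point p p_ideal a A z1 b1 a0 AP locA Az b1V.
- by move=> s _; exact: b1N.
- by move=> P /Qgen[h ->]; rewrite (valM b1V) b1Q mulr0.
exists q; split=> //.
  by move=> s; rewrite -(poly_evC phi z1) qb b1N.
have qz : q (phi X ^+ N * z) = al by rewrite -b1X -qb poly_evX.
by move=> i im; rewrite qz; exact: al_le.
Qed.

Lemma max_point_le (a : nat -> R) z : pos_weights a -> exists b,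
  [/\ points p b, over_gauss a b &
   forall xi, points p xi -> on_weights a xi -> xi z <= b z].
Proof.
move=> a0; have [N [Q [Qm Qp hb]]] := max_point z.
have [b [bp bo bQ]] := hb a a0; exists b; split=> // xi xp xa.
have xV := seminorm_valuation v_abs xp.1; have bV := seminorm_valuation v_abs bp.1.
have XN : 0 < (\prod_(i < d) a i) ^+ N by rewrite exprn_gt0 // prod_weights_gt0.
have ba := over_on v_abs a0 bo.
rewrite -(ler_pM2l XN) -(point_Xmul v_abs _ _ xp.1 xa) -(point_Xmul v_abs _ _ bp.1 ba).
apply: (root_le xV Qm (Qp _ xp) (val_ge0 bV _)) => j jm.
by apply: le_trans (points_le_gauss v_abs a0 _ xp.1 xa) _; exact: bQ.
Qed.

End Prime.
End MaxPoint.

(** * Domination with fixed values of the characters *)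

Lemma pow_dominated (R : realType) (s k k' C : R) : 0 < s -> 0 <= k' ->
  (forall n, s * k ^+ n <= C * k' ^+ n) -> k <= k'.
Proof.
move=> s0 k'0 h; rewrite leNgt; apply/negP => lt_k.
have [e|k'n] := eqVneq k' 0.
  have := h 1%N; rewrite e !expr1 mulr0 leNgt mulr_gt0 //.
  by rewrite -e.
have k'p : 0 < k' by rewrite lt_neqAle eq_sym k'n.
pose r := k / k' - 1.
have r0 : 0 < r by rewrite subr_gt0 ltr_pdivlMr // mul1r.
have ek : k = k' * (1 + r) by rewrite /r addrC subrK mulrCA divff // mulr1.
have bern n : 1 + n%:R * r <= (1 + r) ^+ n.
  elim: n => [|n IHn]; first by rewrite mul0r addr0 expr0.
  rewrite exprS; apply: (@le_trans _ _ ((1 + r) * (1 + n%:R * r))); last first.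
    by rewrite ler_wpM2l // addr_ge0 // ltW.
  rewrite -natr1 -subr_ge0.
  have -> : (1 + r) * (1 + n%:R * r) - (1 + (n%:R + 1) * r) = n%:R * (r * r) by ring.
  by rewrite mulr_ge0 // mulr_ge0 // ltW.
have hn n : n%:R <= C / s / r.
  rewrite ler_pdivlMr // ler_pdivlMr // mulrC.
  have := h n; rewrite ek exprMn mulrCA (mulrC C) ler_pM2l ?exprn_gt0 //.
  apply: le_trans; rewrite ler_pM2l //; apply: le_trans (bern n).
  by rewrite lerDr ler01.
have := truncnS_gt (C / s / r); rewrite ltNge => /negP; apply; exact: hn.
Qed.

Lemma continuous_sum (R : realType) (U : topologicalType) d (f : nat -> U -> R) :
  (forall i, continuous (f i)) -> continuous (fun y => \sum_(i < d) f i y).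
Proof.
move=> cf; elim: d => [|d IHd].
  have -> : (fun y => \sum_(i < 0) f i y) = fun=> 0 by apply/funext => y; rewrite big_ord0.
  exact: cst_continuous.
have -> : (fun y => \sum_(i < d.+1) f i y) = fun y => (\sum_(i < d) f i y) + f d y.
  by apply/funext => y; rewrite big_ord_recr.
by move=> y; apply: (@cvgD R R U); [exact: IHd|exact: cf].
Qed.

Section LocSub.
Context (S T : comNzRingType) (Phi : {rmorphism S -> T}).

Lemma fg_subring_sub (J p A : set T) : ideal J -> ideal p -> J `<=` p ->
  fg_subring Phi J A -> exists A', A `<=` A' /\ fg_subring Phi p A'.
Proof.
move=> J_ideal p_ideal Jp [JA APhi AD AM [l [m [Am Agen]]]].
exists [set f | exists2 g, A g & p (f - g)]; split.
  by move=> f Af; exists f => //; rewrite subrr; exact: (ideal0 p_ideal).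
split.
- move=> f pf; exists 0; last by rewrite subr0.
  exact: (JA _ (ideal0 J_ideal)).
- by move=> s; exists (Phi s) => //; rewrite subrr; exact: (ideal0 p_ideal).
- move=> f g [f' Af ff'] [g' Ag gg']; exists (f' + g'); first exact: AD.
  by rewrite opprD addrACA; exact: (idealD p_ideal).
- move=> f g [f' Af ff'] [g' Ag gg']; exists (f' * g'); first exact: AM.
  exact: ideal_subM.
- exists l, m; split=> [i|f [g Ag fg]].
    by exists (m i) => //; rewrite subrr; exact: (ideal0 p_ideal).
  have [c Jc] := Agen _ Ag; exists c; apply: (ideal_trans p_ideal fg); exact: Jp.
Qed.

Lemma loc_finite_sub (J p : set T) (X : S) : ideal J -> ideal p -> J `<=` p ->
  loc_finite Phi J X -> loc_finite Phi p X.
Proof.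
move=> Ji pi Jp [A [AP locA]]; have [A' [AA' A'P]] := fg_subring_sub Ji pi Jp AP.
by exists A'; split=> // f; have [N hN] := locA f; exists N; exact: AA'.
Qed.

End LocSub.

Section Domination.
Context (R : realType) (K : fieldType) (v : K -> R) (v_abs : nonarch_abs v).
Context (T : comAlgType K) (x : nat -> T) (d : nat).
Local Notation phi := (mveval x d).
Local Notation S := (mvpoly K d).
Local Notation F := {ptws T -> R}.
Local Notation points := (@points R K v T).
Local Notation on_weights := (@on_weights R K T x d).
Local Notation over_gauss := (@over_gauss R K v T x d).
Local Notation pos_weights := (@pos_weights R d).
Local Notation X := (mvX K d).
Context (p : set T) (p_prime : prime_ideal p) (p_fin : loc_finite phi p X).
Hypothesis p_inj : forall s, p (phi s) -> s = 0.

Let p_ideal : ideal p. Proof. by case: p_prime. Qed.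

Section Fiber.
Context (a : nat -> R) (a_gt0 : pos_weights a).

(* If no point has value [al] at [y], then the minimal equation of [y] has a  *)
(* unique dominating coefficient at [al].                                     *)
Lemma separate_value (y : T) (be al : R) : 0 <= be -> be < al ->
  (forall zeta, points p zeta -> on_weights a zeta -> zeta y <= be \/ al < zeta y) ->
  exists (h : T) (kappa : R), 0 < kappa /\
    forall zeta, points p zeta -> on_weights a zeta ->
      (zeta y <= be -> zeta h = kappa) /\ (al < zeta y -> zeta h < kappa).
Proof.
move=> be0 lt_al gap; have NV := gauss_val v_abs a_gt0.
have [A [N [Q [AP locA Az [Qm pQ Qgen]]]]] := minimal_equation p_prime p_fin p_inj y.
have cN : 0 < (\prod_(i < d) a i) ^+ N by rewrite exprn_gt0 // prod_weights_gt0.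
pose al1 := (\prod_(i < d) a i) ^+ N * al.
have al10 : 0 < al1 by rewrite mulr_gt0 // (le_lt_trans be0).
have N0 (s : S) : mvgauss v a s = 0 -> s = 0 by exact: (mvgauss_eq0 v_abs a_gt0).
have z1E zeta : points p zeta -> on_weights a zeta ->
    zeta (phi X ^+ N * y) = (\prod_(i < d) a i) ^+ N * zeta y.
  by move=> [zP _] za; exact: (point_Xmul v_abs).
(* Otherwise monomials with rigid coefficients keep their values modulo Q, and [hypersurface_point]
   gives a point whose value at y is al, in the gap. *)
have [m [i [h [mr lt_m]]]] : exists m i h, rigid_elt v x a m /\
    gauss (@mvgauss R K v a d) al1 (m *: 'X^i - h * Q) < mvgauss v a m * al1 ^+ i.
  apply: contrapT => no.
  have [||||b [bV ble bQ bX bs]] := @hypersurface_point _ _ _ NV al1 al10 N0 (rigid_elt v x a) Q.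
  - exact: rigid1.
  - by move=> m m'; exact: rigidM.
  - by move=> m [].
  - move=> m i h mr; rewrite leNgt; apply/negP => lt_m; apply: no.
    by exists m, i, h.
  have [|zeta [zp za zb]] := lift_point v_abs p_ideal a_gt0 AP locA Az bV bs.
    by move=> P /Qgen[h ->]; rewrite (valM bV) bQ mulr0.
  have e1 : zeta (phi X ^+ N * y) = al1 by rewrite -bX -zb poly_evX.
  have e2 : zeta y = al by move: e1; rewrite z1E // => /(mulfI (lt0r_neq0 cN)).
  by have := gap _ zp za; rewrite e2 ltxx leNgt lt_al => -[].
have [k [l [_ GQ ek dom lt_k]]] := gauss_monomial_multiple NV al10 N0 mr.1 lt_m.
have Nk : 0 < mvgauss v a Q`_k by move: GQ; rewrite -ek pmulr_lgt0 ?exprn_gt0.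
have wdom j : mvgauss v a Q`_j * al1 ^+ j <= mvgauss v a Q`_k * al1 ^+ k.
  by have [->//|jk] := eqVneq j k; rewrite ek ltW // dom.
exists (poly_ev phi (phi X ^+ N * y) (drop_poly k Q)), (mvgauss v a Q`_k); split=> //.
move=> zeta zp za; have zV := seminorm_valuation v_abs zp.1.
have zN s : zeta (phi s) <= mvgauss v a s by exact: (points_le_gauss v_abs a_gt0 s zp.1 za).
split=> [zy|zy].
  apply: (drop_poly_eq zV zN al10 Nk).
  - by rewrite z1E // ler_pM2l // (le_trans zy) // ltW.
  (* Q_k divides a rigid element up to smaller terms, so its value is forced too. *)
  - exact: (rigid_unit v_abs a_gt0 mr lt_k zp.1 za).
  - by move=> j kj; rewrite ek dom // gtn_eqF.
apply: (drop_poly_lt zV zN al10 _ Nk wdom); first exact: (zp.2 _ pQ).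
by rewrite z1E // ltr_pM2l.
Qed.

(* Apply [max_point_le] to [f * h ^ n], with [h] maximal exactly where the     *)
(* elements of [ys] take the same values as at [xi], and let [n] grow.         *)
Lemma over_point_above (xi : T -> R) (ys : seq T) (f : T) :
  points p xi -> on_weights a xi ->
  (forall y, y \in ys -> exists2 y', y' \in ys & y * y' = 1) ->
  (forall y, y \in ys -> exists2 al, xi y < al &
     forall zeta, points p zeta -> on_weights a zeta -> zeta y <= xi y \/ al < zeta y) ->
  exists b, [/\ points p b, over_gauss a b, xi f <= b f & forall y, y \in ys -> b y = xi y].
Proof.
move=> xp xa ys_inv gap; have xV := seminorm_valuation v_abs xp.1.
(* If xi f = 0 the inequality is automatic, and f may be replaced by 1. *)
wlog f0 : f / 0 < xi f.
  move=> h; have [f0|f0] := ltP 0 (xi f); first exact: h.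
  have [|b [bp bo _ by_]] := h 1; first by rewrite (val1 xV).
  exists b; split=> //; apply: le_trans f0 _.
  exact: (val_ge0 (seminorm_valuation v_abs bp.1)).
have /choice[hk hkP] : forall y, exists hk : T * R, y \in ys -> 0 < hk.2 /\
    forall zeta, points p zeta -> on_weights a zeta -> zeta hk.1 <= hk.2 /\
      (zeta y <= xi y <-> zeta hk.1 = hk.2).
  move=> y; have [yy|yn] := boolP (y \in ys); last by exists (0, 0).
  have [al lt_al gapy] := gap _ yy.
  have [h [k [k0 hP]]] := separate_value (val_ge0 xV y) lt_al gapy.
  exists (h, k) => _ /=; split=> // zeta zp za; have [h1 h2] := hP _ zp za.
  case: (gapy _ zp za) => zy; first by rewrite (h1 zy).
  split; first exact/ltW/h2.
  split=> [zy'|e]; last by have := h2 zy; rewrite e ltxx.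
  by have := lt_trans lt_al zy; rewrite ltNge zy'.
pose h := \prod_(y <- ys) (hk y).1; pose k := \prod_(y <- ys) (hk y).2.
have hk_le zeta y : points p zeta -> on_weights a zeta -> y \in ys -> 0 <= zeta (hk y).1 <= (hk y).2.
  move=> zp za yy; rewrite (val_ge0 (seminorm_valuation v_abs zp.1)) /=.
  by have [_ /(_ _ zp za)[]] := hkP _ yy.
have zh_le zeta : points p zeta -> on_weights a zeta -> zeta h <= k.
  move=> zp za; rewrite (val_prod (seminorm_valuation v_abs zp.1)) big_seq /k [leRHS]big_seq.
  by apply: ler_prod => y yy; exact: hk_le.
have xh : xi h = k.
  rewrite (val_prod xV) /k !big_seq; apply: eq_bigr => y yy.
  by have [_ /(_ _ xp xa)[_ /iffLR e]] := hkP _ yy; exact: e.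
have /choice[b hb] := fun z => max_point_le v_abs p_prime p_fin p_inj z a_gt0.
pose Z : set F := points p `&` over_gauss a `&` [set zeta | xi f <= zeta f].
have ba z : on_weights a (b z) by have [_ bo _] := hb z; exact: over_on bo.
have ble n : xi f * k ^+ n <= b (f * h ^+ n) f * b (f * h ^+ n) h ^+ n.
  have [bp _ /(_ _ xp xa)] := hb (f * h ^+ n); have bV := seminorm_valuation v_abs bp.1.
  by rewrite (valM xV) (valX xV) xh (valM bV) (valX bV).
have k0 : 0 < k by rewrite /k big_seq; apply: prodr_gt0 => y /hkP[].
have bZ n : Z (b (f * h ^+ n)).
  have [bp bo _] := hb (f * h ^+ n); have bV := seminorm_valuation v_abs bp.1.
  split=> //=; rewrite -(ler_pM2r (exprn_gt0 n k0)); apply: le_trans (ble n) _.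
  by rewrite ler_wpM2l ?(val_ge0 bV) // lerXn2r ?nnegrE ?(val_ge0 bV) ?zh_le // ltW.
have Zc : compact Z.
  apply: (compact_on_weights v_abs p_ideal p_fin a_gt0).
  - apply: closedI; first by apply: closedI; [exact: closed_points|exact: closed_over].
    by apply: closed_leq; [exact: cst_continuous|exact: eval_continuous].
  - by move=> zeta [[]].
  - by move=> zeta [[_ zo] _]; exact: over_on zo.
have [bm [[bmp bmo] bmf] bmax] : exists2 zeta, Z zeta & forall eta, Z eta -> eta h <= zeta h.
  by apply: (compact_max Zc); [exists (b (f * h ^+ 0))|exact: eval_continuous].
have bma := over_on v_abs a_gt0 bmo; have bmV := seminorm_valuation v_abs bmp.1.
(* Comparing f h^n at xi and at a point where it is maximal bounds xi (f) k^n by a constant times bm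
   (h)^n, for all n. *)
exists bm; have eh : k <= bm h.
  apply: (pow_dominated f0 (val_ge0 bmV h)) => n.
  have [bp0 bo0 bf0] := hb f; have [bp _ _] := hb (f * h ^+ n).
  have bV := seminorm_valuation v_abs bp.1.
  apply: le_trans (ble n) _; apply: ler_pM; rewrite ?exprn_ge0 ?(val_ge0 bV) //.
    exact: (bf0 _ bp (ba _)).
  by rewrite lerXn2r ?nnegrE ?(val_ge0 bV) ?(val_ge0 bmV) // bmax.
(* The product h reaches its bound k at bm, so every factor reaches its own. *)
have bm_le y : y \in ys -> bm y <= xi y.
  move=> yy; have [_ /(_ _ bmp bma)[le_y ->]] := hkP _ yy.
  apply/eqP; rewrite eq_le le_y /= leNgt; apply/negP => lt_y.
  suff : bm h < k by rewrite ltNge eh.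
  rewrite (val_prod bmV); apply: (@prod_lt_seq _ _ _ (fun y => bm (hk y).1) _ y) => //.
    by move=> z zz; exact: hk_le.
  by move=> z /hkP[].
(* The same bound for the inverse of y turns the inequality into an equality. *)
split=> // y yy; have [y' yy' e] := ys_inv _ yy.
have e1 : bm y * bm y' = 1 by rewrite -(valM bmV) e (val1 bmV).
have e2 : xi y * xi y' = 1 by rewrite -(valM xV) e (val1 xV).
have x'0 : 0 < xi y'.
  by rewrite lt_neqAle (val_ge0 xV) andbT; apply/eqP => e'; move: e2; rewrite -e' mulr0 => /eqP; rewrite eq_sym oner_eq0.
apply/eqP; rewrite eq_le bm_le //= -(ler_pM2r x'0) e2 -e1.
by rewrite ler_wpM2l ?(val_ge0 bmV) // bm_le.
Qed.

End Fiber.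
End Domination.

(** * Points over nearby weights *)

Lemma dist_half (R : realType) (u a c : R) : c <= a -> `|u - a| < c / 2 -> c / 2 < u.
Proof. by rewrite ltr_distl => ca /andP[h _]; lra. Qed.

Lemma dist_one (R : realType) (u a c : R) : a <= c -> `|u - a| < 1 -> u <= c + 1.
Proof. by rewrite ltr_distl => ca /andP[_ h]; lra. Qed.

Lemma continuous_dist (R : realType) (U : topologicalType) (f : U -> R) c :
  continuous f -> continuous (fun y => `|f y - c|).
Proof.
move=> cf y; apply: (@continuous_comp _ _ _ f (fun t => `|t - c|)); first exact: cf.
apply: continuous_comp; last exact: norm_continuous.
by apply: continuousB; [exact: cvg_id|exact: cst_continuous].
Qed.

Section Nearby.
Context (R : realType) (K : fieldType) (v : K -> R) (v_abs : nonarch_abs v).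
Context (T : comAlgType K) (x : nat -> T) (d : nat).
Local Notation phi := (mveval x d).
Local Notation S := (mvpoly K d).
Local Notation F := {ptws T -> R}.
Local Notation points := (@points R K v T).
Local Notation on_weights := (@on_weights R K T x d).
Local Notation over_gauss := (@over_gauss R K v T x d).
Local Notation pos_weights := (@pos_weights R d).
Local Notation X := (mvX K d).
Context (p : set T) (p_prime : prime_ideal p) (p_fin : loc_finite phi p X).
Hypothesis p_inj : forall s, p (phi s) -> s = 0.

Let p_ideal : ideal p. Proof. by case: p_prime. Qed.

Lemma open_near (xi : F) (fs : seq T) (e : R) :
  open [set zeta : F | forall f, f \in fs -> `|zeta f - xi f| < e].
Proof.
have -> : [set zeta : F | forall f, f \in fs -> `|zeta f - xi f| < e] =
    \big[setI/setT]_(f <- fs) [set zeta : F | `|zeta f - xi f| < e].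
  elim: fs => [|f fs IHfs]; first by rewrite big_nil; apply/seteqP; split.
  rewrite big_cons -IHfs; apply/seteqP; split=> zeta /= h.
    by split=> [|g gf]; apply: h; rewrite inE ?eqxx // gf orbT.
  by move=> g; rewrite inE => /predU1P[->|]; [exact: h.1|exact: h.2].
elim/big_ind: _ => [|A B oA oB|f _]; first exact: openT; first exact: openI.
have -> : [set zeta : F | `|zeta f - xi f| < e] = ~` [set zeta : F | e <= `|zeta f - xi f|].
  by apply/seteqP; split=> zeta /=; [move=> h; apply/negP; rewrite -ltNge|move/negP; rewrite -ltNge].
apply: closed_openC; apply: closed_leq; first exact: cst_continuous.
by apply: continuous_dist; exact: eval_continuous.
Qed.

(** By [peak_off] some h peaks at xi and is smaller at all points over the same Gauss norm outside
    the given neighbourhood U. For other weights [max_point] gives a point where h is as large as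
    the Newton polygon allows. If such points stayed outside U for weights arbitrarily close to a,
    compactness would yield a point over the Gauss norm of a, outside U, where h is at least k: a
    contradiction. *)
Lemma nearby_points (a : nat -> R) (xi : T -> R) (fs : seq T) (e : R) :
  pos_weights a -> points p xi -> over_gauss a xi -> 0 < e ->
  exists2 de, 0 < de & forall a' : nat -> R, (forall i, (i < d)%N -> `|a' i - a i| < de) ->
    pos_weights a' /\ exists zeta, [/\ points p zeta, over_gauss a' zeta &
      forall f, f \in fs -> `|zeta f - xi f| < e].
Proof.
move=> a0 xp xo e0; have xa := over_on v_abs a0 xo; have xV := seminorm_valuation v_abs xp.1.
pose U : set F := [set zeta | forall f, f \in fs -> `|zeta f - xi f| < e].
have Ux : U xi by move=> f _; rewrite subrr normr0.
have oU : open U by exact: open_near.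
have [||||h [k [k0 xh hlt hle]]] :=
    peak_off v_abs p_ideal p_fin a0 xp xo (C := points p `&` over_gauss a `&` ~` U).
- apply: (compact_on_weights v_abs p_ideal p_fin a0).
  + apply: closedI; last exact: open_closedC.
    by apply: closedI; [exact: closed_points|exact: closed_over].
  + by move=> zeta [[]].
  + by move=> zeta [[_ zo] _]; exact: over_on zo.
- by move=> zeta [[]].
- by move=> zeta [[_ zo] _]; exact: over_on zo.
- by move=> [_]; apply.
have [N [Q [Qm Qp hb]]] := max_point v_abs p_prime p_fin p_inj h.
set z1 := phi X ^+ N * h in Qp hb.
have cN : 0 < (\prod_(i < d) a i) ^+ N by rewrite exprn_gt0 // prod_weights_gt0.
have xz1 : xi z1 = (\prod_(i < d) a i) ^+ N * k by rewrite /z1 (point_Xmul v_abs _ _ xp.1 xa) xh.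
have xz10 : 0 < xi z1 by rewrite xz1 mulr_gt0.
(* An index where the largest slope is attained; by [root_le] the value at xi does not exceed that
   slope. *)
have [j jm Qj] : exists2 j, (j < (size Q).-1)%N &
    xi z1 ^+ ((size Q).-1 - j) <= mvgauss v a Q`_j.
  have Nle j : xi (phi Q`_j) <= mvgauss v a Q`_j by rewrite xo.
  have [Q0|[al [al0 al_le [j jm ej]]]] := largest_slope v_abs Q a0.
    suff : xi z1 <= 0 by rewrite leNgt xz10.
    apply: (root_le xV Qm (Qp _ xp) (lexx 0)) => j jm.
    by rewrite Q0 // rmorph0 (val0 xV) exprn_ge0.
  exists j => //; rewrite ej lerXn2r ?nnegrE ?(ltW al0) ?(ltW xz10) //.
  apply: (root_le xV Qm (Qp _ xp) (ltW al0)) => i im.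
  by apply: le_trans (Nle i) _; exact: al_le.
have Qj0 : Q`_j != 0.
  apply: contraTneq Qj => ->; rewrite (val0 (gauss_val v_abs a0)) -ltNge.
  by rewrite exprn_gt0.
have [t tQ et] := mvgauss_term_ex v_abs a0 Qj0.
have [c1 [c2 [c10 hc]]] := weights_bounds a0.
(* All conditions are closed. Those on the terms of all s say that zeta restricts to the Gauss norm
   of its own weights; the last one bounds z1 from below through one term of Q_j. *)
pose D : set F := points p `&` ~` U `&`
  [set zeta | forall i, (i < d)%N -> c1 / 2 <= zeta (x i)] `&`
  [set zeta | forall i, (i < d)%N -> zeta (x i) <= c2 + 1] `&`
  [set zeta | forall (s : S) u, u \in mvterms s ->
     zeta (u.1 *: mvmon x d u.2) <= zeta (phi s)] `&`
  [set zeta | zeta (t.1 *: mvmon x d t.2) <= zeta (z1 ^+ ((size Q).-1 - j))].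
have c120 : 0 < c1 / 2 by rewrite divr_gt0.
have cst (c : R) : continuous (fun xi : F => c) by exact: cst_continuous.
have cD : closed D.
  apply: closedI; first apply: closedI; first apply: closedI; first apply: closedI; first apply: closedI.
  - exact: closed_points.
  - exact: open_closedC.
  - apply: closed_forall => i; apply: closed_imply; apply: closed_leq => //.
    exact: eval_continuous.
  - apply: closed_forall => i; apply: closed_imply; apply: closed_leq => //.
    exact: eval_continuous.
  - apply: closed_forall => s; apply: closed_forall => u; apply: closed_imply.
    by apply: closed_leq; exact: eval_continuous.
  - by apply: closed_leq; exact: eval_continuous.
have kD : compact D.
  apply: (compact_points v_abs p_ideal p_fin (c2 := c2 + 1) c120 cD).
    by move=> zeta [[[[[]]]]].
  by move=> zeta [[[[_ h1] h2] _] _] i id; rewrite h1 // h2.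
have zD a' zeta : (forall i, (i < d)%N -> `|a' i - a i| < c1 / 2) ->
    (forall i, (i < d)%N -> `|a' i - a i| < 1) -> pos_weights a' ->
    points p zeta -> over_gauss a' zeta -> ~ U zeta ->
    mvgauss v a' Q`_j <= zeta z1 ^+ ((size Q).-1 - j) -> D zeta.
  move=> h1 h2 a'0 zp zo nU hj; have zV := seminorm_valuation v_abs zp.1.
  have za := over_on v_abs a'0 zo.
  have zw (u : K * seq nat) : zeta (u.1 *: mvmon x d u.2) = v u.1 * mvweight a' d u.2.
    rewrite (seminormZ _ _ zp.1) (seminorm_mvmon v_abs) ?zp.1 //; last exact: zp.1.
    by congr (_ * _); apply: eq_bigr => i _; rewrite za.
  split; first split; first split; first split; first by split.
  - move=> i id; rewrite za //; have /andP[ca _] := hc i id.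
    exact: (ltW (dist_half ca (h1 i id))).
  - move=> i id; rewrite za //; have /andP[_ ca] := hc i id.
    exact: (dist_one ca (h2 i id)).
  - by move=> s u us; have := zw u; rewrite zo; move=> ->; exact: mvgauss_term_le.
  - by rewrite /mkset zw (valX zV); apply: le_trans hj; exact: mvgauss_term_le.
have [de de0 hde] : exists2 de, 0 < de & forall zeta, D zeta ->
    exists2 i, (i < d)%N & de <= `|zeta (x i) - a i|.
  have [D0|/nonemptyPn nD] := pselect (D !=set0); last first.
    by exists 1 => // zeta; rewrite nD.
  (* A continuous function whose minimum on the compact set D is positive, because no point of D has
     weights a. *)
  pose g (zeta : F) : R := \sum_(i < d) `|zeta (x i) - a i|.
  have cg : continuous (fun zeta : F => - g zeta).
    move=> zeta; apply: continuousN; move: zeta.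
    apply: (continuous_sum (f := fun i (zeta : F) => `|zeta (x i) - a i|)) => i.
    by apply: continuous_dist; exact: eval_continuous.
  have [zm Dzm zmin] := compact_max kD D0 cg.
  have gm0 : 0 < g zm.
    rewrite lt_neqAle sumr_ge0 ?andbT //; apply/eqP => /esym/eqP.
    rewrite psumr_eq0 // => /allP/= zm0.
    case: Dzm => [[[[[zp nU] h1] _] hs] hj]; have zV := seminorm_valuation v_abs zp.1.
    have za : on_weights a zm.
      move=> i id; have := zm0 (Ordinal id); rewrite mem_index_enum normr_eq0 subr_eq0.
      by move=> /(_ isT)/eqP.
    have zo : over_gauss a zm.
      have x0 i : (i < d)%N -> 0 < zm (x i) by move=> id; rewrite za // a0.
      have /on_gaussP : forall s t, t \in mvterms (s : S) ->
          v t.1 * mvweight (fun i => zm (x i)) d t.2 <= zm (phi s).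
        move=> s u us; have := hs s u us.
        by rewrite (seminormZ _ _ zp.1) (seminorm_mvmon v_abs) //; exact: zp.1.
      move=> /(_ v_abs zp.1 x0) zg s; rewrite zg; apply: mvgauss_ext => i id.
      exact: za.
    have : zm h < k by apply: hlt => //; split=> //.
    rewrite ltNge => /negP; apply; rewrite -(ler_pM2l cN) -xz1.
    rewrite -(point_Xmul v_abs _ _ zp.1 za) -/z1.
    rewrite -(@ler_pXn2r _ ((size Q).-1 - j)) ?subn_gt0 ?nnegrE ?(ltW xz10) ?(val_ge0 zV) //.
    apply: le_trans Qj _; rewrite -et -(valX zV).
    apply: le_trans hj; rewrite (seminormZ _ _ zp.1) (seminorm_mvmon v_abs) //; last exact: zp.1.
    by rewrite le_eqVlt; apply/orP; left; apply/eqP; congr (_ * _); apply: eq_bigr => i _; rewrite za.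
  have d0 : (0 < d)%N.
    rewrite lt0n; apply/negP => /eqP dz; move: gm0; rewrite /g big1 ?ltxx // => i _.
    by have := ltn_ord i; move: (nat_of_ord i) => k'; rewrite dz.
  exists (g zm / d%:R); first by rewrite divr_gt0 // ltr0n.
  move=> zeta Dz; apply: contrapT => no.
  have : g zeta < g zm.
    have -> : g zm = \sum_(i < d) g zm / d%:R.
      by rewrite sumr_const card_ord -[RHS]mulr_natr divfK // pnatr_eq0 -lt0n.
    apply: ltr_sum; first by apply/hasP; exists (Ordinal d0); rewrite ?mem_index_enum.
    by move=> i _; rewrite ltNge; apply/negP => hi; apply: no; exists i.
  by have := zmin _ Dz; rewrite lerN2 leNgt => /negP.
exists (Num.min de (Num.min (c1 / 2) 1)); first by rewrite !lt_min de0 c120 ltr01.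
move=> a' ha'.
have h1 i : (i < d)%N -> `|a' i - a i| < c1 / 2 by move=> /ha'; rewrite !lt_min => /and3P[].
have h2 i : (i < d)%N -> `|a' i - a i| < 1 by move=> /ha'; rewrite !lt_min => /and3P[].
have a'0 : pos_weights a'.
  move=> i id; have /andP[ca _] := hc i id.
  exact: (lt_trans c120 (dist_half ca (h1 i id))).
split=> //; have [b [bp bo bQ]] := hb _ a'0; exists b; split=> //; apply: contrapT => nU.
have [|i id] := hde b; first by apply: (zD a') => //; exact: bQ.
by rewrite (over_on v_abs a'0 bo) // leNgt; have := ha' i id; rewrite lt_min => /andP[->].
Qed.

End Nearby.

(** * Characters and elimination *)

Section Laurent.
Context (K : fieldType) (G : zmodType).
Local Notation T := (monoid_algebra K G).

Lemma chiD (u w : G) : chi K (u + w) = chi K u * chi K w.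
Proof.
change (chi K (u + w) = ma_mul (chi K u) (chi K w)).
rewrite /ma_mul /supp !monalg.msuppU oner_eq0 !big_seq_fset1 /coef !monalg.mcoeffUU mulr1.
by [].
Qed.

Lemma chi0 : chi K (0 : G) = 1. Proof. by []. Qed.

Lemma chiMn (u : G) n : chi K (u *+ n) = chi K u ^+ n.
Proof. by elim: n => [//|n IHn]; rewrite mulrS chiD IHn exprS. Qed.

Lemma chi_sum (I : Type) (r : seq I) (P : pred I) (F : I -> G) :
  chi K (\sum_(i <- r | P i) F i) = \prod_(i <- r | P i) chi K (F i).
Proof. by elim/big_rec2: _ => // i y z _ <-; rewrite chiD. Qed.

Lemma chiN (u : G) : chi K u * chi K (- u) = 1.
Proof. by rewrite -chiD subrr. Qed.

Lemma monomialE (u : G) c : monomial u c = c *: chi K u.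
Proof.
apply/monalg.malgP => w.
by rewrite monalg.mcoeffZ !monalg.mcoeffU mulr_natr.
Qed.

Lemma laurentE (f : T) : f = \sum_(u <- supp f) coef u f *: chi K u.
Proof.
by rewrite {1}[f]monalg.monalgE; apply: eq_bigr => u _; rewrite -monomialE.
Qed.

Lemma chi_mvmon (psi : nat -> G) d e :
  mvmon (fun i => chi K (psi i)) d e = chi K (\sum_(i < d) psi i *+ nth 0%N e i).
Proof. by rewrite chi_sum; apply: eq_bigr => i _; rewrite chiMn. Qed.

Definition characters (psi : nat -> G) (i : nat) : T := chi K (psi i).

End Laurent.

Lemma seq_argmax (I : eqType) (L : seq I) (e : I -> nat) i0 : i0 \in L ->
  exists2 t, t \in L & forall i, i \in L -> (e i <= e t)%N.
Proof.
elim: L i0 => [//|j L IHL] i0 _; case: L IHL => [_|k L /(_ k (mem_head _ _))[t tL ht]].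
  by exists j => [|i]; rewrite inE // => /eqP->.
have [h|h] := leqP (e j) (e t).
  by exists t => [|i]; rewrite inE ?tL ?orbT // => /predU1P[->//|/ht].
exists j => [|i]; first exact: mem_head.
by rewrite inE => /predU1P[->//|/ht/leq_trans]; apply; exact: ltnW.
Qed.

Lemma fg_image (S T : comNzRingType) (Phi : {rmorphism S -> T}) (J : set T) : ideal J ->
  fg_subring Phi J [set f | exists s, J (f - Phi s)].
Proof.
move=> J_ideal; have J0 := ideal0 J_ideal; split.
- by move=> f Jf; exists 0; rewrite rmorph0 subr0.
- by move=> s; exists s; rewrite subrr.
- move=> f g [s hs] [t ht]; exists (s + t); rewrite rmorphD opprD addrACA.
  exact: (idealD J_ideal).
- move=> f g [s hs] [t ht]; exists (s * t); rewrite rmorphM.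
  exact: (ideal_subM J_ideal).
- exists 1%N, (fun=> 1); split=> [_|f [s hs]].
    by exists 1; rewrite rmorph1 subrr.
  by exists (fun=> s); rewrite big_ord_recl big_ord0 addr0 mulr1.
Qed.

Lemma poly_ev_monic (S T : comNzRingType) (Phi : {rmorphism S -> T}) z (Q : {poly S}) :
  Q \is monic ->
  poly_ev Phi z Q = z ^+ (size Q).-1 + \sum_(i < (size Q).-1) Phi Q`_i * z ^+ i.
Proof.
move=> Qm; have sQ : size Q = (size Q).-1.+1 by rewrite prednK // size_poly_gt0 monic_neq0.
rewrite poly_evE -(big_mkord xpredT (fun i => Phi Q`_i * z ^+ i)) [X in index_iota 0 X]sQ.
rewrite big_nat_recr //= big_mkord addrC; congr (_ + _).
by rewrite -lead_coefE (monicP Qm) rmorph1 mul1r.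
Qed.

Section Adjoin.
Context (R : realType) (K : fieldType) (v : K -> R) (v_abs : nonarch_abs v).
Context (G : zmodType).
Local Notation T := (monoid_algebra K G).
Context (J : set T) (J_ideal : ideal J).

Section Loc.
Context (psi : nat -> G) (r : nat).
Local Notation phi := (mveval (characters K psi) r).
Local Notation X := (mvX K r).

Section OneRing.
Context (A : set T) (AP : fg_subring phi J A).
Local Notation loc := (localized A (phi X)).

Lemma loc_scale c f : loc f -> loc (c *: f).
Proof.
move=> [N hN]; exists N; rewrite -scalerAr -mulr_algl -(mveval_mvC (characters K psi) r).
by apply: (fgM AP) => //; exact: (fgPhi AP).
Qed.

Lemma loc_var i : (i < r)%N -> loc (chi K (psi i)).
Proof.
move=> ir; have [s [es _]] := mvpoly_var v_abs (characters K psi) ir.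
by apply: (loc_sub phi); rewrite -[chi _ _]/(characters K psi i) -es; exact: (fgPhi AP).
Qed.

Lemma loc_varN i : (i < r)%N -> loc (chi K (- psi i)).
Proof.
move=> ir; exists 1%N; rewrite expr1 mveval_X (bigD1 (Ordinal ir)) //= mulrC mulrA.
rewrite [X in X * _]mulrC chiN mul1r; apply: big_ind; first exact: (fg1 AP).
  exact: (fgM AP).
move=> j _; have [s [<- _]] := mvpoly_var v_abs (characters K psi) (ltn_ord j).
exact: (fgPhi AP).
Qed.

Lemma loc_comb (n : nat -> nat) : loc (chi K (\sum_(i < r) psi i *+ n i)).
Proof.
rewrite chi_sum; apply: (loc_prod AP) => i _; rewrite chiMn; apply: (locX AP).
exact: loc_var.
Qed.

Lemma loc_combN (n : nat -> nat) : loc (chi K (- (\sum_(i < r) psi i *+ n i))).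
Proof.
rewrite -sumrN chi_sum; apply: (loc_prod AP) => i _; rewrite -mulNrn chiMn.
by apply: (locX AP); exact: loc_varN.
Qed.

Lemma loc_spanning k (e : 'I_k -> G) :
  (forall u, exists n : 'I_k -> int, u = \sum_i e i *~ n i) ->
  (forall i, loc (chi K (e i))) -> (forall i, loc (chi K (- e i))) -> forall f, loc f.
Proof.
move=> span h hN f; rewrite [f]laurentE; apply: (loc_sum AP) => u _.
apply: loc_scale; have [n ->] := span u; rewrite chi_sum; apply: (loc_prod AP) => i _.
case: (n i) => m; first by rewrite -pmulrn chiMn; exact: (locX AP).
by rewrite NegzE mulrNz -pmulrn -mulNrn chiMn; exact: (locX AP).
Qed.

Section Character.
Context (I : eqType) (L : seq I) (c : I -> K) (u : I -> G) (e : I -> nat) (z : G).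
Hypothesis L_uniq : uniq L.
Hypothesis e_inj : {in L &, injective e}.
Hypothesis c_neq0 : forall t, t \in L -> c t != 0.
Hypothesis loc_u : forall t s, t \in L -> s \in L -> loc (chi K (u t - u s)).

(** Divide the relation by its term of highest exponent in z. The exponents are distinct, so what
    remains is a monic equation for chi^z with coefficients in the localised ring. *)
Lemma adjoin_character i0 : i0 \in L ->
  J (\sum_(t <- L) c t *: chi K (u t + z *+ e t)) ->
  exists A', [/\ fg_subring phi J A', A `<=` A' & localized A' (phi X) (chi K z)].
Proof.
move=> i0L JL; have [t0 tL tmax] := seq_argmax e i0L; set D := e t0.
pose y t := (c t / c t0) *: chi K (u t - u t0).
pose b i := \sum_(t <- L | t != t0) (if e t == i then y t else 0).
apply: (fg_adjoin J_ideal AP (D := D) (b := b)) => [i|].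
  rewrite /b big_seq_cond; apply: (loc_sum AP) => t /andP[tL' _].
  case: eqP => _; last exact: (loc_sub phi X (fg0 AP)).
  by apply: loc_scale; exact: loc_u.
suff -> : chi K z ^+ D + \sum_(i < D) b i * chi K z ^+ i =
    ((c t0)^-1 *: chi K (- u t0)) * \sum_(t <- L) c t *: chi K (u t + z *+ e t).
  exact: (idealM J_ideal).
have termE t : ((c t0)^-1 *: chi K (- u t0)) * (c t *: chi K (u t + z *+ e t)) =
    y t * chi K z ^+ e t.
  rewrite -scalerAl -scalerAr scalerA -scalerAl -chiMn -!chiD mulrC; congr (_ *: chi K _).
  by rewrite addrA [- u t0 + _]addrC.
rewrite mulr_sumr (bigD1_seq t0) //= termE {1}/y subrr chi0 divff ?c_neq0 // scale1r mul1r.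
congr (_ + _); rewrite /b.
under eq_bigr do rewrite mulr_suml.
rewrite exchange_big /= big_seq_cond [RHS]big_seq_cond; apply: eq_bigr => t /andP[tL' tt].
have lt_t : (e t < D)%N.
  by rewrite ltn_neqAle tmax // andbT; apply: contra_neq tt; exact: e_inj.
rewrite termE (bigD1 (Ordinal lt_t)) //= eqxx big1 ?addr0 // => i it.
case: eqP => [ei|_]; last by rewrite mul0r.
by case/eqP: it; exact: val_inj.
Qed.

End Character.
End OneRing.
End Loc.

Lemma mvterms_mem0 d (g : mvpoly K d) : g != 0 -> exists t, t \in mvterms g.
Proof.
move=> g0; case e : (mvterms g) => [|t L]; first by rewrite (mvterms_nil e) eqxx in g0.
by exists t; rewrite mem_head.
Qed.

Section Eliminate.
Context (psi : nat -> G) (r N : nat) (g : mvpoly K r.+1).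
Local Notation phi1 := (mveval (characters K psi) r.+1).
Hypotheses (g_neq0 : g != 0) (Jg : J (phi1 g)).
Hypothesis fin1 : loc_finite phi1 J (mvX K r.+1).
Let wt (t : K * seq nat) := (\sum_(i < r.+1) N ^ i * nth 0 t.2 i)%N.
Hypothesis N_sep : forall t u, t \in mvterms g -> u \in mvterms g -> t.2 != u.2 -> wt t != wt u.

(** Nagata's change of variables for characters: in the new ones, a monomial with exponents n_i has
    exponent sum of N^i n_i at psi_0. *)
Definition shear (i : nat) : G := psi i.+1 - psi 0%N *+ (N ^ i.+1)%N.

Local Notation phi := (mveval (characters K shear) r).
Local Notation X := (mvX K r).

Lemma shear_comb (n : nat -> nat) : \sum_(i < r.+1) psi i *+ n i =
  \sum_(i < r) shear i *+ n i.+1 + psi 0%N *+ (\sum_(i < r.+1) N ^ i * n i)%N.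
Proof.
rewrite !big_ord_recl /= expn0 mul1n mulrnDr addrCA; congr (_ + _).
rewrite -sumrMnr -big_split /=; apply: eq_bigr => i _.
by rewrite /shear mulrnBl -!mulrnA /bump /= add1n subrK.
Qed.

Let adjoin_both : exists A, [/\ fg_subring phi J A,
  localized A (phi X) (chi K (psi 0%N)) & localized A (phi X) (chi K (- psi 0%N))].
Proof.
have A0P := fg_image phi J_ideal; set A0 := [set _ | _] in A0P.
pose u (t : K * seq nat) := \sum_(i < r) shear i *+ nth 0%N t.2 i.+1.
have [t0 t0g] := mvterms_mem0 g_neq0.
have guniq : uniq (mvterms g) := map_uniq (mvterms_uniq g).
have wt_inj : {in mvterms g &, injective wt}.
  move=> t t' tg t'g /eqP e; apply: (uniq_map_inj (mvterms_uniq g)) => //.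
  by apply/eqP; apply: contraTT e; exact: N_sep.
have loc_u A : fg_subring phi J A -> forall t s, localized A (phi X) (chi K (u t - u s)).
  by move=> AP t s; rewrite chiD; apply: (locM AP); [exact: (loc_comb AP (fun i => nth 0%N t.2 i.+1))|exact: (loc_combN AP (fun i => nth 0%N s.2 i.+1))].
have gE : phi1 g = \sum_(t <- mvterms g) t.1 *: chi K (u t + psi 0%N *+ wt t).
  rewrite mveval_terms; apply: eq_bigr => t _.
  by rewrite chi_mvmon (shear_comb (nth 0%N t.2)).
have [A1 [A1P _ z1]] : exists A', [/\ fg_subring phi J A', A0 `<=` A' &
    localized A' (phi X) (chi K (psi 0%N))].
  apply: (adjoin_character A0P guniq wt_inj (c := fst) (u := u) _ _ t0g).
  - by move=> t /mvterms_neq0.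
  - by move=> t s _ _; exact: loc_u.
  - by rewrite -gE.
have [tm tmg tmax] := seq_argmax wt t0g.
have [A2 [A2P A12 z2]] : exists A', [/\ fg_subring phi J A', A1 `<=` A' &
    localized A' (phi X) (chi K (- psi 0%N))].
  (* Divided by the highest power of chi^(psi_0), the same relation is an equation for its
     inverse. *)
  apply: (adjoin_character A1P guniq (e := fun t => (wt tm - wt t)%N) _ (c := fst) (u := u) _ _ t0g).
  - move=> t s tg sg; have := tmax _ tg; have := tmax _ sg => h1 h2 h3; apply: wt_inj => //.
    by move: h1 h2 h3; lia.
  - by move=> t /mvterms_neq0.
  - by move=> t s _ _; exact: loc_u.
  - set E := \sum_(t <- _) _; suff <- : chi K (- (psi 0%N *+ wt tm)) * phi1 g = E.
      exact: (idealM J_ideal).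
    rewrite gE mulr_sumr /E big_seq [RHS]big_seq.
    apply: eq_bigr => t tg; rewrite -scalerAr -chiD; congr (_ *: chi K _).
    rewrite addrCA; congr (_ + _); rewrite mulNrn mulrnBr ?tmax // opprB.
    by rewrite addrC.
by exists A2; split=> //; have [M hM] := z1; exists M; exact: A12.
Qed.

(** One step of Noether normalisation for tori. The relation g makes chi^(psi_0) and its inverse
    integral over the sheared characters, after localisation, which brings in all old characters and
    their inverses; the old module generators are then adjoined one by one. *)
Lemma eliminate : loc_finite phi J X.
Proof.
have [A2 [A2P z zN]] := adjoin_both.
have var A : fg_subring phi J A -> A2 `<=` A -> forall i, (i < r.+1)%N ->
    localized A (phi X) (chi K (psi i)) /\ localized A (phi X) (chi K (- psi i)).
  move=> AP A2A; have [M hM] := z; have [M' hM'] := zN.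
  have zA : localized A (phi X) (chi K (psi 0%N)) by exists M; exact: A2A.
  have zA' : localized A (phi X) (chi K (- psi 0%N)) by exists M'; exact: A2A.
  case=> [//|i]; rewrite ltnS => ir.
  have -> : psi i.+1 = shear i + psi 0%N *+ (N ^ i.+1)%N by rewrite subrK.
  move: (loc_var AP ir) (loc_varN AP ir); move: (shear i) => sh hs hsN.
  rewrite opprD !chiD -mulNrn !chiMn.
  by split; apply: (locM AP) => //; exact: (locX AP).
have loc_phi A : fg_subring phi J A -> A2 `<=` A -> forall s, localized A (phi X) (phi1 s).
  move=> AP A2A s; rewrite [phi1 s]mveval_terms; apply: (loc_sum AP) => t _.
  apply: (loc_scale AP); apply: (loc_prod AP) => i _; apply: (locX AP).
  by have [] := var _ AP A2A _ (ltn_ord i).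
have loc_Xinv A : fg_subring phi J A -> A2 `<=` A ->
    localized A (phi X) (\prod_(i < r.+1) chi K (- psi i)).
  by move=> AP A2A; apply: (loc_prod AP) => i _; have [] := var _ AP A2A _ (ltn_ord i).
have [A [AP locA]] := fin1; have [_ _ _ _ [l [m [Am Agen]]]] := AP.
have [A3 [A3P A23 m3]] : exists A3, [/\ fg_subring phi J A3, A2 `<=` A3 &
    forall k : 'I_l, (k < l)%N -> localized A3 (phi X) (m k)].
  suff h n : (n <= l)%N -> exists A3, [/\ fg_subring phi J A3, A2 `<=` A3 &
      forall k : 'I_l, (k < n)%N -> localized A3 (phi X) (m k)] by exact: h.
  elim: n => [|n IHn] nl.
    by exists A2; split=> // k.
  have [B [BP A2B mB]] := IHn (ltnW nl); pose k := Ordinal nl.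
  have [Q [Qm JQ]] := fg_integral J_ideal AP (Am k).
  have [||C [CP BC mC]] := @fg_adjoin _ _ phi J B J_ideal BP X (m k) (size Q).-1 (fun i => phi1 Q`_i).
  - by move=> i; exact: loc_phi.
  - by rewrite -poly_ev_monic.
  exists C; split=> // [f|i]; first by move=> /A2B/BC.
  rewrite ltnS leq_eqVlt => /predU1P[ik|/mB[M hM]]; last by exists M; exact: BC.
  by have -> : i = k by exact: val_inj.
exists A3; split=> // f; have [M hM] := locA f; have [c Jc] := Agen _ hM.
have unit : (\prod_(i < r.+1) chi K (- psi i)) * phi1 (mvX K r.+1) = 1.
  rewrite mveval_X -big_split /= big1 // => i _; rewrite mulrC; exact: chiN.
have -> : f = (\prod_(i < r.+1) chi K (- psi i)) ^+ M * (phi1 (mvX K r.+1) ^+ M * f).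
  by rewrite mulrA -exprMn unit expr1n mul1r.
apply: (locM A3P); first by apply: (locX A3P); exact: loc_Xinv.
rewrite -(subrK (\sum_i phi1 (c i) * m i) (_ * f)); apply: (locD A3P).
  by apply: (loc_sub phi); exact: (fgJ A3P).
apply: (loc_sum A3P) => i _; apply: (locM A3P); first exact: loc_phi.
exact: m3.
Qed.

End Eliminate.
End Adjoin.

(** * Dimension *)

Lemma nat_nonroot (R : realType) (L : seq {poly R}) : (forall p, p \in L -> p != 0) ->
  exists N : nat, forall p, p \in L -> p.[N%:R] != 0.
Proof.
move=> L0; pose P := \prod_(p <- L) p.
have P0 : P != 0 by rewrite /P prodf_seq_neq0; apply/allP => p /L0 ->.
suff [N hN] : exists N : nat, P.[N%:R] != 0.
  exists N => p pL; apply: contra_neq hN => p0.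
  by rewrite horner_prod (big_rem p) //= p0 mul0r.
apply: contrapT => h; have := @max_poly_roots _ P [seq i%:R | i <- iota 0 (size P)] P0.
rewrite size_map size_iota ltnn map_inj_uniq ?iota_uniq; last exact: mulrIn.
have -> : all (root P) [seq i%:R | i <- iota 0 (size P)].
  apply/allP => _ /mapP[i _ ->]; apply/rootP/eqP; apply: contrapT => hi; apply: h.
  by exists i; apply/negP.
by move=> /(_ isT isT).
Qed.

(** Differences of exponent vectors of g are non-zero polynomials; a natural number that is a root
    of none of them separates the terms. The list L adds the conditions that preserve injectivity on
    subspaces. *)
Lemma shear_exponent (R : realType) (K : fieldType) r (g : mvpoly K r.+1) (L : seq {poly R}) :
  (forall p, p \in L -> p != 0) -> exists N : nat,
    (forall t u, t \in mvterms g -> u \in mvterms g -> t.2 != u.2 ->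
       (\sum_(i < r.+1) N ^ i * nth 0 t.2 i != \sum_(i < r.+1) N ^ i * nth 0 u.2 i)%N) /\
    forall p, p \in L -> p.[N%:R] != 0.
Proof.
move=> L0.
pose dif (t u : K * seq nat) : {poly R} :=
  \poly_(i < r.+1) ((nth 0%N t.2 i)%:R - (nth 0%N u.2 i)%:R).
pose L' := [seq dif t u | t <- mvterms g, u <- mvterms g].
have [|N hN] := @nat_nonroot R ([seq p <- L' | p != 0] ++ L).
  by move=> p; rewrite mem_cat mem_filter => /orP[/andP[]|/L0].
exists N; split=> [t u tg ug tu|p pL]; last by apply: hN; rewrite mem_cat pL orbT.
have : (dif t u).[N%:R] != 0.
  apply: hN; rewrite mem_cat mem_filter; apply/orP; left; apply/andP; split; last first.
    by apply/allpairsP; exists (t, u).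
  apply: contra_neq tu => /polyP d0; apply: (@eq_from_nth _ 0%N).
    by rewrite (mvterms_size tg) (mvterms_size ug).
  move=> i; rewrite (mvterms_size tg) => ir; have := d0 i; rewrite coef_poly ir coef0.
  by move=> /eqP; rewrite subr_eq0 eqr_nat => /eqP.
apply: contra_neq => e; rewrite horner_poly.
suff : (\sum_(i < r.+1) N ^ i * nth 0 t.2 i)%:R - (\sum_(i < r.+1) N ^ i * nth 0 u.2 i)%:R = 0 :> R.
  rewrite !natr_sum -sumrB => s0; rewrite -[RHS]s0; apply: eq_bigr => i _.
  by rewrite !natrM natrX mulrC mulrBr.
by rewrite e subrr.
Qed.

Section Primes.
Context (T : comNzRingType).
Implicit Types (I J p : set T).

Lemma prime_pow p z k : prime_ideal p -> p (z ^+ k) -> p z.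
Proof.
move=> [_ p1 pM]; elim: k => [|k IHk]; first by rewrite expr0.
by rewrite exprS => /pM[].
Qed.

Lemma prime_unit p x y : prime_ideal p -> x * y = 1 -> ~ p x.
Proof. by move=> [pI p1 _] e px; apply: p1; rewrite -e mulrC; exact: idealM. Qed.

Lemma minimal_prime_below I p : prime_ideal p -> I `<=` p ->
  exists2 q, minimal_prime I q & q `<=` p.
Proof.
move=> pP Ip; pose X := {q : set T | [/\ prime_ideal q, I `<=` q & q `<=` p]}.
pose le (q q' : X) := `[< sval q' `<=` sval q >].
have [] := @Zorn X le.
- by move=> q; apply/asboolP.
- by move=> q1 q2 q3 /asboolP h1 /asboolP h2; apply/asboolP; apply: subset_trans h1.
- move=> [q1 q1P] [q2 q2P] /asboolP/= h1 /asboolP/= h2; apply: eq_exist.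
  exact/seteqP.
- move=> C totC; have [C0|/set0P[c0 Cc0]] := eqVneq C set0.
    have pX : [/\ prime_ideal p, I `<=` p & p `<=` p] by split.
    by exists (exist _ p pX) => s; rewrite C0.
  pose m : set T := [set f | forall c, C c -> sval c f].
  have mX : [/\ prime_ideal m, I `<=` m & m `<=` p].
    split; last by move=> f /(_ _ Cc0); have [_ _] := svalP c0; apply.
      split.
      - split.
        + by move=> c _; have [[cI _ _] _ _] := svalP c; exact: (ideal0 cI).
        + move=> f g hf hg c Cc; have [[cI _ _] _ _] := svalP c.
          by apply: (idealD cI); [exact: hf|exact: hg].
        + move=> a f hf c Cc; have [[cI _ _] _ _] := svalP c.
          by apply: (idealM cI); exact: hf.
      - by move=> /(_ _ Cc0); have [[_ c1 _] _ _] := svalP c0.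
      - move=> f g hfg; apply: contrapT => /not_orP[/existsNP[c hc] /existsNP[c' hc']].
        move/not_implyP : hc => [Cc cf]; move/not_implyP : hc' => [Cc' cg].
        have [[_ _ cM] _ _] := svalP c; have [[_ _ c'M] _ _] := svalP c'.
        case: (totC c c' Cc Cc') => /asboolP sub.
          by have /c'M[/sub/cf|/cg] := hfg _ Cc'.
        by have /cM[/cf|/sub/cg] := hfg _ Cc.
    by move=> f If c _; have [_ + _] := svalP c; exact.
  by exists (exist _ m mX) => s Cs; apply/asboolP => f /= /(_ _ Cs).
move=> [q [qP Iq qp]] qmax; exists q => //; split=> // q' q'P Iq' q'q.
have q'X : [/\ prime_ideal q', I `<=` q' & q' `<=` p] by split=> //; exact: (subset_trans q'q qp).
have := qmax (exist _ q' q'X); rewrite /le /= asboolT // => /(_ isT) [] //.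
Qed.

End Primes.

Section Contraction.
Context (S T : comNzRingType) (Phi : {rmorphism S -> T}).

(* The lowest coefficient outside [p] of an integral equation lies in [q].    *)
Lemma contraction_lt (p q : set T) (X : S) : prime_ideal p -> ideal q -> p `<` q ->
  loc_finite Phi p X -> ~ p (Phi X) -> exists s, q (Phi s) /\ ~ p (Phi s).
Proof.
move=> pP qI pq; have [f qf npf] : exists2 f, q f & ~ p f.
  apply: contrapT => h; have [pq1 qp] := pq; apply: qp => f qf.
  by apply: contrapT => npf; apply: h; exists f.
have [pq1 _] := pq; move=> [A [AP locA]] npX; have [N hN] := locA f.
have [pI p1 pM] := pP; set z := _ * f in hN.
have qz : q z by exact: (idealM qI).
have npz : ~ p z by move=> /pM[/(prime_pow pP)|].
have [Q [Qm pQ]] := fg_integral pI AP hN.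
have exk : exists k, `[< ~ p (Phi Q`_k) >].
  by exists (size Q).-1; apply/asboolP; rewrite -lead_coefE (monicP Qm) rmorph1.
case: (ex_minnP exk) => k /asboolP Qk kmin; exists Q`_k; split=> //.
have Qlt i : (i < k)%N -> p (Phi Q`_i).
  by move=> ik; apply: contrapT => h; have := kmin i (asboolT h); rewrite leqNgt ik.
pose z2 := poly_ev Phi z (drop_poly k.+1 Q).
have eD : poly_ev Phi z (drop_poly k Q) = Phi Q`_k + z2 * z.
  have -> : drop_poly k Q = (Q`_k)%:P + drop_poly k.+1 Q * 'X.
    apply/polyP => i; rewrite coefD coefC coefMX coef_drop_poly.
    by case: i => [|i] /=; rewrite ?add0n ?addr0 // add0r coef_drop_poly addSnnS.
  by rewrite rmorphD rmorphM poly_evC poly_evX.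
have pD : p (poly_ev Phi z (drop_poly k Q)).
  have : p (poly_ev Phi z (drop_poly k Q) * z ^+ k).
    have -> : poly_ev Phi z (drop_poly k Q) * z ^+ k =
        poly_ev Phi z Q - poly_ev Phi z (take_poly k Q).
      by rewrite -{2}(poly_take_drop k Q) rmorphD rmorphM rmorphXn poly_evX addrC addKr.
    apply: (idealB pI); first exact: pQ.
    rewrite poly_evE; apply: (ideal_sum pI) => i _; rewrite mulrC; apply: (idealM pI).
    rewrite coef_take_poly; case: ltnP => [/Qlt//|_].
    by rewrite rmorph0; exact: (ideal0 pI).
  by case/pM => // /(prime_pow pP).
have -> : Phi Q`_k = poly_ev Phi z (drop_poly k Q) - z2 * z by rewrite eD addrK.
by apply: (idealB qI); [exact: pq1|exact: (idealM qI)].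
Qed.

End Contraction.

(** Extend the trivial valuation with kernel q by [lying_over] and take the kernel of the
    extension. *)
Lemma going_up (R : realType) (S T : comNzRingType) (Phi : {rmorphism S -> T}) (J : set T)
    (X : S) (q : set S) : ideal J -> loc_finite Phi J X -> prime_ideal q -> ~ q X ->
  (forall s, J (Phi s) -> q s) ->
  exists P, [/\ prime_ideal P, J `<=` P & forall s, P (Phi s) <-> q s].
Proof.
move=> J_ideal fin [qI q1 qM] qX Jq.
pose b (s : S) : R := if `[< q s >] then 0 else 1.
have b0 s : q s -> b s = 0 by move=> qs; rewrite /b asboolT.
have b1 s : ~ q s -> b s = 1 by move=> qs; rewrite /b asboolF.
have bV : valuation b.
  split.
  - by move=> s; rewrite /b; case: asboolP.
  - by rewrite b0 //; exact: (ideal0 qI).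
  - by rewrite b1.
  - move=> s t; have [qs|qs] := pselect (q s).
      by rewrite (b0 _ qs) mul0r b0 // mulrC; exact: (idealM qI).
    have [qt|qt] := pselect (q t); first by rewrite (b0 _ qt) mulr0 b0 //; exact: (idealM qI).
    by rewrite (b1 _ qs) (b1 _ qt) mulr1 b1 // => /qM[].
  - move=> s t; have [qs|qs] := pselect (q s); last first.
      by rewrite (b1 _ qs) le_max /b; case: asboolP; rewrite ?lexx ?ler01.
    have [qt|qt] := pselect (q t); last first.
      by rewrite (b1 _ qt) le_max orbC /b; case: asboolP; rewrite ?lexx ?ler01.
    by rewrite b0 ?le_max ?b0 ?lexx //; exact: (idealD qI).
have [||||xi [xiV xiJ xis]] := @lying_over S T Phi J J_ideal R X b => //.
- by rewrite b1.
- by move=> s /Jq; exact: b0.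
exists [set f | xi f = 0]; split.
- split.
  + split=> /=; first exact: (val0 xiV).
    * move=> f g f0 g0; apply/eqP; rewrite eq_le (val_ge0 xiV) andbT.
      by apply: le_trans (valD xiV f g) _; rewrite f0 g0 maxxx.
    * by move=> a f f0; rewrite (valM xiV) f0 mulr0.
  + by rewrite /= (val1 xiV) => /eqP; rewrite oner_eq0.
  + by move=> f g /= /eqP; rewrite (valM xiV) mulf_eq0 => /orP[]/eqP; [left|right].
- exact: xiJ.
- move=> s /=; rewrite xis; split; last exact: b0.
  by rewrite /b; case: asboolP => // _ /eqP; rewrite oner_eq0.
Qed.

(** For i <= d, the kernel of setting the last i variables to 1. The value 1 rather than 0 keeps the
    product of the variables outside, so the chain survives its inversion. *)
Fixpoint coord_primes (K : fieldType) (d : nat) : nat -> set (mvpoly K d) :=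
  match d with
  | 0 => fun _ => [set 0]
  | d'.+1 => fun i => if i is i'.+1
      then [set p : {poly mvpoly K d'} | @coord_primes K d' i' p.[1]] else [set 0]
  end.

Arguments coord_primes : clear implicits.

Lemma coord_primesP (K : fieldType) d i :
  prime_ideal (coord_primes K d i) /\ ~ coord_primes K d i (mvX K d).
Proof.
have zero (A : idomainType) : prime_ideal [set (0 : A)].
  split; first split=> //=.
  - by move=> x y -> ->; rewrite addr0.
  - by move=> a x ->; rewrite mulr0.
  - by move=> /eqP; rewrite oner_eq0.
  - by move=> x y /= /eqP; rewrite mulf_eq0 => /orP[]/eqP; [left|right].
have X0 k : mvX K k <> 0.
  elim: k => [|k IHk]; first by move=> /eqP; rewrite oner_eq0.
  move=> /eqP; rewrite /= mulf_eq0 polyX_eq0 orbF polyC_eq0 => /eqP; exact: IHk.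
elim: d i => [|d IHd] i; first by split; [exact: zero|exact: X0].
case: i => [|i]; first by split; [exact: zero|exact: X0].
have [[[q0 qD qM] q1 qP] qX] := IHd i; split; last first.
  by rewrite /= hornerM hornerC hornerX mulr1.
split; first split=> /=.
- by rewrite horner0.
- by move=> p p' hp hp'; rewrite hornerD; exact: qD.
- by move=> a p hp; rewrite hornerM; exact: qM.
- by rewrite /= hornerC.
- by move=> p p' /=; rewrite hornerM; exact: qP.
Qed.

Lemma coord_primes_lt (K : fieldType) d i : (i < d)%N ->
  coord_primes K d i `<=` coord_primes K d i.+1 /\
  exists s, coord_primes K d i.+1 s /\ ~ coord_primes K d i s.
Proof.
elim: d i => [//|d IHd] [|i] id.
  have [[[q0 _ _] _ _] _] := coord_primesP K d 0.
  split=> [_ -> /=|]; first by rewrite horner0.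
  exists ('X - 1%:P : {poly mvpoly K d}); split=> /=.
    by rewrite hornerXsubC subrr.
  by move=> /eqP; rewrite polyXsubC_eq0.
have [sub [s [s1 s2]]] := IHd i id; split=> [p /= /sub //|].
by exists (s%:P : {poly mvpoly K d}); rewrite /= hornerC.
Qed.

Section Dimension.
Context (R : realType) (K : fieldType) (v : K -> R) (v_abs : nonarch_abs v).
Context (G : zmodType).
Local Notation T := (monoid_algebra K G).
Implicit Types (I J p : set T) (psi : nat -> G).

Lemma prime_mvX psi r p : prime_ideal p -> ~ p (mveval (characters K psi) r (mvX K r)).
Proof.
move=> pP; apply: (prime_unit pP (y := \prod_(i < r) chi K (- psi i))).
by rewrite mveval_X -big_split /= big1 // => i _; exact: chiN.
Qed.

Lemma prime_mvC psi p (c : K) : prime_ideal p -> p (mveval (characters K psi) 0 c) -> c = 0.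
Proof.
move=> pP pc; apply/eqP; apply: contrapT => /negP c0.
have := prime_unit pP (x := c%:A) (y := c^-1%:A); apply=> //.
by rewrite -scalerAl mul1r scalerA divff // scale1r.
Qed.

Lemma chain_sub I J d C : I `<=` J -> prime_chain J d C -> prime_chain I d C.
Proof.
by move=> IJ [h1 h2]; split=> // i id; have [? JC] := h1 i id; split=> //; exact: subset_trans JC.
Qed.

Lemma chain_trunc J d d' C : (d' <= d)%N -> prime_chain J d C -> prime_chain J d' C.
Proof.
move=> dd [h1 h2]; split=> i id; first by apply: h1; exact: leq_trans dd.
by apply: h2; exact: leq_trans dd.
Qed.

Lemma chain_mono d (C : nat -> set T) i : (forall j, (j < d)%N -> C j `<` C j.+1) ->
  (i <= d)%N -> C 0%N `<=` C i.
Proof.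
move=> h; elim: i => [_|i IHi id]; first exact: subset_refl.
apply: subset_trans (IHi (ltnW id)) _.
by have [] := h i id.
Qed.

(** By [contraction_lt] the second prime of a chain contains a relation between the characters;
    eliminating one of them leaves a chain shorter by one. With no character left, the relation
    would be a non-zero constant. *)
Lemma chain_bound r psi J : ideal J ->
  loc_finite (mveval (characters K psi) r) J (mvX K r) -> forall C, ~ prime_chain J r.+1 C.
Proof.
elim: r psi J => [|r IHr] psi J J_ideal fin C [Cp Clt].
all: have [[C0I _ _] JC0] := Cp 0%N isT; have C0P := (Cp 0%N isT).1.
all: have [C1P JC1] := Cp 1%N isT; have C1I : ideal (C 1%N) by case: C1P.
all: have fin0 := loc_finite_sub J_ideal C0I JC0 fin.
all: have [s [C1s C0s]] := contraction_lt C0P C1I (Clt 0%N isT) fin0 (prime_mvX C0P).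
  by apply: C0s; rewrite (prime_mvC C1P C1s) rmorph0; exact: (ideal0 C0I).
have s0 : s != 0.
  by apply/eqP => s0; apply: C0s; rewrite s0 rmorph0; exact: (ideal0 C0I).
have [|N [hN _]] := @shear_exponent R K r s [::]; first by [].

have fin1 := loc_finite_sub J_ideal C1I JC1 fin.
have fin' := eliminate v_abs C1I s0 C1s fin1 hN.
apply: (IHr _ _ C1I fin' (fun i => C i.+1)); split=> i ir; last exact: Clt.
have [CiP _] := Cp i.+1 ir; split=> //.
by apply: (@chain_mono r.+1 (fun i => C i.+1)) ir => j jr; exact: (Clt j.+1 jr).
Qed.

(** Lift the [coord_primes] step by step with [going_up]; their contractions keep the chain
    strict. *)
Lemma chain_exists r psi J : ideal J ->
  loc_finite (mveval (characters K psi) r) J (mvX K r) ->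
  (forall s, J (mveval (characters K psi) r s) -> s = 0) -> exists C, prime_chain J r C.
Proof.
move=> J_ideal fin inj; set phi := mveval _ r in fin inj.
suff h k : (k <= r)%N -> exists C : nat -> set T,
    (forall i, (i <= k)%N -> [/\ prime_ideal (C i), J `<=` C i &
       forall s, C i (phi s) <-> coord_primes K r i s]) /\
    forall i, (i < k)%N -> C i `<=` C i.+1.
  have [C [CP Cle]] := h r (leqnn r); exists C; split=> [i /CP[]//|i ir].
  split; first exact: Cle.
  have [_ [s [s1 s2]]] := coord_primes_lt K ir.
  have [_ _ hi] := CP i (ltnW ir); have [_ _ hi1] := CP i.+1 ir.
  by move=> sub; apply/s2/hi/sub/hi1.
elim: k => [_|k IHk kr].
  have [qP qX] := coord_primesP K r 0.
  have [s /inj ->|P [PP JP hP]] := @going_up R _ _ phi J (mvX K r) _ J_ideal fin qP qX.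
    by have [[]] := qP.
  by exists (fun=> P); split=> // i; rewrite leqn0 => /eqP->.
have [C [CP Cle]] := IHk (ltnW kr).
have [qP qX] := coord_primesP K r k.+1; have [CkP JCk hk] := CP k (leqnn k).
have CkI : ideal (C k) by case: CkP.
have [s /hk|P [PP CkP' hP]] := @going_up R _ _ phi (C k) (mvX K r) _ CkI
    (loc_finite_sub J_ideal CkI JCk fin) qP qX.
  by have [sub _] := coord_primes_lt K kr; exact: sub.
exists (fun i => if (i <= k)%N then C i else P); split=> i.
  move=> ik1; case: (leqP i k) => ik; first exact: CP.
  have -> : i = k.+1 by apply/eqP; rewrite eqn_leq ik1.
  by split=> //; exact: subset_trans JCk _.
move=> ik1; have ik : (i <= k)%N by []; rewrite ik; case: ltnP => [ik'|ki]; first exact: Cle.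
by have -> : i = k by apply/eqP; rewrite eqn_leq ik.
Qed.

Section Equidimensional.
Context (I : set T) (d : nat) (I_ideal : ideal I) (I_dim : equidimensional I d).
Context (P0 : set T) (P0P : prime_ideal P0) (IP0 : I `<=` P0).
Context (r : nat) (psi : nat -> G).
Local Notation phi := (mveval (characters K psi) r).
Hypothesis fin : loc_finite phi I (mvX K r).

Lemma dim_le : (d <= r)%N.
Proof.
rewrite leqNgt; apply/negP => rd.
have [p pm _] := minimal_prime_below P0P IP0; have [_ Ip _] := pm.
have [[C hC] _] := I_dim pm.
exact: (chain_bound I_ideal fin (chain_trunc rd (chain_sub Ip hC))).
Qed.

(** Without a relation [chain_exists] would give a chain of length r > d above some minimal
    prime. *)
Lemma dim_lt : (d < r)%N -> exists2 s, s != 0 & I (phi s).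
Proof.
move=> dr; apply: contrapT => h; have [|C CP] := chain_exists I_ideal fin.
  by move=> s Is; apply/eqP; apply: contrapT => /negP s0; apply: h; exists s.
have [C0P IC0] := CP.1 0%N isT.
have [p pm pC0] := minimal_prime_below C0P IC0; have [_ no] := I_dim pm.
apply: (no C); have [h1 h2] := chain_trunc dr CP; split=> // i id.
have [CiP _] := h1 i id; split=> //; apply: (subset_trans pC0).
exact: chain_mono h2 id.
Qed.

(** A relation modulo p would allow one more elimination, and [chain_bound] would exclude chains of
    length d above p. *)
Lemma dim_eq p s : r = d -> minimal_prime I p -> p (phi s) -> s = 0.
Proof.
move=> rd pm ps; have [pP Ip _] := pm; have pI : ideal p by case: pP.
apply/eqP; apply: contrapT => /negP s0.
have finp := loc_finite_sub I_ideal pI Ip fin; have [[C hC] _] := I_dim pm.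
move: rd hC s ps s0 finp; rewrite -{1}[r]/(id r); case: (r) => [|r'] rd hC s ps s0 finp.
  by move/eqP: s0; apply; exact: prime_mvC ps.
have [|N [hN _]] := @shear_exponent R K r' s [::]; first by [].

by apply: (chain_bound pI (eliminate v_abs pI s0 ps finp hN) (C := C)); rewrite rd.
Qed.

End Equidimensional.
End Dimension.

(** * Noether normalisation adapted to tropical polyhedra *)

Section Convexity.
Context (R : realType) (V : lmodType R).

Definition segment_closed (P : set V) : Prop :=
  forall x y t, P x -> P y -> 0 <= t <= 1 -> P (x + t *: (y - x)).

Definition affine_on (f : V -> R) : Prop :=
  forall x y t, f (x + t *: (y - x)) = f x + t * (f y - f x).

(** Take w good for the tail of the list and w' good for its head: on the segment between them each
    function vanishes at one parameter at most, and the parameters 1 / (N + 1) are infinitely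
    many. *)
Lemma avoid_hyperplanes (I : eqType) (L : seq I) (F : I -> V -> R) (P : set V) :
  segment_closed P -> P !=set0 -> (forall i, i \in L -> affine_on (F i)) ->
  (forall i, i \in L -> exists2 w, P w & F i w != 0) ->
  exists2 w, P w & forall i, i \in L -> F i w != 0.
Proof.
move=> cP [w0 Pw0]; elim: L => [|i L IHL] aff ex; first by exists w0.
have [||w Pw hw] := IHL.
- by move=> j jL; apply: aff; rewrite inE jL orbT.
- by move=> j jL; apply: ex; rewrite inE jL orbT.
have [w' Pw' hw'] := ex i (mem_head _ _).
(* At N this is N + 1 times the value of F_j at the point of parameter 1 / (N + 1). *)
pose q j : {poly R} := (F j w)%:P * ('X + 1) + (F j w' - F j w)%:P.
have qE j (N : nat) : (q j).[N%:R] = F j w * (N%:R + 1) + (F j w' - F j w).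
  by rewrite /q !hornerE.
have [|N hN] := @nat_nonroot R [seq q j | j <- i :: L].
  move=> p /mapP[j jL ->]; apply: contraTneq isT => q0.
  have q1 (x : R) : F j w * (x + 1) + (F j w' - F j w) = 0.
    by have := congr1 (fun p => p.[x]) q0; rewrite /q !hornerE.
  have Fw : F j w = 0 by have := q1 1; have := q1 0; lra.
  have Fw' : F j w' = 0 by have := q1 0; rewrite Fw; lra.
  move: jL; rewrite inE => /predU1P[ji|/hw]; last by rewrite Fw eqxx.
  by rewrite -ji Fw' eqxx in hw'.
have N0 : 0 < N%:R + 1 :> R by rewrite ltr_wpDl.
pose t : R := (N%:R + 1)^-1.
exists (w + t *: (w' - w)).
  apply: cP => //; rewrite invr_ge0 ltW //= invf_le1 // lerDr //.
move=> j jL; rewrite aff //; have := hN (q j) (map_f _ jL); rewrite qE.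
apply: contra_neq => e; have et : (N%:R + 1) * t = 1 by rewrite mulfV // gt_eqF.
transitivity ((N%:R + 1) * (F j w + t * (F j w' - F j w))); last by rewrite e mulr0.
by rewrite [RHS]mulrDr [X in _ = _ + X]mulrA et mul1r [X in _ = X + _]mulrC.
Qed.

Lemma covered_by_hyperplanes (I : eqType) (L : seq I) (F : I -> V -> R) (P : set V) :
  segment_closed P -> P !=set0 -> (forall i, i \in L -> affine_on (F i)) ->
  (forall w, P w -> exists2 i, i \in L & F i w = 0) ->
  exists2 i, i \in L & forall w, P w -> F i w = 0.
Proof.
move=> cP P0 aff cov; apply: contrapT => no.
have [|w Pw hw] := avoid_hyperplanes cP P0 aff.
  move=> i iL; apply: contrapT => h; apply: no; exists i => // w Pw.
  by apply/eqP; apply: contrapT => /negP hw; apply: h; exists w.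
by have [i iL e] := cov _ Pw; have := hw i iL; rewrite e eqxx.
Qed.

End Convexity.

Section Pairing.
Context (R : realType) (V : vectType R) (G : zmodType) (pr : G -> V -> R).
Hypothesis prD : forall u u' w, pr (u + u') w = pr u w + pr u' w.
Hypothesis prL : forall u c w w', pr u (c *: w + w') = c * pr u w + pr u w'.

Lemma pr0 w : pr 0 w = 0.
Proof. by apply: (addrI (pr 0 w)); rewrite -prD !addr0. Qed.

Lemma prN u w : pr (- u) w = - pr u w.
Proof. by apply: (addrI (pr u w)); rewrite -prD !subrr pr0. Qed.

Lemma prMn u n w : pr (u *+ n) w = n%:R * pr u w.
Proof.
elim: n => [|n IHn]; first by rewrite mulr0n pr0 mul0r.
by rewrite mulrS prD IHn -natr1 mulrDl mul1r addrC.
Qed.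

Lemma pr_sum (I : Type) (r : seq I) (Q : pred I) (F : I -> G) w :
  pr (\sum_(i <- r | Q i) F i) w = \sum_(i <- r | Q i) pr (F i) w.
Proof. by elim/big_rec2: _ => [|i y z _ <-]; rewrite ?pr0 ?prD. Qed.

Lemma pr_r0 u : pr u 0 = 0.
Proof. by have := prL u 1 0 0; rewrite scaler0 addr0 mul1r => /eqP; rewrite eq_sym -subr_eq0 addrK => /eqP. Qed.

Lemma prDr u w w' : pr u (w + w') = pr u w + pr u w'.
Proof. by rewrite -[w]scale1r prL mul1r scale1r. Qed.

Lemma prZ u c w : pr u (c *: w) = c * pr u w.
Proof. by rewrite -[c *: w]addr0 prL pr_r0 addr0. Qed.

Lemma pr_sumr (I : Type) (r : seq I) (Q : pred I) (F : I -> V) u :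
  pr u (\sum_(i <- r | Q i) F i) = \sum_(i <- r | Q i) pr u (F i).
Proof. by elim/big_rec2: _ => [|i y z _ <-]; rewrite ?pr_r0 ?prDr. Qed.

Lemma linspan_vanish (S : set V) (f : V -> R) :
  (forall c w w', f (c *: w + w') = c * f w + f w') ->
  (forall w, S w -> f w = 0) -> forall w, w \in linspan S -> f w = 0.
Proof.
move=> fl fS.
pose g : {linear V -> R^o} := HB.pack (f : V -> R^o) (@GRing.isLinear.Build R V R^o *:%R f fl).
have sub : (linspan S <= lker (linfun g))%VS.
  by apply: (proj2 (linspanP S)) => x Sx; rewrite memv_ker lfunE /= fS.
by move=> w /(subvP sub); rewrite memv_ker lfunE => /eqP.
Qed.

Definition lin_comb (psi : nat -> G) (r : nat) (la : nat -> R) (w : V) : R :=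
  \sum_(i < r) la i * pr (psi i) w.

Lemma lin_combL psi r la c w w' :
  lin_comb psi r la (c *: w + w') = c * lin_comb psi r la w + lin_comb psi r la w'.
Proof.
rewrite /lin_comb mulr_sumr -big_split /=; apply: eq_bigr => i _.
by rewrite prL mulrDr mulrCA.
Qed.

Definition injective_on (psi : nat -> G) (r : nat) (W : {vspace V}) : Prop :=
  forall w, w \in W -> (forall i, (i < r)%N -> pr (psi i) w = 0) -> w = 0.

Definition dependent_on (psi : nat -> G) (r : nat) (W : {vspace V}) : Prop :=
  exists2 la : nat -> R, (exists2 i, (i < r)%N & la i != 0) &
    forall w, w \in W -> lin_comb psi r la w = 0.

Lemma dependent_dim psi r (W : {vspace V}) : (\dim W < r)%N -> dependent_on psi r W.
Proof.
move=> Wr; pose b := vbasis W.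
pose A : 'M[R]_(r, \dim W) := \matrix_(i, j) pr (psi i) b`_j.
have : kermx A != 0.
  rewrite -mxrank_eq0 mxrank_ker subn_eq0 -ltnNge.
  exact: leq_ltn_trans (rank_leq_col A) Wr.
case/rowV0Pn => la /sub_kermxP laA la0.
exists (fun i => if insub i is Some j then la 0 j else 0).
  have [j laj] : exists j, la 0 j != 0.
    apply: contrapT => h; case/eqP: la0; apply/rowP => j; rewrite mxE.
    by apply/eqP; apply: contrapT => /negP hj; apply: h; exists j.
  by exists j => //; rewrite valK.
move=> w wW; rewrite /lin_comb.
under eq_bigr do rewrite valK.
rewrite (coord_vbasis wW).
under eq_bigr do rewrite pr_sumr mulr_sumr.
rewrite exchange_big /= big1 // => j _.
under eq_bigr do rewrite prZ mulrCA.
rewrite -mulr_sumr; have /rowP/(_ j) := laA; rewrite !mxE => e.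
rewrite (eq_bigr (fun i => la 0 i * A i j)) ?e ?mulr0 // => i _.
by rewrite mxE.
Qed.

Lemma dirspan_sub (S : set V) x y : S x -> S y -> x - y \in dirspan S.
Proof. by move=> Sx Sy; apply: (proj1 (linspanP _)); exists x => //; exists y. Qed.

Section Shear.
Context (psi : nat -> G) (r N : nat).

(** Where the sheared characters vanish, psi_j = N^j psi_0, and the relation becomes psi_0 times the
    polynomial with coefficients la, taken at N. *)
Lemma shear_injective (W : {vspace V}) (la : nat -> R) :
  injective_on psi r.+1 W -> (forall w, w \in W -> lin_comb psi r.+1 la w = 0) ->
  (\poly_(i < r.+1) la i).[N%:R] != 0 -> injective_on (shear psi N) r W.
Proof.
move=> inj laW laN w wW h; apply: inj => // i ir.
have hi j : (j < r.+1)%N -> pr (psi j) w = N%:R ^+ j * pr (psi 0%N) w.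
  case: j => [|j] jr; first by rewrite expr0 mul1r.
  apply/eqP; rewrite -subr_eq0 -natrX -prMn -prN -prD; apply/eqP; exact: h.
have := laW w wW; rewrite /lin_comb.
under eq_bigr => j _ do rewrite hi // mulrA.
rewrite -mulr_suml => /eqP; rewrite mulf_eq0 => /orP[|/eqP p0].
  by move: laN; rewrite horner_poly => /negPf->.
by rewrite hi // p0 mulr0.
Qed.

End Shear.
End Pairing.

Section GoodCharacters.
Context (R : realType) (K : fieldType) (v : K -> R) (v_abs : nonarch_abs v).
Context (V : vectType R) (G : zmodType) (pr : G -> V -> R).
Hypothesis prD : forall u u' w, pr (u + u') w = pr u w + pr u' w.
Hypothesis prL : forall u c w w', pr u (c *: w + w') = c * pr u w + pr u w'.
Local Notation T := (monoid_algebra K G).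

Definition trop_point (xi : T -> R) (w : V) : Prop :=
  forall u, pr u w = - ln (xi (chi K u)).

Lemma chi_gt0 (xi : T -> R) (u : G) : mult_seminorm v xi -> 0 < xi (chi K u).
Proof.
move=> xP; have xV := seminorm_valuation v_abs xP.
rewrite lt_neqAle (val_ge0 xV) andbT; apply/eqP => e.
have := congr1 xi (chiN K u); rewrite (valM xV) -e mul0r (val1 xV) => /eqP.
by rewrite eq_sym oner_eq0.
Qed.

Lemma trop_chi (xi : T -> R) w u : mult_seminorm v xi -> trop_point xi w ->
  xi (chi K u) = expR (- pr u w).
Proof. by move=> xP xw; rewrite xw opprK lnK // posrE chi_gt0. Qed.

(** For terms with non-zero coefficients, it vanishes exactly where the two have the same absolute
    value over w. *)
Definition tie (psi : nat -> G) r (tu : (K * seq nat) * (K * seq nat)) (w : V) : R :=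
  lin_comb pr psi r (fun i => (nth 0%N tu.1.2 i)%:R - (nth 0%N tu.2.2 i)%:R) w -
  (ln (v tu.1.1) - ln (v tu.2.1)).

Lemma tie_affine psi r tu : affine_on (tie psi r tu).
Proof.
move=> x y t; rewrite /tie; set la := (X in lin_comb pr psi r X x).
have e : lin_comb pr psi r la (x + t *: (y - x)) =
    lin_comb pr psi r la x + t * (lin_comb pr psi r la y - lin_comb pr psi r la x).
  rewrite addrC lin_combL // -[y - x]/(y + - x) addrC [y - x]addrC -scaleN1r lin_combL //.
  by rewrite mulN1r; congr (_ + t * _); rewrite addrC.
by rewrite e; ring.
Qed.

Lemma tie_point (psi : nat -> G) r (s : mvpoly K r) (xi : T -> R) w : mult_seminorm v xi ->
  trop_point xi w ->
  xi (mveval (characters K psi) r s) < mvgauss v (fun i => xi (chi K (psi i))) s ->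
  exists t u, [/\ t \in mvterms s, u \in mvterms s, t.2 != u.2 & tie psi r (t, u) w = 0].
Proof.
move=> xP xw lt_s.
have x0 i : (i < r)%N -> 0 < xi (characters K psi i) by move=> _; exact: chi_gt0.
have [t [u [ts us tu e]]] := gauss_tie v_abs xP x0 lt_s; exists t, u; split=> //.
have vpos c : c != 0 -> 0 < v c.
  move=> c0; have [v0 v00 _ _] := v_abs; rewrite lt_neqAle v0 andbT eq_sym.
  by apply: contra_neq c0 => /v00.
have wt (m : K * seq nat) : m \in mvterms s ->
    ln (v m.1 * mvweight (fun i => xi (characters K psi i)) r m.2) =
    ln (v m.1) - \sum_(i < r) (nth 0%N m.2 i)%:R * pr (psi i) w.
  move=> ms.
  have -> : mvweight (fun i => xi (characters K psi i)) r m.2 =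
      expR (- \sum_(i < r) (nth 0%N m.2 i)%:R * pr (psi i) w).
    rewrite -sumrN expR_sum; apply: eq_bigr => i _.
    by rewrite (trop_chi _ xP xw) -expRM_natl mulrN.
  by rewrite lnM ?posrE ?expR_gt0 ?vpos ?(mvterms_neq0 ms) // expRK.
have := congr1 (@ln R) e; rewrite !wt // /tie /lin_comb /= => e'.
have -> : \sum_(i < r) ((nth 0%N t.2 i)%:R - (nth 0%N u.2 i)%:R) * pr (psi i) w =
   \sum_(i < r) (nth 0%N t.2 i)%:R * pr (psi i) w -
   \sum_(i < r) (nth 0%N u.2 i)%:R * pr (psi i) w.
  by rewrite -sumrB; apply: eq_bigr => i _; rewrite mulrBl.
lra.
Qed.

Lemma tie_neq r (s : mvpoly K r) t u : t \in mvterms s -> u \in mvterms s -> t.2 != u.2 ->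
  exists2 i, (i < r)%N & (nth 0%N t.2 i)%:R - (nth 0%N u.2 i)%:R != 0 :> R.
Proof.
move=> ts us tu; apply: contrapT => h; case/eqP: tu; apply: (@eq_from_nth _ 0%N).
  by rewrite (mvterms_size ts) (mvterms_size us).
move=> i; rewrite (mvterms_size ts) => ir; apply/eqP; rewrite -(eqr_nat R) -subr_eq0.
by apply: contrapT => /negP hi; apply: h; exists i.
Qed.

(** Finitely many ties cover the convex set P, so one of them holds on all of P; its linear part is
    the dependence. *)
Lemma dependent_tie (psi : nat -> G) r (s : mvpoly K r) (P : set V) :
  segment_closed P -> P !=set0 ->
  (forall w, P w -> exists t u, [/\ t \in mvterms s, u \in mvterms s, t.2 != u.2 &
     tie psi r (t, u) w = 0]) ->
  dependent_on pr psi r (dirspan P).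
Proof.
move=> cP P0 hP.
pose L := [seq tu <- [seq (t, u) | t <- mvterms s, u <- mvterms s] | tu.1.2 != tu.2.2].
have [||[t u]] := @covered_by_hyperplanes R V _ L (tie psi r) P cP P0.
- by move=> tu _; exact: tie_affine.
- move=> w /hP[t [u [ts us tu e]]]; exists (t, u) => //.
  by rewrite mem_filter tu /=; apply/allpairsP; exists (t, u).
rewrite mem_filter => /andP[tu /allpairsP[[t' u'] /= [ts us [et eu]]]] tie0.
rewrite -{}et -{}eu in ts us.
exists (fun i => (nth 0%N t.2 i)%:R - (nth 0%N u.2 i)%:R); first exact: tie_neq ts us tu.
apply: (linspan_vanish (fun c w w' => lin_combL prL psi r _ c w w')) => w [x Px [y Py <-]].
have := tie0 _ Px; have := tie0 _ Py; rewrite /tie /=; set la := (X in lin_comb pr psi r X y) => h1 h2.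
have -> : x - y = -1 *: y + x by rewrite scaleN1r addrC.
rewrite lin_combL //; lra.
Qed.

Context (I : set T) (d : nat) (I_ideal : ideal I) (I_dim : equidimensional I d).
Context (P0 : set T) (P0P : prime_ideal P0) (IP0 : I `<=` P0).
Context (e : nat -> G) (k : nat).
Hypothesis e_span : forall u, exists n : 'I_k -> int, u = \sum_(i < k) e i *~ n i.
Hypothesis pr_sep : forall w, (forall u, pr u w = 0) -> w = 0.

Definition good_characters (psi : nat -> G) : Prop :=
  loc_finite (mveval (characters K psi) d) I (mvX K d) /\
  forall p, minimal_prime I p -> forall s, p (mveval (characters K psi) d s) -> s = 0.

(* Noether normalisation, keeping track of the subspaces on which the chosen  *)
(* characters stay injective.                                                 *)
Lemma good_characters_exist (Ws : seq {vspace V}) (Ps : set (set V)) :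
  finite_set Ps -> (forall P, Ps P -> [/\ segment_closed P, P !=set0 &
    forall w, P w -> exists2 xi, points v I xi & trop_point xi w]) ->
  (forall W, W \in Ws -> (\dim W <= d)%N) ->
  exists psi, [/\ good_characters psi,
    forall P, Ps P -> injective_on pr psi d (dirspan P) &
    forall W, W \in Ws -> injective_on pr psi d W].
Proof.
move=> finP hP hW; have [Pl ePl] := proj1 (finite_seqP _) finP.
(* Start from k generators of the lattice and remove one character at a time until d are left. *)
suff main m psi : loc_finite (mveval (characters K psi) (m + d)) I (mvX K (m + d)) ->
    (forall P, Ps P -> injective_on pr psi (m + d) (dirspan P)) ->
    (forall W, W \in Ws -> injective_on pr psi (m + d) W) ->
    exists psi, [/\ good_characters psi,
      forall P, Ps P -> injective_on pr psi d (dirspan P) &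
      forall W, W \in Ws -> injective_on pr psi d W].
  have fin : loc_finite (mveval (characters K e) k) I (mvX K k).
    have AP := fg_image (mveval (characters K e) k) I_ideal.
    eexists; split; first exact: AP.
    apply: (loc_spanning AP (e := fun i : 'I_k => e i)) => //= i.
      exact: (loc_var v_abs AP).
    exact: (loc_varN v_abs AP).
  have inj W : injective_on pr e k W.
    move=> w _ h; apply: pr_sep => u; have [n ->] := e_span u; rewrite pr_sum //.
    apply: big1 => i _; case: (n i) => c; first by rewrite -pmulrn prMn // h // mulr0.
    by rewrite NegzE mulrNz -pmulrn prN // prMn // h // mulr0 oppr0.
  have dk := dim_le v_abs I_ideal I_dim P0P IP0 fin.
  apply: (main (k - d)%N e); rewrite subnK //.
elim: m psi => [|m IHm] psi fin injP injW.
  exists psi; split=> //; split=> // p pm s.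
  exact: (dim_eq v_abs I_ideal I_dim fin (erefl d) pm).
have [|s s0 Is] := dim_lt R I_ideal I_dim fin; first by rewrite ltnS leq_addl.
(* The relation s vanishes at a point above each w in P, so some tie of s holds at w. *)
have depP P : Ps P -> dependent_on pr psi (m + d).+1 (dirspan P).
  move=> PsP; have [cP nP tP] := hP _ PsP; apply: (dependent_tie (s := s) cP nP) => w Pw.
  have [xi [xP xI] xw] := tP _ Pw; apply: (tie_point xP xw).
  rewrite xI // lt_neqAle eq_sym.
  have x0 i : (i < (m + d).+1)%N -> 0 < xi (chi K (psi i)) by move=> _; exact: chi_gt0.
  rewrite (val_ge0 (mvgauss_valuation v_abs x0)) andbT; apply: contra_neq s0.
  exact: mvgauss_eq0.
have depW W : W \in Ws -> dependent_on pr psi (m + d).+1 W.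
  by move=> /hW Wd; apply: dependent_dim => //; rewrite ltnS (leq_trans Wd) // leq_addl.
have /choice[la hla] : forall W : {vspace V}, exists la : nat -> R,
    dependent_on pr psi (m + d).+1 W -> (exists2 i, (i < (m + d).+1)%N & la i != 0) /\
      forall w, w \in W -> lin_comb pr psi (m + d).+1 la w = 0.
  move=> W; have [[la h1 h2]|no] := pselect (dependent_on pr psi (m + d).+1 W).
    by exists la.
  by exists (fun=> 0).
pose po W : {poly R} := \poly_(i < (m + d).+1) la W i.
pose Ls := [seq W <- [seq dirspan P | P <- Pl] ++ Ws | `[< dependent_on pr psi (m + d).+1 W >]].
(* One N separates the terms of s and is a root of no polynomial coming from the chosen
   dependences. *)
have [|N [hN hL]] := @shear_exponent R K (m + d) s [seq po W | W <- Ls].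
  move=> p /mapP[W]; rewrite mem_filter => /andP[/asboolP /hla[[i im lai] _] _] ->.
  apply: contra_neq lai => /polyP/(_ i); rewrite coef_poly coef0.
  by have -> : (i < (m + d).+1)%N by [].
have shW W : dependent_on pr psi (m + d).+1 W -> W \in [seq dirspan P | P <- Pl] ++ Ws ->
    injective_on pr psi (m + d).+1 W -> injective_on pr (shear psi N) (m + d) W.
  move=> dW WL inj; have [_ laW] := hla W dW; apply: (shear_injective prD inj laW).
  by apply: hL; apply: map_f; rewrite mem_filter WL andbT; apply/asboolP.
apply: (IHm (shear psi N)).
- exact: (eliminate v_abs I_ideal s0 Is fin hN).
- move=> P PsP; apply: shW; [exact: depP| |exact: injP].
  by rewrite mem_cat map_f //; move: PsP; rewrite ePl.
- by move=> W WW; apply: shW; [exact: depW|rewrite mem_cat WW orbT|exact: injW].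
Qed.

End GoodCharacters.

(** * Lattices and cones *)

Section PairingLemmas.
Context (R : realType) (n : nat).
Implicit Types (u : 'rV[int]_n) (w : 'rV[R]_n) (sigma tau : set 'rV[R]_n).

Lemma pairingD u u' w : pairing (u + u') w = pairing u w + pairing u' w.
Proof.
rewrite /pairing -big_split /=; apply: eq_bigr => i _.
by rewrite mxE intrD mulrDl.
Qed.

Lemma pairingL u c w w' : pairing u (c *: w + w') = c * pairing u w + pairing u w'.
Proof.
rewrite /pairing mulr_sumr -big_split /=; apply: eq_bigr => i _.
by rewrite !mxE mulrDr mulrCA.
Qed.

Lemma perp_linspan sigma u w : in_perp sigma u -> w \in linspan sigma -> pairing u w = 0.
Proof.
move=> /asboolP pu; apply: (linspan_vanish (f := pairing u)) => // c w1 w2.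
exact: pairingL.
Qed.

Lemma pairingq_piq sigma (u : perpM sigma) w : pairingq u (piq sigma w) = pairing (val u) w.
Proof.
have : vsval (piq sigma w) - w \in linspan sigma.
  by rewrite -quot_pi_eq0 quot_piB quot_piK subrr.
move=> /(perp_linspan (valP u)) e; rewrite /pairingq.
have -> : vsval (piq sigma w) = 1 *: (vsval (piq sigma w) - w) + w by rewrite scale1r subrK.
by rewrite pairingL e mulr0 add0r.
Qed.

Lemma pairingqD sigma (u u' : perpM sigma) (w : NRq sigma) :
  pairingq (u + u') w = pairingq u w + pairingq u' w.
Proof. exact: pairingD. Qed.

Lemma pairingqL sigma (u : perpM sigma) c (w w' : NRq sigma) :
  pairingq u (c *: w + w') = c * pairingq u w + pairingq u w'.
Proof. by rewrite /pairingq linearP pairingL. Qed.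

Lemma pairing_sumr (I : Type) (r : seq I) (Q : pred I) (F : I -> 'rV[R]_n) u :
  pairing u (\sum_(i <- r | Q i) F i) = \sum_(i <- r | Q i) pairing u (F i).
Proof.
have p0 : pairing u (0 : 'rV[R]_n) = 0 by rewrite /pairing big1 // => i _; rewrite mxE mulr0.
elim/big_rec2: _ => [//|i y z _ <-].
by rewrite -[F i]scale1r pairingL mul1r scale1r.
Qed.

Lemma pairingZ u c w : pairing u (c *: w) = c * pairing u w.
Proof.
have p0 : pairing u (0 : 'rV[R]_n) = 0 by rewrite /pairing big1 // => i _; rewrite mxE mulr0.
by rewrite -[c *: w]addr0 pairingL p0 addr0.
Qed.

Lemma pairing_intr u (g : 'rV[int]_n) : pairing u (map_mx intr g) = ((u *m g^T) 0 0)%:~R :> R.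
Proof.
rewrite /pairing mxE rmorph_sum; apply: eq_bigr => i _.
by rewrite !mxE rmorphM.
Qed.

Lemma perp_generators sigma m (g : 'I_m -> 'rV[int]_n) :
  sigma = [set w | exists2 c : 'I_m -> R, (forall i, 0 <= c i) &
                       w = \sum_i c i *: map_mx intr (g i)] ->
  forall u, in_perp sigma u <-> forall i, u *m (g i)^T = 0.
Proof.
move=> es u; have gs i : sigma (map_mx intr (g i)).
  rewrite es; exists (fun j => (j == i)%:R); first by move=> j; rewrite ler0n.
  by rewrite (bigD1 i) //= eqxx scale1r big1 ?addr0 // => j /negPf->; rewrite scale0r.
split=> [/asboolP pu i|h].
  have := pu _ (gs i); rewrite pairing_intr => /eqP; rewrite intr_eq0 => /eqP e.
  by apply/rowP => j; rewrite (ord1 j) e mxE.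
apply/asboolP => w; rewrite es => -[c _ ->]; rewrite pairing_sumr big1 // => i _.
by rewrite pairingZ pairing_intr h mxE mulr0.
Qed.

(* Smith normal form of the matrix of generators. *)
Lemma lattice_bases sigma : rational_cone sigma -> exists (U W : 'M[int]_n) (A : pred 'I_n),
  [/\ W^T *m U = 1%:M, W *m U^T = 1%:M,
      forall u j, in_perp sigma u -> A j -> (u *m U^T) 0 j = 0,
      forall j, ~~ A j -> in_perp sigma (row j W) &
      forall j, A j -> map_mx intr (row j U) \in linspan sigma].
Proof.
move=> [m [g es]]; pose M : 'M[int]_(m, n) := \matrix_(i, j) g i 0 j.
have rowM i : row i M = g i by apply/rowP => j; rewrite !mxE.
have [L Lu [U Uu [d _ eM]]] := int_Smith_normal_form M.
set D := \matrix_(i, j) _ in eM.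
pose W := (invmx U)^T; pose A (j : 'I_n) := (j < m)%N && (d`_j != 0).
have WU : W^T *m U = 1%:M by rewrite /W trmxK mulVmx.
have UW : W *m U^T = 1%:M by rewrite /W -trmx_mul mulmxV // trmx1.
have perpP := perp_generators es.
exists U, W, A; split=> //.
- move=> u j /perpP pu /andP[jm dj].
  have uM : u *m M^T = 0.
    apply/rowP => i; have e := congr1 (fun B : 'M[int]_1 => B 0 0) (pu i).
    rewrite /= mxE [RHS]mxE in e; rewrite mxE [RHS]mxE -[RHS]e.
    by apply: eq_bigr => k _; rewrite !mxE.
  have yD : u *m U^T *m D^T = 0.
    move: uM; rewrite eM !trmx_mul !mulmxA => h.
    have LTu : L^T \in unitmx by rewrite unitmx_tr.
    by rewrite -[LHS](mulmxK LTu) h mul0mx.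
  move: (u *m U^T) yD => y yD.
  have : (y *m D^T) 0 (Ordinal jm) = y 0 j * d`_j.
    rewrite mxE (bigD1 j) //= big1 => [|k kj]; first by rewrite !mxE eqxx mulr1n addr0.
    rewrite !mxE /=; have -> : (j == k :> nat) = false by rewrite eq_sym; exact/negbTE.
    by rewrite mulr0n mulr0.
  by rewrite yD mxE => /esym/eqP; rewrite mulf_eq0 (negPf dj) orbF => /eqP.
- move=> j nAj; apply/perpP => i; rewrite -rowM.
  have e : M *m W^T = L *m D by rewrite eM -!mulmxA /W trmxK mulmxV // mulmx1.
  apply/matrixP => a b; rewrite !ord1 [RHS]mxE.
  have -> : (row j W *m (row i M)^T) 0 0 = (M *m W^T) i j.
    by rewrite !mxE; apply: eq_bigr => k _; rewrite !mxE mulrC.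
  rewrite e mxE big1 // => k _; rewrite !mxE.
  case: eqP => [kj|_]; last by rewrite mulr0n mulr0.
  move: nAj; rewrite /A -kj ltn_ord /= negbK => /eqP->.
  by rewrite mulr1n mulr0.
- move=> j /andP[jm dj].
  have e : invmx L *m M = D *m U by rewrite eM !mulmxA mulVmx // mul1mx.
  have er : d`_j *: row j U = \sum_i (invmx L) (Ordinal jm) i *: g i.
    apply/rowP => k; rewrite summxE !mxE.
    have /matrixP/(_ (Ordinal jm) k) := e; rewrite !mxE => e'.
    transitivity (\sum_l D (Ordinal jm) l * U l k).
      rewrite (bigD1 j) //= big1 => [|l lj]; last first.
        rewrite mxE /= eq_sym; have -> : (l == j :> nat) = false by apply/negbTE.
        by rewrite mulr0n mul0r.
      by rewrite mxE eqxx mulr1n addr0.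
    by rewrite -e'; apply: eq_bigr => i _; rewrite !mxE.
  have dR : (d`_j)%:~R != 0 :> R by rewrite intr_eq0.
  have -> : map_mx intr (row j U) =
      ((d`_j)%:~R)^-1 *: \sum_i ((invmx L) (Ordinal jm) i)%:~R *: (map_mx intr (g i) : 'rV[R]_n).
    have -> : \sum_i ((invmx L) (Ordinal jm) i)%:~R *: (map_mx intr (g i) : 'rV[R]_n) =
        (d`_j)%:~R *: map_mx intr (row j U).
      rewrite -map_mxZ er raddf_sum; apply: eq_bigr => i _.
      by apply/rowP => k; rewrite /= !mxE /= ?rmorphM ?intrM.
    by rewrite scalerA mulVf // scale1r.
  apply: memvZ; apply: memv_suml => i _; apply: memvZ.
  apply: (proj1 (linspanP sigma)); rewrite es; exists (fun j => (j == i)%:R).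
    by move=> k; rewrite ler0n.
  by rewrite (bigD1 i) //= eqxx scale1r big1 ?addr0 // => k /negPf->; rewrite scale0r.
Qed.

Section PerpLattice.
Context (sigma : set 'rV[R]_n) (sigmaP : rational_cone sigma).

(** In the dual bases of [lattice_bases], a vector killed by sigma^perp has coordinates only along
    vectors in the span of sigma. *)
Lemma pairingq_sep (w : NRq sigma) : (forall u : perpM sigma, pairingq u w = 0) -> w = 0.
Proof.
move=> h; have [U [W [A [WU _ _ perpW spanU]]]] := lattice_bases sigmaP.
apply/eqP; rewrite -[w]quot_piK quot_pi_eq0; set x := vsval w.
have -> : x = \sum_j pairing (row j W) x *: map_mx intr (row j U).
  have e : x = x *m map_mx intr W^T *m map_mx intr U.
    by rewrite -mulmxA -map_mxM WU map_mx1 mulmx1.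
  rewrite {1}e; apply/rowP => k; rewrite summxE mxE; apply: eq_bigr => j _.
  rewrite !mxE /pairing; congr (_ * _); apply: eq_bigr => i _.
  by rewrite !mxE mulrC.
apply: memv_suml => j _; have [Aj|nAj] := boolP (A j).
  by apply: memvZ; exact: spanU.
have := h (Sub (row j W) (perpW j nAj)); rewrite /pairingq /= => ->.
by rewrite scale0r mem0v.
Qed.

(** The rows of W outside A form a basis of sigma^perp, and rows of U are dual to them. The family
    is padded with 0 to n members. *)
Lemma perpM_generators : exists e : nat -> perpM sigma,
  (forall u : perpM sigma, exists c : 'I_n -> int, u = \sum_(i < n) e i *~ c i) /\
  forall h : perpM sigma -> R, (forall u u' : perpM sigma, h (u + u') = h u + h u') ->
    exists w : NRq sigma, forall u : perpM sigma, pairingq u w = h u.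
Proof.
have [U [W [A [WU UW perpU perpW _]]]] := lattice_bases sigmaP.
pose e' (j : 'I_n) : perpM sigma := if A j then 0 else insubd 0 (row j W).
have e'A j : A j -> e' j = 0 by rewrite /e' => ->.
have e'N j : ~~ A j -> val (e' j) = row j W.
  by move=> nAj; rewrite /e' (negPf nAj) insubdK //; exact: perpW.
pose e (i : nat) : perpM sigma := if insub i is Some j then e' j else 0.
have vMn (x : perpM sigma) k : val (x *+ k) = val x *+ k.
  by elim: k => [//|k IHk]; rewrite !mulrS -IHk.
have vMz (x : perpM sigma) c : val (x *~ c) = val x *~ c.
  case: c => k; first by rewrite -!pmulrn vMn.
  by rewrite NegzE !mulrNz -!pmulrn -vMn.
have vsum (F : 'I_n -> perpM sigma) : val (\sum_i F i) = \sum_i val (F i).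
  by apply: (big_morph val (id1 := 0) (op1 := +%R)).
have span (u : perpM sigma) : u = \sum_(i < n) e i *~ (val u *m U^T) 0 i.
  apply: val_inj; rewrite vsum.
  have {1}-> : val u = val u *m U^T *m W.
    by rewrite -mulmxA (mulmx1C UW) mulmx1.
  rewrite mulmx_sum_row; apply: eq_bigr => j _; rewrite /e valK vMz.
  have [Aj|nAj] := boolP (A j); last by rewrite e'N // -[X in X *: _]intz scaler_int.
  by rewrite perpU // ?(valP u) // scale0r mulr0z.
exists e; split=> [u|h hD]; first by exists (fun i => (val u *m U^T) 0 i); exact: span.
have h0 : h 0 = 0 by apply: (addrI (h 0)); rewrite -hD !addr0.
have hN (u : perpM sigma) : h (- u) = - h u by apply: (addrI (h u)); rewrite -hD !subrr.
have hMz (u : perpM sigma) c : h (u *~ c) = c%:~R * h u.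
  have hMn k : h (u *+ k) = k%:R * h u.
    elim: k => [|k IHk]; first by rewrite mulr0n h0 mul0r.
    by rewrite mulrS hD IHk -natr1 mulrDl mul1r addrC.
  case: c => k; first by rewrite -pmulrn hMn.
  by rewrite NegzE !mulrNz hN -!pmulrn hMn mulNr.
exists (piq sigma (\sum_(j < n) h (e j) *: map_mx intr (row j U))) => u.
rewrite pairingq_piq pairing_sumr.
have -> : h u = \sum_(i < n) h (e i *~ (val u *m U^T) 0 i).
  by rewrite {1}[u]span; elim/big_rec2: _ => // i y z _ <-; rewrite hD.
apply: eq_bigr => j _; rewrite hMz pairingZ pairing_intr mulrC; congr (_%:~R * _).
by rewrite !mxE; apply: eq_bigr => k _; rewrite !mxE.
Qed.

End PerpLattice.
End PairingLemmas.

(** * Shilov boundaries *)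

Section IdealHull.
Context (A : comNzRingType).
Implicit Types (I J P : set A).

(** The ideal generated by I. [orbit_ideal] is given as an image; passing to its hull keeps the
    points and creates no new minimal primes. *)
Definition ideal_hull I : set A := [set f | forall J, ideal J -> I `<=` J -> J f].

Lemma ideal_hullP I : ideal (ideal_hull I).
Proof.
split.
- by move=> J JI _; exact: (ideal0 JI).
- by move=> f g hf hg J JI IJ; apply: (idealD JI); [exact: hf|exact: hg].
- by move=> a f hf J JI IJ; apply: (idealM JI); exact: hf.
Qed.

Lemma sub_ideal_hull I : I `<=` ideal_hull I.
Proof. by move=> f If J _; apply. Qed.

Lemma ideal_hull_sub I J : ideal J -> I `<=` J -> ideal_hull I `<=` J.
Proof. by move=> JI IJ f; apply. Qed.

Lemma minimal_prime_hull I P : minimal_prime (ideal_hull I) P -> minimal_prime I P.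
Proof.
move=> [PP IP Pmin]; split=> //; first exact: subset_trans (@sub_ideal_hull I) IP.
move=> Q QP IQ QsP; apply: Pmin => //; apply: ideal_hull_sub => //.
by case: QP.
Qed.

Lemma equidimensional_hull I d : equidimensional I d -> equidimensional (ideal_hull I) d.
Proof. by move=> h P /minimal_prime_hull; exact: h. Qed.

End IdealHull.

Section Kernel.
Context (R : realType) (K : fieldType) (v : K -> R) (v_abs : nonarch_abs v).
Context (T : comAlgType K) (xi : T -> R) (xP : mult_seminorm v xi).

Lemma prime_kernel : prime_ideal [set f | xi f = 0].
Proof.
have xV := seminorm_valuation v_abs xP; split.
- split=> /=; first exact: (val0 xV).
  + move=> f g f0 g0; apply/eqP; rewrite eq_le (val_ge0 xV) andbT.
    by apply: le_trans (valD xV f g) _; rewrite f0 g0 maxxx.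
  + by move=> a f f0; rewrite (valM xV) f0 mulr0.
- by rewrite /= (val1 xV) => /eqP; rewrite oner_eq0.
- by move=> f g /= /eqP; rewrite (valM xV) mulf_eq0 => /orP[]/eqP; [left|right].
Qed.

Lemma points_hull I : points v (ideal_hull I) xi <-> forall f, I f -> xi f = 0.
Proof.
split=> [[_ h] f /sub_ideal_hull|h]; first exact: h.
split=> // f; apply: (ideal_hull_sub (J := [set f | xi f = 0])) => //.
by have [] := prime_kernel.
Qed.

End Kernel.

Lemma seq_gap (R : realType) (c : R) (L : seq R) :
  exists2 al, c < al & forall l, l \in L -> l <= c \/ al < l.
Proof.
elim: L => [|l L [al cal h]]; first by exists (c + 1); rewrite ?ltrDl.
have [lc|cl] := leP l c.
  by exists al => // m; rewrite inE => /predU1P[->|/h//]; left.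
exists (Num.min al ((c + l) / 2)); first by rewrite lt_min cal midf_lt.
move=> m; rewrite inE => /predU1P[->|/h[|am]]; [|by left|].
  by right; rewrite gt_min orbC midf_lt.
by right; apply: le_lt_trans am; rewrite ge_min lexx.
Qed.

Section Shilov.
Context (R : realType) (K : fieldType) (v : K -> R) (v_abs : nonarch_abs v).
Context (n : nat) (Delta : set (set 'rV[R]_n)) (X : closed_subscheme K Delta).
Context (sigma : set 'rV[R]_n) (sigmaP : rational_cone sigma).
Local Notation G := (perpM sigma).
Local Notation T := (monoid_algebra K G).
Local Notation F := {ptws T -> R}.
Local Notation pr := (@pairingq R n sigma).
Local Notation I := (ideal_hull (orbit_ideal X sigma : set T)).
Implicit Types (w : NRq sigma) (xi : T -> R).

Lemma trop_exists xi : mult_seminorm v xi -> exists w, trop_point pr xi w.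
Proof.
move=> xP; have [e [_ hw]] := perpM_generators sigmaP.
apply: (hw (fun u => - ln (xi (chi K u)))) => u u'.
have [_ _ xM _] := xP; rewrite chiD xM lnM ?posrE ?(chi_gt0 v_abs) //.
by rewrite opprD.
Qed.

Lemma trop_fiberE w xi : trop_fiber v X w xi <-> points v I xi /\ trop_point pr xi w.
Proof.
split=> [[[xP xI] xw]|[xI xw]]; split=> //; first by apply/(points_hull v_abs).
by have xP := xI.1; split=> //; apply/(points_hull v_abs xP).
Qed.

Lemma closed_fiber w : closed (trop_fiber v X w : set F).
Proof.
have -> : trop_fiber v X w =
    points v I `&` [set xi : F | forall u : G, xi (chi K u) = expR (- pr u w)].
  apply/seteqP; split=> xi.
    by move=> /trop_fiberE[xI xw]; split=> // u; exact: (trop_chi v_abs _ xI.1 xw).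
  move=> [xI h]; apply/trop_fiberE; split=> // u.
  by rewrite h expRK opprK.
apply: closedI; first exact: closed_points.
apply: closed_forall => u; apply: closed_eqfun; first exact: eval_continuous.
exact: cst_continuous.
Qed.

Section Series.
Context (w : NRq sigma) (a : G -> K) (a_series : affinoid_series v w a).
Context (xi : T -> R) (xP : mult_seminorm v xi) (xw : trop_point pr xi w).

Local Notation dirset := (filter_from setT (fun F0 : {fset G} => [set F' : {fset G} | F0 `<=` F']%fset)).

Let dirset_proper : ProperFilter dirset.
Proof.
apply: filter_from_proper; last by move=> F0 _; exists F0 => /=; exact: fsubset_refl.
apply: filter_from_filter; first by exists fset0.
move=> F0 F1 _ _; exists (F0 `|` F1)%fset => // F2 /=.
by rewrite fsubUset => /andP[].
Qed.

Definition partial_sum (F0 : {fset G}) : T := \sum_(u <- F0) monomial u (a u).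

Lemma series_abs_stationary l (F0 : {fset G}) :
  (forall F1 : {fset G}, (F0 `<=` F1)%fset -> xi (partial_sum F1) = l) -> series_abs xi a = l.
Proof.
move=> h; have FP := dirset_proper; apply: cvg_lim; first exact: Rhausdorff.
by apply: cvg_near_cst; exists F0.
Qed.

Lemma series_abs_small :
  (forall e : R, 0 < e -> exists F0 : {fset G}, forall F1 : {fset G}, (F0 `<=` F1)%fset ->
     xi (partial_sum F1) < e) -> series_abs xi a = 0.
Proof.
move=> h; have FP := dirset_proper; apply: cvg_lim; first exact: Rhausdorff.
apply/cvgrPdist_lt => e e0; have [F0 hF] := h e e0; exists F0 => // F1 /hF.
by rewrite sub0r normrN ger0_norm // (val_ge0 (seminorm_valuation v_abs xP)).
Qed.

(** The terms of size at least e, finitely many by convergence. Larger partial sums differ from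
    theirs by less than e, so a value that reaches e is the value of the whole series. *)
Definition big_terms (e : R) : {fset G} :=
  fset_set [set u | e <= v (a u) * expR (- pairingq u w)].

Lemma big_termsP e u : 0 < e ->
  (u \in big_terms e) = (e <= v (a u) * expR (- pairingq u w)).
Proof.
move=> e0; rewrite /big_terms in_fset_set; last exact: a_series.
by apply/idP/idP; rewrite inE.
Qed.

Lemma monomial_abs u c : xi (monomial u c) = v c * expR (- pairingq u w).
Proof. by rewrite monomialE (seminormZ _ _ xP) (trop_chi v_abs _ xP xw). Qed.

Lemma partial_sum_tail e (F1 : {fset G}) : 0 < e -> (big_terms e `<=` F1)%fset ->
  exists2 t, xi t < e & partial_sum F1 = t + partial_sum (big_terms e).
Proof.
move=> e0 sub; have xV := seminorm_valuation v_abs xP.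
exists (\sum_(u <- F1 | u \notin big_terms e) monomial u (a u)).
  apply: (val_sum_lt xV) => // u; rewrite big_termsP // -ltNge => lt_u.
  by rewrite monomial_abs.
rewrite /partial_sum (bigID (mem (big_terms e))) /= addrC; congr (_ + _).
rewrite -big_filter; apply: perm_big; apply: uniq_perm => [||u].
- exact/filter_uniq/fset_uniq.
- exact: fset_uniq.
- rewrite mem_filter; apply/andP/idP => [[]//|ue]; split=> //.
  exact: (fsubsetP sub).
Qed.

Lemma partial_sum_big e (F1 : {fset G}) : 0 < e -> (big_terms e `<=` F1)%fset ->
  e <= xi (partial_sum (big_terms e)) ->
  xi (partial_sum F1) = xi (partial_sum (big_terms e)).
Proof.
move=> e0 /(partial_sum_tail e0)[t te ->] le_e.
by rewrite (val_eqD (seminorm_valuation v_abs xP)) // (lt_le_trans te).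
Qed.

Lemma partial_sum_small e (F1 : {fset G}) : 0 < e -> (big_terms e `<=` F1)%fset ->
  xi (partial_sum (big_terms e)) < e -> xi (partial_sum F1) < e.
Proof.
move=> e0 /(partial_sum_tail e0)[t te ->] lt_e.
apply: le_lt_trans (valD (seminorm_valuation v_abs xP) _ _) _.
by rewrite gt_max te.
Qed.

Lemma series_abs_big e : 0 < e -> e <= xi (partial_sum (big_terms e)) ->
  series_abs xi a = xi (partial_sum (big_terms e)).
Proof.
move=> e0 le_e; apply: (@series_abs_stationary _ (big_terms e)) => F1 sub.
exact: partial_sum_big.
Qed.

Lemma series_abs0 : (forall e, 0 < e -> xi (partial_sum (big_terms e)) < e) ->
  series_abs xi a = 0.
Proof.
move=> h; apply: series_abs_small => e e0; exists (big_terms e) => F1 sub.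
by apply: partial_sum_small => //; exact: h.
Qed.

Lemma series_abs_le e : 0 < e -> xi (partial_sum (big_terms e)) < e -> series_abs xi a <= e.
Proof.
move=> e0 lt_e; have [h|/existsNP[e' /not_implyP[e'0 /negP]]] :=
    pselect (forall e, 0 < e -> xi (partial_sum (big_terms e)) < e).
  by rewrite series_abs0 // ltW.
rewrite -leNgt => le_e'; rewrite (series_abs_big e'0 le_e').
rewrite -(partial_sum_big (F1 := (big_terms e `|` big_terms e')%fset) e'0 _ le_e'); last first.
  exact: fsubsetUr.
by apply/ltW/partial_sum_small => //; exact: fsubsetUl.
Qed.

End Series.

Lemma series_abs_finite (h : T) xi : series_abs xi (fun u => coef u h) = xi h.
Proof.
apply: (@series_abs_stationary _ _ _ (supp h)) => F1 sub; congr xi.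
rewrite /partial_sum [RHS]laurentE.
rewrite [RHS](big_fset_incl _ sub) /= => [|u _ /monalg.mcoeff_outdom e].
  by apply: eq_bigr => u _; rewrite monomialE.
by rewrite /coef e scale0r.
Qed.

Section Boundary.
Context (d : nat) (psi : nat -> G) (good : good_characters I d psi).
Context (Sigma : set (set (NRq sigma))) (Sigma_fin : finite_set Sigma).
Hypothesis Sigma_trop : \bigcup_(P in Sigma) P = Trop v X sigma.
Hypothesis Sigma_inj : forall P, Sigma P -> injective_on pr psi d (dirspan P).
Local Notation x := (characters K psi).

Definition trop_weights (w : NRq sigma) (i : nat) : R := expR (- pr (psi i) w).

Lemma trop_weights_gt0 w : pos_weights d (trop_weights w).
Proof. by move=> i _; exact: expR_gt0. Qed.

Lemma trop_on_weights w xi : mult_seminorm v xi -> trop_point pr xi w ->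
  on_weights x d (trop_weights w) xi.
Proof. by move=> xP xw i _; exact: (trop_chi v_abs _ xP xw). Qed.

Definition over_fiber w : set F := trop_fiber v X w `&` over_gauss v x d (trop_weights w).

(* Over given weights there are only finitely many tropical points, so the    *)
(* characters take finitely many values there.                                *)
Lemma character_gap w (u : G) (c : R) : exists2 al, c < al &
  forall zeta, points v I zeta -> on_weights x d (trop_weights w) zeta ->
    zeta (chi K u) <= c \/ al < zeta (chi K u).
Proof.
have [Pl ePl] := proj1 (finite_seqP _) Sigma_fin.
have /choice[val hval] : forall P : set (NRq sigma), exists l : R, Sigma P ->
    forall w', P w' -> (forall i, (i < d)%N -> pr (psi i) w' = pr (psi i) w) ->
    expR (- pr u w') = l.
  move=> P; have [[w1 [Pw1 h1]]|no] := pselect (exists w', P w' /\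
      forall i, (i < d)%N -> pr (psi i) w' = pr (psi i) w).
    exists (expR (- pr u w1)) => SP w' Pw' h'.
    suff -> : w' = w1 by [].
    apply/eqP; rewrite -subr_eq0; apply/eqP; apply: (Sigma_inj SP) => [|i id].
      exact: dirspan_sub.
    have -> : w' - w1 = -1 *: w1 + w' by rewrite scaleN1r addrC.
    by rewrite pairingqL h1 // h' //; ring.
  by exists 0 => _ w' Pw' h'; case: no; exists w'.
have [al cal hal] := seq_gap c [seq val P | P <- Pl].
exists al => // zeta zI za; have [w' zw'] := trop_exists zI.1.
have : Trop v X sigma w' by exists zeta; apply/trop_fiberE.
rewrite -Sigma_trop => -[P SP Pw']; rewrite (trop_chi v_abs _ zI.1 zw').
rewrite (hval P SP w' Pw') => [|i id]; last first.
  have := za i id; rewrite /trop_weights -[x i]/(chi K (psi i)) (trop_chi v_abs _ zI.1 zw').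
  by move=> /expR_inj/oppr_inj.
by apply: hal; apply: map_f; move: SP; rewrite ePl.
Qed.

(** Apply [over_point_above] modulo a minimal prime below the kernel of xi, with ys the generating
    characters and their inverses; the gaps come from [character_gap]. Keeping these values keeps
    the tropicalization, so b stays in the fiber. *)
Lemma over_fiber_above w xi f : trop_fiber v X w xi ->
  exists2 b, over_fiber w b & xi f <= b f.
Proof.
move=> /trop_fiberE[xI xw]; have [fin inj] := good.
have Iker : I `<=` [set f | xi f = 0] by move=> g; exact: xI.2.
have [p pm pker] := minimal_prime_below (prime_kernel v_abs xI.1) Iker.
have [pP Ip _] := pm; have pI : ideal p by case: pP.
have [e [span _]] := perpM_generators sigmaP.
have pfin := loc_finite_sub (ideal_hullP _) pI Ip fin.
pose ys := [seq chi K (e i) | i <- iota 0 n] ++ [seq chi K (- e i) | i <- iota 0 n].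
have ysP y : y \in ys -> exists u, [/\ y = chi K u & chi K (- u) \in ys].
  rewrite mem_cat => /orP[]/mapP[i ir ->].
    exists (e i); split=> //; rewrite mem_cat; apply/orP; right.
    by apply/mapP; exists i.
  exists (- e i); split=> //; rewrite opprK mem_cat; apply/orP; left.
  by apply/mapP; exists i.
have [||y /ysP[u [-> uy]]|y /ysP[u [-> _]]|b [bp bo xb by_]] :=
    over_point_above v_abs pP pfin (inj p pm) (trop_weights_gt0 w) (xi := xi) (ys := ys) f.
- by split; [exact: xI.1|exact: pker].
- exact: trop_on_weights xI.1 xw.
- by exists (chi K (- u)) => //; exact: chiN.
- have [al cal hal] := character_gap w u (xi (chi K u)).
  by exists al => // zeta [zP zp]; apply: hal; split=> // g /Ip; exact: zp.
have bI : points v I b by split=> [|g /Ip]; [exact: bp.1|exact: bp.2].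
exists b => //; split=> //; apply/trop_fiberE; split=> // u.
have bV := seminorm_valuation v_abs bI.1; have xV := seminorm_valuation v_abs xI.1.
rewrite xw; congr (- ln _).
have [m ->] := span u; rewrite !chi_sum (val_prod xV) (val_prod bV); apply: eq_bigr => i _.
have yi : xi (chi K (e i)) = b (chi K (e i)).
  rewrite by_ // mem_cat; apply/orP; left; apply/mapP; exists (i : nat) => //.
  by rewrite mem_iota ltn_ord.
have yiN : xi (chi K (- e i)) = b (chi K (- e i)).
  rewrite by_ // mem_cat; apply/orP; right; apply/mapP; exists (i : nat) => //.
  by rewrite mem_iota ltn_ord.
case: (m i) => k; first by rewrite -pmulrn !chiMn (valX xV) (valX bV) yi.
by rewrite NegzE mulrNz -pmulrn -mulNrn !chiMn (valX xV) (valX bV) yiN.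
Qed.

Lemma compact_over_fiber w : compact (over_fiber w).
Proof.
have [fin _] := good.
apply: (compact_on_weights v_abs (ideal_hullP _) fin (trop_weights_gt0 w)).
- by apply: closedI; [exact: closed_fiber|exact: closed_over].
- by move=> xi [/trop_fiberE[]].
- by move=> xi [_ xo]; apply: (over_on v_abs (trop_weights_gt0 w)).
Qed.

Lemma over_fiber_max w f : trop_fiber v X w !=set0 ->
  exists2 b, over_fiber w b & forall xi, trop_fiber v X w xi -> xi f <= b f.
Proof.
move=> [xi0 x0]; have [b0 hb0 _] := over_fiber_above 1 x0.
have [|b bB bmax] := compact_max (@compact_over_fiber w) _ (@eval_continuous R T f).
  by exists b0.
exists b => // xi /(over_fiber_above f)[b' b'B le_b']; apply: le_trans le_b' _.
exact: bmax.
Qed.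

(** Either the series vanishes on the whole fiber, or for some e its big terms reach e somewhere.
    Then the maximum of this Laurent polynomial, which [over_fiber_max] provides, is also the
    maximum of the series. *)
Lemma boundary_over_fiber w : trop_fiber v X w !=set0 -> boundary v X w (over_fiber w).
Proof.
move=> fw; split.
- by move=> xi [].
- by apply: closed_subspaceW; apply: closedI; [exact: closed_fiber|exact: closed_over].
move=> a aS.
have fP xi : trop_fiber v X w xi -> mult_seminorm v xi /\ trop_point pr xi w.
  by move=> /trop_fiberE[[]].
have [[e [e0 [xi [xF le_e]]]]|no] := pselect (exists e, 0 < e /\ exists xi : T -> R,
    trop_fiber v X w xi /\ e <= xi (partial_sum a (big_terms w a e))).
  have [b bB bmax] := over_fiber_max (partial_sum a (big_terms w a e)) fw.
  have be : e <= b (partial_sum a (big_terms w a e)) := le_trans le_e (bmax _ xF).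
  exists b => // zeta zF; have [bP bw] := fP _ bB.1; have [zP zw] := fP _ zF.
  rewrite (series_abs_big aS bP bw e0 be).
  have [ze|ze] := leP e (zeta (partial_sum a (big_terms w a e))).
    by rewrite (series_abs_big aS zP zw e0 ze) bmax.
  exact: le_trans (series_abs_le aS zP zw e0 ze) be.
have [b bB _] := over_fiber_max 1 fw; exists b => // zeta zF.
have s0 xi : trop_fiber v X w xi -> series_abs xi a = 0.
  move=> xF; have [xP xw] := fP _ xF; apply: (series_abs0 aS xP xw) => e e0.
  by rewrite ltNge; apply/negP => le_e; apply: no; exists e; split=> //; exists xi.
by rewrite (s0 _ zF) (s0 _ bB.1).
Qed.

(** A boundary that misses b is compact, and [peak_off] gives a Laurent polynomial larger at b than
    anywhere on it. *)
Lemma shilov_over_fiber w : trop_fiber v X w !=set0 ->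
  shilov_boundary v X w (over_fiber w).
Proof.
move=> fw; split; first exact: boundary_over_fiber.
move=> C [CF Cc Cmax] b bB; apply: contrapT => nCb.
have [fin _] := good; have /trop_fiberE[bI bw] := bB.1.
have cC : closed (C : set F).
  have [W cW eW] := proj1 (closed_subspaceP _ _) Cc.
  have -> : C = W `&` trop_fiber v X w by rewrite eW; apply/seteqP; split=> xi; [move=> h; split=> //; exact: CF|case].
  by apply: closedI => //; exact: closed_fiber.
have Con xi : C xi -> on_weights x d (trop_weights w) xi.
  by move=> /CF/trop_fiberE[[xP _] xw]; exact: trop_on_weights.
have CI : C `<=` points v I by move=> xi /CF/trop_fiberE[].
have kC : compact C.
  exact: (compact_on_weights v_abs (ideal_hullP _) fin (trop_weights_gt0 w)).
have [h [k [k0 bh Ch _]]] :=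
  peak_off v_abs (ideal_hullP _) fin (trop_weights_gt0 w) bI bB.2 kC CI Con nCb.
have [|c Cc' cmax] := Cmax (fun u => coef u h).
  move=> e e0; apply: (sub_finite_set (B := [set` supp h])); last exact: finite_fset.
  move=> u /= le_e; rewrite /supp; apply: contraTT le_e => /monalg.mcoeff_outdom hu.
  rewrite -ltNge /coef hu; have [_ v00 _ _] := v_abs.
  by rewrite (proj2 (v00 0)) // mul0r.
have := cmax _ bB.1; rewrite !series_abs_finite bh.
by rewrite leNgt Ch.
Qed.

End Boundary.
End Shilov.

(** * Fourier-Motzkin elimination *)

Section FourierMotzkin.
Context (R : realType) (N : nat).
Implicit Types (u w g : 'rV[R]_N) (gs : seq 'rV[R]_N).

Definition dot u w : R := \sum_i u 0 i * w 0 i.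

Lemma dotDr u w w' : dot u (w + w') = dot u w + dot u w'.
Proof. by rewrite /dot -big_split; apply: eq_bigr => i _; rewrite mxE mulrDr. Qed.

Lemma dotZr u c w : dot u (c *: w) = c * dot u w.
Proof. by rewrite /dot mulr_sumr; apply: eq_bigr => i _; rewrite mxE mulrCA. Qed.

Lemma dotBr u w w' : dot u (w - w') = dot u w - dot u w'.
Proof. by rewrite dotDr -scaleN1r dotZr mulN1r. Qed.

Lemma dotC u w : dot u w = dot w u.
Proof. by apply: eq_bigr => i _; rewrite mulrC. Qed.

Lemma dot_delta i w : dot (delta_mx 0 i) w = w 0 i.
Proof.
rewrite /dot (bigD1 i) //= big1 ?addr0 => [|j ji]; first by rewrite mxE !eqxx mul1r.
by rewrite mxE (negPf ji) andbF mul0r.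
Qed.

Definition integral_vec u : Prop := exists z : 'rV[int]_N, u = map_mx intr z.

Fixpoint cone_of gs : set 'rV[R]_N :=
  if gs is g :: gs' then [set w | exists2 t : R, 0 <= t & cone_of gs' (w - t *: g)]
  else [set 0].

Lemma cone_of0 gs : cone_of gs 0.
Proof. by elim: gs => [//|g gs IHgs]; exists 0 => //; rewrite scale0r subr0. Qed.

Lemma cone_ofD gs w w' : cone_of gs w -> cone_of gs w' -> cone_of gs (w + w').
Proof.
elim: gs w w' => [w w' /= -> ->|g gs IHgs w w' /= [t t0 h] [t' t'0 h']]; first by rewrite addr0.
by exists (t + t'); rewrite ?addr_ge0 // scalerDl opprD addrACA; exact: IHgs.
Qed.

Lemma cone_of_gen gs g t : g \in gs -> 0 <= t -> cone_of gs (t *: g).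
Proof.
move=> + t0; elim: gs => [//|g' gs IHgs]; rewrite inE => /predU1P[->|/IHgs h] /=.
  by exists t => //; rewrite subrr; exact: cone_of0.
by exists 0 => //; rewrite scale0r subr0.
Qed.

Lemma cone_of_sum gs (I : Type) (r : seq I) (P : pred I) (F : I -> 'rV[R]_N) :
  (forall i, P i -> cone_of gs (F i)) -> cone_of gs (\sum_(i <- r | P i) F i).
Proof. by move=> h; apply: big_ind => //; [exact: cone_of0|exact: cone_ofD]. Qed.

Lemma cone_of_min gs (D : set 'rV[R]_N) : D 0 ->
  (forall g t w, g \in gs -> 0 <= t -> D w -> D (w + t *: g)) -> cone_of gs `<=` D.
Proof.
move=> D0; elim: gs => [_ _ -> //|g gs IHgs h w /= [t t0 hw]].
rewrite -(subrK (t *: g) w); apply: (h g) => //; first exact: mem_head.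
by apply: IHgs hw => g' t' w' g'gs; apply: h; rewrite inE g'gs orbT.
Qed.

Lemma seq_max_ge0 (I : eqType) (L : seq I) (f : I -> R) : exists t, [/\ 0 <= t,
  forall i, i \in L -> f i <= t & t = 0 \/ exists2 i, i \in L & t = f i].
Proof.
elim: L => [|i L [t [t0 h ht]]]; first by exists 0; split=> //; left.
have [le_i|lt_i] := leP (f i) t.
  exists t; split=> [//|j|]; first by rewrite inE => /predU1P[->|/h].
  by case: ht => [|[j jL ->]]; [left|right; exists j; rewrite ?inE ?jL ?orbT].
exists (f i); split=> [|j|]; first exact: le_trans (ltW lt_i).
  by rewrite inE => /predU1P[->//|/h/le_trans]; apply; exact: ltW.
by right; exists i; rewrite ?mem_head.
Qed.

Lemma integral_dot u w : integral_vec u -> integral_vec w -> exists z : int, dot u w = z%:~R.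
Proof.
move=> [a ->] [b ->]; exists (\sum_i a 0 i * b 0 i); rewrite rmorph_sum.
by apply: eq_bigr => i _; rewrite !mxE rmorphM.
Qed.

Lemma integral_vecZ (z : int) u : integral_vec u -> integral_vec (z%:~R *: u).
Proof. by move=> [a ->]; exists (z *: a); apply/rowP => i; rewrite !mxE rmorphM. Qed.

Lemma integral_vecD u w : integral_vec u -> integral_vec w -> integral_vec (u + w).
Proof. by move=> [a ->] [b ->]; exists (a + b); apply/rowP => i; rewrite !mxE rmorphD. Qed.

(** Eliminate the coefficient t of the new generator g: forms negative on g bound t from below,
    forms positive on g bound it from above, and each such pair combines to a form that vanishes on
    g, integral when the data are. *)
Lemma fourier_motzkin gs : exists L : seq 'rV[R]_N,
  (forall w, cone_of gs w <-> forall u, u \in L -> 0 <= dot u w) /\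
  ((forall g, g \in gs -> integral_vec g) -> forall u, u \in L -> integral_vec u).
Proof.
elim: gs => [|g gs [L [hL intL]]].
  exists ([seq delta_mx 0 i | i <- enum 'I_N] ++ [seq - delta_mx 0 i | i <- enum 'I_N]); split.
    move=> w; split=> [-> u _|h].
      by rewrite /dot big1 // => i _; rewrite mxE mulr0.
    apply/rowP => i; rewrite mxE; apply/eqP; rewrite eq_le; apply/andP; split.
      have := h (- delta_mx 0 i); rewrite dotC -[in dot _ _]scaleN1r dotZr dotC dot_delta.
      rewrite mulN1r oppr_ge0; apply; rewrite mem_cat; apply/orP; right.
      by apply/mapP; exists i; rewrite ?mem_enum.
    have := h (delta_mx 0 i); rewrite dot_delta; apply.
    by rewrite mem_cat map_f // mem_enum.
  move=> _ u; have dint i : integral_vec (delta_mx 0 i).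
    by exists (delta_mx 0 i); apply/rowP => j; rewrite !mxE; case: (_ && _).
  rewrite mem_cat => /orP[]/mapP[i _ ->]; first exact: dint.
  rewrite -scaleN1r -[-1](_ : (-1)%:~R = _) //; first exact: integral_vecZ.
pose Ln := [seq k <- L | dot k g < 0]; pose Lp := [seq j <- L | 0 < dot j g].
pose cmb k j := (- dot k g) *: j + dot j g *: k.
exists ([seq u <- L | 0 <= dot u g] ++ [seq cmb k j | k <- Ln, j <- Lp]); split; last first.
  move=> hint u; have gint := hint g (mem_head _ _).
  have Lint : forall u, u \in L -> integral_vec u.
    by apply: intL => g' g'gs; apply: hint; rewrite inE g'gs orbT.
  rewrite mem_cat mem_filter => /orP[/andP[_ /Lint]//|/allpairsP[[k j] /= []]].
  rewrite !mem_filter => /andP[_ /Lint kint] /andP[_ /Lint jint] ->.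
  have [z ez] := integral_dot kint gint; have [z' ez'] := integral_dot jint gint.
  rewrite /cmb ez ez'; apply: integral_vecD; last exact: integral_vecZ.
  by rewrite -rmorphN; exact: integral_vecZ.
have cmbE k j w : dot (cmb k j) w = - dot k g * dot j w + dot j g * dot k w.
  by rewrite dotC /cmb dotDr !dotZr !(dotC w).
move=> w; split=> [[t t0 /hL h] u|h].
  have le_u v : v \in L -> t * dot v g <= dot v w.
    by move=> /h; rewrite dotBr dotZr subr_ge0.
  rewrite mem_cat mem_filter => /orP[/andP[u0 /le_u]|/allpairsP[[k j] /= []]].
    by apply: le_trans; rewrite mulr_ge0.
  rewrite !mem_filter => /andP[k0 /le_u kw] /andP[j0 /le_u jw] ->; rewrite cmbE.
  nra.
(* The largest of 0 and the lower bounds for t. *)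
have [t [t0 tmax tval]] := seq_max_ge0 Ln (fun k => dot k w / dot k g).
exists t => //; apply/hL => u uL; rewrite dotBr dotZr subr_ge0.
have h1 v : v \in L -> 0 <= dot v g -> 0 <= dot v w.
  by move=> vL v0; apply: h; rewrite mem_cat mem_filter v0 vL.
have [u0|u0|u0] := ltgtP (dot u g) 0.
- have := tmax u; rewrite mem_filter u0 uL => /(_ isT).
  by rewrite ler_ndivrMr.
- case: tval => [->|[k kL ->]]; first by rewrite mul0r h1 // ltW.
  have := kL; rewrite mem_filter => /andP[k0 _].
  have := h (cmb k u); rewrite mem_cat [X in _ || X](_ : _ = true) ?orbT; last first.
    by apply/allpairsP; exists (k, u); split=> //; rewrite mem_filter u0.
  move=> /(_ isT); rewrite cmbE => hk.
  rewrite mulrAC ler_ndivrMr //; nra.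
- by rewrite u0 mulr0 h1 // u0.
Qed.

End FourierMotzkin.

Section Homogeneous.
Context (R : realType) (V : vectType R).

Lemma linear_coords (f : V -> R) : (forall c w w', f (c *: w + w') = c * f w + f w') ->
  forall w, f w = \sum_j coord (vbasis fullv) j w * f (vbasis fullv)`_j.
Proof.
move=> fl w; pose g : {linear V -> R^o} :=
  HB.pack (f : V -> R^o) (@GRing.isLinear.Build R V R^o *:%R f fl).
rewrite -[f w]/(g w) {1}(coord_vbasis (memvf w)) linear_sum; apply: eq_bigr => j _.
by rewrite linearZ.
Qed.

(* The values up to a slack of a linear map form a finitely generated cone,    *)
(* which is closed.                                                           *)
Lemma homogeneous_limit (r : nat) (h : 'I_r -> V -> R) (b : 'I_r -> R) (C : R) :
  (forall i c w w', h i (c *: w + w') = c * h i w + h i w') ->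
  (forall M : nat, exists w, forall i, M%:R * b i - C <= h i w) ->
  exists y, forall i, b i <= h i y.
Proof.
move=> hlin hM; pose hv w : 'rV[R]_r := \row_i h i w; pose e j := (vbasis (fullv : {vspace V}))`_j.
have h0 i : h i 0 = 0 by have := hlin i 1 0 0; rewrite scaler0 addr0 mul1r; lra.
pose gs := [seq hv (e j) | j : 'I_(\dim (fullv : {vspace V})) <- enum 'I_(\dim (fullv : {vspace V}))] ++
  [seq - hv (e j) | j : 'I_(\dim (fullv : {vspace V})) <- enum 'I_(\dim (fullv : {vspace V}))] ++
  [seq - delta_mx 0 i | i : 'I_r <- enum 'I_r].
have hvL c w w' : hv (c *: w + w') = c *: hv w + hv w'.
  by apply/rowP => i; rewrite !mxE hlin.
have genj (j : 'I_(\dim (fullv : {vspace V}))) c : cone_of gs (c *: hv (e j)).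
  have [c0|c0] := leP 0 c.
    apply: cone_of_gen => //; rewrite mem_cat; apply/orP; left.
    by apply/mapP; exists j; rewrite ?mem_enum.
  have -> : c *: hv (e j) = (- c) *: (- hv (e j)) by rewrite scaleNr scalerN opprK.
  apply: cone_of_gen; last by rewrite oppr_ge0 ltW.
  rewrite !mem_cat; apply/orP; right; apply/orP; left.
  by apply/mapP; exists j; rewrite ?mem_enum.
have coneP z : cone_of gs z <-> exists w, forall i, z 0 i <= h i w.
  split=> [|[w zw]].
    apply: (@cone_of_min _ _ gs [set z | exists w, forall i, z 0 i <= h i w]).
      by exists 0 => i; rewrite mxE h0.
    move=> g t {}z ggs t0 [w zw]; move: ggs; rewrite !mem_cat => /or3P[]/mapP[j _ ->].
    - by exists (t *: e j + w) => i; rewrite !mxE hlin addrC lerD2l.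
    - by exists ((- t) *: e j + w) => i; rewrite !mxE hlin mulrN -mulNr addrC lerD2l.
    - exists w => i; rewrite !mxE; apply: le_trans (zw i); rewrite gerDl mulrN oppr_le0.
      by rewrite mulr_ge0 // ler0n.
  have -> : z = \sum_j coord (vbasis fullv) j w *: hv (e j) +
      \sum_i (h i w - z 0 i) *: (- delta_mx 0 i).
    apply/rowP => k; rewrite mxE !summxE.
    rewrite (eq_bigr (fun j => coord (vbasis fullv) j w * h k (e j))) => [|j _]; last by rewrite !mxE.
    rewrite -(linear_coords (hlin k)) (bigD1 k) //= big1 ?addr0 => [|i ik].
      by rewrite !mxE !eqxx /=; ring.
    by rewrite !mxE eq_sym (negPf ik) andbF oppr0 mulr0.
  apply: cone_ofD; apply: cone_of_sum => i _; first exact: genj.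
  apply: cone_of_gen; last by rewrite subr_ge0.
  rewrite !mem_cat; apply/orP; right; apply/orP; right.
  by apply/mapP; exists i; rewrite ?mem_enum.
have [L [hL _]] := fourier_motzkin gs.
have [|y hy] := proj1 (coneP (\row_i b i)); last by exists y => i; have := hy i; rewrite mxE.
apply/hL => u uL; rewrite leNgt; apply/negP => lt_u.
pose s := dot u (\row_i b i); pose s1 := dot u (const_mx C).
have hs (M : nat) : s1 <= M%:R * s.
  have [w hw] := hM M; have /hL/(_ u uL) : cone_of gs (M%:R *: (\row_i b i) - const_mx C).
    by apply/coneP; exists w => i; rewrite !mxE; exact: hw.
  by rewrite dotBr dotZr subr_ge0.
have := hs (Num.truncn (s1 / s)).+1; have := truncnS_gt (s1 / s).
rewrite ltr_ndivrMr //; lra.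
Qed.

Section Rank.
Context (G : zmodType) (pr : G -> V -> R).
Hypothesis prL : forall u c w w', pr u (c *: w + w') = c * pr u w + pr u w'.

Lemma injective_rank (psi : nat -> G) r (W : {vspace V}) : injective_on pr psi r W ->
  row_free (\matrix_(j < \dim W, i < r) pr (psi i) (vbasis W)`_j).
Proof.
move=> inj; rewrite -kermx_eq0; apply/eqP/eqP/rowV0Pn => -[c /sub_kermxP cA c0].
pose w := \sum_j c 0 j *: (vbasis W)`_j.
have wW : w \in W by apply: memv_suml => j _; apply: memvZ; apply: vbasis_mem; apply: mem_nth; rewrite size_tuple.
have w0 : w = 0.
  apply: inj => // i ir; rewrite /w pr_sumr //.
  transitivity ((c *m \matrix_(j < \dim W, i < r) pr (psi i) (vbasis W)`_j) 0 (Ordinal ir)).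
    by rewrite mxE; apply: eq_bigr => j _; rewrite prZ // mxE.
  by rewrite cA mxE.
case/eqP: c0; apply/rowP => j; rewrite mxE.
by have /freeP/(_ _ w0 j) := basis_free (vbasisP W).
Qed.

Lemma injective_dim (psi : nat -> G) r (W : {vspace V}) :
  injective_on pr psi r W -> (\dim W <= r)%N.
Proof. by move=> /injective_rank /eqP <-; exact: rank_leq_col. Qed.

(** The matrix of pairings with a basis of W is square and of full rank, so its columns satisfy no
    relation. *)
Lemma injective_independent (psi : nat -> G) r (W : {vspace V}) :
  injective_on pr psi r W -> \dim W = r -> ~ dependent_on pr psi r W.
Proof.
move=> inj dW [la [i ir lai] laW].
have := injective_rank inj; set A := \matrix_(_, _) _ => Af.
pose l : 'cV[R]_r := \col_j la j.
have Al : A *m l = 0.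
  apply/colP => j; rewrite mxE [RHS]mxE -[RHS](laW (vbasis W)`_j).
    by apply: eq_bigr => k _; rewrite !mxE mulrC.
  by apply: vbasis_mem; apply: mem_nth; rewrite size_tuple.
have lA : l^T *m A^T = 0 by rewrite -trmx_mul Al trmx0.
have ATf : row_free A^T by rewrite /row_free mxrank_tr (eqP Af) dW.
have l0 : l^T = 0 by apply: (row_free_inj ATf); rewrite lA mul0mx.
have /rowP/(_ (Ordinal ir)) := l0; rewrite !mxE /= => e.
by rewrite e eqxx in lai.
Qed.

End Rank.
End Homogeneous.

(** * Tropical degenerations *)

Lemma seq_min_gt0 (R : realType) (L : seq R) : (forall l, l \in L -> 0 < l) ->
  exists2 e, 0 < e & forall l, l \in L -> e <= l.
Proof.
elim: L => [|l L IHL] h; first by exists 1.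
have [|e e0 he] := IHL; first by move=> m mL; apply: h; rewrite inE mL orbT.
exists (Num.min l e); first by rewrite lt_min h ?mem_head.
move=> m; rewrite inE => /predU1P[->|/he em]; first by rewrite ge_min lexx.
by apply: le_trans em; rewrite ge_min lexx orbT.
Qed.

Lemma expR_near (R : realType) (a de y : R) : 0 < a -> 0 < de ->
  - ln a <= y <= - ln a + de / (2 * a) -> `|expR (- y) - a| < de.
Proof.
move=> a0 de0 /andP[y1 y2].
have ea : expR (- - ln a) = a by rewrite opprK lnK ?posrE.
have le1 : expR (- y) <= a by rewrite -[leRHS]ea ler_expR lerN2.
have h0 : a * (de / (2 * a)) = de / 2 by field; exact: lt0r_neq0.
have le2 : a - de / 2 <= expR (- y).
  apply: (@le_trans _ _ (expR (- (- ln a + de / (2 * a))))); last by rewrite ler_expR lerN2.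
  rewrite opprD expRD ea -h0 -[X in X - _]mulr1 -mulrBr ler_pM2l //.
  exact: expR_ge1Dx.
by rewrite ltr_norml; apply/andP; split; lra.
Qed.

(** A box with positive side lengths lies in no hyperplane, so [avoid_hyperplanes] applies. *)
Lemma avoid_box (R : realType) (d : nat) (I : eqType) (L : seq I) (la : I -> nat -> R)
    (c : I -> R) (b eta : 'I_d -> R) : (forall i, 0 < eta i) ->
  (forall k, k \in L -> exists2 i, (i < d)%N & la k i != 0) ->
  exists y : 'I_d -> R, (forall i, b i <= y i <= b i + eta i) /\
    forall k, k \in L -> \sum_(i < d) la k i * y i != c k.
Proof.
move=> eta0 la0.
pose B : set 'rV[R]_d := [set y | forall i, b i <= y 0 i <= b i + eta i].
pose F k (y : 'rV[R]_d) := \sum_(i < d) la k i * y 0 i - c k.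
have FE k y y' t : F k (y + t *: (y' - y)) = F k y + t * (F k y' - F k y).
  rewrite /F; have -> : \sum_(i < d) la k i * (y + t *: (y' - y)) 0 i =
      \sum_(i < d) la k i * y 0 i + t * (\sum_(i < d) la k i * y' 0 i - \sum_(i < d) la k i * y 0 i).
    rewrite -sumrB mulr_sumr -big_split /=; apply: eq_bigr => i _.
    by rewrite !mxE; ring.
  ring.
have Bb : B (\row_i b i) by move=> i; rewrite mxE lexx lerDl ltW.
have [|||k kL|y By hy] := @avoid_hyperplanes R _ I L F B.
- move=> y y' t By By' /andP[t0 t1] i; rewrite !mxE.
  have /andP[h1 h2] := By i; have /andP[h3 h4] := By' i.
  by apply/andP; split; nra.
- by exists (\row_i b i).
- by move=> k _ y y' t; exact: FE.
- have [i id lai] := la0 k kL; have [F0|F0] := eqVneq (F k (\row_i b i)) 0; last first.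
    by exists (\row_i b i).
  pose y1 : 'rV[R]_d := \row_j (b j + eta j *+ (j == Ordinal id)).
  exists y1.
    move=> j; rewrite mxE; case: eqP => _; rewrite ?mulr1n ?mulr0n ?addr0 lexx ?andbT.
      by rewrite lerDl ltW.
    by rewrite lerDl ltW.
  have -> : F k y1 = F k (\row_i b i) + la k i * eta (Ordinal id).
    rewrite /F addrAC; congr (_ - _).
    rewrite (bigD1 (Ordinal id)) //= [in RHS](bigD1 (Ordinal id)) //= !mxE eqxx mulr1n mulrDr.
    rewrite addrAC; congr (_ + _ + _); apply: eq_bigr => j ji.
    by rewrite !mxE (negPf ji) mulr0n addr0.
  by rewrite F0 add0r mulf_neq0 // gt_eqF.
exists (fun i => y 0 i); split=> // k kL.
by have := hy k kL; rewrite subr_eq0.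
Qed.

Section Degeneration.
Context (R : realType) (K : fieldType) (v : K -> R) (v_abs : nonarch_abs v).
Context (V : vectType R) (G : zmodType) (pr : G -> V -> R).
Hypothesis prD : forall u u' w, pr (u + u') w = pr u w + pr u' w.
Hypothesis prL : forall u c w w', pr u (c *: w + w') = c * pr u w + pr u w'.
Local Notation T := (monoid_algebra K G).
Context (I : set T) (I_ideal : ideal I) (d : nat) (psi : nat -> G).
Local Notation x := (characters K psi).
Local Notation phi := (mveval x d).
Hypothesis fin : loc_finite phi I (mvX K d).
Context (Sigma : set (set V)) (Sigma_fin : finite_set Sigma).
Hypothesis Sigma_inj : forall P, Sigma P -> injective_on pr psi d (dirspan P).
Hypothesis Sigma_cover : forall xi, points v I xi ->
  exists w P, [/\ trop_point pr xi w, Sigma P & P w].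

(* The tropical points near [zeta] over nearby weights satisfy a tie of [g];   *)
(* as the weights fill a box, one of the finitely many ties must hold on a     *)
(* whole [d]-dimensional polyhedron.                                          *)
Lemma tie_polyhedron (a : nat -> R) (zeta : T -> R) (theta : nat -> G) r (g : mvpoly K r)
    (cs : seq (G * R)) : pos_weights d a -> points v I zeta -> over_gauss v x d a zeta ->
  zeta (mveval (characters K theta) r g) < mvgauss v (fun i => zeta (chi K (theta i))) g ->
  (forall uc, uc \in cs -> zeta (chi K uc.1) < uc.2) ->
  exists P, [/\ Sigma P, \dim (dirspan P) = d, dependent_on pr theta r (dirspan P) &
    exists2 w, P w & forall uc, uc \in cs -> expR (- pr uc.1 w) < uc.2].
Proof.
move=> a0 zI zo lt_g lt_cs; have [zP zk] := zI; have zV := seminorm_valuation v_abs zP.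
pose p := [set f | zeta f = 0]; have pP : prime_ideal p by exact: (prime_kernel v_abs).
have pI : ideal p by case: pP.
have Ip : I `<=` p by exact: zk.
have pfin := loc_finite_sub I_ideal pI Ip fin.
have pinj s : p (phi s) -> s = 0 by rewrite /p /mkset zo; exact: (mvgauss_eq0 v_abs a0).
have th0 (xi : T -> R) i : mult_seminorm v xi -> (i < r)%N -> 0 < xi (characters K theta i).
  by move=> xP _; exact: (chi_gt0 v_abs).
have g0 : g != 0.
  apply: contraTneq lt_g => ->; rewrite rmorph0 (val0 zV).
  by rewrite (val0 (mvgauss_valuation v_abs (fun i => th0 zeta i zP))) ltxx.
have [t0 t0g et0] := mvgauss_term_ex v_abs (fun i => th0 zeta i zP) g0.
pose f1 := mveval (characters K theta) r g.
pose f2 : T := t0.1 *: mvmon (characters K theta) r t0.2.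
have f2E (xi : T -> R) : mult_seminorm v xi ->
    xi f2 = v t0.1 * mvweight (fun i => xi (characters K theta i)) r t0.2.
  by move=> xP; rewrite (seminormZ _ _ xP) (seminorm_mvmon v_abs).
have lt_f : zeta f1 < zeta f2 by rewrite (f2E _ zP) et0.
(* Half the gap between f1 and f2, so that their strict inequality survives an error below e in
   both; the conditions [cs] survive likewise. *)
have [|e e0 he] := @seq_min_gt0 R
    ((zeta f2 - zeta f1) / 2 :: [seq uc.2 - zeta (chi K uc.1) | uc <- cs]).
  move=> l; rewrite inE => /predU1P[->|/mapP[uc /lt_cs h ->]]; last by rewrite subr_gt0.
  by rewrite divr_gt0 // subr_gt0.
have [de de0 hde] := nearby_points v_abs pP pfin pinj (f1 :: f2 :: [seq chi K uc.1 | uc <- cs])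
  a0 (conj zP (fun f (pf : p f) => pf)) zo e0.
have [Pl ePl] := proj1 (finite_seqP _) Sigma_fin.
pose Q (k : set V * ((K * seq nat) * (K * seq nat))) : set V := [set w | [/\ k.1 w,
  tie v pr theta r k.2 w = 0 & forall uc, uc \in cs -> expR (- pr uc.1 w) < uc.2]].
pose Ts := [seq tu <- [seq (t, u) | t <- mvterms g, u <- mvterms g] | tu.1.2 != tu.2.2].
pose L := [seq (P, tu) | P <- Pl, tu <- Ts].
pose hyp k (lc : (nat -> R) * R) := (exists2 i, (i < d)%N & lc.1 i != 0) /\
  forall w, Q k w -> lin_comb pr psi d lc.1 w = lc.2.
(* Either some non-empty piece Q_k lies in no hyperplane of the psi-coordinates, and its polyhedron
   is the one sought, or nearby weights can be chosen off all the hyperplanes that occur. *)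
have [[k [kL Qk nh]]|no] :=
    pselect (exists k, [/\ k \in L, Q k !=set0 & ~ exists lc, hyp k lc]).
  move: kL Qk nh => /allpairsP[[P tu] /= [PPl tuT ->]] [w0 [Pw0 tie0 cs0]] nh.
  have SP : Sigma P by rewrite ePl.
  move: tuT; rewrite mem_filter => /andP[tu12 /allpairsP[[t u] /= [tg ug etu]]].
  pose la i : R := (nth 0%N tu.1.2 i)%:R - (nth 0%N tu.2.2 i)%:R.
  pose lf : V -> R := lin_comb pr theta r la.
  have lfL : forall c w w', lf (c *: w + w') = c * lf w + lf w'.
    by move=> c w w'; exact: lin_combL.
  pose lg : {linear V -> R^o} := HB.pack (lf : V -> R^o) (@GRing.isLinear.Build R V R^o *:%R lf lfL).
  (* The directions of P along which the tie is constant. In dimension below d the psi_i would be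
     dependent on them, and Q_k would lie in a hyperplane. *)
  pose W := (dirspan P :&: lker (linfun lg))%VS.
  have Wd : (d <= \dim W)%N.
    rewrite leqNgt; apply/negP => /(dependent_dim prL psi)[mu mu0 muW].
    apply: nh; exists (mu, lin_comb pr psi d mu w0); split=> // w [Pw tiew _] /=.
    apply/eqP; rewrite -subr_eq0; apply/eqP.
    have -> : lin_comb pr psi d mu w - lin_comb pr psi d mu w0 = lin_comb pr psi d mu (w - w0).
      by rewrite addrC -scaleN1r [w - w0]addrC -[- w0]scaleN1r lin_combL // scaleN1r mulN1r.
    apply: muW; rewrite memv_cap dirspan_sub // memv_ker lfunE; change (lf (w - w0) == 0).
    have -> : lf (w - w0) = lf w - lf w0 by rewrite addrC -[- w0]scaleN1r lfL mulN1r addrC.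
    move: tiew tie0; rewrite /tie -/la -/(lf w) -/(lf w0) => /= h1 h2.
    by apply/eqP; lra.
  have Pd := injective_dim prL (Sigma_inj SP).
  have WP : (W <= dirspan P)%VS by exact: capvSl.
  have WE : W = dirspan P by apply/eqP; rewrite eqEdim WP; exact: leq_trans Pd Wd.
  exists P; split=> //; first by apply/eqP; rewrite eqn_leq Pd -WE.
    exists la; first by apply: (tie_neq R (s := g)); rewrite ?etu //; move: tu12; rewrite etu.
    move=> w; rewrite -WE memv_cap => /andP[_]; rewrite memv_ker lfunE => /eqP; exact.
  by exists w0.
exfalso; have /choice[lc hlc] : forall k, exists lc, (exists lc, hyp k lc) -> hyp k lc.
  by move=> k; have [[lc h]|h] := pselect (exists lc, hyp k lc); [exists lc|exists (fun=> 0, 0)].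
pose b (i : 'I_d) := - ln (a i); pose eta (i : 'I_d) := de / (2 * a i).
have eta0 i : 0 < eta i by rewrite divr_gt0 // mulr_gt0 // a0.
have [k|y [yb yL]] := @avoid_box R d _ [seq k <- L | `[< exists lc, hyp k lc >]]
    (fun k => (lc k).1) (fun k => (lc k).2) b eta eta0.
  by rewrite mem_filter => /andP[/asboolP /hlc[]].
pose a' (i : nat) : R := if insub i is Some j then expR (- y j) else 1.
have a'E (i : 'I_d) : a' i = expR (- y i) by rewrite /a' valK.
have [i id|a'0 [zeta' [zp' zo' zn]]] := hde a'.
  by rewrite (a'E (Ordinal id)); apply: expR_near => //; [exact: (a0 i id)|exact: (yb (Ordinal id))].
have zI' : points v I zeta' by split=> [|f If]; [exact: zp'.1|exact: (zp'.2 f (zk f If))].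
have [w' [P [w'z SP Pw']]] := Sigma_cover zI'.
have he1 : e <= (zeta f2 - zeta f1) / 2 by apply: he; exact: mem_head.
have lt' : zeta' f1 < zeta' f2.
  have := zn f1 (mem_head _ _); have := zn f2 (mem_behead (s := _ :: _) (mem_head _ _)).
  rewrite !ltr_norml => /andP[h1 h2] /andP[h3 h4]; lra.
have [|t [u [tg ug tu tie0]]] := tie_point v_abs (psi := theta) (s := g) zp'.1 w'z.
  apply: lt_le_trans lt' _; rewrite (f2E _ zp'.1).
  by apply: mvgauss_term_le => // i ir; exact: (th0 zeta' i zp'.1 ir).
have kL : (P, (t, u)) \in L.
  apply/allpairsP; exists (P, (t, u)); split=> //=; first by move: SP; rewrite ePl.
  by rewrite mem_filter tu; apply/allpairsP; exists (t, u).
have Qk : Q (P, (t, u)) w'.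
  split=> // uc ucs; rewrite -(trop_chi v_abs _ zp'.1 w'z).
  have h1 : e <= uc.2 - zeta (chi K uc.1).
    by apply: he; rewrite inE; apply/orP; right; apply/mapP; exists uc.
  have := zn (chi K uc.1); rewrite !inE; have -> : chi K uc.1 \in [seq chi K uc.1 | uc <- cs].
    by apply/mapP; exists uc.
  by rewrite !orbT => /(_ isT); rewrite ltr_norml => /andP[h2 h3]; lra.
have hk : exists lc, hyp (P, (t, u)) lc.
  by apply: contrapT => h; apply: no; exists (P, (t, u)); split=> //; exists w'.
have := yL (P, (t, u)); rewrite mem_filter kL andbT => /(_ (asboolT hk))/eqP; apply.
have [_ /(_ w' Qk) <-] := hlc _ hk; rewrite /lin_comb; apply: eq_bigr => i _; congr (_ * _).
have za' := over_on v_abs a'0 zo'.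
by rewrite w'z -[chi K (psi i)]/(x i) (za' i (ltn_ord i)) a'E expRK opprK.
Qed.

End Degeneration.

(** * Faces and recession cones *)

Section Cones.
Context (R : realType) (n : nat).
Implicit Types (sigma tau rho : set 'rV[R]_n) (u : 'rV[int]_n) (w : 'rV[R]_n).

Lemma pairingD_r u w w' : pairing u (w + w') = pairing u w + pairing u w'.
Proof. by rewrite -[w]scale1r pairingL mul1r scale1r. Qed.

Lemma pairing0l w : pairing (0 : 'rV[int]_n) w = 0.
Proof. by rewrite /pairing big1 // => i _; rewrite mxE mul0r. Qed.

Lemma pairingMn u k w : pairing (u *+ k) w = k%:R * pairing u w.
Proof.
elim: k => [|k IHk]; first by rewrite mulr0n pairing0l mul0r.
by rewrite mulrS pairingD IHk -natr1 mulrDl mul1r addrC.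
Qed.

Lemma pairing_suml (I : Type) (r : seq I) (Q : pred I) (F : I -> 'rV[int]_n) w :
  pairing (\sum_(i <- r | Q i) F i) w = \sum_(i <- r | Q i) pairing (F i) w.
Proof. by elim/big_rec2: _ => [|i y z _ <-]; rewrite ?pairing0l ?pairingD. Qed.

Lemma pairingZl (c : int) u w : pairing (c *: u) w = c%:~R * pairing u w.
Proof.
rewrite /pairing mulr_sumr; apply: eq_bigr => i _.
by rewrite mxE intrM mulrA.
Qed.

Lemma rational_cone_closed sigma : rational_cone sigma ->
  [/\ sigma 0, forall w w', sigma w -> sigma w' -> sigma (w + w') &
      forall t w, 0 <= t -> sigma w -> sigma (t *: w)].
Proof.
move=> [m [g ->]]; split.
- by exists (fun=> 0) => //; rewrite big1 // => i _; rewrite scale0r.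
- move=> _ _ [c c0 ->] [c' c'0 ->]; exists (fun i => c i + c' i).
    by move=> i; rewrite addr_ge0.
  by rewrite -big_split; apply: eq_bigr => i _; rewrite scalerDl.
- move=> t _ t0 [c c0 ->]; exists (fun i => t * c i).
    by move=> i; rewrite mulr_ge0.
  by rewrite scaler_sumr; apply: eq_bigr => i _; rewrite scalerA.
Qed.

Lemma cone_generator sigma m (g : 'I_m -> 'rV[int]_n) i :
  sigma = [set w | exists2 c : 'I_m -> R, (forall i, 0 <= c i) &
                       w = \sum_i c i *: map_mx intr (g i)] -> sigma (map_mx intr (g i)).
Proof.
move=> ->; exists (fun j => (j == i)%:R); first by move=> j; rewrite ler0n.
by rewrite (bigD1 i) //= eqxx scale1r big1 ?addr0 // => j /negPf->; rewrite scale0r.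
Qed.

Lemma cone_facets sigma : rational_cone sigma -> exists L : seq 'rV[int]_n,
  forall w, sigma w <-> forall u, u \in L -> 0 <= pairing u w.
Proof.
move=> sigmaP; have [s0 sD sZ] := rational_cone_closed sigmaP; have [m [g es]] := sigmaP.
pose gs : seq 'rV[R]_n := [seq map_mx intr (g i) | i <- enum 'I_m].
have [L [hL]] := fourier_motzkin gs.
have /[swap]/[apply] intL : forall h, h \in gs -> integral_vec h.
  by move=> _ /mapP[i _ ->]; exists (g i).
have /choice[z hz] : forall u : 'rV[R]_n, exists z : 'rV[int]_n, u \in L -> u = map_mx intr z.
  move=> u; have [uL|uL] := boolP (u \in L); last by exists 0.
  by have [z ->] := intL u uL; exists z.
exists (map z L) => w.
have coneE : sigma w <-> cone_of gs w.
  split=> [|h].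
    rewrite es => -[c c0 ->]; apply: cone_of_sum => i _; apply: cone_of_gen => //.
    by apply/mapP; exists i; rewrite ?mem_enum.
  apply: (@cone_of_min _ _ gs sigma) h => // _ t {}w /mapP[i _ ->] t0 sw.
  by apply: sD => //; apply: sZ => //; exact: cone_generator es.
have pz (u : 'rV[R]_n) : u \in L -> pairing (z u) w = dot u w.
  by move=> uL; rewrite {2}(hz u uL); apply: eq_bigr => i _; rewrite mxE.
rewrite coneE hL; split=> h u; last by move=> uL; rewrite -pz //; apply: h; exact: map_f.
by move=> /mapP[u' u'L ->]; rewrite pz // h.
Qed.

(** A linear form bounded below on a cone is non-negative there, so the minimum that defines a face
    is 0. *)
Lemma face_form rho sigma : rational_cone sigma -> face rho sigma ->
  exists l : 'Hom('rV[R]_n, R^o), (forall w, sigma w -> 0 <= (l w : R)) /\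
    forall w, rho w <-> sigma w /\ (l w : R) = 0.
Proof.
move=> sigmaP [[x0 +] [l er]]; have [s0 sD sZ] := rational_cone_closed sigmaP.
rewrite er => -[sx0 hx0].
have l0 : (l 0 : R) = 0 by rewrite linear0.
have lpos w : sigma w -> 0 <= (l w : R).
  move=> sw; rewrite leNgt; apply/negP => lw.
  have h t : 0 <= t -> (l x0 : R) <= t * (l w : R).
    by move=> t0; have := hx0 _ (sZ t w t0 sw); rewrite linearZ.
  have := h (1 + `|(l x0 : R) / (l w : R)|); have := ler_norm ((l x0 : R) / (l w : R)).
  set q := _ / _ => hq; rewrite addr_ge0 // => /(_ isT).
  have -> : (l x0 : R) = q * (l w : R) by rewrite divfK // lt_eqF.
  rewrite ler_nM2r //; lra.
exists l; split=> // w; split=> [[sw hw]|[sw lw]]; last first.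
  by split=> // y sy; rewrite lw lpos.
split=> //; apply/eqP; rewrite eq_le lpos // andbT -l0; exact: hw.
Qed.

(* A face of a rational cone is cut out by an integral form: round a large    *)
(* multiple of the given form in an integral basis of the forms that vanish   *)
(* on the face.                                                               *)
Lemma face_character rho sigma : rational_cone sigma -> face rho sigma ->
  exists u0 : 'rV[int]_n, [/\ in_dual sigma u0,
    forall w, sigma w -> (pairing u0 w = 0 <-> rho w) &
    forall u, in_dual rho u -> exists N, forall N', (N <= N')%N -> in_dual sigma (u + u0 *+ N')].
Proof.
move=> sigmaP rs; have [l [lpos lrho]] := face_form sigmaP rs.
have [m [g es]] := sigmaP; pose gR i : 'rV[R]_n := map_mx intr (g i).
have gs i : sigma (gR i) by exact: cone_generator es.
pose A i := (l (gR i) : R) == 0.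
(* Generators off the face become 0, so rho' is spanned by those on it. *)
pose g' i := if A i then g i else 0.
pose rho' : set 'rV[R]_n := [set w | exists2 c : 'I_m -> R, (forall i, 0 <= c i) &
  w = \sum_i c i *: map_mx intr (g' i)].
have rho'P : rational_cone rho' by exists m, g'.
have [U [W [S [WU UW _ perpW spanU]]]] := lattice_bases rho'P.
have lrho' w : rho' w -> (l w : R) = 0.
  move=> [c _ ->]; rewrite linear_sum big1 // => i _; rewrite linearZ /= /g'.
  case: ifP => [/eqP e|_]; first by rewrite [X in _ *: X]e scaler0.
  by rewrite map_mx0 linear0 scaler0.
pose c j : R := l (map_mx intr (row j U)).
have cS j : S j -> c j = 0.
  move=> /spanU; apply: (linspan_vanish (f := fun w => (l w : R))) => // t w w'.
  by rewrite linearP.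
have lE w : (l w : R) = \sum_j c j * pairing (row j W) w.
  have {1}-> : w = \sum_j pairing (row j W) w *: map_mx intr (row j U).
    have e : w = w *m map_mx intr W^T *m map_mx intr U.
      by rewrite -mulmxA -map_mxM WU map_mx1 mulmx1.
    rewrite {1}e; apply/rowP => k; rewrite summxE mxE; apply: eq_bigr => j _.
    rewrite !mxE /pairing; congr (_ * _); apply: eq_bigr => i _.
    by rewrite !mxE mulrC.
  by rewrite linear_sum; apply: eq_bigr => j _; rewrite linearZ /= mulrC.
pose B : R := \sum_i \sum_j `|pairing (row j W) (gR i)|.
have [|e e0 he] := @seq_min_gt0 R [seq (l (gR i) : R) | i <- [seq i <- enum 'I_m | ~~ A i]].
  move=> _ /mapP[i + ->]; rewrite mem_filter => /andP[nA _].
  by rewrite lt_neqAle eq_sym nA lpos.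
(* N l exceeds B on every generator off the face, and rounding its coefficients down lowers this by
   at most B. *)
pose N := (Num.truncn (B / e)).+1.
have NB : B < N%:R * e by rewrite -ltr_pdivrMr // truncnS_gt.
pose u0 : 'rV[int]_n := \sum_j Num.floor (N%:R * c j) *: row j W.
have u0E w : pairing u0 w = \sum_j (Num.floor (N%:R * c j))%:~R * pairing (row j W) w.
  by rewrite /u0 pairing_suml; apply: eq_bigr => j _; rewrite pairingZl.
have u0A i : A i -> pairing u0 (gR i) = 0.
  move=> Ai; rewrite u0E big1 // => j _; have [Sj|nS] := boolP (S j).
    by rewrite cS // mulr0 floor0 mul0r.
  have /asboolP/(_ (gR i)) := perpW j nS; rewrite mulrC => ->; rewrite ?mul0r //.
  have -> : gR i = map_mx intr (g' i) by rewrite /g' Ai.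
  exact: (@cone_generator rho' m g' i).
have u0N i : ~~ A i -> 0 < pairing u0 (gR i).
  move=> nA; rewrite u0E.
  have h1 : e <= (l (gR i) : R).
    by apply: he; apply/mapP; exists i => //; rewrite mem_filter nA mem_enum.
  have h2 : \sum_j (N%:R * c j) * pairing (row j W) (gR i) = N%:R * (l (gR i) : R).
    by rewrite lE mulr_sumr; apply: eq_bigr => j _; rewrite mulrA.
  have h3 : \sum_j (N%:R * c j) * pairing (row j W) (gR i) -
      \sum_j (Num.floor (N%:R * c j))%:~R * pairing (row j W) (gR i) <= B.
    rewrite -sumrB; apply: (@le_trans _ _ (\sum_j `|pairing (row j W) (gR i)|)).
      apply: ler_sum => j _; rewrite -mulrBl; apply: le_trans (ler_norm _) _.
      rewrite normrM ler_piMl //.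
      have := floor_itv (N%:R * c j); rewrite intrD => /andP[f1 f2].
      by rewrite ger0_norm ?subr_ge0 // lerBlDl ltW.
    rewrite /B (bigD1 i) //= lerDl; apply: sumr_ge0 => k _; apply: sumr_ge0 => j _.
    exact: normr_ge0.
  have h4 : N%:R * e <= N%:R * (l (gR i) : R) by rewrite ler_wpM2l.
  lra.
(* A positive integer is at least 1, so multiples of u0 outweigh any given u off the face. *)
have u01 i : ~~ A i -> 1 <= pairing u0 (gR i).
  by move/u0N; rewrite /gR pairing_intr ltr0z -[1]/(1%:~R) ler_int; lia.
have u0pos i : 0 <= pairing u0 (gR i).
  by have [/u0A->//|/u0N/ltW] := boolP (A i).
have pairing_cone u (t : 'I_m -> R) : pairing u (\sum_i t i *: gR i) = \sum_i t i * pairing u (gR i).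
  by rewrite pairing_sumr; apply: eq_bigr => i _; rewrite pairingZ.
exists u0; split.
- apply/asboolP => w; rewrite es => -[t t0 ->]; rewrite pairing_cone.
  by apply: sumr_ge0 => i _; rewrite mulr_ge0.
- move=> w sw; move: (sw); rewrite {1}es => -[t t0 ew]; rewrite lrho.
  have lw : (l w : R) = \sum_i t i * (l (gR i) : R).
    by rewrite ew linear_sum; apply: eq_bigr => i _; rewrite linearZ.
  rewrite {1}ew pairing_cone; split=> [/eqP|[_ /eqP]].
    rewrite psumr_eq0 => [/allP h|i _]; last by rewrite mulr_ge0.
    split=> //; rewrite lw big1 // => i _; have := h i (mem_index_enum i).
    rewrite /= mulf_eq0 => /orP[/eqP->|]; first by rewrite mul0r.
    have [/eqP->|/u0N h0] := boolP (A i); first by rewrite mulr0.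
    by rewrite gt_eqF.
  rewrite lw psumr_eq0 => [/allP h|i _]; last by rewrite mulr_ge0 // lpos.
  rewrite big1 // => i _; have := h i (mem_index_enum i).
  by rewrite /= mulf_eq0 => /orP[/eqP->|/u0A->]; rewrite ?mul0r ?mulr0.
- move=> u /asboolP ur; exists (Num.truncn (\sum_i `|pairing u (gR i)|)).+1 => N' NN'.
  apply/asboolP => w; rewrite es => -[t t0 ->]; rewrite pairing_cone.
  apply: sumr_ge0 => i _; rewrite mulr_ge0 // pairingD pairingMn.
  have [Ai|nA] := boolP (A i).
    rewrite u0A // mulr0 addr0; apply: ur; apply/lrho; split=> //.
    exact/eqP.
  have h1 := truncnS_gt (\sum_i `|pairing u (gR i)|).
  have h2 : `|pairing u (gR i)| <= \sum_i `|pairing u (gR i)|.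
    by rewrite (bigD1 i) //= lerDl; apply: sumr_ge0 => k _; exact: normr_ge0.
  have h3 : (Num.truncn (\sum_i `|pairing u (gR i)|)).+1%:R <= N'%:R :> R by rewrite ler_nat.
  have h4 : N'%:R <= N'%:R * pairing u0 (gR i) by rewrite ler_peMr // u01.
  have := ler_norm (- pairing u (gR i)); rewrite normrN; lra.
Qed.

Lemma fan_face Delta sigma tau : pointed_rational_fan Delta -> Delta sigma -> Delta tau ->
  tau `<=` sigma -> face tau sigma.
Proof.
move=> [_ _ _ hI] Ds Dt ts; have [_] := hI _ _ Dt Ds.
suff -> : tau `&` sigma = tau by [].
by apply/seteqP; split=> w; [case|move=> tw; split=> //; exact: ts].
Qed.

Lemma face_sub (V : vectType R) (F P : set V) : face F P -> F `<=` P.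
Proof. by move=> [_ [l ->]] x []. Qed.

End Cones.

Section Recession.
Context (R : realType) (n : nat) (sigma tau : set 'rV[R]_n).
Hypotheses (sigmaP : rational_cone sigma) (tauP : rational_cone tau) (ts : tau `<=` sigma).
Context (L : seq 'rV[int]_n) (LP : forall w, sigma w <-> forall u, u \in L -> 0 <= pairing u w).

Lemma perp_sub u : in_perp sigma u -> in_perp tau u.
Proof. by move=> /asboolP h; apply/asboolP => w /ts; exact: h. Qed.

Lemma facet_dual u : u \in L -> in_dual sigma u.
Proof. by move=> uL; apply/asboolP => w /LP; exact. Qed.

(** Add up, over the forms that do not vanish on tau, points of tau where they are positive. *)
Lemma interior_point : exists2 x0, tau x0 &
  forall u, u \in L -> ~~ in_perp tau u -> 0 < pairing u x0.
Proof.
have [t0 tD _] := rational_cone_closed tauP.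
suff h : forall L' : seq 'rV[int]_n, {subset L' <= L} -> exists2 x0, tau x0 &
    forall u, u \in L' -> ~~ in_perp tau u -> 0 < pairing u x0 by exact: h.
elim=> [_|u L' IHL' sub]; first by exists 0.
have [|x0 tx0 hx0] := IHL'; first by move=> u' u'L; apply: sub; rewrite inE u'L orbT.
have pos u' w : u' \in u :: L' -> tau w -> 0 <= pairing u' w.
  by move=> /sub/facet_dual/asboolP h /ts; exact: h.
have [up|/asboolP/existsNP[x1 /not_implyP[tx1 px1]]] := boolP (in_perp tau u).
  exists x0 => // u'; rewrite inE => /predU1P[->|/hx0//]; first by rewrite up.
exists (x0 + x1); first exact: tD.
move=> u'; rewrite inE pairingD_r => /predU1P[->|u'L] nu.
  rewrite ltr_wpDl ?pos ?mem_head // lt_neqAle pos ?mem_head // andbT eq_sym.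
  exact/eqP.
by rewrite ltr_pwDl ?hx0 // pos // inE u'L orbT.
Qed.

(** A large multiple of the [interior_point] of tau makes the forms outside tau^perp non-negative
    without changing the class modulo the span of tau. *)
Lemma proj_cone (y : NRq tau) :
  (forall u, u \in L -> in_perp tau u -> 0 <= pairing u (vsval y)) -> (piq tau @` sigma) y.
Proof.
move=> hy; have [x0 tx0 hx0] := interior_point; set w := vsval y in hy.
have [t [t0 tmax _]] := seq_max_ge0 L (fun u => - pairing u w / pairing u x0).
exists (w + t *: x0); last first.
  apply/eqP; rewrite -[y](quot_piK (U := linspan tau)) -subr_eq0 -[X in X - _]/(quot_pi (linspan tau) _).
  rewrite -quot_piB quot_pi_eq0 addrC addKr; apply: memvZ.
  exact: (proj1 (linspanP tau)).
apply/LP => u uL; rewrite pairingD_r pairingZ.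
have [up|un] := boolP (in_perp tau u).
  have p0 : pairing u x0 = 0 by exact: (asboolW up).
  by rewrite p0 mulr0 addr0 hy.
by have := tmax u uL; rewrite ler_pdivrMr ?hx0 // => h; rewrite addrC -lerBlDr sub0r.
Qed.

Context (e : nat -> perpM sigma).
Hypothesis e_span : forall u : perpM sigma, exists c : 'I_n -> int, u = \sum_(i < n) e i *~ c i.

(** [homogeneous_limit] solves l_i (y) <= 0, u (y) >= 1 for the forms u of L in tau^perp but not in
    sigma^perp, and e_i (y) = 0. The first group puts y in the recession cone, the others in the
    relative interior of the image of sigma. *)
Lemma recession_meets (P : set (NRq tau)) (C : R) : polyhedron P ->
  (forall M : nat, exists2 w, P w &
    (forall u, u \in L -> in_perp tau u -> ~~ in_perp sigma u -> M%:R <= pairing u (vsval w)) /\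
    (forall i, (i < n)%N -> `|pairing (val (e i)) (vsval w)| <= C)) ->
  (recession_cone P `&` relint (piq tau @` sigma)) !=set0.
Proof.
move=> [_ [m [l [c eP]]]] hM.
pose LA := [seq u <- L | in_perp tau u && ~~ in_perp sigma u].
pose J := ('I_m + ('I_(size LA) + ('I_n + 'I_n)))%type.
pose h (j : J) (w : NRq tau) : R := match j with
  | inl i => - (l i w : R)
  | inr (inl k) => pairing LA`_k (vsval w)
  | inr (inr (inl i)) => pairing (val (e i)) (vsval w)
  | inr (inr (inr i)) => - pairing (val (e i)) (vsval w) end.
pose b (j : J) : R := if j is inr (inl _) then 1 else 0.
pose D := `|C| + \sum_i `|c i|.
have Dc i : c i <= D.
  rewrite /D (bigD1 i) //=; apply: le_trans (ler_norm _) _.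
  by rewrite addrCA lerDl addr_ge0 ?normr_ge0 // sumr_ge0.
have DC : C <= D.
  by apply: le_trans (ler_norm C) _; rewrite lerDl sumr_ge0.
have D0 : 0 <= D by rewrite addr_ge0 // sumr_ge0.
have pL u (t : R) (w w' : NRq tau) : pairing u (vsval (t *: w + w')) =
    t * pairing u (vsval w) + pairing u (vsval w') by rewrite linearP pairingL.
have [|M|y hy] := @homogeneous_limit R (NRq tau) #|{: J}| (fun i => h (enum_val i))
    (fun i => b (enum_val i)) D.
- move=> i t w w'; rewrite /h; case: (enum_val i) => [k|[k|[k|k]]]; rewrite ?pL //.
    by rewrite linearP /= opprD mulrN.
  by rewrite opprD mulrN.
- have [w Pw [wL we]] := hM M; exists w => i; rewrite /h /b.
  case: (enum_val i) => [k|[k|[k|k]]]; rewrite ?mulr0 ?mulr1 ?sub0r.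
  + by rewrite lerN2; move: Pw; rewrite eP => /(_ k)/le_trans; apply.
  + have : LA`_k \in LA by exact: mem_nth.
    rewrite mem_filter => /andP[/andP[h1 h2] h3].
    by apply: le_trans (wL _ h3 h1 h2); rewrite gerBl.
  + by have := we k (ltn_ord k); rewrite ler_norml => /andP[+ _]; apply: le_trans; rewrite lerN2.
  + by have := we k (ltn_ord k); rewrite ler_norml lerN2 => /andP[_ h1]; exact: le_trans DC.
have hyj j : b j <= h j y by have := hy (enum_rank j); rewrite enum_rankK.
have ly i : (l i y : R) <= 0 by have := hyj (inl i); rewrite /h /b /= oppr_ge0.
have uy u : u \in L -> in_perp tau u -> ~~ in_perp sigma u -> 1 <= pairing u (vsval y).
  move=> uL up un; have uLA : u \in LA by rewrite mem_filter up un uL.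
  have := hyj (inr (inl (Ordinal (eq_ind_r (fun k => (index u LA < k)%N) (eq_ind_r is_true uLA (index_mem u LA)) (erefl (size LA)))))).
  by rewrite /h /b /= nth_index.
have ey i : (i < n)%N -> pairing (val (e i)) (vsval y) = 0.
  move=> id; have := hyj (inr (inr (inl (Ordinal id)))); have := hyj (inr (inr (inr (Ordinal id)))).
  by rewrite /h /b /= oppr_ge0 => h1 h2; apply/eqP; rewrite eq_le h1.
have perp0 u : in_perp sigma u -> pairing u (vsval y) = 0.
  move=> us; have [k ek] := e_span (Sub u us).
  pose f (u : perpM sigma) := pairing (val u) (vsval y).
  have fD u1 u2 : f (u1 + u2) = f u1 + f u2 by exact: pairingD.
  have f0 : f 0 = 0 by apply: (addrI (f 0)); rewrite -fD !addr0.
  have fN u1 : f (- u1) = - f u1 by apply: (addrI (f u1)); rewrite -fD !subrr.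
  have fMn u1 q : f u1 = 0 -> f (u1 *+ q) = 0.
    by move=> h1; elim: q => [|q IHq]; rewrite ?mulr0n // mulrS fD h1 IHq addr0.
  change (f (Sub u us) = 0); rewrite ek; elim/big_ind: _ => [//|u1 u2 h1 h2|i _].
    by rewrite fD h1 h2 addr0.
  case: (k i) => q; first by rewrite -pmulrn fMn // /f ey.
  by rewrite NegzE mulrNz -pmulrn fN fMn ?oppr0 // /f ey.
exists y; split.
  move=> x t; rewrite eP => Px t0 i; rewrite linearD linearZ /=.
  rewrite -[c i]addr0; apply: lerD; first exact: Px.
  by rewrite [X in X <= _]/(t * (l i y : R)) mulr_ge0_le0.
have yC : (piq tau @` sigma) y.
  apply: proj_cone => u uL up; have [us|un] := boolP (in_perp sigma u).
    by rewrite perp0.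
  exact: le_trans ler01 (uy u uL up un).
split=> //; pose bs := vbasis (fullv : {vspace NRq tau}).
pose B (u : 'rV[int]_n) : R := 1 + \sum_(j < \dim (fullv : {vspace NRq tau})) `|pairing u (vsval bs`_j)|.
have B0 u : 0 < B u by rewrite ltr_pwDl // sumr_ge0.
(* A perturbation of sup norm below 1 / B u changes u by at most 1, which u (y) >= 1 can absorb. *)
have [|ep ep0 hep] := @seq_min_gt0 R [seq (B u)^-1 | u <- L].
  by move=> _ /mapP[u _ ->]; rewrite invr_gt0.
exists ep => // z zdir zc; apply: proj_cone => u uL up.
have [us|un] := boolP (in_perp sigma u).
  have z0 : pairing u (vsval (z - y)) = 0.
    apply: (linspan_vanish (f := fun x : NRq tau => pairing u (vsval x))) zdir => [t x x'|x].
      exact: pL.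
    move=> [x1 [s1 ss1 <-] [x2 [s2 ss2 <-] <-]].
    have q s : sigma s -> pairing u (vsval (piq tau s)) = 0.
      move=> ss; have := pairingq_piq (Sub u up : perpM tau) s; rewrite /pairingq /= => ->.
      exact: (asboolW us).
    have -> : piq tau s1 - piq tau s2 = -1 *: piq tau s2 + piq tau s1 by rewrite scaleN1r addrC.
    by rewrite pL !q // mulr0 addr0.
  have -> : z = 1 *: (z - y) + y by rewrite scale1r subrK.
  by rewrite pL z0 perp0 // mulr0 addr0.
have -> : z = 1 *: (z - y) + y by rewrite scale1r subrK.
rewrite pL mul1r; have h1 := uy u uL up un.
have h2 : `|pairing u (vsval (z - y))| <= ep * B u.
  rewrite (linear_coords (fun t x x' => pL u t x x') (z - y)).
  apply: le_trans (ler_norm_sum _ _ _) _.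
  apply: (@le_trans _ _ (\sum_(j < \dim (fullv : {vspace NRq tau})) ep * `|pairing u (vsval bs`_j)|)).
    by apply: ler_sum => j _; rewrite normrM ler_wpM2r // ltW.
  by rewrite -mulr_sumr ler_wpM2l ?(ltW ep0) // lerDr.
have h3 : ep * B u <= 1.
  rewrite -ler_pdivlMr // mul1r; apply: hep.
  by apply/mapP; exists u.
have := ler_norm (- pairing u (vsval (z - y))); rewrite normrN; lra.
Qed.

End Recession.

(** * The topology of the toric variety *)

Section PartialMap.
Context (K : fieldType) (G G' : nmodType) (phi : G -> option G').
Implicit Types f g : monoid_algebra K G.

Let term (u : G) (c : K) : monoid_algebra K G' :=
  if phi u is Some u' then monomial u' c else 0.

Let term0 u : term u 0 = 0.
Proof. by rewrite /term; case: (phi u) => // u'; exact: monalg.monalgU0. Qed.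

Let ma_pmapE (D : {fset G}) f : (supp f `<=` D)%fset ->
  ma_pmap phi f = \sum_(u <- D) term u (coef u f).
Proof.
move=> sub; rewrite /ma_pmap (big_fset_incl _ sub) //= => u _ /monalg.mcoeff_outdom e.
by have := term0 u; rewrite /term /coef e.
Qed.

Lemma ma_pmapD f g : ma_pmap phi (f + g) = ma_pmap phi f + ma_pmap phi g.
Proof.
rewrite (ma_pmapE (monalg.msuppD_le f g)) (ma_pmapE (fsubsetUl _ (supp g))).
rewrite (ma_pmapE (fsubsetUr (supp f) _)) -big_split /=; apply: eq_bigr => u _.
rewrite /term; case: (phi u) => [u'|]; last by rewrite addr0.
by rewrite /coef monalg.mcoeffD; exact: monalg.monalgUD.
Qed.

Lemma ma_pmap0 : ma_pmap phi (0 : monoid_algebra K G) = 0.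
Proof. by apply: (addrI (ma_pmap phi 0)); rewrite -ma_pmapD !addr0. Qed.

Lemma ma_pmap_sum (I : Type) (r : seq I) (F : I -> monoid_algebra K G) :
  ma_pmap phi (\sum_(i <- r) F i) = \sum_(i <- r) ma_pmap phi (F i).
Proof. by elim/big_rec2: _ => [|i y z _ <-]; [exact: ma_pmap0|exact: ma_pmapD]. Qed.

Lemma ma_pmap_monomial u (c : K) :
  ma_pmap phi (monomial u c) = if phi u is Some u' then monomial u' c else 0.
Proof.
rewrite (ma_pmapE (D := [fset u]%fset)); last exact: monalg.msuppU_le.
by rewrite big_seq_fset1 /term /coef monalg.mcoeffUU.
Qed.

End PartialMap.

Section Charts.
Context (R : realType) (K : fieldType) (v : K -> R) (v_abs : nonarch_abs v).
Context (n : nat) (Delta : set (set 'rV[R]_n)) (Delta_fan : pointed_rational_fan Delta).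
Local Notation Y := (toric_an v Delta).
Implicit Types (sigma tau : set 'rV[R]_n) (q : Y).

Lemma monomialM (G : zmodType) (u u' : G) (c : K) :
  monomial (u + u') c = chi K u * monomial u' c.
Proof. by rewrite !monomialE chiD scalerAr. Qed.

Lemma to_orbit_monomial sigma tau (u : dualM sigma) (c : K) :
  to_orbit tau (monomial u c : chart_ring K sigma) =
  if insub (val u) is Some u' then monomial (u' : perpM tau) c else 0.
Proof. exact: ma_pmap_monomial. Qed.

Lemma to_orbit_sum sigma tau (I : Type) (r : seq I) (F : I -> chart_ring K sigma) :
  to_orbit tau (\sum_(i <- r) F i) = \sum_(i <- r) to_orbit tau (F i).
Proof. exact: ma_pmap_sum. Qed.

Lemma in_perpD tau (u u' : 'rV[int]_n) : in_perp tau u' -> in_perp tau (u + u') = in_perp tau u.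
Proof. by move=> h; have := rpredDr u (h : u' \in in_perp tau). Qed.

Lemma val_perpD tau (y y' : perpM tau) : val (y + y') = val y + val y'.
Proof. by []. Qed.

Definition chart_lt sigma (f1 f2 : chart_ring K sigma) (c : R) : set Y :=
  [set q | orb q `<=` sigma /\ chart_snorm sigma q f1 < c * chart_snorm sigma q f2].

(* In the chart of another cone [sigma'], multiply both sides by a power of a  *)
(* character that cuts out the common face and is a unit where the charts     *)
(* meet.                                                                      *)
Lemma open_chart_lt sigma (f1 f2 : chart_ring K sigma) (c : R) : Delta sigma ->
  open (chart_lt f1 f2 c).
Proof.
move=> Ds; change (toric_an_open (chart_lt f1 f2 c)) => sigma' Ds'.
have [_ rat _ hI] := Delta_fan.
have [s'P _] := rat _ Ds'; have [_ ff] := hI _ _ Ds Ds'.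
have [u0 [u0d u0f u0N]] := face_character s'P ff.
(* Only finitely many exponents occur, so one N moves them all into the dual of sigma'. *)
have [N hN] : exists N, forall u : dualM sigma, u \in enum_fset (supp f1) ++ enum_fset (supp f2) ->
    in_dual sigma' (val u + u0 *+ N).
  elim: (_ ++ _) => [|u r [N hN]]; first by exists 0%N.
  have /u0N[N1 hN1] : in_dual (sigma `&` sigma') (val u).
    by apply/asboolP => w [sw _]; exact: (asboolW (valP u)).
  exists (maxn N N1) => u'; rewrite inE => /predU1P[->|/hN h]; first exact/hN1/leq_maxr.
  rewrite -(subnKC (leq_maxl N N1)) mulrnDr addrA.
  exact: (rpredD (h : _ \in in_dual sigma') (rpredMn _ (u0d : u0 \in in_dual sigma'))).
pose s (u : dualM sigma) : dualM sigma' := insubd 0 (val u + u0 *+ N).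
pose S (f : chart_ring K sigma) : chart_ring K sigma' := \sum_(u <- supp f) monomial (s u) (coef u f).
pose z0 : chart_ring K sigma' := monomial (Sub u0 u0d) 1.
exists ([set zeta | 0 < zeta z0] `&` [set zeta | zeta (S f1) < c * zeta (S f2)]).
  have oN (U : topologicalType) (f g : U -> R) : continuous f -> continuous g ->
      open [set y | f y < g y].
    move=> cf cg; have -> : [set y | f y < g y] = ~` [set y | g y <= f y].
      by apply/seteqP; split=> y /=; [move=> h; apply/negP; rewrite -ltNge|move/negP; rewrite -ltNge].
    by apply: closed_openC; exact: closed_leq.
  apply: openI; apply: oN; try exact: eval_continuous; first exact: cst_continuous.
  move=> zeta; apply: (@continuousM R _ (fun=> c) (fun zeta : {ptws _ -> R} => zeta (S f2))).
    exact: cst_continuous.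
  exact: eval_continuous.
move=> q fq; have qV := seminorm_valuation v_abs (snormP q).
have z0E : in_perp (orb q) u0 -> 0 < chart_snorm sigma' q z0.
  move=> up; rewrite /chart_snorm to_orbit_monomial insubT.
  exact: (chi_gt0 v_abs _ (snormP q)).
have z0N : ~~ in_perp (orb q) u0 -> chart_snorm sigma' q z0 = 0.
  by move=> up; rewrite /chart_snorm to_orbit_monomial insubN // (val0 qV).
have shift (f : chart_ring K sigma) (up : in_perp (orb q) u0) :
    {subset supp f <= enum_fset (supp f1) ++ enum_fset (supp f2)} ->
    chart_snorm sigma' q (S f) =
    snorm q (chi K ((Sub u0 up : perpM (orb q)) *+ N)) * chart_snorm sigma q f.
  move=> sub; rewrite /chart_snorm -(valM qV); congr (snorm q _).
  rewrite to_orbit_sum /to_orbit {2}/ma_pmap mulr_sumr big_seq [RHS]big_seq.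
  apply: eq_bigr => u uf; rewrite ma_pmap_monomial.
  have vs : val (s u) = val u + u0 *+ N by rewrite /s insubdK //; exact/hN/sub.
  have uNp : in_perp (orb q) (u0 *+ N) by exact: (rpredMn N (up : u0 \in in_perp (orb q))).
  case: insubP => [u' _ eu'|]; last by rewrite vs in_perpD // => nup; rewrite insubN // mulr0.
  rewrite vs in eu'; have up' : in_perp (orb q) (val u).
    by rewrite -(in_perpD _ uNp) -eu'; exact: valP.
  have vMn (y : perpM (orb q)) k : val (y *+ k) = val y *+ k.
    by elim: k => [//|k IHk]; rewrite !mulrS -IHk.
  have -> : u' = (Sub u0 up : perpM (orb q)) *+ N + (Sub (val u) up' : perpM (orb q)).
    apply: val_inj; rewrite eu' addrC.
    by rewrite val_perpD vMn.
  by rewrite insubT; exact: monomialM.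
have fin1 : {subset supp f1 <= enum_fset (supp f1) ++ enum_fset (supp f2)}.
  by move=> u uf; rewrite mem_cat uf.
have fin2 : {subset supp f2 <= enum_fset (supp f1) ++ enum_fset (supp f2)}.
  by move=> u uf; rewrite mem_cat uf orbT.
have main (up : in_perp (orb q) u0) :
    (chart_snorm sigma q f1 < c * chart_snorm sigma q f2) =
    (chart_snorm sigma' q (S f1) < c * chart_snorm sigma' q (S f2)).
  have scale_lt (x y z : R) : 0 < z -> (x < c * y) = (z * x < c * (z * y)).
    by move=> z_gt0; rewrite mulrCA ltr_pM2l.
  have e1 := shift f1 up fin1; have e2 := shift f2 up fin2.
  rewrite [X in _ = (X < _)]e1 [X in _ = (_ < c * X)]e2; apply: scale_lt.
  exact: (chi_gt0 v_abs _ (snormP q)).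
split=> [[qs lt_f]|[z0q lt_f]].
  have up : in_perp (orb q) u0.
    apply/asboolP => w qw; have qw' := face_sub fq qw.
    by apply/(u0f _ qw'); split=> //; exact: qs.
  by split; [exact: z0E|rewrite /= -main].
have up : in_perp (orb q) u0.
  by apply: contrapT => /negP/z0N; move: z0q => /= z0q e; rewrite e ltxx in z0q.
split; last by rewrite main.
move=> w qw; have qw' := face_sub fq qw.
by have [] : (sigma `&` sigma') w by apply/(u0f _ qw')/(asboolW up).
Qed.

Section Restrict.
Context (sigma tau : set 'rV[R]_n) (ts : tau `<=` sigma).

(** Here [insubd] never returns its default 0, since sigma^perp lies in the dual of sigma; the same
    holds for [restrict_perp] when tau lies in sigma. *)
Definition to_dual (u : perpM sigma) : dualM sigma := insubd 0 (val u).
Definition restrict_perp (u : perpM sigma) : perpM tau := insubd 0 (val u).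

Lemma val_to_dual u : val (to_dual u) = val u.
Proof.
rewrite insubdK //; apply/asboolP => w sw.
by rewrite (asboolW (valP u)).
Qed.

Lemma val_restrict u : val (restrict_perp u) = val u.
Proof. by rewrite insubdK //; exact: (perp_sub ts (valP u)). Qed.

Lemma to_orbit_dual u (c : K) :
  to_orbit tau (monomial (to_dual u) c : chart_ring K sigma) = monomial (restrict_perp u) c.
Proof.
rewrite to_orbit_monomial val_to_dual.
case: insubP => [u' _ eu'|/negP[]]; last exact: (perp_sub ts (valP u)).
by have -> : u' = restrict_perp u by apply: val_inj; rewrite eu' val_restrict.
Qed.

Lemma restrict_comb (psi : nat -> perpM sigma) (d : nat) (m : nat -> nat) :
  restrict_perp (\sum_(i < d) psi i *+ m i) = \sum_(i < d) restrict_perp (psi i) *+ m i.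
Proof.
have rD (u u' : perpM sigma) : restrict_perp (u + u') = restrict_perp u + restrict_perp u'.
  apply: val_inj; rewrite (val_restrict (u + u')) !val_perpD.
  by rewrite (val_restrict u) (val_restrict u').
have r0 : restrict_perp 0 = 0 by apply: val_inj; rewrite val_restrict.
have rMn (u : perpM sigma) k : restrict_perp (u *+ k) = restrict_perp u *+ k.
  by elim: k => [//|k IHk]; rewrite !mulrS rD IHk.
by elim/big_rec2: _ => [//|i y z _ <-]; rewrite rD rMn.
Qed.

End Restrict.

Section ChartPolynomials.
Context (sigma : set 'rV[R]_n) (psi : nat -> perpM sigma) (d : nat).

(** Characters in sigma^perp are regular on the whole chart of sigma, so polynomials in them extend
    from O(sigma) to points of nearby orbits. *)
Definition chart_term (t : K * seq nat) : chart_ring K sigma :=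
  monomial (to_dual (\sum_(i < d) psi i *+ nth 0%N t.2 i)) t.1.

Definition chart_poly (g : mvpoly K d) : chart_ring K sigma :=
  \sum_(t <- mvterms g) chart_term t.

Local Notation restricted q := (fun i => restrict_perp (orb q) (psi i)).

Lemma chart_termE q t : orb q `<=` sigma ->
  chart_snorm sigma q (chart_term t) = snorm q (t.1 *: mvmon (characters K (restricted q)) d t.2).
Proof.
move=> qs; rewrite /chart_snorm to_orbit_dual // restrict_comb // monomialE chi_mvmon.
by [].
Qed.

Lemma chart_polyE q g : orb q `<=` sigma ->
  chart_snorm sigma q (chart_poly g) = snorm q (mveval (characters K (restricted q)) d g).
Proof.
move=> qs; rewrite /chart_snorm to_orbit_sum mveval_terms; congr (snorm q _).
apply: eq_bigr => t _; rewrite to_orbit_dual // restrict_comb // monomialE chi_mvmon.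
by [].
Qed.

End ChartPolynomials.
End Charts.

(** * Closedness of the tropical skeleton *)

Lemma polyhedron_segment (R : realType) (V : vectType R) (P : set V) :
  polyhedron P -> segment_closed P.
Proof.
move=> [_ [m [l [c ->]]]] x y t Px Py /andP[t0 t1] i /=.
have -> : (l i (x + t *: (y - x)) : R) = (l i x : R) + t * ((l i y : R) - (l i x : R)).
  by rewrite linearD linearZ linearB.
have := Px i; have := Py i => /= h1 h2; nra.
Qed.

(** A P that fails at some M0 fails at all larger M and can be discarded. *)
Lemma pigeonhole_nat (X : eqType) (Pl : seq X) (Q : nat -> X -> Prop) :
  (forall M M' P, (M <= M')%N -> Q M' P -> Q M P) ->
  (forall M, exists2 P, P \in Pl & Q M P) -> exists2 P, P \in Pl & forall M, Q M P.
Proof.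
move=> anti; elim: Pl => [|P Pl IHPl] h; first by have [] := h 0%N.
have [hP|/existsNP[M0 nQ]] := pselect (forall M, Q M P); first by exists P; rewrite ?mem_head.
have [|P' P'Pl hP'] := IHPl; last by exists P' => //; rewrite inE P'Pl orbT.
move=> M; have [P'] := h (maxn M M0); rewrite inE => /predU1P[->|P'Pl] hQ.
  by case: nQ; apply: anti hQ; exact: leq_maxr.
by exists P' => //; apply: anti hQ; exact: leq_maxl.
Qed.

Lemma nbhs_all (Y : topologicalType) (p : Y) (I : eqType) (L : seq I) (U : I -> set Y) :
  (forall i, i \in L -> nbhs p (U i)) -> nbhs p [set q | forall i, i \in L -> U i q].
Proof.
elim: L => [_|i L IHL h]; first by apply: filterS filterT => q _ i.
have h1 : nbhs p (U i) by apply: h; exact: mem_head.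
have h2 : nbhs p [set q | forall i, i \in L -> U i q].
  by apply: IHL => j jL; apply: h; rewrite inE jL orbT.
apply: filterS (filterI h1 h2) => q [Uq hq] j.
by rewrite inE => /predU1P[->|/hq].
Qed.

Section Closedness.
Context (R : realType) (K : fieldType) (v : K -> R) (v_abs : nonarch_abs v).
Context (n : nat) (Delta : set (set 'rV[R]_n)) (Delta_fan : pointed_rational_fan Delta).
Context (X : closed_subscheme K Delta) (d : set 'rV[R]_n -> nat).
Hypothesis X_equidim : forall sigma, Delta sigma ->
  equidimensional (orbit_ideal X sigma) (d sigma).
Local Notation Y := (toric_an v Delta).
Local Notation hull sigma :=
  (ideal_hull (orbit_ideal X sigma : set (monoid_algebra K (perpM sigma)))).
Local Notation pr sigma := (@pairingq R n sigma).

Lemma fan_rational sigma : Delta sigma -> rational_cone sigma.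
Proof. by have [_ h _ _] := Delta_fan; move=> /h[]. Qed.

(** The subspaces Ws leave room for the directions of polyhedra projected from other orbits. *)
Lemma adapted_characters sigma (xi : monoid_algebra K (perpM sigma) -> R)
    (Sigma : set (set (NRq sigma))) (Ws : seq {vspace NRq sigma}) : Delta sigma ->
  points v (hull sigma) xi -> polyhedral_complex Sigma ->
  \bigcup_(P in Sigma) P = Trop v X sigma ->
  (forall W, W \in Ws -> (\dim W <= d sigma)%N) ->
  exists psi, [/\ good_characters (hull sigma) (d sigma) psi,
    forall P, Sigma P -> injective_on (pr sigma) psi (d sigma) (dirspan P) &
    forall W, W \in Ws -> injective_on (pr sigma) psi (d sigma) W].
Proof.
move=> Ds xI [Sfin Spoly _ _] Scover hW; have sP := fan_rational Ds.
have [e [span _]] := perpM_generators sP.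
apply: (good_characters_exist v_abs (@pairingqD R n sigma) (@pairingqL R n sigma)
  (ideal_hullP _) (equidimensional_hull (X_equidim Ds)) (prime_kernel v_abs xI.1) xI.2 span
  (pairingq_sep sP) Sfin _ hW) => P SP.
split; [exact: polyhedron_segment (Spoly _ SP)|by have [] := Spoly _ SP|].
move=> w Pw; have [xi' /(trop_fiberE v_abs)[xI' xw']] : Trop v X sigma w by rewrite -Scover; exists P.
by exists xi'.
Qed.

(** The Shilov boundary is contained in the boundary given by [boundary_over_fiber]. *)
Lemma skeleton_over (q : Y) (Sigma : set (set (NRq (orb q)))) (psi : nat -> perpM (orb q)) :
  S_Trop v X q -> polyhedral_complex Sigma ->
  \bigcup_(P in Sigma) P = Trop v X (orb q) ->
  good_characters (hull (orb q)) (d (orb q)) psi ->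
  (forall P, Sigma P -> injective_on (pr (orb q)) psi (d (orb q)) (dirspan P)) ->
  exists w, over_fiber v X (d (orb q)) psi w (snorm q).
Proof.
move=> [Xq [w [qw [B [Bb Bmin] Bq]]]] [Sfin _ _ _] Scover good inj; exists w.
have sP := fan_rational (orbP q).
apply: (Bmin (over_fiber v X (d (orb q)) psi w) _ _ Bq).
apply: (boundary_over_fiber v_abs sP good Sfin Scover inj).
by exists (snorm q).
Qed.

Section Nearby.
Context (sigma : set 'rV[R]_n) (Ds : Delta sigma).
Context (r : nat) (psi : nat -> perpM sigma) (g : mvpoly K r) (t0 : K * seq nat).
Context (L : seq 'rV[int]_n) (LP : forall w, sigma w <-> forall u, u \in L -> 0 <= pairing u w).
Context (e : nat -> perpM sigma).

Definition facet_function (u : 'rV[int]_n) : chart_ring K sigma :=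
  monomial (insubd 0 u : dualM sigma) 1.

Definition orbit_function (u : perpM sigma) : chart_ring K sigma := monomial (to_dual u) 1.

Lemma facet_functionE (q : Y) u : u \in L ->
  chart_snorm sigma q (facet_function u) =
  if in_perp (orb q) u then snorm q (chi K (insubd 0 u : perpM (orb q))) else 0.
Proof.
move=> uL; rewrite /chart_snorm to_orbit_monomial insubdK; last exact: (facet_dual LP uL).
case: ifP => up; last first.
  by rewrite insubN ?up // (val0 (seminorm_valuation v_abs (snormP q))).
case: insubP => [u' _ eu'|]; last by rewrite up.
by have -> : u' = insubd 0 u by apply: val_inj; rewrite eu' insubdK.
Qed.

Lemma orbit_functionE (q : Y) u : orb q `<=` sigma ->
  chart_snorm sigma q (orbit_function u) = snorm q (chi K (restrict_perp (orb q) u)).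
Proof. by move=> qs; rewrite /chart_snorm to_orbit_dual. Qed.

(** The inequality for g at q is a cancellation among restricted characters, which [tie_polyhedron]
    turns into a dependence on a polyhedron of dimension d_tau. Its side conditions transfer to w
    that the facet functions are small at q, so w is far out in the directions of sigma, and that
    the e_i stay bounded. *)
Lemma nearby_polyhedron tau (Sigma : set (set (NRq tau))) (C : R) (M : nat) (q : Y) :
  orb q = tau -> tau `<=` sigma -> polyhedral_complex Sigma ->
  \bigcup_(P in Sigma) P = Trop v X tau -> S_Trop v X q -> t0 \in mvterms g -> 0 < C ->
  chart_snorm sigma q (chart_poly psi g) < chart_snorm sigma q (chart_term psi r t0) ->
  (forall u, u \in L -> ~~ in_perp sigma u ->
     chart_snorm sigma q (facet_function u) < expR (- M%:R)) ->
  (forall i, (i < n)%N -> chart_snorm sigma q (orbit_function (e i)) < C /\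
     chart_snorm sigma q (orbit_function (- e i)) < C) ->
  exists2 P, Sigma P & [/\ affdim P = d tau,
    dependent_on (pr tau) (fun i => restrict_perp tau (psi i)) r (dirspan P) &
    exists2 w, P w &
    (forall u, u \in L -> in_perp tau u -> ~~ in_perp sigma u -> M%:R <= pairing u (vsval w)) /\
    (forall i, (i < n)%N -> `|pairing (val (e i)) (vsval w)| <= ln C)].
Proof.
move=> eq_tau; move: Sigma; rewrite -{tau}eq_tau => Sigma qs Sc Scover Sq t0g C0 h1 h2 h3.
have Dq := orbP q; have sP := fan_rational Dq.
have [Sfin _ _ _] := Sc.
have qI : points v (hull (orb q)) (snorm q).
  by apply/(points_hull v_abs (snormP q)); have [Xq _] := Sq; exact: Xq.2.
have [psiq [goodq injq _]] := adapted_characters (Ws := [::]) Dq qI Sc Scover (fun W h => False_ind _ (notF h)).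
have [w0 [qF qo]] := skeleton_over Sq Sc Scover goodq injq.
pose theta i := restrict_perp (orb q) (psi i).
pose cs := [seq ((insubd 0 u : perpM (orb q)), expR (- M%:R)) |
               u <- [seq u <- L | in_perp (orb q) u && ~~ in_perp sigma u]] ++
           [seq (restrict_perp (orb q) (e i), C) | i <- iota 0 n] ++
           [seq (restrict_perp (orb q) (- e i), C) | i <- iota 0 n].
have qV := seminorm_valuation v_abs (snormP q).
have Scov (xi : monoid_algebra K (perpM (orb q)) -> R) : points v (hull (orb q)) xi ->
    exists w P, [/\ trop_point (pr (orb q)) xi w, Sigma P & P w].
  move=> xI; have [w xw] := trop_exists v_abs sP xI.1; exists w.
  have : Trop v X (orb q) w by exists xi; apply/(trop_fiberE v_abs).
  by rewrite -Scover => -[P SP Pw]; exists P.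
have lt_g : snorm q (mveval (characters K theta) r g) <
    mvgauss v (fun i => snorm q (chi K (theta i))) g.
  move: h1; rewrite (chart_polyE psi g qs) (chart_termE psi r t0 qs) => /lt_le_trans; apply.
  rewrite (seminormZ _ _ (snormP q)) (seminorm_mvmon v_abs); last exact: snormP.
  by apply: mvgauss_term_le => // i _; exact: (chi_gt0 v_abs _ (snormP q)).
have lt_cs uc : uc \in cs -> snorm q (chi K uc.1) < uc.2.
  rewrite !mem_cat => /or3P[]/mapP[u + ->] /=.
  - rewrite mem_filter => /andP[/andP[up un] uL].
    by have := h2 u uL un; rewrite facet_functionE // up.
  - by rewrite mem_iota => /h3[+ _]; rewrite orbit_functionE.
  - by rewrite mem_iota => /h3[_ +]; rewrite orbit_functionE.
have [P [SP dP depP [w Pw hw]]] := tie_polyhedron v_abs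
  (@pairingqL R n (orb q)) (ideal_hullP _) goodq.1 Sfin injq Scov
  (trop_weights_gt0 (d := d (orb q)) psiq w0) qI qo lt_g lt_cs.
exists P => //; split=> //; exists w => //; split=> [u uL up un|i id].
  have /hw /= : ((insubd 0 u : perpM (orb q)), expR (- M%:R)) \in cs.
    rewrite mem_cat; apply/orP; left; apply/mapP; exists u => //.
    by rewrite mem_filter up un.
  by rewrite ltr_expR ltrN2 /pairingq insubdK // => /ltW.
have /hw /= : (restrict_perp (orb q) (e i), C) \in cs.
  rewrite !mem_cat; apply/orP; right; apply/orP; left; apply/mapP; exists i => //.
  by rewrite mem_iota.
have /hw /= : (restrict_perp (orb q) (- e i), C) \in cs.
  rewrite !mem_cat; apply/orP; right; apply/orP; right; apply/mapP; exists i => //.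
  by rewrite mem_iota.
rewrite /pairingq !val_restrict //.
have -> : pairing (val (- e i)) (vsval w) = - pairing (val (e i)) (vsval w).
  rewrite -[val (- e i)]/(- val (e i)).
  by apply: (addrI (pairing (val (e i)) (vsval w))); rewrite -pairingD !subrr pairing0l.
have ltC (z : R) : expR z < C -> z < ln C by rewrite -{1}(lnK C0) ltr_expR.
rewrite opprK => /ltC h4 /ltC h5; rewrite ler_norml; apply/andP; split.
  by rewrite lerNl; exact: (ltW h5).
exact: (ltW h4).
Qed.

End Nearby.

End Closedness.

Lemma nat_upper_bound (R : realType) (f : nat -> R) n :
  exists2 C, 0 < C & forall i, (i < n)%N -> f i < C.
Proof.
elim: n => [|n [C C0 hC]]; first by exists 1.
exists (Num.max C (f n + 1)); first by rewrite lt_max C0.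
move=> i; rewrite ltnS leq_eqVlt => /predU1P[->|/hC h]; rewrite lt_max ?h //.
by rewrite ltrDl ltr01 orbT.
Qed.

Section Closure.
Context (R : realType) (K : fieldType) (v : K -> R) (v_abs : nonarch_abs v).
Context (n : nat) (Delta : set (set 'rV[R]_n)) (Delta_fan : pointed_rational_fan Delta).
Context (X : closed_subscheme K Delta) (d : set 'rV[R]_n -> nat).
Hypothesis X_equidim : forall sigma, Delta sigma ->
  equidimensional (orbit_ideal X sigma) (d sigma).
Local Notation Y := (toric_an v Delta).
Local Notation hull sigma :=
  (ideal_hull (orbit_ideal X sigma : set (monoid_algebra K (perpM sigma)))).
Local Notation pr sigma := (@pairingq R n sigma).

Hypothesis X_proj : forall sigma tau, Delta sigma -> face tau sigma ->
  exists Sigma : set (set (NRq tau)),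
    [/\ polyhedral_complex Sigma,
        \bigcup_(P in Sigma) P = Trop v X tau &
        forall P, Sigma P -> affdim P = d tau ->
          recession_cone P `&` relint (piq tau @` sigma) !=set0 ->
          affdim (piq2 sigma @` P) = d sigma].

(** If p does not restrict to the Gauss norm, [nearby_polyhedron] gives a polyhedron for every M,
    and by finiteness one P serves all M. Then [recession_meets] and the hypothesis give its
    projection dimension d_sigma, where the psi_i are independent by choice although P forces a
    relation. *)
Lemma closure_orbit (tau : set 'rV[R]_n) (p : Y) : Delta tau -> X_an v X p ->
  closure [set q : Y | S_Trop v X q /\ orb q = tau] p -> S_Trop v X p.
Proof.
move=> Dt Xp clp; set sigma := orb p; have Ds : Delta sigma := orbP p.
have sP := fan_rational Delta_fan Ds; have tP := fan_rational Delta_fan Dt.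
(* The constant 1 turns bounds by real numbers into comparisons covered by [open_chart_lt]. *)
have [one oneE] : exists one : chart_ring K sigma, forall q : Y, chart_snorm sigma q one = 1.
  exists (monomial 0 1) => q; have qV := seminorm_valuation v_abs (snormP q); rewrite /chart_snorm to_orbit_monomial.
  case: insubP => [u' _ eu'|/negP[]]; last first.
    by apply/asboolP => w _; rewrite pairing0l.
  have -> : u' = 0 by apply: val_inj.
  exact: (val1 qV).
have lt_nbhs f1 f2 (c : R) : chart_snorm sigma p f1 < c * chart_snorm sigma p f2 ->
    nbhs p (chart_lt (v := v) (Delta := Delta) f1 f2 c).
  by move=> h; apply: open_nbhs_nbhs; split; [exact: (open_chart_lt v_abs Delta_fan _ _ _ Ds)|split].
have lt_one f (c : R) : chart_snorm sigma p f < c ->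
    nbhs p (chart_lt (v := v) (Delta := Delta) f one c).
  by move=> h; apply: lt_nbhs; rewrite oneE mulr1.
have one_lt (q : Y) f (c : R) : chart_lt f one c q -> chart_snorm sigma q f < c.
  by case=> _; rewrite oneE mulr1.
(* The comparison 1 < 2 holds everywhere, so this neighbourhood of p is the chart of sigma, which
   meets only orbits of cones inside sigma. *)
have ts : tau `<=` sigma.
  have [|q [[_ <-] []//]] := clp (chart_lt (v := v) (Delta := Delta) one one 2).
  by apply: lt_nbhs; rewrite !oneE mulr1 ltr1n.
have fts : face tau sigma by exact: fan_face Delta_fan _ _ _.
have fss : face sigma sigma by exact: fan_face Delta_fan _ _ _.
have [Sg [Sgc Sgcov Sgproj]] := X_proj Ds fts.
have [Ss [Ssc Sscov _]] := X_proj Ds fss.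
have pI : points v (hull sigma) (snorm p).
  by apply/(points_hull v_abs (snormP p)); exact: Xp.2.
have [Sgfin Sgpoly _ _] := Sgc; have [Pl ePl] := proj1 (finite_seqP _) Sgfin.
(* The characters have to be injective on all these directions before it is known which P occurs. *)
pose Ws := [seq dirspan (piq2 sigma @` P) | P <- Pl & affdim (piq2 sigma @` P) == d sigma].
have [|psi [good injS injW]] := adapted_characters v_abs Delta_fan X_equidim (Ws := Ws) Ds pI Ssc Sscov.
  by move=> _ /mapP[P + ->]; rewrite mem_filter => /andP[/eqP<- _].
have [Ssfin _ _ _] := Ssc.
have [wp pw] := trop_exists v_abs sP pI.1.
have pF : trop_fiber v X wp (snorm p) by apply/(trop_fiberE v_abs).
have [po|/existsNP[g pg]] := pselect (over_gauss v (characters K psi) (d sigma)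
    (trop_weights psi wp) (snorm p)).
  split=> //; exists wp; split=> //; exists (over_fiber v X (d sigma) psi wp); last by split.
  by apply: (shilov_over_fiber v_abs sP good Ssfin Sscov injS); exists (snorm p).
exfalso; have a0 := trop_weights_gt0 (d := d sigma) psi wp.
have pa := trop_on_weights (d := d sigma) v_abs psi pI.1 pw.
have pV := seminorm_valuation v_abs pI.1.
have lt_g : snorm p (mveval (characters K psi) (d sigma) g) < mvgauss v (trop_weights psi wp) g.
  by rewrite lt_neqAle (points_le_gauss v_abs a0 g pI.1 pa) andbT; exact/eqP.
have g0 : g != 0.
  by apply: contraTneq lt_g => ->; rewrite rmorph0 (val0 pV) (val0 (gauss_val v_abs a0)) ltxx.
have [t0 t0g et0] := mvgauss_term_ex v_abs a0 g0.
have [L LP] := cone_facets sP; have [e [span _]] := perpM_generators sP.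
have restrict_self (u : perpM sigma) : restrict_perp (orb p) u = u.
  by apply: val_inj; rewrite insubdK //; exact: (valP u).
have psi_self : (fun i => restrict_perp (orb p) (psi i)) = psi by apply/funext => i.
have [C C0 hC] := nat_upper_bound
  (fun i => Num.max (snorm p (chi K (e i))) (snorm p (chi K (- e i)))) n.
have Ce i : (i < n)%N -> snorm p (chi K (e i)) < C /\ snorm p (chi K (- e i)) < C.
  by move=> /hC; rewrite gt_max => /andP.
have orbE u : chart_snorm sigma p (orbit_function K u) = snorm p (chi K u).
  by have := orbit_functionE (q := p) (sigma := sigma) u (@subset_refl _ (orb p)); rewrite restrict_self.
pose good_at (M : nat) (P : set (NRq tau)) := [/\ affdim P = d tau,
    dependent_on (pr tau) (fun i => restrict_perp tau (psi i)) (d sigma) (dirspan P) &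
    exists2 w, P w &
    (forall u, u \in L -> in_perp tau u -> ~~ in_perp sigma u -> M%:R <= pairing u (vsval w)) /\
    (forall i, (i < n)%N -> `|pairing (val (e i)) (vsval w)| <= ln C)].
have ex M : exists2 P, P \in Pl & good_at M P.
  have n1 : nbhs p (chart_lt (v := v) (Delta := Delta) (chart_poly psi g) (chart_term psi (d sigma) t0) 1).
    apply: lt_nbhs; rewrite mul1r (chart_polyE psi g) // (chart_termE psi (d sigma) t0) // psi_self.
    apply: lt_le_trans lt_g _; rewrite -et0 (seminormZ _ _ (snormP p)) (seminorm_mvmon v_abs); last exact: snormP.
    rewrite le_eqVlt; apply/orP; left; apply/eqP; congr (_ * _); apply: eq_bigr => i _.
    by rewrite -(pa i).
  have n2 : nbhs p [set q | forall u, u \in [seq u <- L | ~~ in_perp sigma u] ->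
      chart_lt (v := v) (Delta := Delta) (facet_function K sigma u) one (expR (- M%:R)) q].
    apply: nbhs_all => u; rewrite mem_filter => /andP[un uL]; apply: lt_one.
    by rewrite (facet_functionE v_abs LP) // (negPf un) expR_gt0.
  have n3 : nbhs p [set q | forall i, i \in iota 0 n ->
      (chart_lt (v := v) (Delta := Delta) (orbit_function K (e i)) one C `&`
       chart_lt (v := v) (Delta := Delta) (orbit_function K (- e i)) one C) q].
    apply: nbhs_all => i; rewrite mem_iota => /Ce[h1 h2].
    by apply: filterI; apply: lt_one; rewrite orbE.
  have [q [[Sq eq] [[q1 q2] q3]]] := clp _ (filterI (filterI n1 n2) n3).
  suff [P SP hP] : exists2 P, Sg P & good_at M P by exists P => //; move: SP; rewrite ePl.
  apply: (nearby_polyhedron v_abs Delta_fan X_equidim LP eq ts Sgc Sgcov Sq t0g C0).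
  - by have [_] := q1; rewrite mul1r.
  - by move=> u uL un; apply/one_lt/q2; rewrite mem_filter un.
  - by move=> i id; have [|h4 h5] := q3 i; [rewrite mem_iota|split; exact: one_lt].
have [|P PPl hP] := @pigeonhole_nat _ Pl _ _ ex.
  move=> M M' P MM' [h1 h2 [w Pw [h3 h4]]]; split=> //; exists w => //; split=> // u uL up un.
  by apply: le_trans (h3 u uL up un); rewrite ler_nat.
have SP : Sg P by rewrite ePl.
have [dP [la la0 laP] _] := hP 0%N.
have rec : (recession_cone P `&` relint (piq tau @` sigma)) !=set0.
  apply: (recession_meets tP ts LP span (C := ln C)) => [|M]; first exact: Sgpoly.
  by have [_ _] := hP M.
have dproj := Sgproj P SP dP rec.
have injP : injective_on (pr sigma) psi (d sigma) (dirspan (piq2 sigma @` P)).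
  by apply: injW; apply/mapP; exists P => //; rewrite mem_filter dproj eqxx.
apply: (injective_independent (@pairingqL R n sigma) injP dproj); exists la => //.
apply: (linspan_vanish (fun c w w' => lin_combL (@pairingqL R n sigma) psi (d sigma) la c w w')).
have combE w : lin_comb (pr sigma) psi (d sigma) la (piq2 sigma w) =
    lin_comb (pr tau) (fun i => restrict_perp tau (psi i)) (d sigma) la w.
  apply: eq_bigr => i _; congr (_ * _).
  by rewrite /piq2 pairingq_piq /pairingq val_restrict.
move=> _ [_ [x1 Px1 <-] [_ [x2 Px2 <-] <-]].
have -> : piq2 sigma x1 - piq2 sigma x2 = -1 *: piq2 sigma x2 + piq2 sigma x1.
  by rewrite scaleN1r addrC.
rewrite (lin_combL (@pairingqL R n sigma)) !combE -(lin_combL (@pairingqL R n tau)).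
by apply: laP; rewrite scaleN1r addrC dirspan_sub.
Qed.

End Closure.

Theorem theorem6p3 (R : realType) (K : fieldType) (v : K -> R)
    (v_abs : nonarch_abs v) (v_complete : complete_abs v)
    (n : nat) (Delta : set (set 'rV[R]_n))
    (Delta_fan : pointed_rational_fan Delta)
    (X : closed_subscheme K Delta) (d : set 'rV[R]_n -> nat)
    (X_equidim : forall sigma, Delta sigma ->
       equidimensional (orbit_ideal X sigma) (d sigma))
    (X_proj : forall sigma tau, Delta sigma -> face tau sigma ->
       exists Sigma : set (set (NRq tau)),
         [/\ polyhedral_complex Sigma,
             \bigcup_(P in Sigma) P = Trop v X tau &
             forall P, Sigma P -> affdim P = d tau ->
               recession_cone P `&` relint (piq tau @` sigma) !=set0 ->
               affdim (piq2 sigma @` P) = d sigma]) :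
  closed (S_Trop v X : set (subspace (X_an v X))).
Proof.
have [[_ Delta_fin] _ _ _] := Delta_fan.
pose S tau : set (toric_an v Delta) := [set q | S_Trop v X q /\ orb q = tau].
(* The union is closed because Delta is finite, so only limits of skeleton points from a single
   orbit have to be treated. *)
apply/closed_subspaceP; exists (\bigcup_(tau in Delta) closure (S tau)).
  by apply: closed_bigcup => // tau _; exact: closed_closure.
apply/seteqP; split=> p [hp Xp]; split=> //.
  have [tau Dt clp] := hp.
  exact: (closure_orbit v_abs Delta_fan X_equidim X_proj Dt Xp clp).
by exists (orb p); [exact: orbP|apply: subset_closure; split].
Qed.
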